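(* Let $M_1$ and $M_2$ be two compact rank one symmetric spaces of the same dimension. Then the connected sum of $M_1$ and $M_2$ (formed with any choice of orientations) admits a Riemannian metric with strongly nonnegative curvature.
   Context: The compact rank one symmetric spaces are (up to diffeomorphism) the sphere $S^n$, the real projective space $\mathbb{R}P^n$, the complex projective space $\mathbb{C}P^n$, the quaternionic projective space $\mathbb{H}P^n$, and the Cayley plane $\mathrm{Ca}P^2$. ''Any choice of orientations'' means that the boundary spheres of the removed balls may be identified by a diffeomorphism that either preserves or reverses the orientation; e.g. both $\mathbb{C}P^n\#\mathbb{C}P^n$ and $\mathbb{C}P^n\#\overline{\mathbb{C}P}^n$ are covered. Strongly nonnegative curvature: let $(M,\mathrm{g})$ be a Riemannian manifold. For each $p\in M$, $\mathrm{g}$ induces inner products on the exterior powers $\wedge^k T_pM$, which are thereby identified with their duals. A $4$-form $\omega\in\wedge^4T_pM$ is identified with the symmetric linear operator $\omega\colon\wedge^2T_pM\to\wedge^2T_pM$ given by $\langle\omega(X\wedge Y),Z\wedge W\rangle=\omega(X,Y,Z,W)$. Let $R\colon\wedge^2T_pM\to\wedge^2T_pM$ be the curvature operator, with the sign convention that $\langle R(X\wedge Y),X\wedge Y\rangle=\sec(X\wedge Y)$ when $\|X\wedge Y\|=1$. Then $(M,\mathrm{g})$ has strongly nonnegative curvature if for every $p\in M$ there exists $\omega\in\wedge^4T_pM$ such that the operator $R+\omega\colon\wedge^2T_pM\to\wedge^2T_pM$ is positive-semidefinite. *)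

(* Defs.v *)
From HB Require Import structures.
From mathcomp Require Import all_boot all_order all_algebra.
From mathcomp Require Import all_classical all_reals all_analysis.

Set Implicit Arguments.
Unset Strict Implicit.
Unset Printing Implicit Defensive.

Import Order.TTheory GRing.Theory Num.Theory.
Import numFieldNormedType.Exports.

Local Open Scope classical_set_scope.
Local Open Scope ring_scope.

Section Calculus.
Context {R : realType} {n : nat}.
Implicit Types (U : set 'rV[R]_n) (f : 'rV[R]_n -> R).

Definition pd (i : 'I_n) f : 'rV[R]_n -> R := fun x => 'D_(delta_mx 0 i) f x.

Fixpoint Ck_on (k : nat) U f : Prop :=
  {in U, continuous f} /\
  match k with
  | 0%N => True
  | k'.+1 => forall i : 'I_n,
      (forall x, U x -> derivable f x (delta_mx 0 i)) /\ Ck_on k' U (pd i f)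
  end.

(* Meaningful for open U. *)
Definition smooth_on U f := forall k, Ck_on k U f.

End Calculus.

(* The Euclidean square norm; the library norm on 'rV[R]_n is the sup norm. *)
Definition sqnorm {R : realType} {n : nat} (x : 'rV[R]_n) : R :=
  \sum_(i < n) x 0 i ^+ 2.

(* cmap and cinv are total functions whose values matter only on cdom and on
   ccod respectively. *)
Record chart (R : realType) (n : nat) (T : topologicalType) := Chart {
  cdom : set T;
  ccod : set 'rV[R]_n;
  cmap : T -> 'rV[R]_n;
  cinv : 'rV[R]_n -> T;
  chart_open_dom : open cdom;
  chart_open_cod : open ccod;
  chart_mapK : forall p, cdom p -> ccod (cmap p) /\ cinv (cmap p) = p;
  chart_invK : forall x, ccod x -> cdom (cinv x) /\ cmap (cinv x) = x;
  chart_map_continuous : {in cdom, continuous cmap};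
  chart_inv_continuous : {in ccod, continuous cinv} }.

(* The atlas is not required to be maximal: every notion below quantifies over
   all charts of the given atlas and agrees with the one for the maximal atlas
   generated by it. *)
Record manifold (R : realType) (n : nat) := Manifold {
  carrier :> topologicalType;
  atlas : set (chart R n carrier);
  manifold_hausdorff : hausdorff_space carrier;
  manifold_second_countable : @second_countable carrier;
  atlas_cover : forall p, exists2 c, atlas c & cdom c p;
  atlas_compatible : forall c d, atlas c -> atlas d -> forall j : 'I_n,
    smooth_on (ccod c `&` cinv c @^-1` cdom d)
              (fun x => cmap d (cinv c x) 0 j) }.

Section Euclidean.
Context {R : realType} (n : nat).

Lemma continuous_coord (j : 'I_n) : continuous (fun x : 'rV[R]_n => x 0 j).
Proof. exact: coord_continuous. Qed.

Lemma Ck_on_cst k (U : set 'rV[R]_n) (a : R) : Ck_on k U (fun=> a).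
Proof.
elim: k a => [|k IHk] a /=; first by split=> // x _; exact: cst_continuous.
split=> [x _|i]; first exact: cst_continuous.
split=> [x _|]; first exact: derivable_cst.
have -> : pd i (fun=> a) = fun=> 0 :> R.
  by apply/funext => x; exact: derive_cst.
exact: IHk.
Qed.

Lemma is_derive_coord (x v : 'rV[R]_n) (j : 'I_n) :
  is_derive x v (fun y : 'rV[R]_n => y 0 j) (v 0 j).
Proof.
have d : differentiable (fun y : 'rV[R]_n => y 0 j : R) x.
  exact: differentiable_coord.
apply: DeriveDef; first exact: diff_derivable.
rewrite /derive; apply: cvg_lim => //.
apply: cvg_near_cst; near=> h.
have h0 : h != 0 by near: h; exact: nbhs_dnbhs_neq.
by rewrite /= !mxE addrK /GRing.scale /= mulKf.
Unshelve. all: by end_near. Qed.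

Lemma smooth_on_coord (U : set 'rV[R]_n) (j : 'I_n) :
  smooth_on U (fun x => x 0 j).
Proof.
case=> [|k] /=; first by split=> // x _; exact: continuous_coord.
split=> [x _|i]; first exact: continuous_coord.
split=> [x _|]; first by have [] := is_derive_coord x (delta_mx 0 i) j.
have -> : pd i (fun x : 'rV[R]_n => x 0 j) =
          fun=> (delta_mx 0 i : 'rV[R]_n) 0 j.
  by apply/funext => x; have [] := is_derive_coord x (delta_mx 0 i) j.
exact: Ck_on_cst.
Qed.

Lemma rV_second_countable : @second_countable 'rV[R]_n.
Proof.
pose b (p : 'rV[rat]_n * nat) : set 'rV[R]_n :=
  ball (map_mx ratr p.1 : 'rV[R]_n) p.2.+1%:R^-1.
exists (range b).
  apply: (sub_countable (card_image_le _ _)).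
  exact: countableP.
split=> [_ [p _ <-]|x]; first exact: ball_open.
move=> A /nbhs_ballP[e /= e0 xA].
pose k := Num.truncn (2 / e).
have k0 : 0 < k.+1%:R^-1 :> R by rewrite invr_gt0.
have ke : k.+1%:R^-1 + k.+1%:R^-1 < e.
  have h : 2 / e < k.+1%:R by rewrite truncnS_gt.
  rewrite -mulr2n -[ltLHS]mulr_natl ltr_pdivrMr ?ltr0n//.
  by rewrite mulrC -ltr_pdivrMr.
have q_ (j : 'I_n) : exists q : rat, `|x 0 j - ratr q| < k.+1%:R^-1.
  have : x 0 j - k.+1%:R^-1 < x 0 j + k.+1%:R^-1.
    by rewrite ltrD2l gtrN.
  move=> /rat_in_itvoo[q]; rewrite in_itv /= => /andP[q1 q2].
  by exists q; rewrite distrC ltr_distl q1 q2.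
have [q Hq] := choice q_.
have cx : ball (map_mx ratr (\row_j q j) : 'rV[R]_n) k.+1%:R^-1 x.
  by apply: ball_sym; split=> // i j; rewrite /ball /= !mxE ord1.
exists (b (\row_j q j, k)); first by split=> //; exists (\row_j q j, k).
move=> y by_; apply: xA; apply: le_ball (ltW ke) _ _.
exact: ball_triangle (ball_sym cx) by_.
Qed.

Definition euclidean_chart : chart R n 'rV[R]_n :=
  @Chart R n 'rV[R]_n setT setT id id openT openT
    (fun p _ => conj I erefl) (fun p _ => conj I erefl)
    (fun x _ => @cvg_id _ (nbhs x)) (fun x _ => @cvg_id _ (nbhs x)).

Lemma euclidean_cover (p : 'rV[R]_n) :
  exists2 c, [set euclidean_chart] c & cdom c p.
Proof. by exists euclidean_chart. Qed.

Lemma euclidean_compatible (c d : chart R n 'rV[R]_n) :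
  [set euclidean_chart] c -> [set euclidean_chart] d -> forall j : 'I_n,
  smooth_on (ccod c `&` cinv c @^-1` cdom d)
            (fun x => cmap d (cinv c x) 0 j).
Proof. by move=> -> -> j; exact: smooth_on_coord. Qed.

Definition euclidean : manifold R n :=
  @Manifold R n 'rV[R]_n [set euclidean_chart] (@norm_hausdorff R 'rV[R]_n)
    rV_second_countable euclidean_cover euclidean_compatible.

End Euclidean.
Arguments euclidean R n : clear implicits.

Section SmoothMaps.
Context {R : realType}.

(* Smoothness of f on an open set A. *)
Definition smooth_map {m n} {M : manifold R m} {N : manifold R n}
    (A : set M) (f : M -> N) : Prop :=
  {in A, continuous f} /\
  forall c d, atlas c -> atlas d -> forall j : 'I_n,
    smooth_on (ccod c `&` cinv c @^-1` (A `&` f @^-1` cdom d))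
              (fun x => cmap d (f (cinv c x)) 0 j).

(* f maps the open set A diffeomorphically onto an open set. *)
Definition open_embedding {n} {M N : manifold R n} (A : set M) (f : M -> N) :
    Prop :=
  [/\ open A, open (f @` A), smooth_map A f &
      exists2 g : N -> M, smooth_map (f @` A) g &
        forall p, A p -> g (f p) = p].

(* Smoothness of the inverse X -> M means that it extends locally to a smooth
   map on an open subset of the ambient space. *)
Definition diffeomorphic_to_subset {n N} (M : manifold R n)
    (X : set (euclidean R N)) : Prop :=
  exists f : M -> euclidean R N,
    [/\ smooth_map setT f, range f = X &
        forall q, X q -> exists (U : set (euclidean R N))
                                (h : euclidean R N -> M),
          [/\ open U, U q, smooth_map U h &
              forall p, U (f p) -> h (f p) = p]].

End SmoothMaps.

(* The Cayley-Dickson algebras R, C, H, Ca for k = 0, 1, 2, 3, with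
   (a, b)(c, d) = (ac - d^* b, da + bc^* ) and (a, b)^* = (a^*, - b). *)
Fixpoint cd_dim (k : nat) : nat :=
  if k is k'.+1 then (cd_dim k' + cd_dim k')%N else 1%N.

Section CayleyDickson.
Context {R : realType}.

Fixpoint cd_one (k : nat) : 'rV[R]_(cd_dim k) :=
  match k return 'rV[R]_(cd_dim k) with
  | 0%N => const_mx 1
  | k'.+1 => row_mx (cd_one k') 0
  end.

Fixpoint cd_conj (k : nat) : 'rV[R]_(cd_dim k) -> 'rV[R]_(cd_dim k) :=
  match k return 'rV[R]_(cd_dim k) -> 'rV[R]_(cd_dim k) with
  | 0%N => id
  | k'.+1 => fun x => row_mx (cd_conj (lsubmx x)) (- rsubmx x)
  end.

Fixpoint cd_mul (k : nat) :
    'rV[R]_(cd_dim k) -> 'rV[R]_(cd_dim k) -> 'rV[R]_(cd_dim k) :=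
  match k return
    'rV[R]_(cd_dim k) -> 'rV[R]_(cd_dim k) -> 'rV[R]_(cd_dim k) with
  | 0%N => fun x y => const_mx (x 0 0 * y 0 0)
  | k'.+1 => fun x y =>
      let a := lsubmx x in let b := rsubmx x in
      let c := lsubmx y in let d := rsubmx y in
      row_mx (cd_mul a c - cd_mul (cd_conj d) b)
             (cd_mul d a + cd_mul b (cd_conj c))
  end.

(* A vector of R^(m * m * cd_dim k) read as an m x m matrix over the k-th
   Cayley-Dickson algebra. *)
Definition cd_entry {k m} (v : 'rV[R]_(m * m * cd_dim k)) (i j : 'I_m) :
    'rV[R]_(cd_dim k) :=
  row (mxvec_index i j) (vec_mx v).

Definition unit_sphere (n : nat) : set (euclidean R n.+1) :=
  [set x : 'rV[R]_n.+1 | sqnorm x = 1].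
Arguments unit_sphere n : clear implicits.

(* The projective n-space over the k-th Cayley-Dickson algebra K, embedded in
   the (n+1) x (n+1) matrices over K: a line is represented by the orthogonal
   projection onto it, i.e. by a Hermitian idempotent matrix of trace 1.  For
   k = 3 and n = 2 this is the standard description of the Cayley plane inside
   the exceptional Jordan algebra. *)
Definition projective_space (k n : nat) :
    set (euclidean R (n.+1 * n.+1 * cd_dim k)) :=
  [set v : 'rV[R]_(n.+1 * n.+1 * cd_dim k) |
    [/\ forall i j, cd_entry v j i = cd_conj (cd_entry v i j),
        forall i j, \sum_l cd_mul (cd_entry v i l) (cd_entry v l j)
                    = cd_entry v i j &
        \sum_i cd_entry v i i = cd_one k]].
Arguments projective_space k n : clear implicits.

(* S^n, RP^n, CP^n, HP^n or CaP^2, up to diffeomorphism; n is the real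
   dimension. *)
Definition is_CROSS {n} (M : manifold R n) : Prop :=
  [\/ diffeomorphic_to_subset M (unit_sphere n),
      exists k m : nat, [/\ (k <= 2)%N, n = (m * cd_dim k)%N &
        diffeomorphic_to_subset M (projective_space k m)] |
      n = 16%N /\ diffeomorphic_to_subset M (projective_space 3 2)].

End CayleyDickson.

(* M is obtained from M1 and M2 by removing the open balls i1(B) and i2(B), B
   the unit ball, and identifying the boundary spheres by i2 \o i1^-1.  The
   smooth structure near the common sphere is the one given by the collars:
   equivalently, M is the gluing of M1 minus i1(0) and M2 minus i2(0) along the
   inversion x |-> x / |x|^2, which exchanges the inside and the outside of B
   and is the identity on its boundary.  i1 and i2 may each preserve or reverse
   any given orientations, so all choices of orientations are covered. *)
Definition connected_sum {R : realType} {n : nat} (M1 M2 M : manifold R n) :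
    Prop :=
  exists (i1 : euclidean R n -> M1) (i2 : euclidean R n -> M2)
         (j1 : M1 -> M) (j2 : M2 -> M),
    let A1 := [set p | p <> i1 (0 : 'rV[R]_n)] in
    let A2 := [set p | p <> i2 (0 : 'rV[R]_n)] in
    [/\ open_embedding setT i1 /\ open_embedding setT i2,
        open_embedding A1 j1 /\ open_embedding A2 j2,
        j1 @` A1 `|` j2 @` A2 = setT &
        forall p q, A1 p -> A2 q ->
          (j1 p = j2 q <-> exists2 x : 'rV[R]_n, x <> 0 &
             p = i1 x /\ q = i2 ((sqnorm x)^-1 *: x))].

(* A Riemannian metric is given by its Gram matrices (g(d_i, d_j))_ij in each
   chart of the atlas.  The Jacobian 'J of the library acts on row vectors on
   the right, hence the place of the transpose in metric_compatible. *)
Record riemannian_metric {R : realType} {n : nat} (M : manifold R n) :=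
  RiemannianMetric {
  gram : chart R n M -> 'rV[R]_n -> 'M[R]_n;
  metric_smooth : forall c, atlas c -> forall i j : 'I_n,
    smooth_on (ccod c) (fun x => gram c x i j);
  metric_sym : forall c, atlas c -> forall x, ccod c x ->
    (gram c x)^T = gram c x;
  metric_pos : forall c, atlas c -> forall x, ccod c x ->
    forall v : 'rV[R]_n, v != 0 -> 0 < (v *m gram c x *m v^T) 0 0;
  metric_compatible : forall c d, atlas c -> atlas d ->
    forall x, ccod c x -> cdom d (cinv c x) ->
    let t := cmap d \o cinv c in
    gram c x = 'J t x *m gram d (t x) *m ('J t x)^T }.

Section Curvature.
Context {R : realType} {n : nat}.
Implicit Types G : 'rV[R]_n -> 'M[R]_n.

Definition christoffel G (k i j : 'I_n) (x : 'rV[R]_n) : R :=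
  2^-1 * \sum_l invmx (G x) k l *
    (pd i (fun y => G y j l) x + pd j (fun y => G y i l) x
     - pd l (fun y => G y i j) x).

(* The coefficient of d_l in R(d_i, d_j) d_k, where
   R(X, Y) = [nabla_X, nabla_Y] - nabla_[X, Y]. *)
Definition riemann G (l i j k : 'I_n) (x : 'rV[R]_n) : R :=
  pd i (christoffel G l j k) x - pd j (christoffel G l i k) x
  + \sum_m (christoffel G m j k x * christoffel G l i m x
            - christoffel G m i k x * christoffel G l j m x).

(* <R(d_i /\ d_j), d_k /\ d_l> = g(R(d_i, d_j) d_l, d_k), so that
   <R(X /\ Y), X /\ Y> = sec(X /\ Y) for X, Y orthonormal. *)
Definition curvature_coef G (x : 'rV[R]_n) (i j k l : 'I_n) : R :=
  \sum_m riemann G m i j l x * G x m k.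

Definition alternating4 (w : 'I_n -> 'I_n -> 'I_n -> 'I_n -> R) : Prop :=
  forall i j k l, [/\ w j i k l = - w i j k l, w i k j l = - w i j k l &
                      w i j l k = - w i j k l].

(* The value at the bivector sum_(i < j) A_ij d_i /\ d_j, A antisymmetric, of
   the quadratic form with coefficients <q(d_i /\ d_j), d_k /\ d_l>; this
   bivector is half of the sum over all i and j. *)
Definition bivector_form (q : 'I_n -> 'I_n -> 'I_n -> 'I_n -> R)
    (A : 'M[R]_n) : R :=
  4^-1 * \sum_i \sum_j \sum_k \sum_l A i j * A k l * q i j k l.

Definition bivector_psd (q : 'I_n -> 'I_n -> 'I_n -> 'I_n -> R) : Prop :=
  forall A : 'M[R]_n, A^T = - A -> 0 <= bivector_form q A.

End Curvature.

Definition strongly_nonnegative_curvature {R : realType} {n : nat}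
    {M : manifold R n} (g : riemannian_metric M) : Prop :=
  forall (p : M) (c : chart R n M), atlas c -> cdom c p ->
    exists2 w : 'I_n -> 'I_n -> 'I_n -> 'I_n -> R, alternating4 w &
      bivector_psd (fun i j k l =>
        curvature_coef (gram g c) (cmap c p) i j k l + w i j k l).

(* Main.v *)
Require Import Defs.
From HB Require Import structures.
From mathcomp Require Import all_boot all_order all_algebra.
From mathcomp Require Import all_classical all_reals all_analysis.
From mathcomp Require Import ring lra.

(* A compact rank one symmetric space embeds homogeneously in a Euclidean space of
 matrices, in affine cells over R, C, H or O (the sphere by stereographic
 projection). Composing the embedding, in the cell centred at the removed ball,
 with a radial profile turns the complement of the ball into a submanifold which
 ends in a round cylinder; two such submanifolds are glued along their cylinders,
 whatever the orientations. The metric is induced by this immersion, so by the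
 Gauss equation its curvature is quadratic in the second fundamental form. That
 form is computed from the Clifford multiplication defining the algebra, and a
 multiple of a 4-form built from the Clifford generators compensates the negative
 part of the curvature operator. Parametrizations of the removed ball are absorbed
 by extending, up to an orthogonal map, every diffeomorphism germ of R^n to a
 diffeomorphism equal to the identity outside a ball. *)

Set Implicit Arguments.
Unset Strict Implicit.
Unset Printing Implicit Defensive.

Import Order.TTheory GRing.Theory Num.Theory.
Import numFieldNormedType.Exports.

Local Open Scope classical_set_scope.
Local Open Scope ring_scope.

(* Geometrically, the complement of a ball is a disc bundle over the cut locus of its centre, and
   its distance spheres carry a Hopf fibration. The profile solves the constraint [E1], which keeps
   horizontal lengths independent of the radius; only the fibre ratio [x] varies, from 1 on the
   round end to 0 at the cut locus. The mixed terms of the second fundamental form that remain are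
   dominated by taking the last coordinate [expR (kap * t)] steep, with [kap] large. The hardest
   case is the Cayley plane. Without associativity the Clifford generators depend on the point, the
   4-form needs other coefficients, and the decisive inequality [oct_slope] holds with a small
   margin; the constant 1000 comes from there. The octonionic frame exists only on a dense open set,
   and the cell coordinates degenerate at the cut locus. Both gaps are filled by the closedness of
   strong nonnegativity, [snn_limit]. Near its end every piece is exactly [(x / |x|, 0, height)].
   The direction [x / |x|] is invariant under the gluing inversion, so gluing only has to
   interpolate two monotone heights. *)
Tactic Notation "eqsum" ident(i) := apply: eq_bigr => i _.
Tactic Notation "swapsum" ident(i) := rewrite exchange_big;eqsum i.
Tactic Notation "swapsum'" ident(i) := rewrite exchange_big /=;eqsum i.
Tactic Notation "distrsum" ident(i) := rewrite mulr_sumr;eqsum i.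
Local Notation is_der t := (is_derive t 1).
Local Notation crd h j := (fun y => h y 0 j).
Local Notation smooth_row U h := (forall j, smooth_on U (crd h j)).

(** * Elementary calculus of smooth functions on open subsets of R^n *)

Section SmoothBasics.
Context {R : realType} {n : nat}.
Implicit Types (U V : set 'rV[R]_n) (f g : 'rV[R]_n -> R).

Local Notation ei i := (delta_mx 0 i : 'rV[R]_n).

Lemma Ck_onW k U V f : V `<=` U -> Ck_on k U f -> Ck_on k V f.
move=> VU;elim: k f => [|k IHk] f /= [cf Hf].
 by split=> // x;rewrite inE => /VU Ux;apply: cf;rewrite inE.
split=> [x|i];first by rewrite inE => /VU Ux;apply: cf;rewrite inE.
have [df Cf] := Hf i;split=> [x /VU /df //|];exact: IHk.
Qed.

Lemma smoothW U V f : V `<=` U -> smooth_on U f -> smooth_on V f.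
by move=> VU sf k;apply: Ck_onW VU (sf k). Qed.

Lemma smooth_on_local U f :
 (forall x, U x -> exists2 V : set 'rV[R]_n, V x & smooth_on V f) ->
 smooth_on U f.
move=> H k.
have {}H : forall x, U x -> exists2 V : set 'rV[R]_n, V x & Ck_on k V f.
 by move=> x /H[V Vx sV];exists V.
elim: k f H => [|k IHk] f H /=.
 split=> // x;rewrite inE => /H[V Vx [cf _]];by apply: cf;rewrite inE.
split=> [x|i].
 by rewrite inE => /H[V Vx [cf _]];apply: cf;rewrite inE.
split=> [x /H[V Vx [_ /(_ i) [df _]]]|];first exact: df.
apply: IHk => x /H[V Vx [_ /(_ i) [_ Cf]]];by exists V.
Qed.

Lemma smooth_cts U f x : smooth_on U f -> U x -> {for x, continuous f}.
by move=> /(_ 0%N)[cf _] Ux;apply: cf;rewrite inE. Qed.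

Lemma smooth_on_derivable U f x i : smooth_on U f -> U x -> derivable f x (ei i).
by move=> /(_ 1%N)[_ /(_ i)[df _]] Ux;exact: df. Qed.

Lemma smooth_on_pd U f i : smooth_on U f -> smooth_on U (pd i f).
by move=> sf k;have [_ /(_ i)[_]] := sf k.+1. Qed.

Lemma open_near_eq U f g x : open U -> (forall y, U y -> f y = g y) -> U x ->
 {near x, f =1 g}.
by move=> oU fg Ux;near=> y;apply: fg;near: y;exact: open_nbhs_nbhs.
Unshelve. all: by end_near. Qed.

Lemma pd_near f g x i : {near x, f =1 g} -> pd i f x = pd i g x.
by move=> fg;exact: near_eq_derive. Qed.

Lemma Ck_on_eq k U f g : open U -> (forall x, U x -> f x = g x) ->
 Ck_on k U f -> Ck_on k U g.
move=> oU;elim: k f g => [|k IHk] f g fg /= [cf Hf].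
 split=> // x;rewrite inE => Ux;rewrite /continuous_at -(fg _ Ux).
 apply: cvg_trans (cf x _);last by rewrite inE.
 exact: near_eq_cvg (open_near_eq oU fg Ux).
split=> [x|i].
 rewrite inE => Ux;rewrite /continuous_at -(fg _ Ux).
 apply: cvg_trans (cf x _);last by rewrite inE.
 exact: near_eq_cvg (open_near_eq oU fg Ux).
have [df Cf] := Hf i;split=> [x Ux|].
 by apply: near_eq_derivable (df x Ux);exact: open_near_eq Ux.
by apply: IHk Cf => x Ux;apply: pd_near;exact: open_near_eq Ux.
Qed.

Lemma smooth_on_eq U f g : open U -> (forall x, U x -> f x = g x) ->
 smooth_on U f -> smooth_on U g.
by move=> oU fg sf k;exact: Ck_on_eq oU fg (sf k). Qed.

(* Coinduction principle for smoothness. *)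
Lemma smooth_coind U (S : ('rV[R]_n -> R) -> Prop) : open U ->
 (forall f, S f -> (forall x, U x -> {for x, continuous f}) /\
  forall i, exists2 g, S g & forall x, U x -> is_derive x (ei i) f (g x)) ->
 forall f, S f -> smooth_on U f.
move=> oU HS f Sf k;elim: k f Sf => [|k IHk] f /HS[cf Hf] /=.
 by split=> // x;rewrite inE => /cf.
split=> [x|i];first by rewrite inE => /cf.
have [g Sg dg] := Hf i;split=> [x /dg[]//|].
by apply: Ck_on_eq (IHk _ Sg) => // x /dg [].
Qed.

Lemma smooth_isd U f x i : smooth_on U f -> U x ->
 is_derive x (ei i) f (pd i f x).
by move=> sf Ux;apply: derivableP;exact: smooth_on_derivable sf Ux. Qed.

Lemma der_line f (y v : 'rV[R]_n) (s d : R) :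
 is_derive (y+s *: v) v f d -> is_derive s (1 : R) (fun t : R => f (y+t *: v)) d.
have E : (fun h : R => h^-1 *: ((f \o shift (y+s *: v)) (h *: v) - f (y+s *: v)))
 = (fun h : R => h^-1 *: (((fun t : R => f (y+t *: v)) \o shift s) (h *: (1 : R))
    - f (y+s *: v))).
 apply/funext => h /=;congr (_ *: (f _ - _)).
 by rewrite -[h *: (1 : R)]/(h * 1) mulr1 scalerDl addrCA.
by case=> df <-;split;[move: df|];rewrite /derivable /derive E.
Qed.

Definition linform (c : 'I_n -> R) (h : 'rV[R]_n) : R := \sum_i h 0 i*c i.

Lemma linform_is_linear c : linear (linform c).
move=> a u v;rewrite /linform scaler_sumr -big_split /=.
by eqsum i;rewrite !mxE mulrDl scalerAl.
Qed.

HB.instance Definition _ c := @GRing.isLinear.Build R 'rV[R]_n R *:%R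
 (linform c) (linform_is_linear c).

Lemma continuous_sum_fin (T : topologicalType) (I : Type) (r : seq I)
  (F : I -> T -> R) x :
 (forall i, {for x, continuous (F i)}) ->
 {for x, continuous (fun y => \sum_(i <- r) F i y)}.
move=> cF;elim: r => [|i r IHr].
 have -> : (fun y => \sum_(i <- [::]) F i y) = fun=> 0 :> R.
  by apply/funext => y;rewrite big_nil.
 exact: cst_continuous.
have -> : (fun y => \sum_(j <- i :: r) F j y) =
  (fun y => F i y + \sum_(j <- r) F j y).
 by apply/funext => y;rewrite big_cons.
exact: continuousD (cF i) IHr.
Qed.

Lemma linform_continuous c : continuous (linform c).
move=> x;apply: continuous_sum_fin => i.
by apply: continuousM;[exact: coord_continuous|exact: cst_continuous].
Qed.

(** Passes from the epsilon form of a first-order expansion to the library predicate, whose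
    differential is picked by choice among the continuous linear maps. *)
Lemma differentiable_expansion f x (df : {linear 'rV[R]_n -> R}) :
 continuous df ->
 (forall e : R, 0 < e -> \forall h \near (0 : 'rV[R]_n),
  `|f (h+x) - f x - df h| <= e * `|h|) ->
 differentiable f x.
move=> dfc H;apply/diffP => /=.
apply: (@getPex _ (fun (df : {linear 'rV[R]_n -> R}) => continuous df /\
 forall y, f y = f (lim (nbhs x))+df (y - lim (nbhs x))
         +o_(y \near x) (y - lim (nbhs x)))).
exists df;split=> //;apply/eqaddoEx => y;rewrite lim_id //;move: y.
apply/funeqP;apply/eqaddoP => e e0.
suff : \forall y \near x, `|f y - (f x+df (y - x))| <= e * `|y - x| by [].
rewrite (near_shift 0 x) subr0;near=> h => /=.
rewrite addrK opprD addrA.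
by near: h;exact: H.
Unshelve. all: by end_near. Qed.

Lemma row_norm_coord (h : 'rV[R]_n) i : `|h 0 i| <= `|h|.
rewrite [leRHS]/Num.Def.normr/= mx_normrE.
exact: le_trans (le_bigmax _ _ (0, i)).
Qed.

Lemma row_norm_lt (h : 'rV[R]_n) e : 0 < e -> (forall i, `|h 0 i| < e) ->
 `|h| < e.
move=> e0 H;rewrite [ltLHS]/Num.Def.normr/= mx_normrE.
by apply: bigmax_lt => // -[i j] _ /=;rewrite ord1.
Qed.

Lemma row_norm_le (h : 'rV[R]_n) e : 0 <= e -> (forall i, `|h 0 i| <= e) ->
 `|h| <= e.
move=> e0 H;rewrite [leLHS]/Num.Def.normr/= mx_normrE.
by apply: bigmax_le => // -[i j] _ /=;rewrite ord1.
Qed.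

(** Handles increments of either sign at once: the intermediate point is located only by its
    absolute value, which is all that estimates along the coordinate axes require. *)
Lemma MVT_abs (g dg : R -> R) (b : R) :
 (forall s, `|s| <= `|b| -> is_derive s (1 : R) g (dg s)) ->
 exists2 c, `|c| <= `|b| & g b - g 0 = dg c*b.
move=> gd.
have gc (s : R) : `|s| <= `|b| -> {for s, continuous g}.
 move=> /gd [+ _];by move/derivable1_diffP/differentiable_continuous.
have [b0|b0] := leP 0 b.
 have sb (s : R) : s \in `[0, b]%R -> `|s| <= `|b|.
  by rewrite in_itv /= => /andP[s0 sb];rewrite !ger0_norm.
 have [c cb E] : exists2 c, c \in `[0, b]%R & g b - g 0 = dg c*(b - 0).
  apply: (@MVT_segment R) => //.
   by move=> s sb';apply: gd;apply: sb;exact: subset_itv_oo_cc sb'.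
  by apply: continuous_in_subspaceT => s;rewrite inE => /sb /gc.
 by exists c;[exact: sb|rewrite E subr0].
have sb (s : R) : s \in `[b, 0]%R -> `|s| <= `|b|.
 rewrite in_itv /= => /andP[bs s0];rewrite !ler0_norm ?lerN2 //.
 exact: ltW.
have [c cb E] : exists2 c, c \in `[b, 0]%R & g 0 - g b = dg c*(0 - b).
 apply: (@MVT_segment R);first exact: ltW.
  by move=> s sb';apply: gd;apply: sb;exact: subset_itv_oo_cc sb'.
 by apply: continuous_in_subspaceT => s;rewrite inE => /sb /gc.
by exists c;[exact: sb|rewrite -opprB E sub0r mulrN opprK].
Qed.

(* The
 increment is split along the coordinate axes, with the mean value theorem
 on each piece. *)
Lemma C1_differentiable U f x : open U -> U x -> smooth_on U f ->
 differentiable f x.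
move=> oU Ux sf.
apply: (@differentiable_expansion f x (linform (fun i => pd i f x))).
 exact: linform_continuous.
move=> e e0.
(* Each of the [n] axis steps costs an error of [e'] times the norm of [h]; the successor keeps the
   quotient meaningful when [n] is 0. *)
pose e' := e / n.+1%:R.
have e'0 : 0 < e' by rewrite divr_gt0 ?ltr0n.
have nearP : \forall y \near x, U y /\ forall i, `|pd i f x - pd i f y| < e'.
 near=> y;split;first by near: y;exact: open_nbhs_nbhs.
 near: y;apply: filter_forall => i.
 have /cvgrPdist_lt := smooth_cts (smooth_on_pd i sf) Ux.
 by apply.
have /nbhs_ballP[d /= d0 Hd] := nearP.
near=> h.
have hd : `|h| < d.
 near: h;apply/nbhs_ballP;exists d => // y.
 by rewrite -ball_normE /ball_ /= sub0r normrN.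
pose tr k := (\row_j (if (j < k)%N then h 0 j else 0) : 'rV[R]_n).
have inB (k : nat) (i : 'I_n) (s : R) : nat_of_ord i = k -> `|s| <= `|h 0 i| ->
  ball x d (x+tr k+s *: ei i).
 move=> ik sh;rewrite -ball_normE /ball_ /= -addrA opprD addrA subrr.
 rewrite sub0r normrN;apply: row_norm_lt => // j;rewrite !mxE eqxx /=.
 have hj j' : `|h 0 j'| < d by exact: le_lt_trans (row_norm_coord _ _) hd.
 have [jk|kj] := ltnP j k.
  rewrite (_ : j == i = false) ?mulr0 ?addr0 //.
  by apply/eqP => ji;rewrite ji ik ltnn in jk.
 rewrite add0r;have [_|_] := eqVneq j i;last by rewrite mulr0 normr0.
 by rewrite mulr1;exact: le_lt_trans sh (hj i).
have step k : (k <= n)%N ->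
  `|f (x+tr k) - f x - \sum_(i < n | (i < k)%N) h 0 i * pd i f x|
  <= k%:R*(e' * `|h|).
 elim: k => [_|k IHk kn].
  rewrite mul0r big_pred0 // subr0 (_ : tr 0%N = 0) ?addr0 ?subrr ?normr0 //.
  by apply/rowP => j;rewrite !mxE.
 have {}IHk := IHk (ltnW kn).
 pose i := Ordinal kn.
 pose g (s : R) := f (x+tr k+s *: ei i).
 pose dg (s : R) := pd i f (x+tr k+s *: ei i).
 have gd (s : R) : `|s| <= `|h 0 i| -> is_derive s (1 : R) g (dg s).
  move=> sh;apply: der_line;apply: smooth_isd sf _.
  exact: (Hd _ (inB _ i _ erefl sh)).1.
 have [c ch E] := MVT_abs gd.
 have -> : tr k.+1 = tr k+h 0 i *: ei i.
  apply/rowP => j;rewrite !mxE eqxx /= ltnS leq_eqVlt.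
  have [jk|] := eqVneq (nat_of_ord j) k.
   have -> : j = i by apply: val_inj.
   by rewrite eqxx mulr1 /= ltnn add0r.
  move=> jk /=;rewrite (_ : j == i = false) ?mulr0 ?addr0 //.
  by apply/eqP => ji;rewrite ji eqxx in jk.
 rewrite (bigD1 i) //=.
 rewrite (eq_bigl (fun j : 'I_n => (j < k)%N));last first.
  move=> j;rewrite ltnS leq_eqVlt -(inj_eq val_inj) /=.
  by have [->|] := eqVneq (nat_of_ord j) k;rewrite ?ltnn ?andbT.
 rewrite addrA;set S := \sum_(_ < _ | _) _ in IHk *.
 have -> : f (x+tr k+h 0 i *: ei i) - f x - (h 0 i * pd i f x+S) =
   (f (x+tr k) - f x - S)+(dg c - pd i f x)*h 0 i.
  have -> : f (x+tr k+h 0 i *: ei i) = f (x+tr k)+dg c*h 0 i.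
   have := E;rewrite /g scale0r addr0 => <-;by rewrite [RHS]addrC subrK.
  by ring.
 apply: le_trans (ler_normD _ _) _.
 have -> : k.+1%:R = k%:R + 1 :> R by rewrite natr1.
 rewrite [leRHS]mulrDl mul1r lerD // normrM.
 apply: ler_pM => //;last exact: row_norm_coord.
 by rewrite distrC ltW //;apply: (Hd _ (inB _ i _ erefl ch)).2.
have := step n (leqnn n).
have -> : tr n = h by apply/rowP => j;rewrite mxE ltn_ord.
rewrite (eq_bigl xpredT);last by move=> j;rewrite ltn_ord.
rewrite [h+x]addrC => /le_trans;apply.
rewrite mulrA ler_wpM2r // /e' mulrCA ger_pMr //.
by rewrite ler_pdivrMr ?ltr0n // mul1r ler_nat.
Unshelve. all: by end_near. Qed.

End SmoothBasics.

(** * Chain rule and closure properties of smoothness *)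

Section Composition.
Context {R : realType}.

Lemma row_delta_sum n (v : 'rV[R]_n) :
 v = \sum_i v 0 i *: (delta_mx 0 i : 'rV[R]_n).
exact: row_sum_delta. Qed.

Lemma diff_pdE n (f : 'rV[R]_n -> R) x v : differentiable f x ->
 'd f x v = \sum_i v 0 i * pd i f x.
move=> df;rewrite {1}(row_delta_sum v) linear_sum /=.
by eqsum i;rewrite linearZ /= /pd deriveE.
Qed.

Lemma differentiable_row n m (h : 'rV[R]_n -> 'rV[R]_m) x :
 (forall j, differentiable (crd h j) x) -> differentiable h x.
move=> dh.
have -> : h = \sum_(j < m) (fun y => h y 0 j *: (delta_mx 0 j : 'rV[R]_m)).
 apply/funext => y;rewrite fct_sumE;exact: row_delta_sum.
by apply: differentiable_sum => j;apply: differentiableZl.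
Qed.

Lemma diff_coord n m (h : 'rV[R]_n -> 'rV[R]_m) x v j : differentiable h x ->
 ('d h x v) 0 j = 'd (crd h j) x v.
move=> dh;have dc := @differentiable_coord R _ _ (h x) 0 j.
have E := congr1 (fun g => g v) (diff_comp dh dc).
rewrite -[fun y => h y 0 j]/((fun N : 'rV[R]_m => N 0 j) \o h) E /=.
have [_] : is_derive (h x) ('d h x v) (fun y : 'rV[R]_m => y 0 j) (('d h x v) 0 j).
 exact: is_derive_coord.
by rewrite deriveE // => ->.
Qed.

Lemma pd_comp n m (f : 'rV[R]_m -> R) (h : 'rV[R]_n -> 'rV[R]_m) x i :
 (forall j, differentiable (crd h j) x) -> differentiable f (h x) ->
 pd i (fun y => f (h y)) x =
 \sum_j pd j f (h x) * pd i (crd h j) x.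
move=> dh df;have dh' := differentiable_row dh.
rewrite {1}/pd deriveE;last exact: differentiable_comp.
rewrite -[fun y => f (h y)]/(f \o h) diff_comp //= diff_pdE //.
by eqsum j;rewrite diff_coord // -deriveE // mulrC.
Qed.

(** Coinductive encoding of smoothness in one variable: [p] lies in some family stable under
    differentiation on [D]. An explicit function is treated by exhibiting such a family. *)
Definition smooth1 (D : set R) (p : R -> R) : Prop :=
 exists2 S : (R -> R) -> Prop, S p &
 forall g, S g -> exists2 g', S g' &
  forall t, D t -> is_der t g (g' t).

Lemma smooth1_dest D p : smooth1 D p ->
 exists2 p', smooth1 D p' & forall t, D t -> is_der t p (p' t).
move=> [S Sp HS];have [p' Sp' dp] := HS _ Sp.
by exists p' => //;exists S.
Qed.

Lemma differentiable_comp1 n (p : R -> R) (f : 'rV[R]_n -> R) x d :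
 differentiable f x -> is_derive (f x) (1 : R) p d ->
 differentiable (fun y => p (f y)) x.
by move=> df [/derivable1_diffP dp _];exact: (@differentiable_comp _ _ _ _ f p).
Qed.

Lemma pd_comp1 n (p : R -> R) (f : 'rV[R]_n -> R) x i d :
 differentiable f x -> is_derive (f x) (1 : R) p d ->
 pd i (fun y => p (f y)) x = d * pd i f x.
move=> df [/derivable1_diffP dp dE].
have dpf : differentiable (p \o f) x by exact: differentiable_comp.
rewrite /pd deriveE // -[fun y => p (f y)]/(p \o f) diff_comp //=.
by rewrite diff1E // derive1E dE deriveE // mulrC.
Qed.

(** This family is stable under partial derivatives, since the chain and product rules produce only
    sums and products of its members. The coinduction principle then gives all closure properties at
    once, without an induction on the order of differentiability. *)
Inductive smooth_alg n (U : set 'rV[R]_n) : ('rV[R]_n -> R) -> Prop :=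
| SA_base f of smooth_on U f : smooth_alg U f
| SA_comp m (V : set 'rV[R]_m) (h : 'rV[R]_n -> 'rV[R]_m) f of
  open V & (smooth_row U h) &
  (forall x, U x -> V (h x)) & smooth_on V f : smooth_alg U (fun x => f (h x))
| SA_comp1 (D : set R) p f of smooth1 D p & smooth_on U f &
  (forall x, U x -> D (f x)) : smooth_alg U (fun x => p (f x))
| SA_add f g of smooth_alg U f & smooth_alg U g : smooth_alg U (fun x => f x+g x)
| SA_mul f g of smooth_alg U f & smooth_alg U g : smooth_alg U (fun x => f x * g x).

Lemma smooth_alg_sum n (U : set 'rV[R]_n) (I : Type) (r : seq I) F :
 (forall i, smooth_alg U (F i)) -> smooth_alg U (fun x => \sum_(i <- r) F i x).
move=> HF;elim: r => [|i r IHr].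
 have -> : (fun x => \sum_(i <- [::]) F i x) = fun=> 0 :> R.
  by apply/funext => x;rewrite big_nil.
 by apply: SA_base => k;exact: Ck_on_cst.
have -> : (fun x => \sum_(j <- i :: r) F j x) =
  (fun x => F i x + \sum_(j <- r) F j x).
 by apply/funext => x;rewrite big_cons.
exact: SA_add.
Qed.

Lemma smooth_alg_diff n (U : set 'rV[R]_n) f : open U -> smooth_alg U f ->
 (forall x, U x -> differentiable f x) /\
 forall i, exists2 g, smooth_alg U g & forall x, U x -> pd i f x = g x.
move=> oU;elim => {f}
 [f sf|m V h f oV sh hV sf|D p f sp sf fD|f g _ [df Hf] _ [dg Hg]|
 f g saf [df Hf] sag [dg Hg]].
- split=> [x Ux|i];first exact: C1_differentiable Ux sf.
 by exists (pd i f) => //;apply: SA_base;exact: smooth_on_pd.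
- have dh x j : U x -> differentiable (crd h j) x.
  by move=> Ux;exact: C1_differentiable Ux (sh j).
 have df x : U x -> differentiable f (h x).
  by move=> /hV Vx;exact: C1_differentiable Vx sf.
 split=> [x Ux|i].
  apply: differentiable_comp;last exact: df.
  by apply: differentiable_row => j;exact: dh.
 exists (fun x => \sum_j pd j f (h x) * pd i (crd h j) x).
  apply: smooth_alg_sum => j;apply: SA_mul.
   by apply: (SA_comp oV sh hV);exact: smooth_on_pd.
  by apply: SA_base;exact: smooth_on_pd.
 by move=> x Ux;apply: pd_comp => [j|];[exact: dh|exact: df].
- have df x : U x -> differentiable f x.
  by move=> Ux;exact: C1_differentiable Ux sf.
 have [p' sp' dp] := smooth1_dest sp.
 split=> [x Ux|i];first exact: differentiable_comp1 (df x Ux) (dp _ (fD _ Ux)).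
 exists (fun x => p' (f x) * pd i f x).
  by apply: SA_mul;[exact: SA_comp1 sp' sf fD|apply: SA_base;exact: smooth_on_pd].
 by move=> x Ux;exact: pd_comp1 (df x Ux) (dp _ (fD _ Ux)).
- split=> [x Ux|i];first by apply: differentiableD;[exact: df|exact: dg].
 have [f' sf' Ef] := Hf i;have [g' sg' Eg] := Hg i.
 exists (fun x => f' x+g' x);first exact: SA_add.
 move=> x Ux;rewrite -Ef // -Eg // /pd -deriveD //;apply: diff_derivable.
  exact: df.
 exact: dg.
- split=> [x Ux|i];first by apply: differentiableM;[exact: df|exact: dg].
 have [f' sf' Ef] := Hf i;have [g' sg' Eg] := Hg i.
 exists (fun x => f x * g' x+g x*f' x);first by apply: SA_add;exact: SA_mul.
 move=> x Ux;rewrite -Ef // -Eg // /pd [LHS](deriveM (f := f)) //.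
  by apply: diff_derivable;exact: df.
 by apply: diff_derivable;exact: dg.
Qed.

Lemma smooth_alg_smooth n (U : set 'rV[R]_n) f : open U -> smooth_alg U f ->
 smooth_on U f.
move=> oU;apply: smooth_coind => // {}f /(smooth_alg_diff oU)[df Hf].
split=> [x /df /differentiable_continuous //|i].
have [g sg Eg] := Hf i;exists g => // x Ux;rewrite -Eg //.
by apply: derivableP;apply: diff_derivable;exact: df.
Qed.

Section Closure.
Context {n : nat} (U : set 'rV[R]_n) (oU : open U).
Implicit Types f g : 'rV[R]_n -> R.

Lemma smooth_cst (a : R) : smooth_on U (fun=> a).
by move=> k;exact: Ck_on_cst. Qed.

Lemma smoothD f g : smooth_on U f -> smooth_on U g -> smooth_on U (fun x => f x+g x).
by move=> sf sg;apply: smooth_alg_smooth => //;apply: SA_add;exact: SA_base. Qed.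

Lemma smoothM f g : smooth_on U f -> smooth_on U g -> smooth_on U (fun x => f x * g x).
by move=> sf sg;apply: smooth_alg_smooth => //;apply: SA_mul;exact: SA_base. Qed.

Lemma smoothZ (a : R) f : smooth_on U f -> smooth_on U (fun x => a*f x).
by move=> sf;apply: smoothM => //;exact: smooth_cst. Qed.

Lemma smoothN f : smooth_on U f -> smooth_on U (fun x => - f x).
move=> sf;have -> : (fun x => - f x) = (fun x => -1*f x).
 by apply/funext => x;rewrite mulN1r.
exact: smoothZ.
Qed.

Lemma smoothB f g : smooth_on U f -> smooth_on U g -> smooth_on U (fun x => f x - g x).
by move=> sf sg;apply: smoothD => //;exact: smoothN. Qed.

Lemma smooth_sum (I : Type) (r : seq I) F :
 (forall i, smooth_on U (F i)) -> smooth_on U (fun x => \sum_(i <- r) F i x).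
move=> HF;apply: smooth_alg_smooth => //;apply: smooth_alg_sum => i.
exact: SA_base.
Qed.

Lemma smooth_comp m (V : set 'rV[R]_m) (h : 'rV[R]_n -> 'rV[R]_m) (f : 'rV[R]_m -> R) :
 open V -> (smooth_row U h) ->
 (forall x, U x -> V (h x)) -> smooth_on V f -> smooth_on U (fun x => f (h x)).
by move=> oV sh hV sf;apply: smooth_alg_smooth => //;exact: SA_comp sf. Qed.

Lemma smooth_comp1 (D : set R) p f : smooth1 D p -> smooth_on U f ->
 (forall x, U x -> D (f x)) -> smooth_on U (fun x => p (f x)).
by move=> sp sf fD;apply: smooth_alg_smooth => //;exact: SA_comp1 sp sf fD. Qed.

End Closure.

End Composition.

(* A sealed copy of [pd]: conversion must never unfold a partial derivative. *)
HB.lock Definition dd {R : realType} {n : nat} (i : 'I_n) (f : 'rV[R]_n -> R) :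
 'rV[R]_n -> R := pd i f.

Section SealedDerivative.
Context {R : realType} {n : nat}.
Implicit Types (U : set 'rV[R]_n) (f g : 'rV[R]_n -> R).

Lemma ddE i f : pd i f = dd i f. Proof. by rewrite dd.unlock. Qed.

Lemma smooth_dd U f i : smooth_on U f -> smooth_on U (dd i f).
by rewrite dd.unlock;exact: smooth_on_pd. Qed.

Lemma smooth_der U f x i : smooth_on U f -> U x ->
 is_derive x (delta_mx 0 i : 'rV[R]_n) f (dd i f x).
by rewrite dd.unlock;exact: smooth_isd. Qed.

Lemma dd_is_derive f x i d :
 is_derive x (delta_mx 0 i : 'rV[R]_n) f d -> dd i f x = d.
by rewrite dd.unlock => -[_]. Qed.

Lemma dd_near f g x i : {near x, f =1 g} -> dd i f x = dd i g x.
by rewrite dd.unlock;exact: pd_near. Qed.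

Lemma dd_eq_on U f g x i : open U -> (forall y, U y -> f y = g y) -> U x ->
 dd i f x = dd i g x.
by move=> oU fg Ux;apply: dd_near;exact: open_near_eq Ux. Qed.

Lemma smooth_diff U f x : open U -> smooth_on U f -> U x ->
 differentiable f x.
by move=> oU sf Ux;exact: C1_differentiable Ux sf. Qed.

Lemma dd_comp m (f : 'rV[R]_m -> R) (h : 'rV[R]_n -> 'rV[R]_m) x i :
 (forall j, differentiable (crd h j) x) -> differentiable f (h x) ->
 dd i (fun y => f (h y)) x =
 \sum_j dd j f (h x)*dd i (crd h j) x.
by rewrite !dd.unlock => dh df;rewrite pd_comp. Qed.

Lemma dd_comp1 (p : R -> R) f x i d :
 differentiable f x -> is_derive (f x) (1 : R) p d ->
 dd i (fun y => p (f y)) x = d*dd i f x.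
by rewrite !dd.unlock;exact: pd_comp1. Qed.

Lemma diff_ddE f x v : differentiable f x ->
 'd f x v = \sum_i v 0 i*dd i f x.
by move=> df;rewrite diff_pdE //;under eq_bigr do rewrite ddE. Qed.

Lemma dd_cst (a : R) i (x : 'rV[R]_n) : dd i (fun=> a) x = 0.
by rewrite dd.unlock;exact: derive_cst. Qed.

Lemma dd_coord i j (x : 'rV[R]_n) : dd i (fun y : 'rV[R]_n => y 0 j) x = (i == j)%:R.
by apply: dd_is_derive;apply: is_derive_eq (is_derive_coord _ _ _) _;rewrite mxE eqxx /= eq_sym.
Qed.

Lemma ddD U f g x i : smooth_on U f -> smooth_on U g -> U x ->
 dd i (fun y => f y+g y) x = dd i f x+dd i g x.
move=> sf sg Ux;apply: dd_is_derive.
exact: (is_deriveD (smooth_der i sf Ux) (smooth_der i sg Ux)).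
Qed.

Lemma ddM U f g x i : smooth_on U f -> smooth_on U g -> U x ->
 dd i (fun y => f y * g y) x = f x*dd i g x+g x*dd i f x.
move=> sf sg Ux;apply: dd_is_derive.
exact: (is_deriveM (smooth_der i sf Ux) (smooth_der i sg Ux)).
Qed.

Lemma ddZ U (a : R) f x i : smooth_on U f -> U x ->
 dd i (fun y => a*f y) x = a*dd i f x.
move=> sf Ux;rewrite (@ddM U) //;last exact: smooth_cst.
by rewrite dd_cst mulr0 addr0.
Qed.

Lemma ddN U f x i : smooth_on U f -> U x -> dd i (fun y => - f y) x = - dd i f x.
move=> sf Ux;rewrite -mulN1r -(ddZ (-1) i sf Ux);congr (dd i _ x).
by apply/funext => y;rewrite mulN1r.
Qed.

Lemma ddB U f g x i : smooth_on U f -> smooth_on U g -> U x -> open U ->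
 dd i (fun y => f y - g y) x = dd i f x - dd i g x.
move=> sf sg Ux oU;rewrite (ddD (g := fun y => - g y) i sf) //;last exact: smoothN.
by rewrite (ddN i sg).
Qed.

Lemma dd_sum U (I : Type) (r : seq I) (F : I -> 'rV[R]_n -> R) x i : open U ->
 (forall k, smooth_on U (F k)) -> U x ->
 dd i (fun y => \sum_(k <- r) F k y) x = \sum_(k <- r) dd i (F k) x.
move=> oU sF Ux;elim: r => [|k r IHr].
 have -> : (fun y => \sum_(k <- [::]) F k y) = fun=> 0 :> R.
  by apply/funext => y;rewrite big_nil.
 by rewrite big_nil dd_cst.
have -> : (fun y => \sum_(j <- k :: r) F j y) =
  (fun y => F k y + \sum_(j <- r) F j y).
 by apply/funext => y;rewrite big_cons.
by rewrite big_cons (@ddD U) ?IHr //;exact: smooth_sum.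
Qed.

End SealedDerivative.

(** * Symmetry of second partial derivatives *)

Section Schwarz.
Context {R : realType} {n : nat}.
Implicit Types (U : set 'rV[R]_n) (f : 'rV[R]_n -> R).
Local Notation ei i := (delta_mx 0 i : 'rV[R]_n).

(** The mean value theorem is used twice: along [i] for the difference of [f] in the direction [j],
    then along [j] for [dd i f]. *)
Lemma second_difference U f x t (i j : 'I_n) : 0 < t -> smooth_on U f ->
 (forall a b : R, `|a| <= t -> `|b| <= t -> U (x+a *: ei i+b *: ei j)) ->
 exists a b : R, [/\ `|a| <= t, `|b| <= t &
  f (x+t *: ei i+t *: ei j) - f (x+t *: ei i) - f (x+t *: ei j)+f x
  = t ^+ 2*dd j (dd i f) (x+a *: ei i+b *: ei j)].
move=> t0 sf HU;have tE : `|t| = t by rewrite gtr0_norm.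
pose g (s : R) := f (x+t *: ei j+s *: ei i) - f (x+s *: ei i).
pose dg (s : R) := dd i f (x+t *: ei j+s *: ei i) - dd i f (x+s *: ei i).
have gd (s : R) : `|s| <= `|t| -> is_derive s (1 : R) g (dg s).
 rewrite tE => st;apply: is_deriveB;apply: der_line.
  apply: smooth_der sf _;rewrite addrAC;apply: HU => //;by rewrite tE.
 apply: smooth_der sf _;rewrite -[X in U X]addr0 -(scale0r (ei j)).
 by apply: HU => //;rewrite normr0 ltW.
have [a at_ E1] := MVT_abs gd;rewrite tE in at_.
pose g2 (s : R) := dd i f (x+a *: ei i+s *: ei j).
pose dg2 (s : R) := dd j (dd i f) (x+a *: ei i+s *: ei j).
have gd2 (s : R) : `|s| <= `|t| -> is_derive s (1 : R) g2 (dg2 s).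
 rewrite tE => st;apply: der_line.
 by apply: smooth_der (smooth_dd i sf) _;exact: HU.
have [b bt E2] := MVT_abs gd2;rewrite tE in bt.
exists a, b;split=> //.
have := E1;rewrite /g !scale0r !addr0 /dg [x+t *: ei j + _]addrAC.
have -> : dd i f (x+t *: ei j+a *: ei i) - dd i f (x+a *: ei i) =
  dg2 b * t.
 by rewrite -E2 /g2 scale0r addr0 addrAC.
move=> E;rewrite -[_ ^+ 2]/(t * t) -/(dg2 b) mulrC mulrA -E;by ring.
Qed.

Lemma smooth_near_lt U f x (e : R) : smooth_on U f -> U x -> 0 < e ->
 \forall y \near x, `|f x - f y| < e.
by move=> sf Ux e0;have /cvgrPdist_lt := smooth_cts sf Ux;apply.
Qed.

(** The second difference is symmetric in [i] and [j], so it yields equal values of the two mixed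
    derivatives at two nearby points; continuity brings both points back to [x]. *)
Lemma dd_comm U f x i j : open U -> smooth_on U f -> U x ->
 dd i (dd j f) x = dd j (dd i f) x.
move=> oU sf Ux;apply/eqP;rewrite -subr_eq0 -normr_le0.
apply/ler_addgt0Pl => e e0;rewrite addr0.
have e20 : 0 < e / 2 by rewrite divr_gt0.
have nearP : \forall y \near x, [/\ U y,
  `|dd i (dd j f) x - dd i (dd j f) y| < e / 2 &
  `|dd j (dd i f) x - dd j (dd i f) y| < e / 2].
 have N1 : \forall y \near x, U y by exact: open_nbhs_nbhs.
 have N2 := smooth_near_lt (smooth_dd i (smooth_dd j sf)) Ux e20.
 have N3 := smooth_near_lt (smooth_dd j (smooth_dd i sf)) Ux e20.
 apply: filterS3 N1 N2 N3 => y;by split.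
have /nbhs_ballP[d /= d0 Hd] := nearP.
pose t := d / 3.
have t0 : 0 < t by rewrite divr_gt0.
have HB a b k l : `|a| <= t -> `|b| <= t -> ball x d (x+a *: ei k+b *: ei l).
 move=> ha hb;rewrite -ball_normE /ball_ /= -addrA opprD addrA subrr sub0r normrN.
 apply: row_norm_lt => // q;rewrite !mxE eqxx /=.
 apply: le_lt_trans (ler_normD _ _) _.
 have h (c : R) (m : 'I_n) : `|c| <= t -> `|c*(q == m)%:R| <= t.
  by move=> ct;case: (q == m);rewrite ?mulr1 ?mulr0 ?normr0 // ltW.
 apply: le_lt_trans (lerD (h _ _ ha) (h _ _ hb)) _.
 by rewrite /t;lra.
have [a [b [ha hb E]]] := second_difference t0 sf
 (fun a b ha hb => let: And3 u _ _ := Hd _ (HB a b i j ha hb) in u).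
have [a' [b' [ha' hb' E']]] := second_difference t0 sf
 (fun a b ha hb => let: And3 u _ _ := Hd _ (HB a b j i ha hb) in u).
have [_ _ h1] := Hd _ (HB a b i j ha hb).
have [_ h2 _] := Hd _ (HB a' b' j i ha' hb').
have EE : dd j (dd i f) (x+a *: ei i+b *: ei j) =
     dd i (dd j f) (x+a' *: ei j+b' *: ei i).
 have t2 : t ^+ 2 != 0 by rewrite expf_neq0 // gt_eqF.
 have : t ^+ 2*dd j (dd i f) (x+a *: ei i+b *: ei j) =
    t ^+ 2*dd i (dd j f) (x+a' *: ei j+b' *: ei i).
  apply: (etrans (esym E)).
  apply: etrans E'.
  have -> : x+t *: ei j+t *: ei i = x+t *: ei i+t *: ei j by rewrite addrAC.
  congr (_ + _).
  exact: addrAC.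
 move/(mulfI t2).
 by apply.
rewrite EE in h1.
move: h1 h2;move: (dd i (dd j f) (x+a' *: ei j+b' *: ei i)) => y h1 h2.
have -> : dd i (dd j f) x - dd j (dd i f) x =
  (dd i (dd j f) x - y)+(y - dd j (dd i f) x) by rewrite subrKA.
apply: le_trans (ler_normD _ _) _.
rewrite [leLHS]addrC distrC.
have -> : e = e / 2+e / 2 by exact: splitr.
exact: lerD (ltW h1) (ltW h2).
Qed.

End Schwarz.

(** * One-variable derivatives and the flat exponential *)

Section OneVariable.
Context {R : realType}.

Lemma derZ (g : R -> R) (t a d : R) : is_der t g d ->
 is_der t (fun s => a * g s) (a*d).
by move=> h;have := is_deriveZ a h. Qed.

Lemma derD (f g : R -> R) (t d e : R) : is_der t f d ->
 is_der t g e -> is_der t (fun s => f s+g s) (d+e).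
by move=> h h';have := is_deriveD h h'. Qed.

Lemma derM (f g : R -> R) (t d e : R) : is_der t f d ->
 is_der t g e ->
 is_der t (fun s => f s * g s) (f t*e+g t*d).
by move=> h h';have := is_deriveM h h'. Qed.

Lemma der_comp (f g : R -> R) (t a b : R) : is_derive (g t) (1 : R) f a ->
 is_der t g b -> is_der t (fun s => f (g s)) (a*b).
by move=> h h';have := is_derive1_comp h h'. Qed.

Lemma is_derive_pow (g : R -> R) (t d : R) k : is_der t g d ->
 is_der t (fun s => g s ^+ k) (k%:R * g t ^+ k.-1*d).
move=> h;have := is_deriveX k h.
have -> : g ^+ k = fun s => g s ^+ k.
 by apply/funext => s;elim: k => [|k IHk];rewrite ?expr0 // !exprS -IHk.
by [].
Qed.

Lemma derV (g : R -> R) (t d : R) : g t != 0 -> is_der t g d ->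
 is_der t (fun s => (g s)^-1) (- (g t) ^- 2*d).
by move=> g0 h;have := is_deriveV g0 h. Qed.

Lemma smooth1_expR (D : set R) (c : R) : smooth1 D (fun t => expR (c * t)).
exists (fun p => exists a, p = fun t => a*expR (c * t)).
 by exists 1;apply/funext => t;rewrite mul1r.
move=> g [a ->];exists (fun t => (a*c)*expR (c * t));first by exists (a*c).
move=> t _;have h1 : is_der t (fun t => c * t) c.
 by apply: is_derive_eq;rewrite ?scaler0 ?add0r /GRing.scale /= mulr1.
apply: (is_derive_eq (derZ a (der_comp (is_derive_expR _) h1))).
by rewrite -mulrA [_*c]mulrC.
Qed.

Lemma smooth1_powR (a : R) : smooth1 [set t | 0 < t] (fun t => t `^ a).
exists (fun p => exists c b, p = fun t => c * t `^ b).
 by exists 1, a;apply/funext => t;rewrite mul1r.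
move=> g [c [b ->]];exists (fun t => (c*b) * t `^ (b - 1)).
 by exists (c*b), (b - 1).
move=> t /= t0;apply: (is_derive_eq (derZ c (is_derive1_powR b t0))).
by rewrite mulrA.
Qed.

Lemma smooth1_inv : smooth1 [set t : R | t != 0] (fun t => t^-1).
exists (fun p => exists (c : R) k, p = fun t => c*(t^-1) ^+ k).
 by exists 1, 1%N;apply/funext => t;rewrite mul1r expr1.
move=> g [c [k ->]];exists (fun t => (- c*k%:R)*(t^-1) ^+ k.+1).
 by exists (- c*k%:R), k.+1.
move=> t /= t0.
apply: (is_derive_eq (derZ c (is_derive_pow k (derV t0 (is_derive_id t 1))))).
rewrite mulr1;case: k => [|k];first by rewrite !mul0r !mulr0 mul0r.
by rewrite /= -exprVn !exprS !expr0;ring.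
Qed.

Lemma is_derive_quadratic_bound (g : R -> R) (C : R) : g 0 = 0 ->
 (forall s, `|g s| <= C*s ^+ 2) -> is_derive 0 (1 : R) g 0.
move=> g0 Hg.
have C0 : 0 <= C by have := Hg 1;rewrite expr1n mulr1;apply: le_trans.
have cv : (fun h : R => h^-1 *: ((g \o shift 0) (h *: (1 : R)) - g 0)) @ 0^' --> (0 : R).
 apply/cvgrPdist_lt => e e0;near=> h.
 rewrite sub0r normrN g0 subr0 /= addr0 -[h *: (1 : R)]/(h * 1) mulr1.
 have h0 : h != 0 by near: h;exact: nbhs_dnbhs_neq.
 have hp : 0 < `|h| by rewrite normr_gt0.
 rewrite -[_ *: _]/(_ * _) normrM normfV mulrC ltr_pdivrMr //.
 apply: le_lt_trans (Hg h) _.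
 rewrite -[h ^+ 2]ger0_norm ?sqr_ge0 // normrX expr2 mulrA ltr_pM2r //.
 have hd : `|h| < e / (C + 1).
  near: h;apply: dnbhs0_lt;by rewrite divr_gt0 // ltr_wpDl.
 apply: le_lt_trans (_ : (C + 1) * `|h| < _).
  by rewrite ler_wpM2r // lerDl.
 by rewrite mulrC -ltr_pdivlMr // ltr_wpDl.
by split;[apply/cvg_ex;exists 0|exact/cvg_lim].
Unshelve. all: by end_near. Qed.

(** All exponents [k] are kept because differentiation mixes them: the linear span of these
    functions is stable under differentiation, as [smooth1] asks. *)
Definition flat (k : nat) (s : R) : R :=
 if 0 < s then (s^-1) ^+ k*expR (- s^-1) else 0.

Lemma flat_ge0 k s : 0 <= flat k s.
rewrite /flat;case: ifPn => // s0.
by rewrite mulr_ge0 ?expR_ge0 // exprn_ge0 // invr_ge0 ltW.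
Qed.

(** A quadratic bound makes the derivative at 0 vanish. It comes from the term of degree [k + 2] of
    the exponential series at [s^-1]. *)
Lemma flat_bound k s : flat k s <= k.+2`!%:R*s ^+ 2.
rewrite /flat;case: ifPn => [s0|_];last by rewrite mulr_ge0 // sqr_ge0.
have si0 : 0 <= s^-1 by rewrite invr_ge0 ltW.
have h := expR_ge1Dxn k.+1 si0.
have {h} h : (s^-1) ^+ k.+2 <= k.+2`!%:R*expR s^-1.
 rewrite mulrC -ler_pdivrMr ?ltr0n ?fact_gt0 //.
 by apply: le_trans h;rewrite lerDr.
rewrite expRN ler_pdivrMr ?expR_gt0 //.
have -> : (s^-1) ^+ k = (s^-1) ^+ k.+2*s ^+ 2.
 by rewrite -addn2 exprD -mulrA -exprMn mulVf ?expr1n ?mulr1 // gt_eqF.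
by rewrite [leRHS]mulrAC ler_wpM2r // sqr_ge0.
Qed.

Lemma flat_is_derive k s :
 is_derive s (1 : R) (flat k) (flat k.+2 s - k%:R*flat k.+1 s).
have [s0|s0|->] := ltrgt0P s;last first.
- rewrite /flat !ltxx mulr0 subr0.
 apply: (@is_derive_quadratic_bound _ (k.+2`!%:R));first by rewrite ltxx.
 by move=> t;rewrite -/(flat k t) ger0_norm ?flat_ge0 // flat_bound.
- rewrite /flat ltNge (ltW s0) /= mulr0 subr0.
 apply: (@near_eq_is_derive _ _ _ (fun=> 0 : R)).
 near=> t;have t0 : t < 0 by near: t;exact: lt_nbhsl.
 by rewrite ltNge (ltW t0).
rewrite /flat s0.
apply: (@near_eq_is_derive _ _ _ (fun t : R => (t^-1) ^+ k*expR (- t^-1))).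
 near=> t;have t0 : 0 < t by near: t;exact: lt_nbhsr.
 by rewrite t0.
have sn0 : s != 0 by rewrite gt_eqF.
have h1 : is_derive s (1 : R) (fun y : R => - y^-1) (s ^- 2).
 have := derZ (-1) (derV sn0 (is_derive_id s 1)).
 rewrite mulr1 mulN1r opprK (_ : (fun _ => _) = fun y : R => - y^-1) //.
 by apply/funext => y;rewrite mulN1r.
have h2 := der_comp (is_derive_expR _) h1.
have h3 := is_derive_pow k (derV sn0 (is_derive_id s 1)).
apply: (is_derive_eq (derM h3 h2));rewrite mulr1.
case: k {h3} => [|k];first by rewrite !mul0r !mulr0 addr0 subr0 expr0 !mul1r exprVn mulrC.
by rewrite /= -!exprVn !exprS !expr0;ring.
Unshelve. all: by end_near. Qed.

Lemma smooth1_flat (D : set R) k : smooth1 D (flat k).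
pose S (p : R -> R) := exists l : seq (R*nat),
 p = fun s => \sum_(c <- l) c.1*flat c.2 s.
exists S.
 by exists [:: (1, k)];apply/funext => s;rewrite big_seq1 mul1r.
move=> g [l ->].
exists (fun s => \sum_(c <- flatten [seq [:: (c.1, c.2.+2);(- (c.1*c.2%:R), c.2.+1)] | c <- l])
      c.1*flat c.2 s).
 by eexists.
move=> s _;elim: l => [|[a m] l IHl] /=.
 rewrite big_nil (_ : (fun=> _) = fun=> 0 :> R);first exact: is_derive_cst.
 by apply/funext => t;rewrite big_nil.
have -> : (fun s => \sum_(c <- (a, m) :: l) c.1*flat c.2 s) =
 (fun s => a*flat m s + \sum_(c <- l) c.1*flat c.2 s).
 by apply/funext => t;rewrite big_cons.
have h := flat_is_derive m s.
apply: (is_derive_eq (derD (derZ a h) IHl)).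
by rewrite !big_cons /= addrA;congr (_ + _);ring.
Qed.

End OneVariable.

Section SmoothDet.
Context {R : realType} {n : nat} (U : set 'rV[R]_n).

Lemma smooth_prod (oU : open U) (I : Type) (r : seq I) (F : I -> 'rV[R]_n -> R) :
 (forall k, smooth_on U (F k)) -> smooth_on U (fun y => \prod_(k <- r) F k y).
move=> sF;elim: r => [|k r IHr].
 have -> : (fun y => \prod_(k <- [::]) F k y) = fun=> 1 :> R.
  by apply/funext => y;rewrite big_nil.
 exact: smooth_cst.
have -> : (fun y => \prod_(j <- k :: r) F j y) =
  (fun y => F k y * \prod_(j <- r) F j y).
 by apply/funext => y;rewrite big_cons.
exact: smoothM.
Qed.

Lemma smooth_det (oU : open U) m (A : 'rV[R]_n -> 'M[R]_m) :
 (forall i j, smooth_on U (fun y => A y i j)) -> smooth_on U (fun y => \det (A y)).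
move=> sA;apply: smooth_sum => // s;apply: smoothM => //;first exact: smooth_cst.
by apply: smooth_prod.
Qed.

Lemma smooth_invmx (oU : open U) m (A : 'rV[R]_n -> 'M[R]_m) :
 (forall i j, smooth_on U (fun y => A y i j)) ->
 (forall y, U y -> A y \in unitmx) ->
 forall i j, smooth_on U (fun y => invmx (A y) i j).
move=> sA uA i j.
apply: (@smooth_on_eq _ _ _ (fun y => (\det (A y))^-1*cofactor (A y) j i)) => //.
 by move=> y Uy;rewrite /invmx uA // !mxE.
apply: smoothM => //.
 apply: (smooth_comp1 oU smooth1_inv);first exact: smooth_det.
 by move=> y Uy /=;have := uA y Uy;rewrite unitmxE unitfE.
apply: smoothM => //;first exact: smooth_cst.
apply: smooth_det => // k l.
have -> : (fun y => row' j (col' i (A y)) k l) = fun y => A y (lift j k) (lift i l).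
 by apply/funext => y;rewrite !mxE.
exact: sA.
Qed.

End SmoothDet.

(** * Curvature of the metric induced by an immersion in a Euclidean space *)

Section Gauss.
Context {R : realType} {n : nat} {L : finType}.
Implicit Types (F : L -> 'rV[R]_n -> R) (U : set 'rV[R]_n).

Definition gramF F (x : 'rV[R]_n) : 'M[R]_n :=
 \matrix_(i, j) \sum_a dd i (F a) x*dd j (F a) x.

Definition immersive F (x : 'rV[R]_n) : Prop :=
 forall v : 'rV[R]_n, (forall a, \sum_i v 0 i*dd i (F a) x = 0) -> v = 0.

Lemma gramF_sym F x : (gramF F x)^T = gramF F x.
by apply/matrixP => i j;rewrite !mxE;eqsum a;rewrite mulrC. Qed.

Lemma gramF_form F x (v : 'rV[R]_n) :
 (v *m gramF F x *m v^T) 0 0 = \sum_a (\sum_i v 0 i*dd i (F a) x) ^+ 2.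
rewrite mxE;under eq_bigr do rewrite mxE mulr_suml.
transitivity (\sum_j \sum_i \sum_a
 (v 0 i*dd i (F a) x)*(v 0 j*dd j (F a) x)).
 eqsum j;eqsum i.
 rewrite !mxE mulr_sumr mulr_suml;eqsum a;ring.
rewrite exchange_big /=;under eq_bigr do rewrite exchange_big /=.
swapsum' a.
rewrite expr2 mulr_suml;eqsum i.
by rewrite mulr_sumr.
Qed.

Lemma gramF_pos F x (v : 'rV[R]_n) : immersive F x -> v != 0 ->
 0 < (v *m gramF F x *m v^T) 0 0.
move=> imF v0;rewrite gramF_form lt_neqAle sumr_ge0 ?andbT => [|a _];last exact: sqr_ge0.
apply: contraNneq v0 => /esym/eqP;rewrite psumr_eq0 => [/allP H|a _];last exact: sqr_ge0.
apply/eqP/imF => a;apply/eqP;rewrite -sqrf_eq0.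
by apply: H;rewrite mem_index_enum.
Qed.

Lemma gramF_unit F x : immersive F x -> gramF F x \in unitmx.
move=> imF;rewrite -row_free_unit -kermx_eq0;apply/eqP/row_matrixP => i.
rewrite row0;apply/eqP/negPn/negP => v0.
have := gramF_pos imF v0.
by rewrite (sub_kermxP (row_sub _ _)) mul0mx mxE ltxx.
Qed.

Lemma smooth_gramF U F : open U -> (forall a, smooth_on U (F a)) ->
 forall i j, smooth_on U (fun y => gramF F y i j).
move=> oU sF i j.
have -> : (fun y => gramF F y i j) = fun y => \sum_a dd i (F a) y*dd j (F a) y.
 by apply/funext => y;rewrite mxE.
apply: smooth_sum => // a;apply: smoothM => //;exact: smooth_dd.
Qed.

Section Equation.
Variables (U : set 'rV[R]_n) (F : L -> 'rV[R]_n -> R).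
Hypotheses (oU : open U) (sF : forall a, smooth_on U (F a)).
Hypothesis imF : forall x, U x -> immersive F x.

Local Notation F1 i a := (dd i (F a)).
Local Notation F2 i j a := (dd i (dd j (F a))).
Local Notation G := (gramF F).

Let s1 i a : smooth_on U (F1 i a). Proof. exact: smooth_dd. Qed.
Let s2 i j a : smooth_on U (F2 i j a). Proof. exact: smooth_dd. Qed.

Lemma dd_gramF x i j l : U x ->
 dd i (fun y => G y j l) x =
 \sum_a (F2 i j a x*F1 l a x+F1 j a x*F2 i l a x).
move=> Ux.
have -> : (fun y => G y j l) = fun y => \sum_a F1 j a y*F1 l a y.
 by apply/funext => y;rewrite mxE.
rewrite (dd_sum _ _ oU) => [|a|//];last exact: smoothM.
eqsum a;rewrite (ddM _ (s1 j a) (s1 l a) Ux).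
by rewrite addrC [F1 l a x * _]mulrC.
Qed.

Lemma christoffelE x k i j : U x ->
 christoffel G k i j x = \sum_l invmx (G x) k l * \sum_a F2 i j a x*F1 l a x.
move=> Ux;rewrite /christoffel mulr_sumr;eqsum l.
rewrite mulrCA;congr (_ * _).
rewrite !ddE !dd_gramF // -big_split -sumrB mulr_sumr /=;eqsum a.
rewrite (dd_comm j i oU (sF a) Ux) (dd_comm l i oU (sF a) Ux).
rewrite (dd_comm l j oU (sF a) Ux).
set A := F2 i j a x;set B := F2 i l a x;set C := F2 j l a x.
set a1 := F1 i a x;set b1 := F1 j a x;set c1 := F1 l a x.
clearbody A B C a1 b1 c1;field;by [].
Qed.

(** For an induced metric the Levi-Civita connection is the tangential part of the ordinary second
    derivative; this is that fact with the index lowered. *)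
Lemma christoffel_gram x i j l : U x ->
 \sum_m christoffel G m i j x * G x m l = \sum_a F2 i j a x*F1 l a x.
move=> Ux;under eq_bigr do rewrite christoffelE // mulr_suml.
rewrite exchange_big /=.
transitivity (\sum_p (\sum_a F2 i j a x*F1 p a x)*(invmx (G x) *m G x) p l).
 eqsum p;rewrite mxE mulr_sumr;eqsum m.
 have -> : invmx (G x) m p = invmx (G x) p m.
  by rewrite -[in LHS](gramF_sym F x) -trmx_inv mxE.
 by rewrite mulrCA mulrA.
rewrite mulVmx ?gramF_unit //;last exact: imF.
rewrite (bigD1 l) //= [X in _+X = _]big1;last first.
 by move=> p pl;rewrite mxE (negPf pl) mulr0n mulr0.
by rewrite mxE eqxx mulr1n mulr1 addr0.
Qed.

Lemma smooth_christoffel k i j : smooth_on U (christoffel G k i j).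
apply: (@smooth_on_eq _ _ _
 (fun x => \sum_l invmx (G x) k l * \sum_a F2 i j a x*F1 l a x)) => //.
 by move=> x Ux;rewrite christoffelE.
apply: smooth_sum => // l;apply: smoothM => //.
 apply: smooth_invmx => //;first exact: smooth_gramF.
 by move=> y Uy;apply: gramF_unit;exact: imF.
by apply: smooth_sum => // a;apply: smoothM.
Qed.

(** Obtained by differentiating the lowered identity [christoffel_gram], which spares the derivative
    of the inverse Gram matrix. *)
Lemma dd_christoffel_gram x p i j l : U x ->
 \sum_m dd p (christoffel G m i j) x * G x m l =
 \sum_a (dd p (F2 i j a) x*F1 l a x+F2 i j a x*F2 p l a x)
 - \sum_m christoffel G m i j x * \sum_a (F2 p m a x*F1 l a x+F1 m a x*F2 p l a x).
move=> Ux.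
have E : dd p (fun y => \sum_m christoffel G m i j y * G y m l) x =
    dd p (fun y => \sum_a F2 i j a y*F1 l a y) x.
 by apply: dd_near;apply: (open_near_eq oU) => // y Uy;exact: christoffel_gram.
have sG := smooth_gramF oU sF;have sC := smooth_christoffel.
rewrite (dd_sum _ _ oU) in E => [|m|//];last by apply: smoothM.
rewrite (dd_sum _ _ oU) in E => [|a|//];last by apply: smoothM.
apply/eqP;rewrite -subr_eq0 opprB addrA;apply/eqP.
transitivity (\sum_m dd p (fun y => christoffel G m i j y * G y m l) x -
 \sum_a dd p (fun y => F2 i j a y*F1 l a y) x);last by rewrite E subrr.
congr (_ - _).
 rewrite -big_split /=;eqsum m.
 rewrite (ddM _ (sC _ _ _) (sG _ _) Ux) dd_gramF //;by rewrite addrC [G x m l * _]mulrC.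
eqsum a;rewrite (ddM _ (s2 i j a) (s1 l a) Ux).
by rewrite addrC [F1 l a x * _]mulrC.
Qed.

(** The third derivatives of [F] are symmetric in [i] and [j] and cancel ([E3]); the quadratic
    Christoffel terms recombine into the tangential parts subtracted on the right. *)
Lemma gauss_christoffel x i j k l : U x ->
 curvature_coef G x i j k l =
 \sum_a (F2 j l a x - \sum_m christoffel G m j l x*F1 m a x)*F2 i k a x
 - \sum_a (F2 i l a x - \sum_m christoffel G m i l x*F1 m a x)*F2 j k a x.
move=> Ux;rewrite /curvature_coef /riemann.
under eq_bigr do rewrite !ddE.
have E1 (p q : 'I_n) :
 \sum_a (F2 q l a x - \sum_m christoffel G m q l x*F1 m a x)*F2 p k a x =
 \sum_m dd p (christoffel G m q l) x * G x m k
 - \sum_a dd p (F2 q l a) x*F1 k a x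
 + \sum_m christoffel G m q l x * \sum_a F2 p m a x*F1 k a x.
 rewrite dd_christoffel_gram // big_split /= -!addrA [RHS]addrC -!addrA.
 under [X in _ = _+(- X + _)]eq_bigr => m _ do rewrite big_split /= mulrDr.
 rewrite big_split /=.
 set A := \sum_a F2 q l a x*F2 p k a x.
 set B := \sum_m christoffel G m q l x * \sum_a F2 p m a x*F1 k a x.
 set C := \sum_a dd p (F2 q l a) x*F1 k a x.
 transitivity (A - \sum_m christoffel G m q l x * \sum_a F1 m a x*F2 p k a x).
  under eq_bigr do rewrite mulrBl.
  rewrite sumrB;congr (_ - _).
  under eq_bigr do rewrite mulr_suml.
  swapsum' m;rewrite mulr_sumr.
  by eqsum a;rewrite mulrA.
 set D := \sum_m _ * \sum_a F1 m a x * _;clearbody A B C D;ring.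
have E2 (p q : 'I_n) :
 \sum_m christoffel G m q l x * \sum_a F2 p m a x*F1 k a x =
 \sum_m (\sum_r christoffel G r q l x*christoffel G m p r x) * G x m k.
 under eq_bigr do rewrite -christoffel_gram // mulr_sumr.
 swapsum' m;rewrite mulr_suml.
 by eqsum r;rewrite mulrA.
have E3 : \sum_a dd j (F2 i l a) x*F1 k a x = \sum_a dd i (F2 j l a) x*F1 k a x.
 by eqsum a;congr (_ * _);exact: (dd_comm j i oU (s1 l a) Ux).
rewrite (E1 i j) (E1 j i) (E2 i j) (E2 j i) E3.
transitivity (
 (\sum_m dd i (christoffel G m j l) x * G x m k
 - \sum_m dd j (christoffel G m i l) x * G x m k)
+(\sum_m (\sum_r christoffel G r j l x*christoffel G m i r x) * G x m k
 - \sum_m (\sum_r christoffel G r i l x*christoffel G m j r x) * G x m k)).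
 rewrite -!sumrB -big_split /=;eqsum m.
 by rewrite mulrDl mulrBl sumrB mulrBl.
set a := \sum_m _;set b := \sum_m _;set c := \sum_m _;set d := \sum_m _.
set e := \sum_a0 dd i _ x * _;clearbody a b c d e;ring.
Qed.

(** Coefficients that leave a normal residual are unique, because the Gram matrix is invertible.
    Hence any guess [g] with normal residual may be used, and the Christoffel symbols of the
    examples are never computed from their definition. *)
Lemma gauss x (g : 'I_n -> 'I_n -> 'I_n -> R) : U x ->
 (forall i j l, \sum_a (F2 i j a x - \sum_m g m i j*F1 m a x)*F1 l a x = 0) ->
 forall i j k l,
 let N i j a := F2 i j a x - \sum_m g m i j*F1 m a x in
 curvature_coef G x i j k l = \sum_a N i k a*N j l a - \sum_a N i l a*N j k a.
move=> Ux Hg i j k l N.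
have gE i' j' : forall m, christoffel G m i' j' x = g m i' j'.
 have H l' : \sum_m g m i' j' * G x m l' = \sum_a F2 i' j' a x*F1 l' a x.
  apply/eqP;rewrite eq_sym -subr_eq0;apply/eqP;rewrite -[RHS](Hg i' j' l').
  under [RHS]eq_bigr => a _ do rewrite mulrBl.
  rewrite sumrB;congr (_ - _).
  under [RHS]eq_bigr => a _ do rewrite mulr_suml.
  swapsum' m;rewrite mxE mulr_sumr.
  by eqsum a;rewrite mulrA.
 have E : (\row_m christoffel G m i' j' x) *m G x = (\row_m g m i' j') *m G x.
  apply/rowP => l';rewrite !mxE.
  under eq_bigr do rewrite mxE.
  under [RHS]eq_bigr => m _ do rewrite mxE.
  by rewrite christoffel_gram // H.
 have E' := can_inj (mulmxK (gramF_unit (imF Ux))) E.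
 by move=> m;move/rowP/(_ m): E';rewrite !mxE.
have NN p q r s : \sum_a N p q a*F2 r s a x = \sum_a N p q a*N r s a.
 apply/eqP;rewrite -subr_eq0 -sumrB;apply/eqP.
 under eq_bigr do rewrite -mulrBr /N subKr mulr_sumr.
 rewrite exchange_big /= big1 // => m _.
 transitivity (g m r s * \sum_a N p q a*F1 m a x);last by rewrite Hg mulr0.
 by distrsum a;rewrite mulrCA.
rewrite gauss_christoffel //.
under eq_bigr do under eq_bigr do rewrite gE.
under [X in _ - X]eq_bigr => a _ do under eq_bigr do rewrite gE.
rewrite -/N.
have -> : \sum_a N i k a*N j l a = \sum_a N j l a*N i k a.
 by eqsum a;rewrite mulrC.
by congr (_ - _);[exact: NN|exact: NN].
Qed.

End Equation.
End Gauss.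

(** * Quadratic forms on bivectors and their pullbacks *)

Section Tensors.
Context {R : realType}.

Definition tens4 (I : Type) := I -> I -> I -> I -> R.

(** This is [bivector_form] without the factor 1/4 and over any finite index type, so that frames
    indexed by structured or redundant sets can be used. *)
Definition bform (I : finType) (q : tens4 I) (A : I -> I -> R) : R :=
 \sum_i \sum_j \sum_k \sum_l A i j*A k l*q i j k l.

Definition psd (I : finType) (q : tens4 I) : Prop :=
 forall A : I -> I -> R, (forall i j, A j i = - A i j) -> 0 <= bform q A.

Definition altern (I : Type) (w : tens4 I) : Prop :=
 forall i j k l, [/\ w j i k l = - w i j k l, w i k j l = - w i j k l &
           w i j l k = - w i j k l].

Lemma bivector_psdP n (q : tens4 'I_n) : bivector_psd q <-> psd q.
split=> H A antiA.
 have /H : (\matrix_(i, j) A i j)^T = - (\matrix_(i, j) A i j).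
  by apply/matrixP => i j;rewrite !mxE.
 rewrite /bivector_form pmulr_rge0 ?invr_gt0 //.
 congr (0 <= _);do 4 (apply: eq_bigr => ? _);by rewrite !mxE.
rewrite /bivector_form pmulr_rge0 ?invr_gt0 //;apply: (H (fun i j => A i j)) => i j.
by have /matrixP/(_ i j) := antiA;rewrite !mxE.
Qed.

Lemma bformE (I : finType) (q : tens4 I) A :
 bform q A = \sum_(u : I*I) \sum_(v : I*I)
  A u.1 u.2*A v.1 v.2*q u.1 u.2 v.1 v.2.
rewrite /bform pair_big /=;apply: eq_bigr => -[i j] _ /=.
by rewrite pair_big /=.
Qed.

Lemma bformD (I : finType) (q q' : tens4 I) A :
 bform (fun i j k l => q i j k l+q' i j k l) A = bform q A+bform q' A.
rewrite !bformE -big_split;eqsum u;rewrite -big_split.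
by eqsum v;rewrite mulrDr.
Qed.

Definition pull (I K : finType) (J : I -> K -> R) (q : tens4 K) : tens4 I :=
 fun i j k l => \sum_p \sum_r \sum_s \sum_t
  J i p*J j r*(J k s*J l t)*q p r s t.

Definition push (I K : finType) (J : I -> K -> R) (A : I -> I -> R) (p r : K) : R :=
 \sum_i \sum_j A i j*(J i p*J j r).

Lemma bform_pull (I K : finType) (J : I -> K -> R) (q : tens4 K) A :
 bform (pull J q) A = bform q (push J A).
rewrite !bformE.
have E (u v : I*I) : pull J q u.1 u.2 v.1 v.2 =
  \sum_(P : K*K) \sum_(Q : K*K)
  J u.1 P.1*J u.2 P.2*(J v.1 Q.1*J v.2 Q.2)*q P.1 P.2 Q.1 Q.2.
 by rewrite /pull pair_big /=;apply: eq_bigr => -[p r] _;rewrite pair_big.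
under eq_bigr do under eq_bigr do rewrite E.
transitivity (\sum_u \sum_v \sum_P \sum_Q
 (A u.1 u.2*(J u.1 P.1*J u.2 P.2)) *
 ((A v.1 v.2*(J v.1 Q.1*J v.2 Q.2))*q P.1 P.2 Q.1 Q.2)).
 eqsum u;eqsum v;rewrite mulr_sumr.
 eqsum P;distrsum Q;ring.
under eq_bigr do rewrite exchange_big /=.
swapsum' P.
have Ep (S : K*K) : push J A S.1 S.2 = \sum_(u : I*I) A u.1 u.2*(J u.1 S.1*J u.2 S.2).
 by rewrite /push pair_big.
rewrite Ep.
transitivity (\sum_(u : I*I) (A u.1 u.2*(J u.1 P.1*J u.2 P.2)) *
 \sum_(Q : K*K) push J A Q.1 Q.2*q P.1 P.2 Q.1 Q.2).
 eqsum u;rewrite exchange_big /= mulr_sumr.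
 eqsum Q;rewrite Ep mulr_suml mulr_sumr.
 by eqsum v.
rewrite -mulr_suml mulr_sumr;eqsum Q;by rewrite mulrA.
Qed.

Lemma push_anti (I K : finType) (J : I -> K -> R) A :
 (forall i j, A j i = - A i j) -> forall p r, push J A r p = - push J A p r.
move=> antiA p r;rewrite /push -sumrN exchange_big /=;eqsum i.
rewrite -sumrN;eqsum j;rewrite antiA;ring.
Qed.

Lemma psd_pull (I K : finType) (J : I -> K -> R) (q : tens4 K) :
 psd q -> psd (pull J q).
by move=> Hq A antiA;rewrite bform_pull;apply: Hq;exact: push_anti. Qed.

Lemma pull_alternating (I K : finType) (J : I -> K -> R) (w : tens4 K) :
 altern w -> altern (pull J w).
move=> aw i j k l;split;rewrite /pull -sumrN.
- swapsum' p;rewrite -sumrN.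
 eqsum r;rewrite -sumrN;eqsum s;rewrite -sumrN.
 eqsum t;have [-> _ _] := aw p r s t;ring.
- eqsum p;rewrite exchange_big -sumrN.
 eqsum r;rewrite -sumrN;eqsum s;rewrite -sumrN.
 eqsum t;have [_ -> _] := aw p r s t;ring.
- eqsum p;rewrite -sumrN.
 eqsum r;rewrite exchange_big -sumrN;eqsum s;rewrite -sumrN.
 eqsum t;have [_ _ ->] := aw p r s t;ring.
Qed.

Definition gaussq (I : Type) (L : finType) (N : I -> I -> L -> R) : tens4 I :=
 fun i j k l => \sum_a N i k a*N j l a - \sum_a N i l a*N j k a.

Definition strong_psd (I : finType) (q : tens4 I) : Prop :=
 exists2 w, altern w & psd (fun i j k l => q i j k l+w i j k l).

Lemma pullD (I K : finType) (J : I -> K -> R) (q q' : tens4 K) i j k l :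
 pull J (fun i j k l => q i j k l+q' i j k l) i j k l =
 pull J q i j k l+pull J q' i j k l.
rewrite /pull;do 4 (rewrite -big_split;apply: eq_bigr => ? _).
by rewrite mulrDr.
Qed.

Lemma eq_psd (I : finType) (q q' : tens4 I) :
 (forall i j k l, q i j k l = q' i j k l) -> psd q -> psd q'.
move=> qq Hq A antiA;have := Hq A antiA;congr (0 <= _).
by do 4 (apply: eq_bigr => ? _);rewrite qq.
Qed.

Lemma eq_strong_psd (I : finType) (q q' : tens4 I) :
 (forall i j k l, q i j k l = q' i j k l) -> strong_psd q -> strong_psd q'.
move=> qq [w aw pw];exists w => //;apply: eq_psd pw => i j k l.
by rewrite qq.
Qed.

(** Holds for rectangular [J], because 4-forms pull back to 4-forms. It is the tool that moves
    positivity from a convenient frame to the coordinate vectors. *)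
Lemma strong_psd_pull (I K : finType) (J : I -> K -> R) (q : tens4 K) :
 strong_psd q -> strong_psd (pull J q).
move=> [w aw pw];exists (pull J w);first exact: pull_alternating.
by apply: eq_psd (psd_pull J pw) => i j k l;rewrite pullD.
Qed.

Lemma gaussq_pull (I K L : finType) (J : I -> K -> R) (N : K -> K -> L -> R) i j k l :
 gaussq (fun i j a => \sum_p \sum_r J i p*J j r*N p r a) i j k l =
 pull J (gaussq N) i j k l.
have E (f g : K -> K -> L -> R) (a b c d : I) :
 \sum_x (\sum_p \sum_r J a p*J b r*f p r x) *
    (\sum_s \sum_t J c s*J d t * g s t x) =
 \sum_p \sum_r \sum_s \sum_t J a p*J b r*(J c s*J d t) *
  \sum_x f p r x * g s t x.
 transitivity (\sum_x \sum_(P : K*K) \sum_(Q : K*K)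
  J a P.1*J b P.2*(J c Q.1*J d Q.2)*(f P.1 P.2 x * g Q.1 Q.2 x)).
  eqsum x.
  have F1 (h : K -> K -> L -> R) e e' : \sum_p \sum_r J e p*J e' r*h p r x =
   \sum_(S : K*K) J e S.1*J e' S.2*h S.1 S.2 x by rewrite pair_big.
  rewrite !F1 mulr_suml.
  eqsum P;distrsum Q;ring.
 rewrite exchange_big /= [RHS]pair_big /=;apply: eq_bigr => -[p r] _.
 rewrite exchange_big /= [RHS]pair_big /=;apply: eq_bigr => -[s t] _ /=.
 by rewrite mulr_sumr.
rewrite /gaussq !E /pull.
rewrite [X in X - _](_ : _ = \sum_p \sum_r \sum_s \sum_t J i p*J j r *
 (J k s*J l t) * \sum_x N p s x*N r t x);last first.
 eqsum p;swapsum' s.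
 eqsum r;eqsum t;congr (_ * _);ring.
rewrite [X in _ - X](_ : _ = \sum_p \sum_r \sum_s \sum_t J i p*J j r *
 (J k s*J l t) * \sum_x N p t x*N r s x);last first.
 eqsum p;swapsum' t.
 swapsum' s.
 eqsum r;congr (_ * _);ring.
by do 4 (rewrite -sumrB;apply: eq_bigr => ? _);rewrite -mulrBr.
Qed.

End Tensors.

(** * Strong nonnegativity at a point, and its invariance *)

Section Immersions.
Context {R : realType} {n : nat}.

Lemma inj_unitmx (A : 'M[R]_n) : (forall v : 'rV[R]_n, v *m A = 0 -> v = 0) ->
 A \in unitmx.
move=> H;rewrite -row_free_unit -kermx_eq0;apply/eqP/row_matrixP => i.
by rewrite row0;apply: H;apply/sub_kermxP;exact: row_sub.
Qed.

Lemma unit_immersive (L : finType) (F : L -> 'rV[R]_n -> R) x :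
 gramF F x \in unitmx -> immersive F x.
move=> uG v Hv;apply: (can_inj (mulmxK uG));rewrite mul0mx.
apply/rowP => j;rewrite !mxE.
under eq_bigr do rewrite mxE mulr_sumr.
rewrite exchange_big /= big1 // => a _.
transitivity ((\sum_i v 0 i*dd i (F a) x)*dd j (F a) x);last by rewrite Hv mul0r.
by rewrite mulr_suml;eqsum i;rewrite mulrA.
Qed.

Definition smooth_near (L : Type) (F : L -> 'rV[R]_n -> R) x :=
 exists U, [/\ open U, U x & forall a, smooth_on U (F a)].

Definition nice (L : finType) (F : L -> 'rV[R]_n -> R) x :=
 exists U, [/\ open U, U x, forall a, smooth_on U (F a) &
  forall y, U y -> immersive F y].

Lemma open_near_ex (P : set 'rV[R]_n) x : (\forall y \near x, P y) ->
 exists U, [/\ open U, U x & U `<=` P].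
by move=> H;exists P°;split;[exact: open_interior|exact: H|exact: interior_subset].
Qed.

(** Immersivity is the non-vanishing of the Gram determinant, hence it spreads to a
    neighbourhood. *)
Lemma nice_immersive (L : finType) (F : L -> 'rV[R]_n -> R) x :
 smooth_near F x -> immersive F x -> nice F x.
move=> [U [oU Ux sF]] imF.
have sdet := smooth_det oU (smooth_gramF oU sF).
have uG : \det (gramF F x) != 0 by rewrite -unitfE -unitmxE gramF_unit.
have N : \forall y \near x, U y /\ \det (gramF F y) != 0.
 apply: filterI;first exact: open_nbhs_nbhs.
 have := smooth_near_lt sdet Ux;move=> /(_ `|\det (gramF F x)|).
 rewrite normr_gt0 => /(_ uG);apply: filterS => y.
 by apply: contraTN => /eqP ->;rewrite subr0 ltxx.
have [W [oW Wx WU]] := open_near_ex N.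
exists W;split=> // [a|y /WU[_ d0]].
 by apply: smoothW (sF a) => y /WU[].
by apply: unit_immersive;rewrite unitmxE unitfE.
Qed.

Definition snn (L : finType) (F : L -> 'rV[R]_n -> R) x :=
 strong_psd (curvature_coef (gramF F) x).

Lemma snn_gauss (L : finType) (F : L -> 'rV[R]_n -> R) x
  (g : 'I_n -> 'I_n -> 'I_n -> R) : nice F x ->
 let N i j a := dd i (dd j (F a)) x - \sum_m g m i j*dd m (F a) x in
 (forall i j l, \sum_a N i j a*dd l (F a) x = 0) ->
 snn F x <-> strong_psd (gaussq N).
move=> [U [oU Ux sF imF]] N HN.
by split;apply: eq_strong_psd => i j k l;rewrite (gauss oU sF imF Ux HN).
Qed.

Lemma normal_correction (L : finType) (F : L -> 'rV[R]_n -> R) x : nice F x ->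
 exists2 g : 'I_n -> 'I_n -> 'I_n -> R,
 forall m i j, g m i j = g m j i &
 forall i j l, \sum_a (dd i (dd j (F a)) x - \sum_m g m i j*dd m (F a) x) *
        dd l (F a) x = 0.
move=> [U [oU Ux sF imF]];exists (fun m i j => christoffel (gramF F) m i j x).
 move=> m i j;rewrite !(christoffelE oU sF) //;eqsum l.
 by congr (_ * _);eqsum a;rewrite (dd_comm i j oU (sF a) Ux).
move=> i j l;under eq_bigr do rewrite mulrBl.
rewrite sumrB;apply/eqP;rewrite subr_eq0;apply/eqP.
rewrite -(christoffel_gram oU sF imF i j l Ux).
under [RHS]eq_bigr => a _ do rewrite mulr_suml.
swapsum' m.
rewrite mxE mulr_sumr;eqsum a;by rewrite mulrA.
Qed.

Lemma open_preimage_on m (V : set 'rV[R]_n) (W : set 'rV[R]_m) (h : 'rV[R]_n -> 'rV[R]_m) :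
 open V -> open W -> (forall y, V y -> {for y, continuous h}) ->
 open (V `&` h @^-1` W).
move=> oV oW ch;rewrite openE => y [Vy Wy];apply: filterI;first exact: open_nbhs_nbhs.
exact: ch Vy _ (open_nbhs_nbhs (conj oW Wy)).
Qed.

Lemma smooth_row_cts m (V : set 'rV[R]_n) (h : 'rV[R]_n -> 'rV[R]_m) y : open V ->
 (smooth_row V h) -> V y -> {for y, continuous h}.
move=> oV sh Vy;apply: differentiable_continuous;apply: differentiable_row => j.
exact: smooth_diff oV (sh j) Vy.
Qed.

Definition etale m (h : 'rV[R]_n -> 'rV[R]_m) x :=
 forall v : 'rV[R]_n, (forall j, \sum_i v 0 i*dd i (crd h j) x = 0) -> v = 0.

Section Reparam.
Variables (L : finType) (E : L -> 'rV[R]_n -> R) (h : 'rV[R]_n -> 'rV[R]_n).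
Variables (x : 'rV[R]_n) (V : set 'rV[R]_n).
Hypotheses (oV : open V) (Vx : V x) (sh : smooth_row V h).
Hypotheses (eh : etale h x) (nE : nice E (h x)).

Lemma reparam_nice : nice (fun a y => E a (h y)) x.
have [U [oU Ux sE imE]] := nE.
have ch y : V y -> {for y, continuous h} by exact: smooth_row_cts.
have oW := open_preimage_on oV oU ch.
have shW j : smooth_on (V `&` h @^-1` U) (crd h j).
 by apply: smoothW (sh j) => y [].
have sF a : smooth_on (V `&` h @^-1` U) (fun y => E a (h y)).
 by apply: (smooth_comp oW oU shW _ (sE a)) => y [].
apply: nice_immersive;first by exists (V `&` h @^-1` U).
move=> v Hv;apply: eh => p.
have imEx := imE _ Ux.
suff /rowP/(_ p) : (\row_p \sum_i v 0 i*dd i (crd h p) x) = 0.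
 by rewrite !mxE.
apply: imEx => a;rewrite -[RHS](Hv a).
under eq_bigr do rewrite mxE mulr_suml.
swapsum' i.
rewrite dd_comp => [|j|];last 2 first.
- exact: smooth_diff (sh j) Vx.
- exact: smooth_diff (sE a) Ux.
distrsum q;by rewrite -mulrA [dd q _ _ * _]mulrC.
Qed.

(** The second derivative of the composite is the pullback of that of [E] plus a term tangent to the
    image. The normal parts therefore correspond under the Jacobian [J], and [strong_psd_pull]
    applies. *)
Lemma reparam_snn : snn E (h x) -> snn (fun a y => E a (h y)) x.
have nF := reparam_nice.
have [U [oU Ux sE imE]] := nE.
have ch y : V y -> {for y, continuous h} by exact: smooth_row_cts.
pose W := V `&` h @^-1` U.
have oW : open W := open_preimage_on oV oU ch.
have Wx : W x by [].
have shW j : smooth_on W (crd h j) by apply: smoothW (sh j) => y [].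
have hW y : W y -> U (h y) by case.
have dh y j : W y -> differentiable (crd h j) y.
 by move=> Wy;exact: smooth_diff (shW j) Wy.
have ddF i a y : W y -> dd i (fun y => E a (h y)) y =
  \sum_p dd p (E a) (h y)*dd i (crd h p) y.
 move=> Wy;apply: dd_comp => [j|];first exact: dh.
 exact: smooth_diff (sE a) (hW _ Wy).
have sEh f : smooth_on U f -> smooth_on W (fun y => f (h y)).
 by move=> sf;exact: (smooth_comp oW oU shW hW sf).
pose J i p := dd i (crd h p) x.
have dd2F i j a : dd i (dd j (fun y => E a (h y))) x =
  \sum_p \sum_r J i p*J j r*dd p (dd r (E a)) (h x) +
  \sum_p dd i (dd j (crd h p)) x*dd p (E a) (h x).
 rewrite (dd_eq_on i oW (fun y => ddF j a y)) //.
 rewrite (dd_sum _ _ oW) => [|p|//];last first.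
  apply: smoothM => //;first by apply: sEh;exact: smooth_dd.
  exact: smooth_dd.
 rewrite [X in _ = X + _]exchange_big -big_split /=;eqsum r.
 rewrite (ddM _ (sEh _ (smooth_dd _ (sE a))) (smooth_dd _ (shW r)) Wx).
 have -> : dd i (fun y => dd r (E a) (h y)) x =
   \sum_p dd p (dd r (E a)) (h x)*J i p.
  apply: dd_comp => [q|];first exact: dh.
  exact: smooth_diff (smooth_dd _ (sE a)) Ux.
 rewrite addrC [_*dd r (E a) _]mulrC;congr (_ + _).
 distrsum p;rewrite -/(J j r).
 by rewrite mulrA mulrAC -mulrA [RHS]mulrC mulrCA mulrC -mulrA.
have [g _ Hg] := normal_correction nE.
pose N p r a := dd p (dd r (E a)) (h x) - \sum_m g m p r*dd m (E a) (h x).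
move=> /(snn_gauss nE Hg) sE'.
pose JM : 'M[R]_n := \matrix_(i, p) J i p.
have uJ : JM \in unitmx.
 apply: inj_unitmx => v Hv;apply: eh => j.
 have /rowP/(_ j) := Hv;rewrite !mxE => H0;rewrite -[RHS]H0.
 by eqsum i;rewrite mxE.
pose c i j p := dd i (dd j (crd h p)) x + \sum_q \sum_r J i q*J j r * g p q r.
(* The tangent coefficients [c] refer to the derivatives of [E]; the inverse Jacobian rewrites them
   in the derivatives of the composite. *)
pose gF m i j := \sum_p c i j p * invmx JM p m.
have EF p a : dd p (E a) (h x) = \sum_m invmx JM p m*dd m (fun y => E a (h y)) x.
 under eq_bigr do rewrite ddF // mulr_sumr.
 rewrite exchange_big /=.
 transitivity (\sum_q dd q (E a) (h x)*(invmx JM *m JM) p q).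
  rewrite mulVmx // (bigD1 p) //= big1 => [|q qp];last first.
   by rewrite mxE eq_sym (negPf qp) mulr0.
  by rewrite mxE eqxx mulr1 addr0.
 eqsum q;rewrite mxE mulr_sumr;eqsum m.
 by rewrite mxE -/(J m q) mulrCA.
have NF i j a : dd i (dd j (fun y => E a (h y))) x -
  \sum_m gF m i j*dd m (fun y => E a (h y)) x =
  \sum_p \sum_r J i p*J j r*N p r a.
 have -> : \sum_m gF m i j*dd m (fun y => E a (h y)) x =
      \sum_p c i j p*dd p (E a) (h x).
  under [RHS]eq_bigr => p _ do rewrite EF mulr_sumr.
  swapsum' m;rewrite mulr_suml.
  by eqsum p;rewrite mulrA.
 rewrite dd2F /c;under [X in _ - X]eq_bigr => p _ do rewrite mulrDl.
 rewrite big_split /= opprD addrA addrK.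
 have -> : \sum_p (\sum_q \sum_r J i q*J j r * g p q r)*dd p (E a) (h x) =
   \sum_q \sum_r J i q*J j r * \sum_p g p q r*dd p (E a) (h x).
  under eq_bigr do rewrite mulr_suml.
  swapsum' q.
  under eq_bigr do rewrite mulr_suml.
  swapsum' r.
  by distrsum p;rewrite mulrA.
 by do 2 (rewrite -sumrB;apply: eq_bigr => ? _);rewrite /N mulrBr.
apply/(snn_gauss nF (g := gF)).
 move=> i j l;under eq_bigr do rewrite NF ddF // mulr_sumr.
 rewrite exchange_big /= big1 // => s _.
 under eq_bigr do rewrite mulr_suml.
 rewrite exchange_big /= big1 // => p _.
 under eq_bigr do rewrite mulr_suml.
 rewrite exchange_big /= big1 // => r _.
 transitivity ((J i p*J j r*J l s) * \sum_a N p r a*dd s (E a) (h x)).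
  distrsum a;rewrite -/(J l s).
  set u := N p r a;set t := dd s _ _;clearbody u t;ring.
 by rewrite Hg mulr0.
apply: eq_strong_psd (strong_psd_pull J sE') => i j k l.
rewrite -gaussq_pull /gaussq;congr (_ - _);eqsum a;by rewrite !NF.
Qed.

End Reparam.

Lemma curvature_coef_local U (G G' : 'rV[R]_n -> 'M[R]_n) x i j k l : open U ->
 (forall y, U y -> G y = G' y) -> U x ->
 curvature_coef G x i j k l = curvature_coef G' x i j k l.
move=> oU GG Ux.
have chE m p q y : U y -> christoffel G m p q y = christoffel G' m p q y.
 move=> Uy;rewrite /christoffel;congr (_ * _);eqsum r.
 by rewrite GG // !ddE;congr (_*(_ + _ - _));apply: (dd_eq_on _ oU) => // z Uz;
  rewrite GG.
have Er m : riemann G m i j l x = riemann G' m i j l x.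
 rewrite /riemann !ddE.
 rewrite (dd_eq_on i oU (fun y => @chE m j l y) Ux).
 rewrite (dd_eq_on j oU (fun y => @chE m i l y) Ux).
 have -> // : \sum_p (christoffel G p j l x*christoffel G m i p x -
          christoffel G p i l x*christoffel G m j p x) =
    \sum_p (christoffel G' p j l x*christoffel G' m i p x -
          christoffel G' p i l x*christoffel G' m j p x).
 by eqsum p;rewrite !chE.
by rewrite /curvature_coef;eqsum m;rewrite Er GG.
Qed.

Lemma snn_isometric (L L' : finType) (F : L -> 'rV[R]_n -> R) (F' : L' -> 'rV[R]_n -> R) U x :
 open U -> U x -> (forall y, U y -> gramF F y = gramF F' y) ->
 snn F x -> snn F' x.
move=> oU Ux E;apply: eq_strong_psd => i j k l.
exact: curvature_coef_local oU E Ux.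
Qed.

End Immersions.

(** * Closedness of strong nonnegativity *)

Section PsdBound.
Context {R : realType} {I : finType}.
Implicit Types q w : @tens4 R I.

Definition elem (i j p r : I) : R := ((p == i) && (r == j))%:R - ((p == j) && (r == i))%:R.

Lemma sum_elem (t : I -> I -> R) i j :
 \sum_p \sum_r elem i j p r * t p r = t i j - t j i.
have E (k l : I) : \sum_p \sum_r ((p == k) && (r == l))%:R * t p r = t k l.
 rewrite (bigD1 k) //= (bigD1 l) //= !eqxx mul1r.
 rewrite big1 => [|r rl];last by rewrite (negPf rl) mul0r.
 rewrite big1 ?addr0 // => p pk;rewrite big1 // => r _.
 by rewrite (negPf pk) mul0r.
under eq_bigr do under eq_bigr do rewrite /elem mulrBl.
under eq_bigr do rewrite sumrB.
by rewrite sumrB !E.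
Qed.

Definition pair_antisym q := forall i j k l,
 q j i k l = - q i j k l /\ q i j l k = - q i j k l.

Lemma bform_elem q i j k l (s : R) : pair_antisym q ->
 q k l i j = q i j k l ->
 bform q (fun p r => elem i j p r+s*elem k l p r) =
 4*(q i j i j+s ^+ 2*q k l k l + 2*s*q i j k l).
move=> aq sq.
pose B (A A' : I -> I -> R) := \sum_p \sum_r A p r * \sum_u \sum_v A' u v*q p r u v.
have E A : bform q A = B A A.
 eqsum p;eqsum r;rewrite mulr_sumr.
 eqsum u;distrsum v;by rewrite mulrA.
have Bel a b c d : B (elem a b) (elem c d) = 4*q a b c d.
 rewrite /B;under eq_bigr do under eq_bigr do rewrite sum_elem.
 rewrite sum_elem;have [h1 _] := aq a b c d;have [_ h2] := aq a b c d.
 have [h3 _] := aq a b d c;rewrite h3 h1 h2;by ring.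
have Bl A A' : B (fun p r => A p r+s*A' p r) (fun p r => A p r+s*A' p r) =
  B A A+s ^+ 2*B A' A'+s*B A A'+s*B A' A.
 rewrite /B !mulr_sumr -!big_split;eqsum p => /=.
 rewrite !mulr_sumr -!big_split;eqsum r => /=.
 have -> : \sum_u \sum_v (A u v+s*A' u v)*q p r u v =
  \sum_u \sum_v A u v*q p r u v+s * \sum_u \sum_v A' u v*q p r u v.
  rewrite mulr_sumr -big_split;eqsum u => /=.
  rewrite mulr_sumr -big_split;eqsum v => /=;ring.
 ring.
by rewrite E Bl !Bel sq;ring.
Qed.

Lemma alternating_swap w i j k l : altern w -> w k l i j = w i j k l.
move=> aw;have [_ h1 _] := aw i j k l;have [h2 _ _] := aw i k j l.
have [_ _ h3] := aw k i j l;have [_ h4 _] := aw k i l j.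
by rewrite h4 h3 h2 h1 !opprK.
Qed.

Lemma alternating_diag w i j : altern w -> w i j i j = 0.
move=> aw;have [_ h1 _] := aw i i j j;have [h2 _ _] := aw i i j j.
have E : w i i j j = 0 by lra.
by rewrite h1 E oppr0.
Qed.

(** A 4-form vanishes on decomposable bivectors, so on the sum or difference of [elem i j] and
    [elem k l] only its cross term survives; positivity for both signs bounds that term by the
    entries of [q]. *)
Lemma psd_bound q w B i j k l : pair_antisym q ->
 (forall i j k l, q k l i j = q i j k l) ->
 altern w -> psd (fun i j k l => q i j k l+w i j k l) ->
 (forall i j k l, `|q i j k l| <= B) -> `|w i j k l| <= 2*B.
move=> aq sq aw pw HB.
pose Q i j k l := q i j k l+w i j k l.
have aQ : pair_antisym Q.
 move=> a b c d;have [h1 h2] := aq a b c d;have [h3 _ h4] := aw a b c d.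
 by rewrite /Q h1 h2 h3 h4 !opprD.
have sQ : Q k l i j = Q i j k l by rewrite /Q sq (alternating_swap _ _ _ _ aw).
have H s : 0 <= 4*(Q i j i j+s ^+ 2*Q k l k l + 2*s*Q i j k l).
 rewrite -bform_elem //;apply: pw => p r;rewrite /elem.
 rewrite [(r == j) && _]andbC [(r == i) && _]andbC [(r == l) && _]andbC.
 rewrite [(r == k) && _]andbC;ring.
have := H 1;have := H (-1);rewrite /Q !(alternating_diag _ _ aw) !addr0.
have := HB i j i j;have := HB k l k l;have := HB i j k l.
rewrite !ler_norml => /andP[a1 a2] /andP[b1 b2] /andP[c1 c2] h1 h2.
apply/andP;split;lra.
Qed.

End PsdBound.

Section Limit.
Context {R : realType} {n : nat} {L : finType}.
Variables (F : L -> 'rV[R]_n -> R) (x : 'rV[R]_n).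

Local Notation I4 := ('I_n * 'I_n * 'I_n * 'I_n)%type.
Local Notation N4 := #|{: I4}|.

Let tens (v : 'rV[R]_N4) : @tens4 R 'I_n :=
 fun i j k l => v 0 (enum_rank (i, j, k, l)).

Lemma smooth_curvature_coef U : open U -> (forall a, smooth_on U (F a)) ->
 (forall y, U y -> immersive F y) -> forall i j k l,
 smooth_on U (fun y => curvature_coef (gramF F) y i j k l).
move=> oU sF imF i j k l;have sC := smooth_christoffel oU sF imF.
apply: smooth_sum => // m;apply: smoothM => //;last exact: smooth_gramF.
rewrite /riemann;apply: smoothD => //.
 by apply: smoothB => //;apply: smooth_on_pd.
by apply: smooth_sum => // p;apply: smoothB => //;exact: smoothM.
Qed.

(* The 4-forms witnessing strong nonnegativity near [x] stay in a compact set,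
 so they accumulate at a witness at [x]. *)
Lemma snn_limit : nice F x ->
 (forall U, open U -> U x -> exists2 y, U y & snn F y) -> snn F x.
move=> nF Hd;have [U [oU Ux sF imF]] := nF.
have sR := smooth_curvature_coef oU sF imF.
have /choice[w Hw] : forall y, exists w : @tens4 R 'I_n, snn F y ->
  altern w /\ psd (fun i j k l => curvature_coef (gramF F) y i j k l+w i j k l).
 move=> y;have [[w aw pw]|ns] := pselect (snn F y);first by exists w.
 by exists (fun _ _ _ _ => 0).
pose W y : 'rV[R]_N4 := \row_m let: (i, j, k, l) := enum_val m in w y i j k l.
have WE y : tens (W y) = w y.
 by do 4 (apply/funext => ?);rewrite /tens mxE enum_rankK.
pose B := \sum_(u : I4) `|let: (i, j, k, l) := u in curvature_coef (gramF F) x i j k l| + 1.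
have nearB : \forall y \near x, U y /\ forall i j k l,
  `|curvature_coef (gramF F) y i j k l| <= B.
 apply: filterI;first exact: open_nbhs_nbhs.
 have H (u : I4) : \forall y \near x,
  `|(let: (i, j, k, l) := u in curvature_coef (gramF F) y i j k l)| <= B.
  case: u => [[[i j] k] l].
  have := smooth_near_lt (sR i j k l) Ux (ltr01);apply: filterS => y.
  move=> h;rewrite /B (bigD1 (i, j, k, l)) //= -addrA.
  apply: le_trans (_ : `|curvature_coef (gramF F) x i j k l| + 1 <= _).
   rewrite -lerBlDl;apply: le_trans (lerB_dist _ _) _.
   by rewrite distrC ltW.
  by rewrite lerD2l lerDr sumr_ge0.
 have H' := filter_forall (nbhs_filter x) H.
 by apply: filterS H' => y Hy i j k l;exact: (Hy (i, j, k, l)).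
have [V [oV Vx VB]] := open_near_ex nearB.
pose D := [set y | V y /\ snn F y].
have clD : closure D x.
 move=> A;rewrite nbhsE => -[Z [oZ Zx] ZA].
 have [y [Vy Zy] sy] := Hd _ (openI oV oZ) (conj Vx Zx).
 by exists y;split;[split|exact: ZA].
have PF : ProperFilter (within D (nbhs x)) by exact: within_nbhs_proper.
pose K := [set v : 'rV[R]_N4 | forall m, `[- (2*B), 2*B]%classic (v 0 m)].
have cK : compact K by apply: (@rV_compact _ _ (fun=> _)) => m;exact: segment_compact.
have WK y : D y -> K (W y).
 move=> [Vy sy] m;rewrite /= in_itv /= -ler_norml mxE.
 case: (enum_val m) => [[[i j] k] l].
 have [aw pw] := Hw _ sy;have [Uy RB] := VB _ Vy.
 have nFy : nice F y by exists U.
 have [g gS Hg] := normal_correction nFy.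
 have GE := gauss oU sF imF Uy Hg.
 pose N p r a := dd p (dd r (F a)) y - \sum_m0 g m0 p r*dd m0 (F a) y.
 have NS p r a : N p r a = N r p a.
  rewrite /N (dd_comm p r oU (sF a) Uy);congr (_ - _).
  by eqsum e;rewrite gS.
 apply: psd_bound aw pw RB => a b c d;rewrite !GE -/(N _ _).
  split;last by rewrite opprB.
  rewrite opprB;congr (_ - _);eqsum e;exact: mulrC.
 congr (_ - _);eqsum e;rewrite -/(N _ _ _) -/(N _ _ _).
  by rewrite (NS c) (NS d).
 by rewrite mulrC (NS d) (NS c).
have [v [Kv clv]] : K `&` cluster (W @ within D (nbhs x)) !=set0.
 apply: cK.
 suff : nbhs x (fun y => D y -> K (W y)) by [].
 by apply: filterE => y;exact: WK.
(* Inequalities that are linear in the 4-form and continuous in the point pass to the cluster value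
   [v]. The alternation identities pass as pairs of opposite inequalities in [lim2]. *)
have lim_ge0 (c : 'rV[R]_n -> R) (l : 'I_N4 -> R) : {for x, continuous c} ->
  (forall y, D y -> 0 <= c y+linform l (W y)) -> 0 <= c x+linform l v.
 move=> cc Hc;rewrite leNgt;apply/negP => neg.
 pose d := - (c x+linform l v) / 2.
 have d0 : 0 < d by rewrite divr_gt0 // oppr_gt0.
 pose A := [set W y | y in [set y | D y /\ `|c x - c y| < d]].
 pose Bd := [set u | `|linform l v - linform l u| < d].
 have FA : (W @ within D (nbhs x)) A.
  have /cvgrPdist_lt/(_ _ d0) : c @ x --> c x by exact: cc.
  move=> h0;suff : nbhs x (fun y => D y -> A (W y)) by [].
  by apply: filterS h0 => y h Dy;exists y.
 have NB : nbhs v Bd.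
  have /cvgrPdist_lt/(_ _ d0) : linform l @ v --> linform l v.
   exact: linform_continuous.
  by [].
 have [_ [[y [Dy h1] <-] h2]] := clv _ _ FA NB.
 have := Hc _ Dy;move: h1 h2;rewrite /Bd /= !ltr_distl /d => /andP[a1 a2] /andP[b1 b2].
 by lra.
have lim2 (m1 m2 : 'I_N4) : (forall y, D y -> W y 0 m1 = - W y 0 m2) -> v 0 m1 = - v 0 m2.
 move=> H.
 have lE (s : R) (u : 'rV[R]_N4) : linform (fun m => s*((m == m1)%:R+(m == m2)%:R)) u =
   s*(u 0 m1+u 0 m2).
  have E (m0 : 'I_N4) : \sum_m u 0 m*(m == m0)%:R = u 0 m0.
   rewrite (bigD1 m0) //= eqxx mulr1 big1 ?addr0 // => m mm.
   by rewrite (negPf mm) mulr0.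
  rewrite /linform -(E m1) -(E m2) -big_split /= mulr_sumr.
  by eqsum m;rewrite mulrCA mulrDr.
 have Z : {for x, continuous (fun _ : 'rV[R]_n => 0 : R)} by exact: cst_continuous.
 have h1 := lim_ge0 _ (fun m => 1*((m == m1)%:R+(m == m2)%:R)) Z.
 have h2 := lim_ge0 _ (fun m => -1*((m == m1)%:R+(m == m2)%:R)) Z.
 have {}h1 : 0 <= v 0 m1+v 0 m2.
  rewrite -[leRHS]mul1r -lE -[leRHS]add0r;apply: h1 => y Dy.
  by rewrite lE H // addNr mulr0 addr0.
 have {}h2 : 0 <= -1*(v 0 m1+v 0 m2).
  rewrite -lE -[leRHS]add0r;apply: h2 => y Dy.
  by rewrite lE H // addNr mulr0 addr0.
 lra.
exists (tens v).
 move=> i j k l;split;apply: lim2 => y [_ sy];have [aw _] := Hw _ sy;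
  have := aw i j k l;rewrite -WE => -[h1 h2 h3];by [exact: h1|exact: h2|exact: h3].
move=> A antiA;rewrite bformD.
have lE u : bform (tens u) A = linform (fun m => let: (i, j, k, l) := enum_val m in A i j*A k l) u.
 rewrite /linform (reindex (@enum_rank I4)) /=;last first.
  by exists enum_val => ? _;rewrite ?enum_rankK ?enum_valK.
 rewrite /bform;do 3 rewrite pair_bigA /=.
 by apply: eq_bigr => -[[[i j] k] l] _;rewrite enum_rankK /tens mulrC.
rewrite lE;apply: (lim_ge0 (fun y => bform (curvature_coef (gramF F) y) A)).
 apply: (@smooth_cts _ _ U) => //.
 do 4 (apply: smooth_sum => // ?);by apply: smoothM => //;exact: smooth_cst.
move=> y [Vy sy];have [_ pw] := Hw _ sy.
by rewrite -lE WE -bformD;exact: pw.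
Qed.

End Limit.

(** * Maps of R^n with injective derivative *)

Section EtaleMaps.
Context {R : realType} {n : nat}.
Implicit Types (h k : 'rV[R]_n -> 'rV[R]_n).

Lemma etale_near h k x (U : set 'rV[R]_n) : open U -> U x ->
 (forall y, U y -> h y = k y) -> etale h x -> etale k x.
move=> oU Ux hk eh v Hv;apply: eh => j;rewrite -[RHS](Hv j).
eqsum i;congr (_ * _).
by apply: (dd_eq_on _ oU) => // y Uy;rewrite hk.
Qed.

Lemma dd_row_comp h k x i j (U V : set 'rV[R]_n) : open U -> open V -> U x -> V (h x) ->
 (smooth_row U h) -> (smooth_row V k) ->
 dd i (fun y => k (h y) 0 j) x =
 \sum_p dd p (crd k j) (h x)*dd i (crd h p) x.
move=> oU oV Ux Vx sh sk;apply: (dd_comp (f := fun y => k y 0 j)) => [p|].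
 exact: smooth_diff oU (sh p) Ux.
exact: smooth_diff oV (sk j) Vx.
Qed.

Lemma etale_comp h k x (U V : set 'rV[R]_n) : open U -> open V -> U x -> V (h x) ->
 (smooth_row U h) -> (smooth_row V k) ->
 etale h x -> etale k (h x) -> etale (fun y => k (h y)) x.
move=> oU oV Ux Vx sh sk eh ek v Hv;apply: eh => p.
suff /rowP/(_ p) : (\row_p \sum_i v 0 i*dd i (crd h p) x) = 0.
 by rewrite !mxE.
apply: ek => j;rewrite -[RHS](Hv j).
under eq_bigr do rewrite mxE mulr_suml.
swapsum' i.
rewrite (dd_row_comp i j oU oV Ux Vx sh sk) mulr_sumr;eqsum q.
by rewrite -mulrA [dd q _ _ * _]mulrC.
Qed.

Lemma etale_id x : etale (fun y : 'rV[R]_n => y) x.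
move=> v Hv;apply/rowP => j;rewrite mxE -(Hv j) (bigD1 j) //= dd_coord eqxx mulr1.
by rewrite big1 ?addr0 // => i ij;rewrite dd_coord (negPf ij) mulr0.
Qed.

Lemma etale_left_inverse h k x (U V : set 'rV[R]_n) : open U -> open V -> U x -> V (h x) ->
 (smooth_row U h) -> (smooth_row V k) ->
 (forall y, U y -> k (h y) = y) -> etale h x.
move=> oU oV Ux Vx sh sk kh v Hv;apply: (@etale_id x) => j.
have E i : dd i (fun y : 'rV[R]_n => y 0 j) x =
  \sum_p dd p (crd k j) (h x)*dd i (crd h p) x.
 rewrite -(dd_row_comp i j oU oV Ux Vx sh sk).
 by apply: (dd_eq_on _ oU) => // y Uy;rewrite kh.
under eq_bigr do rewrite E mulr_sumr.
rewrite exchange_big /= big1 // => p _.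
transitivity (dd p (crd k j) (h x) * \sum_i v 0 i*dd i (crd h p) x).
 distrsum i;by rewrite mulrCA.
by rewrite Hv mulr0.
Qed.

End EtaleMaps.

(** * Smooth maps of manifolds, local diffeomorphisms and induced metrics *)

Section ManifoldMaps.
Context {R : realType}.

Section Charts.
Context {n : nat} (M : manifold R n).

Definition cd (c : chart R n M) (A : set M) : set 'rV[R]_n := ccod c `&` cinv c @^-1` A.

Lemma open_cd (c : chart R n M) (A : set M) : open A -> open (cd c A).
move=> oA;rewrite openE => x [Cx Ax];apply: filterI.
 by apply: open_nbhs_nbhs;split=> //;exact: chart_open_cod.
have /(_ _ _) cc := @chart_inv_continuous _ _ _ c.
by apply: (cc x);rewrite ?inE //;exact: open_nbhs_nbhs.
Qed.

(** Real functions are the basic notion: a map is smooth when it is continuous and pulls chart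
    coordinates back to such functions ([smooth_mapE]), so change of charts is handled once, in
    [smoothf_comp]. *)
Definition smoothf (A : set M) (g : M -> R) : Prop :=
 forall c, atlas c -> smooth_on (cd c A) (fun x => g (cinv c x)).

Lemma smoothfW (A B : set M) g : B `<=` A -> smoothf A g -> smoothf B g.
by move=> BA sg c ac;apply: smoothW (sg c ac) => x [Cx /BA Ax]. Qed.

Lemma smoothf_local (A : set M) g :
 (forall p, A p -> exists2 B : set M, B p & smoothf B g) -> smoothf A g.
move=> H c ac;apply: smooth_on_local => x [Cx Ax];have [B Bp sB] := H _ Ax.
by exists (cd c B);[split|exact: sB].
Qed.

Lemma smoothf_coord d j : atlas d -> smoothf (cdom d) (fun p => cmap d p 0 j).
by move=> ad c ac;exact: atlas_compatible. Qed.

End Charts.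
Arguments open_cd {n M} c [A].

Lemma smooth_mapE m n (M : manifold R m) (N : manifold R n) (A : set M) (f : M -> N) :
 smooth_map A f <-> {in A, continuous f} /\ forall d, atlas d -> forall j,
  smoothf (A `&` f @^-1` cdom d) (fun p => cmap d (f p) 0 j).
split=> -[cf sf];split=> //;first by move=> d ad j c ac;exact: sf.
by move=> c d ac ad j;exact: sf.
Qed.

Lemma smooth_mapW m n (M : manifold R m) (N : manifold R n) (A B : set M) (f : M -> N) :
 B `<=` A -> smooth_map A f -> smooth_map B f.
move=> BA /smooth_mapE[cf sf];apply/smooth_mapE;split=> [p|d ad j].
 by rewrite inE => /BA Ap;apply: cf;rewrite inE.
by apply: smoothfW (sf d ad j) => p [/BA Ap dp];split.
Qed.

Lemma open_preim m n (M : manifold R m) (N : manifold R n) (A : set M) (B : set N) (f : M -> N) :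
 open A -> open B -> {in A, continuous f} -> open (A `&` f @^-1` B).
move=> oA oB cf;rewrite openE => p [Ap Bp];apply: filterI;first exact: open_nbhs_nbhs.
by apply: (cf p);rewrite ?inE //;exact: open_nbhs_nbhs.
Qed.

Lemma smoothf_comp m n (M : manifold R m) (N : manifold R n) (A : set M) (B : set N)
  (f : M -> N) g : open A -> open B -> smooth_map A f -> smoothf B g ->
 (forall p, A p -> B (f p)) -> smoothf A (fun p => g (f p)).
move=> oA oB /smooth_mapE[cf sf] sg AB c ac;apply: smooth_on_local => x [Cx Ax].
have [d ad dfx] := atlas_cover (f (cinv c x)).
have oAd := open_preim oA (@chart_open_dom _ _ _ d) cf.
exists (cd c (A `&` f @^-1` cdom d));first by split.
have oW := open_cd c oAd.
apply: (smooth_on_eq (f := fun y => g (cinv d (cmap d (f (cinv c y))))) oW).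
 by move=> y [Cy [Ay dy]];have [_ ->] := chart_mapK dy.
apply: (smooth_comp oW (open_cd d oB) (h := fun y => cmap d (f (cinv c y)))
     (f := fun z => g (cinv d z))).
- by move=> j;exact: sf d ad j c ac.
- move=> y [Cy [Ay dy]];have [Dy E] := chart_mapK dy.
 by split=> //=;rewrite E;exact: AB.
- exact: sg.
Qed.

Lemma smooth_map_comp l m n (M : manifold R l) (N : manifold R m) (P : manifold R n)
  (A : set M) (B : set N) (f : M -> N) (g : N -> P) : open A -> open B ->
 smooth_map A f -> smooth_map B g -> (forall p, A p -> B (f p)) ->
 smooth_map A (fun p => g (f p)).
move=> oA oB sf /smooth_mapE[cg sg] AB;have [cf _] := sf.
apply/smooth_mapE;split=> [p pA|d ad j].
 have Ap : A p by move: pA;rewrite inE.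
 by apply: continuous_comp;[exact: cf|apply: cg;rewrite inE;exact: AB].
have oB' := open_preim oB (@chart_open_dom _ _ _ d) cg.
have oA' := open_preim oA oB' cf.
apply: (smoothfW (A := A `&` f @^-1` (B `&` g @^-1` cdom d))).
 by move=> p [Ap dp];split=> //;split=> //;exact: AB.
apply: (smoothf_comp (g := fun q => cmap d (g q) 0 j) oA' oB').
- by apply: smooth_mapW sf => p [].
- exact: sg.
- by move=> p [].
Qed.

Lemma smooth_map_local m n (M : manifold R m) (N : manifold R n) (A : set M) (f : M -> N) :
 (forall p, A p -> exists2 B : set M, B p & smooth_map B f) -> smooth_map A f.
move=> H;apply/smooth_mapE;split=> [p|d ad j].
 rewrite inE => /H[B Bp [cf _]];by apply: cf;rewrite inE.
apply: smoothf_local => p [/H[B Bp /smooth_mapE[_ sf]] dp].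
by exists (B `&` f @^-1` cdom d);[split|exact: sf].
Qed.

Lemma smoothf_eq n (M : manifold R n) (A : set M) f g : open A ->
 (forall p, A p -> f p = g p) -> smoothf A f -> smoothf A g.
move=> oA fg sf c ac;apply: smooth_on_eq (open_cd c oA) _ (sf c ac).
by move=> x [_ Ax];exact: fg.
Qed.

Lemma smooth_map_eq m n (M : manifold R m) (N : manifold R n) (A : set M) (f g : M -> N) :
 open A -> (forall p, A p -> f p = g p) -> smooth_map A f -> smooth_map A g.
move=> oA fg sf;have [cf _] := sf;have /smooth_mapE[_ sf'] := sf.
apply/smooth_mapE;split=> [p pA|d ad j].
 have Ap : A p by move: pA;rewrite inE.
 rewrite /continuous_at -(fg _ Ap);apply: cvg_trans (cf _ pA).
 by apply: near_eq_cvg;near=> q;apply: fg;near: q;exact: open_nbhs_nbhs.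
have oA' := open_preim oA (@chart_open_dom _ _ _ d) cf.
have -> : A `&` g @^-1` cdom d = A `&` f @^-1` cdom d.
 by apply/seteqP;split=> p [Ap];rewrite /= fg.
apply: smoothf_eq oA' _ (sf' d ad j) => p [Ap _];by rewrite fg.
Unshelve. all: by end_near. Qed.

Lemma smooth_map_id n (M : manifold R n) (A : set M) : smooth_map A (fun p => p).
apply/smooth_mapE;split=> [p _|d ad j];first exact: cvg_id.
by apply: smoothfW (smoothf_coord j ad) => p [].
Qed.

Lemma smoothf_euclidean n (A : set (euclidean R n)) (g : euclidean R n -> R) :
 smooth_on (A : set 'rV[R]_n) g -> smoothf A g.
by move=> sg c -> /=;apply: smoothW sg => x []. Qed.

Lemma euclidean_smoothf n (A : set (euclidean R n)) (g : euclidean R n -> R) :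
 smoothf A g -> smooth_on (A : set 'rV[R]_n) g.
by move=> /(_ (euclidean_chart n) erefl);apply: smoothW => x Ax;split.
Qed.

Lemma smooth_map_to_euclidean m n (M : manifold R m) (A : set M) (f : M -> euclidean R n) :
 open A -> (forall j, smoothf A (fun p => (f p : 'rV[R]_n) 0 j)) -> smooth_map A f.
move=> oA sf;apply/smooth_mapE;split=> [p pA|d -> /= j];last first.
 by apply: smoothfW (sf j) => p [].
have Ap : A p by move: pA;rewrite inE.
have [c ac cp] := atlas_cover p;have [Cx cpE] := chart_mapK cp.
have oW := open_cd c oA.
have Wp : cd c A (cmap c p) by split=> //;rewrite /= cpE.
have ch : {for cmap c p, continuous (fun x => f (cinv c x) : 'rV[R]_n)}.
 by apply: (smooth_row_cts oW) => // j;exact: sf.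
have E : \forall q \near p, f q = f (cinv c (cmap c q)).
 near=> q;have cq : cdom c q.
  near: q;apply: open_nbhs_nbhs;split=> //;exact: chart_open_dom.
 by have [_ ->] := chart_mapK cq.
apply: (@cvg_trans _ ((fun q => f (cinv c (cmap c q))) @ p)).
 by apply: near_eq_cvg;apply: filterS E => q ->.
rewrite -[f p](_ : f (cinv c (cmap c p)) = f p);last by rewrite cpE.
apply: (@continuous_comp _ _ _ (cmap c) (fun x => f (cinv c x) : 'rV[R]_n));last exact: ch.
by apply: chart_map_continuous;rewrite inE.
Unshelve. all: by end_near. Qed.

Lemma smooth_map_coord m n (M : manifold R m) (A : set M) (f : M -> euclidean R n) j :
 smooth_map A f -> smoothf A (fun p => (f p : 'rV[R]_n) 0 j).
move=> /smooth_mapE[_ sf].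
by apply: smoothfW (sf (euclidean_chart n) erefl j) => p Ap;split.
Qed.

Section LocalDiffeo.
Context {n : nat}.
Implicit Types (M N P : manifold R n).

(** Only injectivity of the derivative in charts is asked. It is what [reparam_snn] consumes and it
    composes, so no local inverse has to be produced. *)
Definition ldiffeo M N (f : M -> N) (p : M) : Prop :=
 (exists2 A : set M, open A /\ A p & smooth_map A f) /\
 forall c d, atlas c -> atlas d -> cdom c p -> cdom d (f p) ->
  etale (fun x => cmap d (f (cinv c x))) (cmap c p).

Lemma smooth_charts M N (f : M -> N) (A : set M) (c : chart R n M) (d : chart R n N) :
 open A -> smooth_map A f -> atlas c -> atlas d ->
 open (cd c (A `&` f @^-1` cdom d)) /\
 forall j, smooth_on (cd c (A `&` f @^-1` cdom d)) (fun x => cmap d (f (cinv c x)) 0 j).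
move=> oA sf ac ad;have [cf sf'] := sf;split=> [|j];last exact: sf'.
by apply: open_cd;apply: open_preim cf => //;exact: chart_open_dom.
Qed.

Lemma chart_in_cd M N (f : M -> N) (A : set M) (c : chart R n M) (d : chart R n N) p : A p -> cdom c p -> cdom d (f p) ->
 cd c (A `&` f @^-1` cdom d) (cmap c p).
by move=> Ap cp dp;have [Cx E] := chart_mapK cp;split=> //=;rewrite E. Qed.

Lemma local_diffeo_comp M N P (f : M -> N) (g : N -> P) p :
 ldiffeo f p -> ldiffeo g (f p) -> ldiffeo (fun q => g (f q)) p.
move=> [[A [oA Ap] sf] ef] [[B [oB Bp] sg] eg];have [cf _] := sf;split.
 exists (A `&` f @^-1` B);first by split;[exact: open_preim|].
 apply: (smooth_map_comp _ oB _ sg) => [||q []//];first exact: open_preim.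
 by apply: smooth_mapW sf => q [].
move=> c e ac ae cp ep;have [d ad dp] := atlas_cover (f p).
have [oW sW] := smooth_charts oA sf ac ad.
have [oV sV] := smooth_charts oB sg ad ae.
have Wp := chart_in_cd Ap cp dp;have Vp := chart_in_cd Bp dp ep.
have [_ Ec] := chart_mapK cp.
have Vp' : cd d (B `&` g @^-1` cdom e) (cmap d (f (cinv c (cmap c p)))) by rewrite Ec.
have := etale_comp oW oV Wp Vp' sW sV (ef _ _ ac ad cp dp).
rewrite {1}Ec => /(_ (eg _ _ ad ae dp ep)).
apply: etale_near oW Wp _ => x [_ [_ dx]].
by have [_ ->] := chart_mapK dx.
Qed.

Lemma local_diffeo_near M N (f g : M -> N) p (O : set M) : open O -> O p ->
 (forall q, O q -> f q = g q) -> ldiffeo f p -> ldiffeo g p.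
move=> oO Op fg [[A [oA Ap] sf] ef];split.
 exists (A `&` O);first by split;[exact: openI|].
 apply: (@smooth_map_eq _ _ _ _ _ f);first exact: openI.
  by move=> q [_ /fg].
 by apply: smooth_mapW sf => q [].
move=> c d ac ad cp;rewrite -fg // => dp;have [Cx Ec] := chart_mapK cp.
apply: etale_near (open_cd c oO) _ _ (ef c d ac ad cp dp);first by split=> //=;rewrite Ec.
by move=> x [_ Ox];rewrite fg.
Qed.

Lemma local_diffeo_id M p : ldiffeo (fun q : M => q) p.
split;first by exists setT;[split=> //;exact: openT|exact: smooth_map_id].
move=> c d ac ad cp dp.
have [oW sW] := smooth_charts openT (smooth_map_id (M := M) setT) ac ad.
have [oV sV] := smooth_charts openT (smooth_map_id (M := M) setT) ad ac.
have Wp := @chart_in_cd _ _ (fun q : M => q) setT c d p I cp dp.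
have Vp := @chart_in_cd _ _ (fun q : M => q) setT d c p I dp cp.
have [_ Ec] := chart_mapK cp.
apply: (etale_left_inverse (k := fun y => cmap c (cinv d y)) oW oV Wp _ sW sV).
 by rewrite Ec.
move=> x [Cx [_ dx]];have [_ ->] := chart_mapK dx;by have [] := chart_invK Cx.
Qed.

Lemma local_diffeo_left_inverse M N (f : M -> N) (g : N -> M) p (A : set M) (B : set N) :
 open A -> open B -> A p -> B (f p) -> smooth_map A f -> smooth_map B g ->
 (forall q, A q -> g (f q) = q) -> ldiffeo f p.
move=> oA oB Ap Bp sf sg gf;split;first by exists A.
move=> c d ac ad cp dp.
have [oW sW] := smooth_charts oA sf ac ad.
have [oV sV] := smooth_charts oB sg ad ac.
have Wp := chart_in_cd Ap cp dp.
have cp' : cdom c (g (f p)) by rewrite gf.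
have Vp := chart_in_cd Bp dp cp'.
have [_ Ec] := chart_mapK cp.
apply: (etale_left_inverse (k := fun y => cmap c (g (cinv d y))) oW oV Wp _ sW sV).
 by rewrite Ec.
move=> x [Cx [Ax dx]];have [_ ->] := chart_mapK dx;rewrite gf //.
by have [] := chart_invK Cx.
Qed.

Lemma local_diffeo_euclidean (h : euclidean R n -> euclidean R n) (x : 'rV[R]_n)
  (U : set 'rV[R]_n) : open U -> U x -> (forall j, smooth_on U (fun y => (h y : 'rV[R]_n) 0 j)) ->
 etale (h : 'rV[R]_n -> 'rV[R]_n) x -> ldiffeo h x.
move=> oU Ux sh eh;split.
 exists U => //;apply: smooth_map_to_euclidean => // j;exact: smoothf_euclidean.
by move=> c d -> -> _ _.
Qed.

End LocalDiffeo.

Section Metric.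
Context {n : nat} (M : manifold R n) (L : finType) (G : L -> M -> R).

Definition good p := forall c, atlas c -> cdom c p ->
 nice (fun a x => G a (cinv c x)) (cmap c p) /\
 snn (fun a x => G a (cinv c x)) (cmap c p).

(** One local parametrization suffices: reading it in another chart is a reparametrization by an
    étale map, to which [reparam_nice] and [reparam_snn] apply. *)
Lemma good_local (E : L -> 'rV[R]_n -> R) (k : M -> euclidean R n) (O : set M) p :
 open O -> O p -> (forall a q, O q -> G a q = E a (k q)) -> ldiffeo k p ->
 nice E (k p) -> snn E (k p) -> good p.
move=> oO Op GE [[A [oA Ap] sk] ek] nE sE c ac cp;have [Cx Ec] := chart_mapK cp.
have oW := open_cd c (openI oA oO).
have Wp : cd c (A `&` O) (cmap c p) by split=> //=;rewrite Ec.
have sW j : smooth_on (cd c (A `&` O)) (fun x => (k (cinv c x) : 'rV[R]_n) 0 j).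
 by apply: smoothW (smooth_map_coord j sk ac) => x [Cx' []].
have ek' := ek c (euclidean_chart n) ac erefl cp I.
have nE' : nice E (k (cinv c (cmap c p))) by rewrite Ec.
have sE' : snn E (k (cinv c (cmap c p))) by rewrite Ec.
have nF := reparam_nice oW Wp sW ek' nE'.
have sF := reparam_snn oW Wp sW ek' nE' sE'.
have eqW a y : cd c (A `&` O) y -> E a (k (cinv c y)) = G a (cinv c y).
 by move=> [_ [_ Oy]];rewrite GE.
have eqdd i a y : cd c (A `&` O) y -> dd i (fun y => E a (k (cinv c y))) y =
  dd i (fun y => G a (cinv c y)) y.
 move=> Wy;apply: (dd_eq_on _ oW) => // z;exact: eqW.
split;last first.
 apply: snn_isometric oW Wp _ sF => y Wy;apply/matrixP => i j;rewrite !mxE.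
 by eqsum a;rewrite !eqdd.
have [U [oU Ux sU iU]] := nF.
exists (U `&` cd c (A `&` O));split=> [||a|y [Uy Wy] v Hv].
- exact: openI.
- by [].
- apply: (@smooth_on_eq _ _ _ (fun y => E a (k (cinv c y))));first exact: openI.
  by move=> y [_ /eqW].
 by apply: smoothW (sU a) => y [].
- by apply: (iU y Uy) => a;rewrite -[RHS](Hv a);eqsum i;rewrite eqdd.
Qed.

Hypothesis Ggood : forall p, good p.

Let smoothG c : atlas c -> forall a, smooth_on (ccod c) (fun x => G a (cinv c x)).
move=> ac a;apply: smooth_on_local => x Cx;have [cx Ex] := chart_invK Cx.
have [[U [oU Ux sU _]] _] := Ggood ac cx.
by exists U;rewrite ?Ex // -Ex.
Qed.

Let immG c x : atlas c -> ccod c x -> immersive (fun a x => G a (cinv c x)) x.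
move=> ac Cx;have [cx Ex] := chart_invK Cx.
have [[U [oU Ux _ iU]] _] := Ggood ac cx;rewrite -Ex;exact: iU.
Qed.

Lemma jacobianE (h : 'rV[R]_n -> 'rV[R]_n) x i j :
 (forall j, differentiable (crd h j) x) -> ('J h x) i j = dd i (crd h j) x.
move=> dh;rewrite /jacobian mxE diff_coord;last exact: differentiable_row.
rewrite diff_ddE // (bigD1 i) //= mxE !eqxx mul1r big1 ?addr0 // => k ki.
by rewrite mxE eqxx (negPf ki) mul0r.
Qed.

(** The functions [G] live on all of [M], so their Gram matrices in the charts are related by the
    chain rule, which is the compatibility required of a metric. *)
Lemma metric_of_good : exists g : riemannian_metric M, strongly_nonnegative_curvature g.
pose gr (c : chart R n M) x := gramF (fun a x => G a (cinv c x)) x.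
have gs c : atlas c -> forall i j, smooth_on (ccod c) (fun x => gr c x i j).
 by move=> ac i j;apply: smooth_gramF;[exact: chart_open_cod|exact: smoothG].
have gsym c : atlas c -> forall x, ccod c x -> (gr c x)^T = gr c x.
 by move=> ac x Cx;exact: gramF_sym.
have gpos c : atlas c -> forall x, ccod c x -> forall v : 'rV[R]_n, v != 0 ->
  0 < (v *m gr c x *m v^T) 0 0.
 by move=> ac x Cx v v0;apply: gramF_pos => //;exact: immG.
have gcomp c d : atlas c -> atlas d -> forall x, ccod c x -> cdom d (cinv c x) ->
  let t := cmap d \o cinv c in
  gr c x = 'J t x *m gr d (t x) *m ('J t x)^T.
 move=> ac ad x Cx dx t.
 have oW := open_cd c (@chart_open_dom _ _ _ d).
 have Wx : cd c (cdom d) x by [].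
 have st j : smooth_on (cd c (cdom d)) (crd t j) by exact: atlas_compatible.
 have dt j : differentiable (crd t j) x.
  exact: smooth_diff oW (st j) Wx.
 have [Dt Et] := chart_mapK dx.
 have E a i : dd i (fun y => G a (cinv c y)) x =
   \sum_p dd p (fun y => G a (cinv d y)) (t x)*dd i (crd t p) x.
  rewrite -(dd_comp (f := fun y => G a (cinv d y)) i dt).
   by apply: (dd_eq_on _ oW) => // y [Cy dy];rewrite /t /=;have [_ ->] := chart_mapK dy.
  exact: smooth_diff (@chart_open_cod _ _ _ d) (smoothG ad a) Dt.
 have JE i j : ('J t x) i j = dd i (crd t j) x by rewrite jacobianE.
 move: ('J t x) JE => JJ JE;apply/matrixP => i j;rewrite !mxE.
 under eq_bigr do rewrite !E mulr_suml.
 under eq_bigr do under eq_bigr do rewrite mulr_sumr.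
 rewrite exchange_big /=;under eq_bigr do rewrite exchange_big /=.
 swapsum' q.
 rewrite !mxE mulr_suml;eqsum p.
 rewrite !JE !mxE mulr_sumr mulr_suml;eqsum a.
 set u := dd p _ _;set v := dd q _ _;set r := dd i _ _;set s := dd j _ _.
 clearbody u v r s;ring.
exists (RiemannianMetric gs gsym gpos gcomp) => p c ac cp /=.
have [_ [w aw pw]] := Ggood ac cp.
by exists w => //;apply/bivector_psdP.
Qed.

End Metric.

End ManifoldMaps.

(** * A cutoff function with an explicit slope bound *)

Section Bump.
Context {R : realType}.

Definition bump (t : R) : R := flat 0 (2 - t) / (flat 0 (2 - t)+flat 0 (t - 1)).

Lemma flat_gt0 k (s : R) : 0 < s -> 0 < flat k s.
by move=> s0;rewrite /flat s0 mulr_gt0 ?expR_gt0 // exprn_gt0 // invr_gt0. Qed.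

Lemma flat_le0 k (s : R) : s <= 0 -> flat k s = 0.
by move=> s0;rewrite /flat ltNge s0. Qed.

Lemma bump_den (t : R) : 0 < flat 0 (2 - t)+flat 0 (t - 1).
have [t2|t2] := ltP t 2.
 by rewrite ltr_wpDr ?flat_ge0 // flat_gt0 // subr_gt0.
have t1 : 0 < t - 1 by lra.
by rewrite ltr_wpDl ?flat_ge0 // flat_gt0.
Qed.

Lemma bump1 (t : R) : t <= 1 -> bump t = 1.
move=> t1;rewrite /bump (flat_le0 0 (s := t - 1)) ?subr_le0 // addr0 divff // gt_eqF //.
by apply: flat_gt0;lra.
Qed.

Lemma bump0 (t : R) : 2 <= t -> bump t = 0.
by move=> t2;rewrite /bump flat_le0 ?mul0r // subr_le0. Qed.

Lemma bump_ge0 (t : R) : 0 <= bump t.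
by rewrite divr_ge0 ?flat_ge0 // ltW // bump_den. Qed.

Lemma bump_le1 (t : R) : bump t <= 1.
by rewrite ler_pdivrMr ?bump_den // mul1r lerDl flat_ge0. Qed.

(** The explicit slope is needed in [slow_cutoff]. One of [2 - t] and [t - 1] is at least 1/2, so
    the denominator is at least [expR (- 2)]; the factor 24 is the factorial of 4 from
    [flat_bound]. *)
Lemma bump_is_derive (t : R) :
 exists2 d, d <= 0 /\ (t <= 2 -> - (24*expR 2) <= d) & is_der t bump d.
have h1 : is_der t (fun s => 2 - s) (-1).
 have := derD (is_derive_cst (2 : R) t 1) (derZ (-1) (is_derive_id t 1)).
 rewrite add0r mulr1 (_ : (fun s => _ + -1 * _) = fun s => 2 - s) //.
 by apply/funext => s;rewrite mulN1r.
have h2 : is_der t (fun s => s - 1) 1.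
 by have := derD (is_derive_id t 1) (is_derive_cst (-1 : R) t 1);rewrite addr0.
have u' := der_comp (f := flat 0) (g := fun s => 2 - s) (flat_is_derive 0 _) h1.
have v' := der_comp (f := flat 0) (g := fun s => s - 1) (flat_is_derive 0 _) h2.
have D := bump_den t.
have := derM u' (derV (g := fun s => flat 0 (2 - s)+flat 0 (s - 1)) (lt0r_neq0 D) (derD u' v')).
rewrite !mul0r !subr0 => h;eexists;last exact: h.
have fb (s : R) : 0 <= s <= 1 -> flat 2 s <= 24.
 move=> /andP[s0 s1];apply: le_trans (flat_bound 2 s) _.
 by rewrite ler_piMr // expr_le1.
have a1 : 1 <= t <= 2 -> flat 2 (2 - t) <= 24 by move=> t12;apply: fb;lra.
have b1 : 1 <= t <= 2 -> flat 2 (t - 1) <= 24 by move=> t12;apply: fb;lra.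
have fe (s : R) : 2^-1 <= s -> expR (- 2) <= flat 0 s.
 move=> s2;have s0 : 0 < s by apply: lt_le_trans s2;lra.
 rewrite /flat s0 expr0 mul1r ler_expR lerN2 -[leRHS]invrK lef_pV2 ?posrE //.
have uv : expR (- 2) <= flat 0 (2 - t)+flat 0 (t - 1).
 have [t1|t1] := leP t (3 / 2).
  by rewrite -[leLHS]addr0 lerD ?flat_ge0 // fe //;lra.
 by rewrite -[leLHS]add0r lerD ?flat_ge0 // fe //;lra.
have z : t <= 1 -> flat 0 (t - 1) = 0 /\ flat 2 (t - 1) = 0.
 by move=> t1;rewrite !flat_le0 // subr_le0.
have a0 : 0 <= flat 2 (2 - t) by exact: flat_ge0.
have b0 : 0 <= flat 2 (t - 1) by exact: flat_ge0.
move: (flat_ge0 0 (2 - t)) (flat_ge0 0 (t - 1)) D uv z.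
move: (flat 0 (2 - t)) (flat 0 (t - 1)) => u v u0 v0 D uv z.
move: (flat 2 (2 - t)) (flat 2 (t - 1)) a0 b0 a1 b1 z => a b a0 b0 a1 b1 z.
have -> : u*(- (u+v) ^- 2*(a * -1+b * 1))+(u+v)^-1*(a * -1) =
 - ((u*b+v*a) / (u+v) ^+ 2) by field;rewrite gt_eqF.
split;first by rewrite oppr_le0 divr_ge0 ?sqr_ge0 // addr_ge0 // mulr_ge0.
move=> t2;have [/z[-> ->]|t1] := leP t 1.
 by rewrite mulr0 mul0r addr0 mul0r oppr0 oppr_le0 mulr_ge0 // expR_ge0.
have t12 : 1 <= t <= 2 by rewrite t2 ltW.
rewrite lerN2 ler_pdivrMr ?exprn_gt0 //.
apply: le_trans (_ : 24*(u+v) <= _).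
 rewrite mulrDr ![24 * _]mulrC lerD // ler_wpM2l //;[exact: b1|exact: a1].
rewrite expr2 mulrA ler_wpM2r ?(ltW D) // -mulrA ler_peMr //.
by move: uv;rewrite expRN -[_^-1]div1r ler_pdivrMr ?expR_gt0 // mulrC.
Qed.

Context {n : nat}.
Implicit Types x : 'rV[R]_n.

Lemma smooth_bump U (f : 'rV[R]_n -> R) : open U -> smooth_on U f ->
 smooth_on U (fun x => bump (f x)).
move=> oU sf.
have s1 : smooth_on U (fun x => flat 0 (2 - f x)).
 apply: (smooth_comp1 oU (D := setT) (smooth1_flat _ 0)) => //.
 by apply: smoothB => //;exact: smooth_cst.
have s2 : smooth_on U (fun x => flat 0 (f x - 1)).
 apply: (smooth_comp1 oU (D := setT) (smooth1_flat _ 0)) => //.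
 by apply: smoothB => //;exact: smooth_cst.
apply: smoothM => //;apply: (smooth_comp1 oU smooth1_inv);first exact: smoothD.
by move=> x _;rewrite /= gt_eqF // bump_den.
Qed.

Lemma smooth_sqnorm (U : set 'rV[R]_n) : open U -> smooth_on U sqnorm.
move=> oU;apply: smooth_sum => // i.
have -> : (fun x : 'rV[R]_n => x 0 i ^+ 2) = fun x => x 0 i*x 0 i.
 by apply/funext => x;rewrite expr2.
by apply: smoothM => //;exact: smooth_on_coord.
Qed.

Lemma sqnorm_ge0 x : 0 <= sqnorm x.
by rewrite sumr_ge0 // => i _;exact: sqr_ge0. Qed.

Lemma sqnorm_coord x i : x 0 i ^+ 2 <= sqnorm x.
by rewrite /sqnorm (bigD1 i) //= lerDl sumr_ge0 // => j _;exact: sqr_ge0. Qed.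

Lemma sqnorm_eq0 x : sqnorm x = 0 -> x = 0.
move=> x0;apply/rowP => i;rewrite mxE;apply/eqP;rewrite -sqrf_eq0 eq_le sqr_ge0 andbT.
by rewrite -x0 sqnorm_coord.
Qed.

Lemma sqnorm0 : sqnorm (0 : 'rV[R]_n) = 0.
by rewrite /sqnorm big1 // => i _;rewrite mxE expr0n. Qed.

Lemma sqnorm_gt0 x : x <> 0 -> 0 < sqnorm x.
move=> x0;rewrite lt_neqAle sqnorm_ge0 andbT eq_sym.
by apply/eqP => /sqnorm_eq0.
Qed.

Lemma sqnormZ a x : sqnorm (a *: x) = a ^+ 2*sqnorm x.
by rewrite /sqnorm mulr_sumr;eqsum i;rewrite mxE exprMn. Qed.

Lemma row_norm_sqnorm x r : 0 <= r -> sqnorm x <= r ^+ 2 -> `|x| <= r.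
move=> r0 xr;apply: row_norm_le => // i.
rewrite -(ler_pXn2r (n := 2)) ?nnegrE // -normrX ger0_norm ?sqr_ge0 //.
exact: le_trans (sqnorm_coord x i) xr.
Qed.

Lemma open_sqnorm_lt (r : R) : open [set x : 'rV[R]_n | sqnorm x < r].
rewrite openE => x /= xr.
have d0 : 0 < r - sqnorm x by rewrite subr_gt0.
have := smooth_near_lt (smooth_sqnorm openT) (I : setT x) d0.
apply: filterS => y;rewrite ltr_distl => /andP[h1 h2] /=;lra.
Qed.

Lemma open_sqnorm_gt (r : R) : open [set x : 'rV[R]_n | r < sqnorm x].
rewrite openE => x /= xr.
have d0 : 0 < sqnorm x - r by rewrite subr_gt0.
have := smooth_near_lt (smooth_sqnorm openT) (I : setT x) d0.
apply: filterS => y;rewrite ltr_distl => /andP[h1 h2] /=;lra.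
Qed.

Lemma compact_sqnorm_le (r : R) : compact [set x : 'rV[R]_n | sqnorm x <= r].
apply: bounded_closed_compact.
 exists (`|r| + 1);split;first by rewrite num_real.
 move=> b rb x /= xr;apply: row_norm_sqnorm;first by apply: le_trans (ltW rb);rewrite addr_ge0.
 apply: le_trans xr _;apply: le_trans (ler_norm r) _.
 have b1 : 1 <= b by apply: le_trans (ltW rb);rewrite lerDr.
 apply: le_trans (_ : b <= _);first by apply: le_trans (ltW rb);rewrite lerDl.
 by rewrite expr2 ler_pMl // (lt_le_trans _ b1).
have -> : [set x : 'rV[R]_n | sqnorm x <= r] = ~` [set x | r < sqnorm x].
 by apply/seteqP;split=> x /=;rewrite leNgt => /negP.
exact/open_closedC/open_sqnorm_gt.
Qed.

Lemma mean_value_bound U (f : 'rV[R]_n -> R) x y c : open U -> smooth_on U f ->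
 (forall t : R, 0 <= t <= 1 -> U (y+t *: (x - y))) ->
 (forall z i, U z -> `|dd i f z| <= c) -> `|f x - f y| <= n%:R*c * `|x - y|.
move=> oU sf HU Hc;set v := x - y.
pose g (t : R) := f (y+t *: v).
pose dg (t : R) := \sum_i v 0 i*dd i f (y+t *: v).
have gd (t : R) : 0 <= t <= 1 -> is_der t g (dg t).
 move=> t01;apply: der_line.
 have df := smooth_diff oU sf (HU t t01).
 rewrite /dg -(diff_ddE v df) -deriveE //.
 by apply: derivableP;exact: diff_derivable.
have [t t01 E] : exists2 t, t \in `[0, 1]%R & g 1 - g 0 = dg t*(1 - 0).
 apply: (@MVT_segment R) => // [t t01|].
  by apply: gd;have := subset_itv_oo_cc t01;rewrite in_itv.
 apply: continuous_in_subspaceT => t;rewrite inE /= in_itv => /gd [+ _].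
 by move/derivable1_diffP/differentiable_continuous.
have vE : y+v = x by rewrite /v addrC subrK.
move: E;rewrite /g scale1r scale0r addr0 subr0 mulr1 vE => ->.
rewrite in_itv /= in t01.
apply: le_trans (ler_norm_sum _ _ _) _.
apply: le_trans (_ : \sum_(i < n) c * `|v| <= _);last first.
 by rewrite sumr_const card_ord -mulrA mulr_natl.
apply: ler_sum => i _;rewrite normrM mulrC;apply: ler_pM => //;last exact: row_norm_coord.
by apply: Hc;exact: HU.
Qed.

End Bump.

(** * Injective local diffeomorphisms equal to the identity far out *)

Section CompactDiffeos.
Context {R : realType} {n : nat}.
Implicit Types (s k : 'rV[R]_n -> 'rV[R]_n) (x y v w : 'rV[R]_n).

Definition dot x y : R := \sum_i x 0 i*y 0 i.

Lemma dotxx x : dot x x = sqnorm x.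
by eqsum i;rewrite expr2. Qed.

Lemma dotDl x y v : dot (x+y) v = dot x v+dot y v.
by rewrite /dot -big_split;eqsum i;rewrite mxE mulrDl. Qed.

Lemma dotZl a x v : dot (a *: x) v = a*dot x v.
by rewrite /dot mulr_sumr;eqsum i;rewrite mxE mulrA. Qed.

Lemma dotC x y : dot x y = dot y x.
by eqsum i;rewrite mulrC. Qed.

Lemma dotBl x y v : dot (x - y) v = dot x v - dot y v.
by rewrite dotDl -scaleN1r dotZl mulN1r. Qed.

Lemma dot0l v : dot 0 v = 0.
by rewrite /dot big1 // => i _;rewrite mxE mul0r. Qed.

Definition Dv s x v : 'rV[R]_n := \row_j \sum_i v 0 i*dd i (crd s j) x.

Lemma etale_Dv s x : (forall v, Dv s x v = 0 -> v = 0) <-> etale s x.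
split=> H v Hv;apply: H;last by move=> j;move/rowP/(_ j): Hv;rewrite !mxE.
by apply/rowP => j;rewrite !mxE.
Qed.

(** Injectivity is what later identifies the only point sent to the centre of a cell; the identity
    far out is what allows transplantation to a manifold. *)
Definition diff0 s :=
 [/\ smooth_row setT s, forall x, etale s x, injective s &
   exists r, forall x, r < sqnorm x -> s x = x].

Lemma smooth_compT s (f : 'rV[R]_n -> R) : (smooth_row setT s) ->
 smooth_on setT f -> smooth_on setT (fun x => f (s x)).
by move=> ss sf;apply: (smooth_comp openT openT ss). Qed.

Lemma etale_compT s k x : (smooth_row setT s) ->
 (smooth_row setT k) ->
 etale s x -> etale k (s x) -> etale (fun y => k (s y)) x.
by move=> ss sk;apply: (etale_comp openT openT). Qed.

Lemma diff0_comp s k : diff0 s -> diff0 k -> diff0 (fun x => k (s x)).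
move=> [ss es is_ [r Hr]] [sk ek ik [r' Hr']];split=> [j|x|x y /ik/is_ //|].
- exact: (smooth_compT (f := fun y => k y 0 j)).
- exact: etale_compT.
- exists (Num.max r r') => x;rewrite gt_max => /andP[h h'];by rewrite Hr ?Hr'.
Qed.

Lemma smooth_linear (B : 'M[R]_n) j : smooth_on setT (fun x : 'rV[R]_n => (x *m B) 0 j).
have -> : (fun x : 'rV[R]_n => (x *m B) 0 j) = fun x => \sum_i x 0 i*B i j.
 by apply/funext => x;rewrite mxE.
apply: (smooth_sum openT) => i;apply: (smoothM openT);first exact: smooth_on_coord.
exact: smooth_cst.
Qed.

Lemma dd_linear (B : 'M[R]_n) x i j : dd i (fun y : 'rV[R]_n => (y *m B) 0 j) x = B i j.
have -> : (fun x : 'rV[R]_n => (x *m B) 0 j) = fun x => \sum_i B i j*x 0 i.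
 by apply/funext => y;rewrite mxE;eqsum p;rewrite mulrC.
rewrite (dd_sum (U := setT) _ _ openT) // => [|p];last first.
 by apply: (smoothZ openT);exact: smooth_on_coord.
transitivity (\sum_p B p j*(i == p)%:R).
 eqsum p;rewrite (ddZ (U := setT)) ?dd_coord //;exact: smooth_on_coord.
rewrite (bigD1 i) //= eqxx mulr1 big1 ?addr0 // => p /negPf pi.
by rewrite eq_sym pi mulr0.
Qed.

Lemma dot_Dv s x v : dot (Dv s x v) v = \sum_j \sum_i v 0 i*v 0 j*dd i (crd s j) x.
eqsum j;rewrite mxE mulr_suml;eqsum i.
by rewrite mulrAC.
Qed.

(* A map whose derivative is positive in the sense of quadratic forms is
 strictly monotone, hence injective. *)
Lemma monotone_diff0 s r : (smooth_row setT s) ->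
 (forall x, r < sqnorm x -> s x = x) ->
 (forall x v, v <> 0 -> 0 < dot (Dv s x v) v) -> diff0 s.
move=> ss sr Dpos;split=> // [x|x y sxy|];last by exists r.
- apply/etale_Dv => v v0;apply/eqP;rewrite -[_ == _]negbK;apply/negP => /eqP /Dpos.
 by move=> /(_ x);rewrite v0 dot0l ltxx.
- apply/eqP;rewrite -subr_eq0 -[_ == _]negbK;apply/negP => /eqP.
 set v := x - y => v0.
 pose f z := \sum_j v 0 j*s z 0 j.
 have sf : smooth_on setT f.
  by apply: (smooth_sum openT) => j;exact: (smoothZ openT).
 have gd (t : R) : is_der t (fun t => f (y+t *: v)) (dot (Dv s (y+t *: v) v) v).
  apply: der_line;set z := y+t *: v.
  have df := smooth_diff openT sf (I : setT z).
  have -> : dot (Dv s z v) v = 'd f z v.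
   rewrite diff_ddE // dot_Dv exchange_big /=;eqsum i.
   rewrite (dd_sum _ _ openT (F := fun j z => v 0 j*s z 0 j)) //;last first.
    by move=> j;exact: (smoothZ openT).
   distrsum j.
   by rewrite (ddZ _ _ (ss j)) // mulrA.
  by rewrite -deriveE //;apply: derivableP;exact: diff_derivable.
 have [t _ E] : exists2 t, t \in `[0, 1]%R & f (y + 1 *: v) - f (y + 0 *: v) =
   dot (Dv s (y+t *: v) v) v*(1 - 0).
  apply: (@MVT_segment R (fun t => f (y+t *: v))) => //.
  apply: continuous_subspaceT => t;have [+ _] := gd t.
  by move/derivable1_diffP/differentiable_continuous.
 have yv : y+v = x by rewrite /v addrC subrK.
 have := Dpos (y+t *: v) v v0.
 move: E;rewrite scale1r scale0r addr0 yv /f sxy subrr subr0 mulr1 => <-.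
 by rewrite ltxx.
Qed.

Lemma cauchy_schwarz x y : dot x y ^+ 2 <= sqnorm x*sqnorm y.
have [->|y0] := pselect (y = 0).
 by rewrite dotC dot0l expr0n /= mulr_ge0 ?sqnorm_ge0.
have q0 := sqnorm_gt0 y0.
have := sqnorm_ge0 (x - (dot x y / sqnorm y) *: y).
rewrite -dotxx dotBl !(dotC _ (_ - _)) !dotBl !dotZl (dotC y x) !(dotC _ (_ *: _)) !dotZl !dotxx.
rewrite (dotC y x);move: (dot x y) (sqnorm x) (sqnorm y) q0 => a b c c0 H.
have E : b - a / c*a - (a / c*a - a / c*(a / c*c)) = b - a ^+ 2 / c by field;rewrite gt_eqF.
by move: H;rewrite E subr_ge0 ler_pdivrMr.
Qed.

Lemma dd_sqnorm x i : dd i sqnorm x = 2*x 0 i.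
have -> : sqnorm = fun y : 'rV[R]_n => \sum_j y 0 j*y 0 j.
 by apply/funext => y;eqsum j;rewrite expr2.
rewrite (dd_sum (U := setT) _ _ openT) // => [|p];last first.
 by apply: (smoothM openT);exact: smooth_on_coord.
transitivity (\sum_p 2*(x 0 p*(i == p)%:R)).
 eqsum p;rewrite (ddM (U := setT)) ?dd_coord //;try exact: smooth_on_coord.
 by rewrite -mulr2n mulr_natl.
rewrite (bigD1 i) //= eqxx mulr1 big1 ?addr0 // => p /negPf pi.
by rewrite eq_sym pi !mulr0.
Qed.

(** Interpolates between a monotone map [k] near 0 and the identity. An ordinary cutoff has a
    gradient of the order of the inverse radius, which may destroy monotonicity. Here the cutoff
    depends on a small power [tau] of the squared radius, so its gradient is smaller by the factor
    [e], and the linear bound on [k w - w] makes the extra term at most half of [lam]. *)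
Lemma slow_cutoff (lam C : R) : 0 < lam -> lam <= 1 -> 0 <= C -> exists2 c, 0 < c &
 forall k rho, 0 < rho ->
 (forall j, smooth_on [set w : 'rV[R]_n | sqnorm w < rho] (crd k j)) ->
 (forall w v, sqnorm w < rho -> lam*sqnorm v <= dot (Dv k w v) v) ->
 (forall w, sqnorm w < rho -> sqnorm (k w - w) <= C ^+ 2*sqnorm w) ->
 exists2 s, diff0 s & forall w, sqnorm w < c*rho -> s w = k w.
move=> lam0 lam1 C0;pose K : R := 24*expR 2.
have K0 : 0 < K by rewrite mulr_gt0 // expR_gt0.
(* The gradient term is bounded by [4 * K * e * C]; this exponent brings it below [lam / 2]. *)
pose e := lam / (8*K*(C + 1)).
have C1 : 0 < C + 1 by lra.
have e0 : 0 < e by rewrite divr_gt0 // mulr_gt0 // mulr_gt0.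
have eC : 4*K*e*C <= lam / 2.
 have -> : 4*K*e*C = (lam / 2)*(C / (C + 1)).
  by rewrite /e;field;rewrite !gt_eqF.
 rewrite ler_piMr //;first by rewrite divr_ge0 // ltW.
 by rewrite ler_pdivrMr // mul1r lerDl.
clearbody e.
(* With this ratio [tau] equals 1 at squared radius [c * rho] and 2 at squared radius [rho / 2], the
   two ends of the transition of [bump]. *)
pose c := (2 `^ (- e^-1)) / 2.
have p0 : 0 < 2 `^ (- e^-1) :> R by rewrite powR_gt0.
have c0 : 0 < c by rewrite divr_gt0.
exists c => // k rho rho0 sk Hpos Hk.
pose d := c*rho;have d0 : 0 < d by rewrite mulr_gt0.
pose tau w := (d^-1*sqnorm w) `^ e.
have pw1 : 1 `^ e = 1 :> R by rewrite powR1.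
have mono (a b : R) : 0 <= a -> a <= b -> a `^ e <= b `^ e.
 by move=> a0 ab;rewrite ge0_ler_powR ?nnegrE ?(ltW e0) // (le_trans a0).
have di0 : 0 <= d^-1 by rewrite invr_ge0 ltW.
have tq0 w : 0 <= d^-1*sqnorm w by rewrite mulr_ge0 ?sqnorm_ge0.
have r2 : 0 <= d^-1*(rho / 2) by rewrite mulr_ge0 // divr_ge0 // ltW.
have tau1 w : sqnorm w <= d -> tau w <= 1.
 by move=> wd;rewrite -pw1;apply: mono => //;rewrite mulrC ler_pdivrMr // mul1r.
have tau_gt1 w : d <= sqnorm w -> 1 <= tau w.
 by move=> wd;rewrite -pw1;apply: mono => //;rewrite mulrC ler_pdivlMr // mul1r.
have E2 : 2 = (d^-1*(rho / 2)) `^ e.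
 have -> : d^-1*(rho / 2) = 2 `^ (e^-1).
  by rewrite /d /c powRN;field;rewrite !gt_eqF ?powR_gt0.
 by rewrite -powRrM mulVf ?gt_eqF // powRr1.
have tau2 w : rho / 2 <= sqnorm w -> 2 <= tau w.
 by move=> wd;rewrite {1}E2;apply: mono => //;rewrite ler_wpM2l.
have tau2' w : sqnorm w <= rho / 2 -> tau w <= 2.
 by move=> wd;rewrite [leRHS]E2;apply: mono => //;rewrite ler_wpM2l.
pose chi w := bump (tau w).
pose s w := w+chi w *: (k w - w).
have s1 w : sqnorm w < d -> s w = k w.
 by move=> wd;rewrite /s /chi bump1 ?scale1r ?tau1 ?ltW // addrC subrK.
have s2 w : rho / 2 < sqnorm w -> s w = w.
 by move=> wd;rewrite /s /chi bump0 ?scale0r ?addr0 // tau2 // ltW.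
exists s => //.
pose U1 := [set w : 'rV[R]_n | sqnorm w < d].
pose U2 := [set w : 'rV[R]_n | rho / 2 < sqnorm w].
pose U3 := [set w : 'rV[R]_n | sqnorm w < rho] `&` [set w | 0 < sqnorm w].
have o1 : open U1 by exact: open_sqnorm_lt.
have o2 : open U2 by exact: open_sqnorm_gt.
have o3 : open U3 by apply: openI;[exact: open_sqnorm_lt|exact: open_sqnorm_gt].
have rd : d < rho.
 rewrite /d gtr_pMl // /c ltr_pdivrMr // mul1r.
 apply: lt_trans (_ : 1 < _);last by lra.
 rewrite powRN invf_lt1 ?powR_gt0 //.
 have {1}-> : 1 = 1 `^ (e^-1) :> R by rewrite powR1.
 by rewrite gt0_ltr_powR ?invr_gt0 ?nnegrE //;lra.
have k3 j : smooth_on U3 (crd k j) by apply: smoothW (sk j) => w [].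
have stau : smooth_on U3 tau.
 apply: (smooth_comp1 o3 (smooth1_powR e)).
  by apply: (smoothZ o3);exact: smooth_sqnorm.
 by move=> w [_ w0];rewrite /= mulr_gt0 // invr_gt0.
have schi : smooth_on U3 chi by exact: smooth_bump.
have scrd j : smooth_on U3 (fun w : 'rV[R]_n => w 0 j) by exact: smooth_on_coord.
have s3E j : (crd s j) = fun y => y 0 j+chi y*(k y 0 j - y 0 j).
 by apply/funext => y;rewrite !mxE.
have s3 j : smooth_on U3 (crd s j).
 rewrite s3E;apply: (smoothD o3) => //;apply: (smoothM o3) => //;exact: (smoothB o3).
have cover w : [\/ U1 w, U2 w | U3 w /\ d <= sqnorm w <= rho / 2].
 have [w1|w1] := ltP (sqnorm w) d;first by constructor 1.
 have [w2|w2] := ltP (rho / 2) (sqnorm w);first by constructor 2.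
 constructor 3;split=> //;split;last exact: lt_le_trans d0 w1.
 by apply: (le_lt_trans w2);lra.
apply: (@monotone_diff0 s (rho / 2)) => // [j|w v v0].
 apply: smooth_on_local => w _;have [w1|w2|[w3 _]] := cover w.
 - exists U1 => //;apply: (smooth_on_eq (f := fun y => k y 0 j) o1) => [y /s1 -> //|].
  by apply: smoothW (sk j) => y yd;exact: lt_trans yd rd.
 - exists U2 => //;apply: (smooth_on_eq (f := fun y => y 0 j) o2) => [y /s2 -> //|].
  exact: smooth_on_coord.
 - by exists U3.
have q0 := sqnorm_gt0 v0.
have [w1|w2|[w3 /andP[wd wr]]] := cover w.
- have -> : Dv s w v = Dv k w v.
  apply/rowP => j;rewrite !mxE;eqsum i;congr (_ * _).
  by apply: (dd_eq_on _ o1) => // y /s1 ->.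
 by apply: lt_le_trans (Hpos _ _ _);[exact: mulr_gt0|exact: lt_trans rd].
- have -> : Dv s w v = v.
  apply/rowP => j;rewrite !mxE (bigD1 j) //= big1 => [|i /negPf ij].
   rewrite (dd_eq_on (g := fun y => y 0 j) _ o2) // => [|y /s2 -> //].
   by rewrite dd_coord eqxx mulr1 addr0.
  rewrite (dd_eq_on (g := fun y => y 0 j) _ o2) // => [|y /s2 -> //].
  by rewrite dd_coord ij mulr0.
 by rewrite dotxx.
have [w3r w30] := w3.
have [b [b0 bK] hb] := bump_is_derive (tau w).
have {}bK : - K <= b by apply: bK;rewrite tau2'.
have bN : 0 <= - b by rewrite oppr_ge0.
have hd : 0 < d^-1*sqnorm w by rewrite mulr_gt0 ?invr_gt0.
pose g := 2*b*e * tau w / sqnorm w.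
have dchi i : dd i chi w = g*w 0 i.
 rewrite (dd_comp1 (p := bump) (f := tau) i (smooth_diff o3 stau w3) hb).
 rewrite (dd_comp1 (p := fun t => t `^ e) (f := fun w => d^-1*sqnorm w) i _
      (is_derive1_powR e hd));last first.
  apply: (smooth_diff o3 _ w3);apply: (smoothZ o3);exact: smooth_sqnorm.
 rewrite (ddZ _ _ (smooth_sqnorm openT)) // dd_sqnorm /g /tau powRB //;last by rewrite (gt_eqF hd) implybT.
 rewrite powRr1 ?ltW //;move: (_ `^ e) => T;field;by rewrite !gt_eqF.
have ds i j : dd i (crd s j) w = (1 - chi w)*(i == j)%:R +
  chi w*dd i (crd k j) w+g*w 0 i*(k w 0 j - w 0 j).
 rewrite s3E (ddD (U := U3)) //;last by apply: (smoothM o3) => //;exact: (smoothB o3).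
 rewrite (ddM (U := U3)) //;last exact: (smoothB o3).
 rewrite (ddB (U := U3)) // dchi dd_coord.
 move: (dd i _ w) (chi w) (k w 0 j) (w 0 j) => a1 a2 a3 a4;ring.
(* A convex combination of the derivatives of the identity and of [k], plus the rank one term
   carrying the gradient of the cutoff. Both ends of the combination are at least [lam], which uses
   [lam <= 1]. *)
have -> : dot (Dv s w v) v = (1 - chi w)*sqnorm v+chi w*dot (Dv k w v) v +
  g*dot w v*dot (k w - w) v.
 rewrite !dot_Dv -dotxx /dot !mulr_sumr -!big_split /=;eqsum j.
 under eq_bigr do rewrite ds (mulrDr _ (_ + _) (_*(_ - _))) (mulrDr _ (_*(_)%:R)).
 rewrite !big_split /=;congr (_ + _ + _).
 - rewrite (bigD1 j) //= eqxx big1 ?addr0 ?mulr1;first by rewrite mulrC.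
  by move=> i /negPf ->;rewrite !mulr0.
 - by distrsum i;rewrite mulrCA.
 - rewrite mulr_suml;eqsum i;rewrite !mxE.
  move: (k w 0 j) => a;ring.
have h1 := Hpos w v w3r.
have x0 := bump_ge0 (tau w);have x1 := bump_le1 (tau w);rewrite -/(chi w) in x0 x1.
have cs : `|dot w v*dot (k w - w) v| <= C*sqnorm w*sqnorm v.
 have r0 : 0 <= C*sqnorm w*sqnorm v by rewrite !mulr_ge0 ?sqnorm_ge0.
 rewrite -(ler_pXn2r (n := 2)) ?nnegrE // -normrX ger0_norm ?sqr_ge0 // exprMn.
 apply: le_trans (ler_pM (sqr_ge0 _) (sqr_ge0 _) (cauchy_schwarz w v) (cauchy_schwarz (k w - w) v)) _.
 have h2 := Hk w w3r;have vv : 0 <= sqnorm w*sqnorm v*sqnorm v by rewrite !mulr_ge0 ?sqnorm_ge0.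
 move: (sqnorm (k w - w)) (sqnorm w) (sqnorm v) h2 vv => A B D h2 vv.
 have := ler_wpM2l vv h2;congr (_ <= _);ring.
have gb : `|g|*(C*sqnorm w) <= lam / 2.
 have t1 := tau_gt1 w wd;have t2 := tau2' w wr.
 have -> : `|g|*(C*sqnorm w) = 2*(- b)*e * tau w*C.
  have gN : - g = 2*(- b)*e * tau w / sqnorm w.
   by rewrite /g;move: (tau w) (sqnorm w) => T q;ring.
  have T0 : 0 <= tau w by rewrite (le_trans _ t1).
  have g0 : 0 <= - g.
   by rewrite gN divr_ge0 ?(ltW w30) // !mulr_ge0 ?(ltW e0).
  rewrite ler0_norm -?oppr_ge0 // gN;move: w30;rewrite /=;move: (tau w) (sqnorm w) => T q q00.
  by field;rewrite gt_eqF.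
 apply: le_trans eC;rewrite ler_wpM2r //.
 have -> : 4*K*e = 2*K*e * 2 by ring.
 apply: ler_pM => //;first by rewrite !mulr_ge0 ?(ltW e0).
  by rewrite (le_trans _ t1).
 rewrite ler_wpM2r ?(ltW e0) // ler_wpM2l //;lra.
have gc : `|g*dot w v*dot (k w - w) v| <= lam / 2*sqnorm v.
 rewrite -mulrA normrM;apply: le_trans (ler_wpM2l (normr_ge0 g) cs) _.
 by rewrite mulrA ler_wpM2r // ltW.
have h3 : chi w*(lam*sqnorm v) <= chi w*dot (Dv k w v) v by rewrite ler_wpM2l.
have h4 : (1 - chi w)*(lam*sqnorm v) <= (1 - chi w)*sqnorm v.
 by rewrite ler_wpM2l ?subr_ge0 // ler_piMl // ltW.
have h5 : 0 < lam*sqnorm v by rewrite mulr_gt0.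
move: gc;rewrite ler_norml => /andP[gc _].
move: (g * _ * _) (dot (Dv _ _ _) _) (chi w) (sqnorm v) gc h3 h4 h5 => p1 p2 p3 p4 *.
nra.
Qed.

End CompactDiffeos.

(** * Extension of germs with positive derivative *)

Section Straighten.
Context {R : realType}.

Section Germs.
Context {n : nat}.
Implicit Types (s k : 'rV[R]_n -> 'rV[R]_n) (x y v w : 'rV[R]_n).

Lemma nbhs_sqnorm w0 (P : set 'rV[R]_n) : nbhs w0 P ->
 exists2 r, 0 < r & forall w, sqnorm (w - w0) < r -> P w.
move=> /nbhs_ballP[e /= e0 He];exists (e ^+ 2);first exact: exprn_gt0.
move=> w wr;apply: He;rewrite -ball_normE /= distrC;apply: row_norm_lt => // i.
rewrite -(ltr_pXn2r (n := 2)) ?nnegrE ?(ltW e0) // -normrX ger0_norm ?sqr_ge0 //.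
exact: le_lt_trans (sqnorm_coord _ i) wr.
Qed.

Lemma dot_sum_bound (a : 'I_n -> 'I_n -> R) v (e : R) : (forall i j, `|a i j| <= e) ->
 `|\sum_j \sum_i v 0 i*v 0 j*a i j| <= n%:R*e*sqnorm v.
move=> Ha;apply: le_trans (ler_norm_sum _ _ _) _.
apply: le_trans (_ : \sum_j \sum_i (v 0 i ^+ 2+v 0 j ^+ 2) / 2*e <= _);last first.
 have -> : \sum_j \sum_i (v 0 i ^+ 2+v 0 j ^+ 2) / 2*e =
   \sum_(j < n) (sqnorm v*e / 2) + \sum_j (n%:R*v 0 j ^+ 2*e / 2).
  rewrite -big_split /=;eqsum j.
  have -> : n%:R*v 0 j ^+ 2*e / 2 = \sum_(i < n) v 0 j ^+ 2*e / 2.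
   by rewrite sumr_const card_ord -mulr_natl;ring.
  rewrite !mulr_suml -big_split /=;eqsum i;ring.
 have -> : \sum_j (n%:R*v 0 j ^+ 2*e / 2) = n%:R*e / 2*sqnorm v.
  by distrsum j;ring.
 rewrite sumr_const card_ord -mulr_natl le_eqVlt;apply/orP;left;apply/eqP.
 by move: (sqnorm v) => q;field.
apply: ler_sum => j _;apply: le_trans (ler_norm_sum _ _ _) _.
apply: ler_sum => i _;rewrite normrM;apply: ler_pM => //.
rewrite ler_norml;apply/andP;split.
 have := sqr_ge0 (v 0 i+v 0 j);nra.
have := sqr_ge0 (v 0 i - v 0 j);nra.
Qed.

(** By continuity the derivative stays positive, with half the constant, on a small ball; the linear
    growth required by [slow_cutoff] follows from the mean value bound. *)
Lemma germ_diff0 k (U : set 'rV[R]_n) (lam : R) : open U -> U 0 -> (smooth_row U k) ->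
 k 0 = 0 -> 0 < lam -> (forall v, lam*sqnorm v <= dot (Dv k 0 v) v) ->
 exists2 s, diff0 s & exists2 r, 0 < r & forall w, sqnorm w < r -> s w = k w.
move=> oU U0 sk k0 lam0 Hlam.
pose e : R := lam / (2*(n%:R + 1)).
have n1 : 0 < n%:R + 1 :> R by rewrite ltr_wpDl.
have e0 : 0 < e by rewrite divr_gt0 // mulr_gt0.
have near_ij : forall i j, \forall w \near (0 : 'rV[R]_n),
  `|dd i (crd k j) w - dd i (crd k j) 0| < e.
 by move=> i j;apply: filterS (smooth_near_lt (smooth_dd i (sk j)) U0 e0) => w;rewrite distrC.
have : \forall w \near (0 : 'rV[R]_n), U w /\ forall i j,
  `|dd i (crd k j) w - dd i (crd k j) 0| < e.
 apply: filterI;first exact: open_nbhs_nbhs.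
 have near_i i := filter_forall (nbhs_filter (0 : 'rV[R]_n)) (near_ij i).
 exact: (filter_forall (nbhs_filter (0 : 'rV[R]_n)) near_i).
move=> /nbhs_sqnorm[rho rho0 Hrho].
have {}Hrho w : sqnorm w < rho -> U w /\ forall i j,
  `|dd i (crd k j) w - dd i (crd k j) 0| < e.
 by move=> wr;apply: Hrho;rewrite subr0.
pose B := [set w : 'rV[R]_n | sqnorm w < rho].
have oB : open B by exact: open_sqnorm_lt.
have sB j : smooth_on B (crd k j) by apply: smoothW (sk j) => w /Hrho[].
pose c := \sum_i \sum_j `|dd i (crd k j) 0| + e.
have c_ge i j : `|dd i (crd k j) 0| <= c - e.
 rewrite /c addrK (bigD1 i) //= (bigD1 j) //= -addrA lerDl addr_ge0 ?sumr_ge0 //.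
 by move=> i' _;rewrite sumr_ge0.
have c0 : 0 <= c.
 by rewrite addr_ge0 ?(ltW e0) // sumr_ge0 // => i _;rewrite sumr_ge0.
have Hc j z i : B z -> `|dd i (crd k j) z| <= c.
 move=> /Hrho[_ /(_ i j) h1];have h2 := c_ge i j.
 rewrite -[dd i _ z](subrK (dd i (crd k j) 0)).
 by apply: le_trans (ler_normD _ _) _;rewrite -[c](subrK e) addrC lerD // ltW.
(* Since [C0 >= 1], a bound by [C0] gives the bound by its square that [slow_cutoff] expects,
   without extracting a root. *)
pose C0 := 2*n%:R*(n%:R*c) ^+ 2 + 2.
have C00 : 1 <= C0.
 by rewrite /C0 -[leLHS]add0r lerD //;[rewrite !mulr_ge0 // sqr_ge0|lra].
have kw w : sqnorm w < rho -> sqnorm (k w - w) <= C0 ^+ 2*sqnorm w.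
 move=> wr;have q0 := sqnorm_ge0 w.
 have kj j : k w 0 j ^+ 2 <= (n%:R*c) ^+ 2*sqnorm w.
  have H := @mean_value_bound _ _ B (crd k j) w 0 c oB (sB j).
  have {}H : `|k w 0 j| <= n%:R*c * `|w|.
   have := H;rewrite k0 mxE !subr0;apply=> [t /andP[t0 t1]|z i];last exact: Hc.
   rewrite add0r /B /= sqnormZ;apply: le_lt_trans wr.
   by rewrite ler_piMl // expr_le1.
  rewrite -[leLHS]ger0_norm ?sqr_ge0 // normrX.
  apply: le_trans (_ : (n%:R*c * `|w|) ^+ 2 <= _).
   by rewrite ler_pXn2r ?nnegrE // !mulr_ge0.
  rewrite exprMn ler_wpM2l ?sqr_ge0 //.
  rewrite -[leRHS](sqr_sqrtr q0) ler_pXn2r ?nnegrE ?sqrtr_ge0 //.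
  by apply: row_norm_sqnorm;rewrite ?sqrtr_ge0 // sqr_sqrtr.
 apply: le_trans (_ : C0*sqnorm w <= _);last first.
  by rewrite ler_wpM2r // expr2 ler_peMl // (le_trans _ C00).
 apply: le_trans (_ : \sum_(j < n) (2*((n%:R*c) ^+ 2*sqnorm w) + 2*w 0 j ^+ 2) <= _).
  apply: ler_sum => j _;rewrite !mxE;have := kj j;have := sqr_ge0 (k w 0 j+w 0 j).
  move: (k w 0 j) (w 0 j) ((n%:R*c) ^+ 2*sqnorm w) => p q r;nra.
 rewrite big_split /= sumr_const card_ord -mulr_sumr -/(sqnorm w) /C0 -mulr_natl.
 rewrite le_eqVlt;apply/orP;left;apply/eqP.
 move: (n%:R*c) (sqnorm w) => p q;ring.
have Hpos w v : sqnorm w < rho -> Num.min (lam / 2) 1*sqnorm v <= dot (Dv k w v) v.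
 move=> /Hrho[_ Hw];have q0 := sqnorm_ge0 v.
 apply: le_trans (_ : lam / 2*sqnorm v <= _);first by rewrite ler_wpM2r // ge_min lexx.
 have := Hlam v;rewrite !dot_Dv => h.
 have := @dot_sum_bound (fun i j => dd i (crd k j) w - dd i (crd k j) 0) v e
  (fun i j => ltW (Hw i j)).
 have -> : \sum_j \sum_i v 0 i*v 0 j *
   (dd i (crd k j) w - dd i (crd k j) 0) =
  \sum_j \sum_i v 0 i*v 0 j*dd i (crd k j) w -
  \sum_j \sum_i v 0 i*v 0 j*dd i (crd k j) 0.
  by rewrite -sumrB;eqsum j;rewrite -sumrB;eqsum i;rewrite mulrBr.
 have ne : n%:R*e <= lam / 2.
  have -> : n%:R*e = (lam / 2)*(n%:R / (n%:R + 1)) by rewrite /e;field;rewrite gt_eqF.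
  by rewrite ler_piMr ?divr_ge0 ?(ltW lam0) // ler_pdivrMr // mul1r lerDl.
 have ne' := ler_wpM2r q0 ne;rewrite ler_norml => /andP[h1 _].
 move: h h1 ne';move: (\sum_j _) (\sum_j _) (sqnorm v) (n%:R*e) => a b q m;lra.
have lam' : 0 < Num.min (lam / 2) 1 by rewrite lt_min ltr01 andbT divr_gt0.
have [||cc cc0 Hcc] := @slow_cutoff R n (Num.min (lam / 2) 1) C0 lam'.
- by rewrite ge_min lexx orbT.
- by apply: le_trans C00;exact: ler01.
have [s ds sE] := Hcc k rho rho0 sB Hpos kw.
by exists s => //;exists (cc*rho) => //;exact: mulr_gt0.
Qed.

(** The radius [r] is arbitrary because the ratio given by [slow_cutoff] does not depend on
    [rho]. *)
Lemma dilation_diff0 (c r : R) : 0 < c -> c <= 1 -> 0 < r ->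
 exists2 s, diff0 s & forall w, sqnorm w < r -> s w = c *: w.
move=> c0 c1 r0.
have [e e0 He] := @slow_cutoff R n c 1 c0 c1 ler01.
have sc j : smooth_on [set w : 'rV[R]_n | sqnorm w < r / e] (fun y => (c *: y) 0 j).
 have -> : (fun y : 'rV[R]_n => (c *: y) 0 j) = fun y => c*y 0 j.
  by apply/funext => y;rewrite mxE.
 have o : open [set w : 'rV[R]_n | sqnorm w < r / e] by exact: open_sqnorm_lt.
 exact: (smoothZ o c (smooth_on_coord _ j)).
have [|||s ds sE] := He (fun y => c *: y) (r / e) _ sc.
- by rewrite divr_gt0.
- move=> w v _;have -> : Dv (fun y => c *: y) w v = c *: v.
  apply/rowP => j;rewrite !mxE.
  have E i : dd i (fun y : 'rV[R]_n => (c *: y) 0 j) w = c*(i == j)%:R.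
   rewrite -(dd_coord _ _ w) -(ddZ (U := setT) c i (smooth_on_coord _ j)) //;congr (dd i _ w).
   by apply/funext => y;rewrite mxE.
  rewrite (bigD1 j) //= big1 => [|i /negPf ij];rewrite E ?ij ?mulr0 //.
  by rewrite eqxx mulr1 addr0 mulrC.
 by rewrite dotZl dotxx.
- move=> w _;have -> : c *: w - w = (c - 1) *: w by rewrite scalerBl scale1r.
 by rewrite sqnormZ expr1n ler_wpM2r ?sqnorm_ge0 // -[leLHS]sqrrN opprB expr_le1 ?subr_ge0 // lerBlDr lerDl ltW.
by exists s => // w wr;apply: sE;rewrite mulrC divfK // gt_eqF.
Qed.

Lemma diff0_shift s a : diff0 s -> diff0 (fun w => s (w+a) - a).
move=> [ss es is_ [r Hr]].
have sadd b j : smooth_on setT (fun w : 'rV[R]_n => (w+b) 0 j).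
 rewrite (_ : (fun _ => _) = fun w : 'rV[R]_n => w 0 j+b 0 j);last by apply/funext => w;rewrite mxE.
 by apply: (smoothD openT);[exact: smooth_on_coord|exact: smooth_cst].
have eadd b w : etale (fun w : 'rV[R]_n => w+b) w.
 exact: (etale_left_inverse openT openT I I (sadd b) (sadd (- b)) (fun w _ => addrK b w)).
have s1 j : smooth_on setT (fun w => s (w+a) 0 j).
 exact: (smooth_compT (s := fun w => w+a) (f := fun y => s y 0 j) (sadd a) (ss j)).
split=> [j|w|x y /addIr/is_/addIr //|].
- exact: (smooth_compT (s := fun w => s (w+a)) (f := fun y => (y - a) 0 j) s1 (sadd (- a) j)).
- apply: (etale_compT (s := fun w => s (w+a)) (k := fun y => y - a)) => //.
 exact: (etale_compT (s := fun w => w+a)).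
exists (2*r + 2*sqnorm a) => x xr;rewrite Hr ?addrK //.
have : sqnorm x <= 2*sqnorm (x+a) + 2*sqnorm a.
 rewrite !mulr_sumr -big_split;apply: ler_sum => i _;rewrite mxE /=.
 by have := sqr_ge0 (x 0 i + 2*a 0 i);move: (x 0 i) (a 0 i) => p q;nra.
lra.
Qed.

End Germs.

End Straighten.

(** * Polar decomposition by a variational argument *)

Section PositiveRotation.
Context {R : realType} {n : nat}.
Implicit Types (B Q : 'M[R]_n) (u v x : 'rV[R]_n).

Local Notation form C v := (dot (v *m C) v).

Let mul_tr_dot u v : u *m v^T = (dot u v)%:M.
by rewrite [LHS]mx11_scalar mxE;congr (_%:M);eqsum i;rewrite [v^T _ _]mxE. Qed.

Lemma form_trace C v : \tr (C *m (v^T *m v)) = form C v.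
by rewrite mulmxA mxtrace_mulC mulmxA mul_tr_dot mxtrace_scalar.
Qed.

Lemma dot_mulmx_tr u v C : dot (u *m C) v = dot u (v *m C^T).
rewrite /dot;under eq_bigr do rewrite mxE mulr_suml.
swapsum i;rewrite mxE mulr_sumr;eqsum j.
by rewrite mxE;ring.
Qed.

Lemma nonneg_quadratic (a b : R) : (forall e, 0 <= a*e+b*e ^+ 2) -> a = 0.
move=> h;have b0 : 0 <= b by have := h 1;have := h (-1);lra.
have b1 : 0 < b + 1 by lra.
have := h (- a / (b + 1)).
have -> : a*(- a / (b + 1))+b*(- a / (b + 1)) ^+ 2 = - (a ^+ 2 / (b + 1) ^+ 2).
 by field;rewrite gt_eqF.
rewrite oppr_ge0 => h1;apply/eqP;rewrite -sqrf_eq0 eq_le sqr_ge0 andbT.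
by move: h1;rewrite pmulr_lle0 // invr_gt0 exprn_gt0.
Qed.

Definition reflection v : 'M[R]_n := 1%:M - (2 / sqnorm v) *: (v^T *m v).

Lemma reflection_orth v : v <> 0 -> reflection v *m (reflection v)^T = 1%:M.
move=> v0;have q0 : sqnorm v != 0 by rewrite gt_eqF // sqnorm_gt0.
have tE : (reflection v)^T = reflection v.
 by rewrite /reflection linearB linearZ /= trmx1 trmx_mul trmxK.
rewrite tE /reflection mulmxBl mul1mx mulmxBr mulmx1 -!scalemxAl -!scalemxAr.
rewrite -!mulmxA (mulmxA v) mul_tr_dot dotxx mul_scalar_mx -scalemxAr.
by apply/matrixP => i j;rewrite !mxE;move: (\sum__ _) => z;field.
Qed.

Let O := [set q : 'rV[R]_(n*n) | vec_mx q *m (vec_mx q)^T = 1%:M].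

Let coordE (q : 'rV[R]_(n*n)) i j : (vec_mx q : 'M[R]_n) i j = q 0 (mxvec_index i j).
by rewrite mxE. Qed.

Let grE (q : 'rV[R]_(n*n)) i j : (vec_mx q *m (vec_mx q)^T : 'M[R]_n) i j =
 \sum_l q 0 (mxvec_index i l)*q 0 (mxvec_index j l).
by rewrite mxE;eqsum l;rewrite [_^T _ _]mxE !coordE. Qed.

Let compactO : compact O.
pose F (q : 'rV[R]_(n*n)) : R := \sum_i \sum_j
 (\sum_l q 0 (mxvec_index i l)*q 0 (mxvec_index j l) + - (i == j)%:R) *
 (\sum_l q 0 (mxvec_index i l)*q 0 (mxvec_index j l) + - (i == j)%:R).
have sF : smooth_on setT F.
 have s1 i j : smooth_on setT (fun q : 'rV[R]_(n*n) =>
   \sum_l q 0 (mxvec_index i l)*q 0 (mxvec_index j l) + - (i == j)%:R).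
  apply: (smoothD openT);last exact: smooth_cst.
  by apply: (smooth_sum openT) => l;apply: (smoothM openT);exact: smooth_on_coord.
 by apply: (smooth_sum openT) => i;apply: (smooth_sum openT) => j;exact: (smoothM openT).
have OF : O = F @^-1` [set x | x = 0].
 apply/seteqP;split=> q /= Hq.
  rewrite /F big1 // => i _;rewrite big1 // => j _.
  have := congr1 (fun A : 'M[R]_n => A i j) Hq;rewrite /= grE mxE => ->.
  by rewrite subrr mul0r.
 apply/matrixP => i j;rewrite grE mxE.
 move/eqP: Hq;rewrite psumr_eq0 => [|i' _];last by rewrite sumr_ge0 // => j' _;rewrite -expr2 sqr_ge0.
 move=> /allP/(_ i);rewrite mem_index_enum => /(_ isT).
 rewrite psumr_eq0 => [|j' _];last by rewrite -expr2 sqr_ge0.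
 move=> /allP/(_ j);rewrite mem_index_enum => /(_ isT);rewrite mulf_eq0 orbb subr_eq0 => /eqP.
 by move=> ->.
apply: subclosed_compact (@compact_sqnorm_le R _ n%:R) _.
 rewrite OF;apply: closed_comp;last exact: closed_eq.
 by move=> q _;exact: (smooth_cts sF (I : setT q)).
move=> q /= Hq.
have -> : sqnorm q = \sum_i (vec_mx q *m (vec_mx q)^T : 'M[R]_n) i i.
 under eq_bigr do rewrite grE;rewrite pair_bigA /sqnorm (reindex _ (curry_mxvec_bij n n)).
 by apply: eq_bigr => -[i j] _;rewrite expr2.
rewrite Hq;under eq_bigr do rewrite mxE eqxx.
by rewrite sumr_const card_ord.
Qed.

(* A maximizer of [tr (B Q)] over the orthogonal group; reflecting it in [v]
 cannot increase the trace. *)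
Lemma positive_rotation B : (0 < n)%N -> B \in unitmx -> exists Q lam, [/\ Q *m Q^T = 1%:M, 0 < lam &
 forall v, lam*sqnorm v <= form (B *m Q) v].
move=> n0 uB;pose g (q : 'rV[R]_(n*n)) : R := \sum_i \sum_j B i j*q 0 (mxvec_index j i).
have gE q : g q = \tr (B *m vec_mx q).
 by eqsum i;rewrite mxE;eqsum j;rewrite mxE.
have sg : smooth_on setT g.
 apply: (smooth_sum openT) => i;apply: (smooth_sum openT) => j.
 by apply: (smoothZ openT);exact: smooth_on_coord.
have O0 : O !=set0 by exists (mxvec 1%:M);rewrite /O /= mxvecK trmx1 mulmx1.
have cg : {within O, continuous g}.
 by apply: continuous_subspaceT => q;exact: (smooth_cts sg (I : setT q)).
have [q Oq qmax] := compact_EVT_max O0 compactO cg.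
pose Q : 'M[R]_n := vec_mx q;have QQ : Q *m Q^T = 1%:M by move: Oq;rewrite inE.
have trH C v : \tr (C *m reflection v) = \tr C - 2 / sqnorm v*form C v.
 by rewrite /reflection mulmxBr mulmx1 -scalemxAr linearB linearZ /= form_trace.
have PH (P : 'M[R]_n) v : P *m P^T = 1%:M -> v <> 0 -> (P *m reflection v) *m (P *m reflection v)^T = 1%:M.
 by move=> PP v0;rewrite trmx_mul mulmxA -(mulmxA P) reflection_orth // mulmx1.
have max P : P *m P^T = 1%:M -> \tr (B *m P) <= \tr (B *m Q).
 by move=> PP;have := qmax (mxvec P);rewrite !gE mxvecK;apply;rewrite inE /O /= mxvecK.
have psd P : P *m P^T = 1%:M -> \tr (B *m P) = \tr (B *m Q) -> forall v, 0 <= form (B *m P) v.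
 move=> PP PE v;have [->|v0] := pselect (v = 0);first by rewrite mul0mx dot0l.
 have q0 := sqnorm_gt0 v0.
 have := max _ (PH P v PP v0);rewrite mulmxA trH PE gerBl => h;rewrite -(pmulr_rge0 _ (x := 2 / sqnorm v)) //.
 by rewrite divr_gt0.
set C := B *m Q;have psdC := psd Q QQ erefl.
have uC : C \in unitmx by rewrite unitmx_mul uB;case/mulmx1_unit: QQ.
have dotDr' x y z : dot x (y+z) = dot x y+dot x z by rewrite !(dotC x) dotDl.
have dotZr' (a : R) x y : dot x (a *: y) = a*dot x y by rewrite !(dotC x) dotZl.
(* If the form vanished at [v], the reflected rotation would also be a maximizer, so its form would
   be nonnegative too ([psdH]). Its first variation at [v] in the direction [u] is [- 2 * sqnorm u],
   which forces [u = 0] and contradicts the invertibility of [C]. *)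
have pos v : v <> 0 -> 0 < form C v.
 move=> v0;have q0 := sqnorm_gt0 v0;rewrite lt_neqAle psdC andbT eq_sym;apply/eqP => fv.
 pose u := v *m C^T;have uE x : dot (x *m C) v = dot x u by exact: dot_mulmx_tr.
 have vu : dot v u = 0 by rewrite -uE.
 have psdH x : 0 <= form C x - 2 / sqnorm v*dot x u*dot v x.
  have := psd _ (PH Q v QQ v0) _ x;rewrite !mulmxA trH -/C fv mulr0 subr0 => /(_ erefl).
  rewrite /reflection mulmxBr mulmx1 -scalemxAr mulmxA dotBl dotZl ?mulmxA.
  have -> : x *m B *m Q *m v^T *m v = dot x u *: v.
   have -> : x *m B *m Q *m v^T = (dot x u)%:M by rewrite -uE /C mulmxA mul_tr_dot.
   by rewrite mul_scalar_mx.
  by rewrite dotZl mulrA.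
 have fE (e : R) : form C (v+e *: u) = (dot (v *m C) u+dot (u *m C) v)*e+form C u*e ^+ 2.
  by rewrite mulmxDl -scalemxAl dotDl !dotDr' !dotZl !dotZr' fv;ring.
 have b0 : dot (v *m C) u+dot (u *m C) v = 0.
  by apply: (@nonneg_quadratic _ (form C u)) => e;rewrite -fE.
 have : - 2*sqnorm u = 0.
  apply: (@nonneg_quadratic _ (form C u)) => e;have := psdH (v+e *: u);rewrite fE b0.
  rewrite dotDl dotDr' dotZl dotZr' vu !dotxx;move: (form C u) (sqnorm u) (sqnorm v) q0 => a b c c0.
  by have -> : 0*e+a*e ^+ 2 - 2 / c*(0+e*b)*(c+e * 0) = -2*b*e+a*e ^+ 2 by [field;rewrite gt_eqF].
 move/eqP;rewrite mulf_eq0 oppr_eq0 pnatr_eq0 /= => /eqP/sqnorm_eq0 u0.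
 by apply: v0;apply: (can_inj (mulmxK (_ : C^T \in unitmx)));rewrite ?unitmx_tr // -/u u0 mul0mx.
(* The constant [lam] is the minimum of the form on this compact sphere, nonempty because [n] is
   positive. *)
pose S := [set v : 'rV[R]_n | sqnorm v = 1].
have cS : compact S.
 apply: subclosed_compact (@compact_sqnorm_le R n 1) _ => [|v /= -> //].
 rewrite (_ : S = sqnorm @^-1` [set x | x = 1]) //;apply: closed_comp;last exact: closed_eq.
 by move=> v _;exact: (smooth_cts (smooth_sqnorm openT) (I : setT v)).
have S0 : S !=set0.
 exists (delta_mx 0 (Ordinal n0));rewrite /S /= /sqnorm (bigD1 (Ordinal n0)) //= mxE !eqxx expr1n big1 ?addr0 // => i /negPf h.
 by rewrite mxE h andbF expr0n.
have sf : smooth_on setT (fun v : 'rV[R]_n => form C v).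
 by apply: (smooth_sum openT) => i;apply: (smoothM openT);[exact: smooth_linear|exact: smooth_on_coord].
have cf : {within S, continuous (fun v : 'rV[R]_n => form C v)}.
 by apply: continuous_subspaceT => v;exact: (smooth_cts sf (I : setT v)).
have [v1 Sv1 vmin] := compact_EVT_min S0 cS cf.
have v1n : v1 <> 0 by move=> h;move: Sv1;rewrite inE /S /= h sqnorm0 => /esym/eqP;rewrite oner_eq0.
exists Q, (form C v1);split=> [//||v];first exact: pos.
have [->|v0] := pselect (v = 0);first by rewrite sqnorm0 mulr0 mul0mx dot0l.
have q0 := sqnorm_gt0 v0;pose a := (Num.sqrt (sqnorm v))^-1.
have a2 : a ^+ 2 = (sqnorm v)^-1 by rewrite exprVn sqr_sqrtr // ltW.
have := vmin (a *: v);rewrite inE /S /= sqnormZ a2 mulVf ?gt_eqF // => /(_ erefl).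
rewrite -scalemxAl dotZl dotZr' mulrA -expr2 a2 mulrC => h.
by rewrite -ler_pdivlMr.
Qed.

End PositiveRotation.

(** * Straightening an arbitrary germ and transplanting it to a manifold *)

Section StraightenGerm.
Context {R : realType}.

(** The rotation [Q] absorbs the orthogonal part of the derivative, including a reversal of
    orientation; what is left has positive derivative. The base point is first carried to 0 by a
    cut-off dilation of ratio 1/2 centred at [- w0], and [germ_diff0] is applied there. *)
Lemma straighten n (k : 'rV[R]_n -> 'rV[R]_n) (U : set 'rV[R]_n) w0 : (0 < n)%N -> open U -> U w0 ->
 (smooth_row U k) -> etale k w0 -> k w0 = 0 ->
 exists s (Q : 'M[R]_n) r, [/\ diff0 s, Q *m Q^T = 1%:M, 0 < r, s w0 = 0 &
  forall w, sqnorm (w - w0) < r -> s w = k w *m Q].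
move=> n0 oU Uw0 sk ek kw0.
pose B : 'M[R]_n := \matrix_(i, j) dd i (crd k j) w0.
have uB : B \in unitmx.
 apply: inj_unitmx => v Hv;apply: ek => j;move/rowP: Hv => /(_ j);rewrite !mxE => E.
 by rewrite -[RHS]E;eqsum i;rewrite mxE.
have [Q [lam [QQ lam0 Hlam]]] := positive_rotation n0 uB.
have q0 := sqnorm_ge0 w0.
have h0 : 0 < 2^-1 :> R by lra.
have h1 : 2^-1 <= 1 :> R by lra.
(* The dilation must be exact on the points [w + w0] with [w] at squared distance less than 1 from
   [w0], whose squared norm is at most twice that distance plus [8 * sqnorm w0]. *)
have r0 : 0 < 8*sqnorm w0 + 2 by lra.
have [d dd0 dE] := @dilation_diff0 R n _ _ h0 h1 r0.
have dE' w : sqnorm (w - w0) < 1 -> d (w+w0) - w0 = 2^-1 *: (w - w0).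
 move=> w1;rewrite dE;first by apply/rowP => i;rewrite !mxE;field.
 have : sqnorm (w+w0) <= 2*sqnorm (w - w0) + 8*sqnorm w0;last by lra.
 rewrite !mulr_sumr -big_split;apply: ler_sum => i _;rewrite !mxE /=.
 by have := sqr_ge0 (w 0 i - 3*w0 0 i);move: (w 0 i) (w0 0 i) => p q;nra.
(* The inverse of the half-dilation [dE'], so that composing with it turns the germ at [w0] into a
   germ at 0. *)
pose h u := w0 + 2 *: u;pose U1 : set 'rV[R]_n := h @^-1` U.
have hE j : (crd h j) = fun u => w0 0 j + 2*u 0 j by apply/funext => u;rewrite !mxE.
have s2 j : smooth_on setT (fun u : 'rV[R]_n => 2*u 0 j) by apply: (smoothZ openT);exact: smooth_on_coord.
have sh j : smooth_on setT (crd h j).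
 by rewrite hE;apply: (smoothD openT);[exact: smooth_cst|exact: s2].
have oU1 : open U1.
 have ch x : setT x -> {for x, continuous h} by move=> _;exact: (smooth_row_cts openT).
 by have := open_preimage_on openT oU ch;rewrite setTI.
have sh1 j : smooth_on U1 (crd h j) by apply: smoothW (sh j).
pose k1 y := k y *m Q.
have k1E j : (crd k1 j) = fun y => \sum_p Q p j*k y 0 p.
 by apply/funext => y;rewrite mxE;eqsum p;rewrite mulrC.
have sZ j p : smooth_on U (fun y => Q p j*k y 0 p) by exact: smoothZ.
have sk1 j : smooth_on U (crd k1 j) by rewrite k1E;exact: smooth_sum.
have sk2 j : smooth_on U1 (fun u => k1 (h u) 0 j) by exact: (smooth_comp oU1 oU sh1 (fun _ h => h) (sk1 j)).
have U10 : U1 0 by rewrite /U1 /= /h scaler0 addr0.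
have Uh : U (h 0) by exact: U10.
have h00 : h 0 = w0 by rewrite /h scaler0 addr0.
have k20 : k1 (h 0) = 0 by rewrite h00 /k1 kw0 mul0mx.
have dk i j : dd i (fun u => k1 (h u) 0 j) 0 = 2*(B *m Q) i j.
 rewrite (dd_row_comp i j oU1 oU U10 Uh sh1 sk1) (bigD1 i) //= big1 => [|p /negPf ip];last first.
  rewrite hE (ddD (U := setT)) //;last exact: smooth_cst.
  by rewrite dd_cst add0r (ddZ (U := setT)) ?dd_coord 1?eq_sym ?ip ?mulr0 //;exact: smooth_on_coord.
 rewrite hE (ddD (U := setT)) //;last exact: smooth_cst.
 rewrite dd_cst add0r (ddZ (U := setT)) ?dd_coord ?eqxx //;last exact: smooth_on_coord.
 rewrite mulr1 addr0 mulrC h00;congr (2 * _);rewrite k1E (dd_sum (U := U)) // mxE.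
 by eqsum p;rewrite (ddZ (U := U)) // mxE mulrC.
have lam2 : 0 < 2 * lam by lra.
have pos v : 2 * lam*sqnorm v <= dot (Dv (fun u => k1 (h u)) 0 v) v.
 have := Hlam v;rewrite -mulrA => H.
 have -> : dot (Dv (fun u => k1 (h u)) 0 v) v = 2*dot (v *m (B *m Q)) v;last by lra.
 rewrite /dot mulr_sumr;eqsum j;rewrite mulrA;congr (_ * _).
 by rewrite [LHS]mxE [X in 2*X]mxE mulr_sumr;eqsum i;rewrite dk mulrCA.
have [s ds [r rp sE]] := germ_diff0 oU1 U10 sk2 k20 lam2 pos.
have E w : sqnorm (w - w0) < Num.min 1 r -> s (d (w+w0) - w0) = k w *m Q.
 rewrite lt_min => /andP[w1 w2];rewrite dE' // sE.
  by rewrite /k1 /h scalerA divff ?pnatr_eq0 // scale1r addrC subrK.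
 rewrite sqnormZ;apply: le_lt_trans w2;rewrite ler_piMl ?sqnorm_ge0 //.
 by rewrite expr_le1 //;lra.
exists (fun w => s (d (w+w0) - w0)), Q, (Num.min 1 r);split=> //.
- exact: (diff0_comp (diff0_shift w0 dd0) ds).
- by rewrite lt_min ltr01.
- by rewrite E ?kw0 ?mul0mx // subrr sqnorm0 lt_min ltr01.
Qed.

Section Modification.
Context {n : nat} (M : manifold R n) (iota : euclidean R n -> M).
Hypothesis emb : open_embedding setT iota.

Lemma embedding_inj : injective iota.
by move=> x y xy;have [_ _ _ [g _ gK]] := emb;rewrite -(gK x I) -(gK y I) xy. Qed.

Lemma embedding_local_diffeo x : ldiffeo iota x.
have [oT oi si [g sg gK]] := emb.
apply: (local_diffeo_left_inverse oT oi I _ si sg gK);by exists x.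
Qed.

Lemma inverse_local_diffeo (g : M -> euclidean R n) p : smooth_map (iota @` setT) g ->
 (forall x, g (iota x) = x) -> (iota @` setT) p -> ldiffeo g p.
move=> sg gK ip;have [oT oi si _] := emb.
apply: (local_diffeo_left_inverse oi oT ip I sg si) => _ [x _ <-];by rewrite gK.
Qed.

(** Conjugates [s] by [iota] and extends by the identity. Smoothness outside the image of [iota]
    holds because the image of a closed ball is compact, hence closed in the Hausdorff space [M]. *)
Lemma modification s : diff0 s -> exists Phi : M -> M,
 [/\ forall x, Phi (iota x) = iota (s x), forall p, ldiffeo Phi p &
   forall p y, Phi p = iota y -> exists2 x, p = iota x & s x = y].
move=> [ss es is_ [r sr]];have [oT oi si [g sg gK]] := emb.
pose Phi p := if `[< (iota @` setT) p >] then iota (s (g p)) else p.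
have PhiE x : Phi (iota x) = iota (s x).
 by rewrite /Phi asboolT;[rewrite gK|exists x].
have PhiN p : ~ (iota @` setT) p -> Phi p = p by move=> ip;rewrite /Phi asboolF.
exists Phi;split=> // [p|p y].
- have [ip|ip] := pselect ((iota @` setT) p).
  apply: (local_diffeo_near (f := fun q => iota (s (g q))) oi ip).
   by move=> _ [x _ <-];rewrite PhiE gK.
  apply: (local_diffeo_comp (N := euclidean R n) (f := fun q => s (g q)) (g := iota));last exact: embedding_local_diffeo.
  apply: (local_diffeo_comp (N := euclidean R n) (P := euclidean R n) (f := g) (g := s)).
   by apply: inverse_local_diffeo => // x;exact: gK.
  exact: (local_diffeo_euclidean openT).
 pose K := iota @` [set x : 'rV[R]_n | sqnorm x <= r].
 have cK : compact K.
  apply: continuous_compact;last exact: compact_sqnorm_le.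
  by apply: continuous_subspaceT => x;have [ci _] := si;apply: ci;rewrite inE.
 have oK : open (~` K) by apply: closed_openC;exact: compact_closed (@manifold_hausdorff _ _ M) cK.
 apply: (local_diffeo_near (f := fun q => q) oK);last exact: local_diffeo_id.
  by move=> [x _ xp];apply: ip;exists x.
 move=> q qK;have [[x _ xq]|/PhiN//] := pselect ((iota @` setT) q).
 rewrite -xq PhiE sr // ltNge;apply/negP => xr;apply: qK;by exists x.
- have [[x _ <-]|ip] := pselect ((iota @` setT) p).
  by rewrite PhiE => /embedding_inj sxy;exists x.
 by rewrite PhiN // => py;case: ip;exists y.
Qed.

End Modification.
End StraightenGerm.

(** * Algebra of 4-forms and Gram tensors on bivectors *)

Section BivectorPairing.
Context {R : realType} {I : finType}.
Implicit Types (A f g : I -> I -> R).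

Definition antisym A := forall i j, A j i = - A i j.

(** For symmetric arguments, the contribution of a product of two quadratic forms to the Gauss
    equation. The same contraction appears in the cross terms of [wedge], which is what lets the
    4-form cancel parts of the curvature. *)
Definition pairing A f g : R := \sum_i \sum_j \sum_k \sum_l A i j*A k l*(f i k * g j l).

Definition inner A f : R := \sum_i \sum_j A i j*f i j.

(** Exterior product of two 2-forms, written over the six shuffles. *)
Definition wedge f g : @tens4 R I := fun i j k l =>
 f i j * g k l+f k l * g i j - f i k * g j l - f j l * g i k+f i l * g j k+f j k * g i l.

Lemma wedge_alternating f g : antisym f -> antisym g -> altern (wedge f g).
move=> af ag i j k l;rewrite /wedge;split.
- rewrite (af i j) (ag i j);ring.
- rewrite (af j k) (ag j k);ring.
- rewrite (af k l) (ag k l);ring.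
Qed.

Lemma bform_product A f g : bform (fun i j k l => f i j * g k l) A = inner A f * inner A g.
rewrite /bform /inner mulr_suml;eqsum i;rewrite mulr_suml;eqsum j.
distrsum k;distrsum l;ring.
Qed.

Lemma bform_cross A f g : antisym A -> bform (fun i j k l => f i l * g j k) A = - pairing A f g.
move=> aA;rewrite /bform /pairing -sumrN;eqsum i.
rewrite -sumrN;eqsum j;rewrite exchange_big -sumrN;eqsum k => /=.
by rewrite -sumrN;eqsum l;rewrite (aA k l);ring.
Qed.

Lemma bformZ A (c : R) (q : tens4 I) : bform (fun i j k l => c*q i j k l) A = c*bform q A.
rewrite /bform mulr_sumr;eqsum i;distrsum j.
distrsum k;distrsum l;ring.
Qed.

Lemma bform_sum A (J : finType) (q : J -> tens4 I) :
 bform (fun i j k l => \sum_m q m i j k l) A = \sum_m bform (q m) A.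
rewrite /bform [RHS]exchange_big;eqsum i => /=.
rewrite [RHS]exchange_big;eqsum j => /=.
rewrite [RHS]exchange_big;eqsum k => /=.
by rewrite [RHS]exchange_big;eqsum l => /=;rewrite mulr_sumr.
Qed.

Lemma pairing_swap A f g : antisym A -> pairing A g f = pairing A f g.
move=> aA;rewrite /pairing exchange_big;eqsum i => /=;eqsum j.
swapsum k => /=;eqsum l.
by rewrite (aA i j) (aA k l);ring.
Qed.

Lemma bform_wedge A f g : antisym A ->
 bform (wedge f g) A = 2*(inner A f * inner A g) - 4 * pairing A f g.
move=> aA.
have h f' g' := bform_cross f' g' aA.
have h' f' g' : bform (fun i j k l => f' i k * g' j l) A = pairing A f' g' by [].
transitivity (bform (fun i j k l => f i j * g k l) A+bform (fun i j k l => g i j*f k l) A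
 - bform (fun i j k l => f i k * g j l) A - bform (fun i j k l => g i k*f j l) A
+bform (fun i j k l => f i l * g j k) A+bform (fun i j k l => g i l*f j k) A).
 rewrite /bform -!sumrN -!big_split;eqsum i => /=.
 rewrite -!sumrN -!big_split;eqsum j => /=.
 rewrite -!sumrN -!big_split;eqsum k => /=.
 rewrite -!sumrN -!big_split;eqsum l => /=;rewrite /wedge;ring.
rewrite !bform_product !h !h' (pairing_swap f g aA);ring.
Qed.

(* The curvature tensor of a submanifold depends on the second fundamental form
 only through its Gram tensor. *)
Definition gramq (t : @tens4 R I) : @tens4 R I := fun i j k l => t i k j l - t i l j k.

Lemma bform_gramq A (t : tens4 I) : antisym A ->
 bform (gramq t) A = 2 * \sum_i \sum_j \sum_k \sum_l A i j*A k l * t i k j l.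
move=> aA;have -> : bform (gramq t) A = bform (fun i j k l => t i k j l) A -
  bform (fun i j k l => t i l j k) A.
 rewrite /bform -sumrB;eqsum i;rewrite -sumrB;eqsum j.
 rewrite -sumrB;eqsum k;rewrite -sumrB;eqsum l;rewrite /gramq;ring.
have -> : bform (fun i j k l => t i l j k) A = - bform (fun i j k l => t i k j l) A.
 rewrite /bform -sumrN;eqsum i;rewrite -sumrN;eqsum j.
 rewrite exchange_big -sumrN;eqsum k => /=;rewrite -sumrN;eqsum l.
 by rewrite (aA k l);ring.
by rewrite opprK mulr2n mulrDl !mul1r.
Qed.

(** In matrix terms, minus the trace of the square of [A f]; for the sparse matrices [eY] this trace
    can be taken block by block. *)
Lemma pairing_sym A f : antisym A -> (forall i j, f j i = f i j) ->
 let B i k := \sum_j A i j*f j k in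
 pairing A f f = - \sum_i \sum_k B i k*B k i.
move=> aA sf B;rewrite /pairing -sumrN exchange_big;eqsum j => /=.
rewrite exchange_big -sumrN;eqsum k => /=.
rewrite /B mulr_suml -sumrN;eqsum i.
rewrite mulr_sumr -sumrN;eqsum l.
by rewrite (aA i j) (sf j l) ;ring.
Qed.

End BivectorPairing.

(** * The model tensor in a radial, vertical and horizontal frame *)

Section ModelTensor.
Context {R : realType} {D S : finType}.
Local Notation K := (unit+(D+S))%type.
Variables (C : D -> S -> S -> R) (KT KV x phi sigma : R) (HH : @tens4 R S).

Definition iT : K := inl tt.
Definition iV (a : D) : K := inr (inl a).
Definition iH (s : S) : K := inr (inr s).

Lemma sumK (F : K -> R) : \sum_i F i = F iT+(\sum_a F (iV a) + \sum_s F (iH s)).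
rewrite big_sumType /= big_sumType /=;congr (_ + _).
by rewrite (bigD1 tt) //= big1 ?addr0 // => -[].
Qed.

Definition eT (i k : K) : R := if (i, k) is (inl _, inl _) then 1 else 0.
Definition eV (i k : K) : R :=
 if (i, k) is (inr (inl a), inr (inl b)) then (a == b)%:R else 0.
Definition eH (i k : K) : R :=
 if (i, k) is (inr (inr s), inr (inr t)) then (s == t)%:R else 0.
(** The [u]-th component of the part of the second fundamental form with horizontal values: the
    radial direction acts on horizontal vectors by [phi], and the vertical direction [a] by [sigma]
    times the Clifford matrix [C a]. *)
Definition eY (u : S) (i k : K) : R :=
 match i, k with
 | inl _, inr (inr s) | inr (inr s), inl _ => phi*(s == u)%:R
 | inr (inl a), inr (inr s) | inr (inr s), inr (inl a) => sigma*C a s u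
 | _, _ => 0
 end.
Definition eHH (i k j l : K) : R :=
 match i, k, j, l with
 | inr (inr s), inr (inr t), inr (inr u), inr (inr v) => HH s t u v
 | _, _, _, _ => 0
 end.

(** Inner products of a second fundamental form with a radial normal, a vertical normal, the part
    [eY] and a purely horizontal part. [KT] pairs the first two, [KV] is the square of the second,
    and [phi ^+ 2] and [x] pair them with the horizontal part. The square of the radial normal is
    left out, as it disappears from the Gauss equation. *)
Definition model_gram (i k j l : K) : R :=
 KT*(eT i k*eV j l+eV i k*eT j l)+phi ^+ 2*(eT i k*eH j l+eH i k*eT j l)
 + \sum_u eY u i k*eY u j l+KV*(eV i k*eV j l)
+x*(eV i k*eH j l+eH i k*eV j l)+eHH i k j l.

Definition eC (a : D) (i k : K) : R :=
 if (i, k) is (inr (inr s), inr (inr t)) then C a s t else 0.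
Definition GC (a b : D) (s t : S) : R := \sum_u C a s u*C b t u.
(** The part of [GC] antisymmetric in [a] and [b]. It is also skew in [s] and [t] ([gC_skew]), hence
    a horizontal 2-form that may enter a 4-form. *)
Definition gC (a b : D) (s t : S) : R := (GC a b s t - GC b a s t) / 2.
Definition eG (a b : D) (i k : K) : R :=
 if (i, k) is (inr (inr s), inr (inr t)) then gC a b s t else 0.
Definition eTV (a : D) (i k : K) : R :=
 match i, k with
 | inl _, inr (inl b) => (a == b)%:R
 | inr (inl b), inl _ => - (a == b)%:R
 | _, _ => 0
 end.
Definition eVV (a b : D) (i k : K) : R :=
 if (i, k) is (inr (inl c), inr (inl d)) then
  (a == c)%:R*(b == d)%:R - (a == d)%:R*(b == c)%:R else 0.

Hypothesis Cskew : forall a s t, C a t s = - C a s t.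

Variable A : K -> K -> R.
Hypothesis aA : antisym A.

Local Notation al a := (A iT (iV a)).
Local Notation th s := (A iT (iH s)).
Local Notation be a b := (A (iV a) (iV b)).
Local Notation ga a s := (A (iV a) (iH s)).
Local Notation et s t := (A (iH s) (iH t)).

Let AVT a : A (iV a) iT = - al a. Proof. exact: aA. Qed.
Let AHT s : A (iH s) iT = - th s. Proof. exact: aA. Qed.
Let AHV s a : A (iH s) (iV a) = - ga a s. Proof. exact: aA. Qed.
Let ATT : A iT iT = 0. Proof. have := aA iT iT;lra. Qed.

Lemma sum_eq (T : finType) (F : T -> R) t : \sum_s F s*(s == t)%:R = F t.
rewrite (bigD1 t) //= eqxx mulr1 big1 ?addr0 // => s /negPf st.
by rewrite st mulr0.
Qed.

Lemma sum_eq' (T : finType) (F : T -> R) t : \sum_s F s*(t == s)%:R = F t.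
by rewrite -[RHS](sum_eq F t);eqsum s;rewrite eq_sym. Qed.

Lemma sum_eV (F : K -> K -> R) : \sum_i \sum_k F i k*eV i k = \sum_a F (iV a) (iV a).
rewrite sumK [X in X + _]big1 ?add0r => [|k _];last by rewrite mulr0.
rewrite [X in _+X]big1 ?addr0 => [|s _];last by rewrite big1 // => k _;rewrite mulr0.
eqsum a;rewrite sumK mulr0 add0r [X in _+X]big1 ?addr0 => [|s _];last by rewrite mulr0.
exact: sum_eq'.
Qed.

Lemma sum_eH (F : K -> K -> R) : \sum_i \sum_k F i k*eH i k = \sum_s F (iH s) (iH s).
rewrite sumK [X in X + _]big1 ?add0r => [|k _];last by rewrite mulr0.
rewrite [X in X + _]big1 ?add0r => [|s _];last by rewrite big1 // => k _;rewrite mulr0.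
eqsum a;rewrite sumK mulr0 add0r [X in X + _]big1 ?add0r => [|s _];last by rewrite mulr0.
exact: sum_eq'.
Qed.

Lemma pairingE f g : pairing A f g = \sum_i \sum_k (\sum_j \sum_l A i j*A k l * g j l)*f i k.
eqsum i;swapsum k => /=.
rewrite mulr_suml;eqsum j;rewrite mulr_suml;eqsum l;ring.
Qed.

Lemma sum_eT (F : K -> K -> R) : \sum_i \sum_k F i k*eT i k = F iT iT.
rewrite sumK [X in _+X](_ : _ = 0) ?addr0.
 by rewrite sumK !big1 ?addr0 ?mulr1 // => s _;rewrite mulr0.
by rewrite !big1 ?addr0 // => s _;rewrite big1 // => k _;rewrite mulr0.
Qed.

Lemma pairing_eT g : pairing A eT g = \sum_j \sum_l A iT j*A iT l * g j l.
by rewrite pairingE sum_eT. Qed.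

Lemma pairing_TV : pairing A eT eV = \sum_a al a ^+ 2.
by rewrite pairing_eT sum_eV;eqsum a;rewrite expr2. Qed.

Lemma pairing_TH : pairing A eT eH = \sum_s th s ^+ 2.
by rewrite pairing_eT sum_eH;eqsum a;rewrite expr2. Qed.

Lemma pairing_VV : pairing A eV eV = \sum_a \sum_b be a b ^+ 2.
rewrite pairingE sum_eV;eqsum a;rewrite sum_eV.
by eqsum b;rewrite expr2.
Qed.

Lemma pairing_VH : pairing A eV eH = \sum_a \sum_s ga a s ^+ 2.
rewrite pairingE sum_eV;eqsum a;rewrite sum_eH.
by eqsum b;rewrite expr2.
Qed.

Lemma sum_lift (F : K -> K -> R) (h : S -> S -> R) (f : K -> K -> R) :
 (forall s t, f (iH s) (iH t) = h s t) -> (forall k, f iT k = 0) -> (forall i, f i iT = 0) ->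
 (forall a k, f (iV a) k = 0) -> (forall a i, f i (iV a) = 0) ->
 \sum_i \sum_k F i k*f i k = \sum_s \sum_t F (iH s) (iH t)*h s t.
move=> fh f1 f2 f3 f4.
rewrite sumK [X in X + _]big1 ?add0r => [|k _];last by rewrite f1 mulr0.
rewrite [X in X + _]big1 ?add0r => [|s _];last by rewrite big1 // => k _;rewrite f3 mulr0.
eqsum s;rewrite sumK f2 mulr0 add0r [X in X + _]big1 ?add0r => [|a _].
 by eqsum t;rewrite fh.
by rewrite f4 mulr0.
Qed.

Lemma sum_eC a (F : K -> K -> R) :
 \sum_i \sum_k F i k*eC a i k = \sum_s \sum_t F (iH s) (iH t)*C a s t.
by apply: sum_lift => // [[|[]]|b [|[]]]. Qed.

Lemma sum_eG a b (F : K -> K -> R) :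
 \sum_i \sum_k F i k*eG a b i k = \sum_s \sum_t F (iH s) (iH t) * gC a b s t.
by apply: sum_lift => // [[|[]]|c [|[]]]. Qed.

Lemma sum_eTV a (F : K -> K -> R) :
 \sum_i \sum_k F i k*eTV a i k = F iT (iV a) - F (iV a) iT.
rewrite sumK [X in _+(_+X)]big1 ?addr0 => [|s _];last first.
 by rewrite big1 // => k _;rewrite mulr0.
congr (_ + _).
 rewrite sumK mulr0 add0r [X in _+X]big1 ?addr0 => [|s _];last by rewrite mulr0.
 exact: sum_eq'.
transitivity (\sum_b - F (iV b) iT*(a == b)%:R);last by rewrite sum_eq'.
eqsum b;rewrite sumK !big1 ?addr0 => [|s _|s _];rewrite ?mulr0 //.
by rewrite /= mulrN mulNr.
Qed.

Lemma sum_eVV a b (F : K -> K -> R) :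
 \sum_i \sum_k F i k*eVV a b i k = F (iV a) (iV b) - F (iV b) (iV a).
rewrite sumK [X in X + _]big1 ?add0r => [|k _];last by rewrite mulr0.
rewrite [X in _+X]big1 ?addr0 => [|s _];last by rewrite big1 // => k _;rewrite mulr0.
transitivity (\sum_c (F (iV c) (iV b)*(a == c)%:R - F (iV c) (iV a)*(b == c)%:R)).
 eqsum c;rewrite sumK mulr0 add0r [X in _+X]big1 ?addr0 => [|s _];last by rewrite mulr0.
 rewrite -(sum_eq' (fun d => F (iV c) (iV d)*(a == c)%:R) b).
 rewrite -(sum_eq' (fun d => F (iV c) (iV d)*(b == c)%:R) a) -sumrB.
 by eqsum d;rewrite /eVV /=;ring.
by rewrite sumrB !sum_eq'.
Qed.

Definition CA a : R := \sum_s \sum_t et s t*C a s t.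
Definition gA a b : R := \sum_s \sum_t et s t * gC a b s t.

Lemma inner_eTV a : inner A (eTV a) = 2*al a.
by rewrite /inner sum_eTV AVT;ring. Qed.

Lemma inner_eVV a b : inner A (eVV a b) = 2*be a b.
by rewrite /inner sum_eVV (aA (iV a) (iV b));ring. Qed.

Lemma inner_eC a : inner A (eC a) = CA a.
exact: sum_eC. Qed.

Lemma inner_eG a b : inner A (eG a b) = gA a b.
exact: sum_eG. Qed.

Lemma pairing_TVC a : pairing A (eTV a) (eC a) = 2 * \sum_s \sum_t th s * ga a t*C a s t.
rewrite pairingE sum_eTV !sum_eC.
rewrite [X in _ - X]exchange_big /= -sumrB mulr_sumr;eqsum s.
rewrite -sumrB mulr_sumr;eqsum t;rewrite (Cskew a s t);ring.
Qed.

Lemma gC_skew a b s t : gC a b t s = - gC a b s t.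
rewrite /gC;have -> : GC a b t s = GC b a s t by eqsum u;rewrite mulrC.
have -> : GC b a t s = GC a b s t by eqsum u;rewrite mulrC.
by rewrite -mulNr opprB.
Qed.

Lemma pairing_VVG a b :
 pairing A (eVV a b) (eG a b) = 2 * \sum_s \sum_t ga a s * ga b t * gC a b s t.
rewrite pairingE sum_eVV !sum_eG.
rewrite [X in _ - X]exchange_big /= -sumrB mulr_sumr;eqsum s.
rewrite -sumrB mulr_sumr;eqsum t;rewrite (gC_skew a b s t);ring.
Qed.

Definition PC a : R := \sum_s \sum_t \sum_u \sum_v et s t*et u v*(C a s u*C a t v).

Lemma pairing_CC a : pairing A (eC a) (eC a) = PC a.
rewrite pairingE sum_eC /PC;eqsum s;swapsum' u.
rewrite sum_eC mulr_suml;eqsum t;rewrite mulr_suml;eqsum v;ring.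
Qed.

Lemma sum4 (T1 T2 T3 T4 : finType) (F : T1 -> T2 -> T3 -> T4 -> R) :
 \sum_s \sum_t \sum_a \sum_b F s t a b = \sum_a \sum_b \sum_s \sum_t F s t a b.
transitivity (\sum_s \sum_a \sum_b \sum_t F s t a b).
 by eqsum s;swapsum a;exact: exchange_big.
by swapsum a;exact: exchange_big.
Qed.

Let TG := \sum_u \sum_a \sum_s th s*C a s u * ga a u.
Let GG := \sum_a \sum_b \sum_s \sum_t ga a s * ga b t * GC b a s t.
Let BG := \sum_a \sum_b be a b * \sum_s \sum_t et s t * GC b a s t.

(** [TG], [GG] and [BG] are the couplings radial-horizontal with vertical-horizontal,
    vertical-horizontal with itself, and vertical-vertical with horizontal-horizontal. Skewness of
    [C] and [A] reduces all other sums to these. *)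
Lemma pairing_Y : \sum_u pairing A (eY u) (eY u) =
 - (2 * phi ^+ 2*(\sum_s th s ^+ 2) + 4*(phi*sigma)*TG
  + 4*(phi*sigma)*(\sum_a al a*CA a) + 2*sigma ^+ 2 * GG + 2*sigma ^+ 2*BG).
have Ysym u i j : eY u j i = eY u i j by case: i => [|[]] ?;case: j => [|[]] ?.
pose B u i k := \sum_j A i j*eY u j k.
have BT u i : B u i iT = phi*A i (iH u).
 rewrite /B sumK mulr0 add0r big1 ?add0r => [|a _];last by rewrite mulr0.
 by rewrite -(sum_eq (fun s => A i (iH s)) u) mulr_sumr;eqsum s;rewrite mulrCA.
have BV u i a : B u i (iV a) = sigma * \sum_s A i (iH s)*C a s u.
 rewrite /B sumK mulr0 add0r big1 ?add0r => [|b _];last by rewrite mulr0.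
 by distrsum s;rewrite mulrCA.
have BH u i s : B u i (iH s) = phi*A i iT*(s == u)%:R+sigma * \sum_a A i (iV a)*C a s u.
 rewrite /B sumK [X in _+(_+X)]big1 ?addr0 => [|b _];last by rewrite mulr0.
 by rewrite mulr_sumr mulrCA mulrA;congr (_ + _);eqsum a;rewrite mulrCA.
have E u : pairing A (eY u) (eY u) =
 - (phi ^+ 2 * th u ^+ 2
 + 2*(phi*sigma)*(\sum_a (\sum_s th s*C a s u) * ga a u)
 + 2*(phi*sigma)*(\sum_s (\sum_a al a*C a s u)*et s u)
+sigma ^+ 2*(\sum_a \sum_b (\sum_s ga a s*C b s u)*(\sum_s ga b s*C a s u))
 + 2*(sigma ^+ 2*(\sum_a \sum_s (\sum_b be a b*C b s u)*(\sum_t et s t*C a t u))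
    - phi*sigma * \sum_a al a * \sum_t et u t*C a t u)
+(phi ^+ 2 * th u ^+ 2 + 2*(phi*sigma)*(\sum_s th s * \sum_a ga a u*C a s u)
  +sigma ^+ 2 * \sum_s \sum_t (\sum_a ga a s*C a t u)*(\sum_a ga a t*C a s u))).
 transitivity (- \sum_i \sum_k B u i k*B u k i);first by rewrite (pairing_sym aA (Ysym u)).
 congr (- _);rewrite sumK (sumK (fun k => B u iT k*B u k iT)) BT.
 have -> : \sum_a \sum_k B u (iV a) k*B u k (iV a) =
   \sum_a B u iT (iV a)*B u (iV a) iT +
   (\sum_a \sum_b B u (iV a) (iV b)*B u (iV b) (iV a) +
   \sum_a \sum_s B u (iV a) (iH s)*B u (iH s) (iV a)).
  rewrite -!big_split;eqsum a.
  by rewrite (sumK (fun k => B u (iV a) k*B u k (iV a))) [in LHS]mulrC.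
 have -> : \sum_s \sum_k B u (iH s) k*B u k (iH s) =
   \sum_s B u iT (iH s)*B u (iH s) iT +
   (\sum_a \sum_s B u (iV a) (iH s)*B u (iH s) (iV a) +
   \sum_s \sum_t B u (iH s) (iH t)*B u (iH t) (iH s)).
  rewrite [X in _ = _+(X + _)]exchange_big -!big_split;eqsum s => /=.
  rewrite (sumK (fun k => B u (iH s) k*B u k (iH s))) [B u (iH s) iT * _]mulrC.
  by congr (_+(_ + _));eqsum a;rewrite mulrC.
 have e1 : \sum_a B u iT (iV a)*B u (iV a) iT =
   phi*sigma*(\sum_a (\sum_s th s*C a s u) * ga a u).
  distrsum a;rewrite BT BV;ring.
 have e2 : \sum_s B u iT (iH s)*B u (iH s) iT =
   phi*sigma*(\sum_s (\sum_a al a*C a s u)*et s u).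
  distrsum s;rewrite BT BH ATT;ring.
 have e4 : \sum_a \sum_s B u (iV a) (iH s)*B u (iH s) (iV a) =
   sigma ^+ 2*(\sum_a \sum_s (\sum_b be a b*C b s u)*(\sum_t et s t*C a t u))
    - phi*sigma * \sum_a al a * \sum_t et u t*C a t u.
  rewrite !mulr_sumr -sumrB;eqsum a.
  rewrite [X in _ - X](_ : _ = \sum_s phi*sigma*al a*(\sum_t et s t*C a t u)*(s == u)%:R);
   last by rewrite sum_eq;ring.
  rewrite mulr_sumr -sumrB;eqsum s;rewrite BV BH AVT;ring.
 have e5 : \sum_s \sum_t B u (iH s) (iH t)*B u (iH t) (iH s) =
   phi ^+ 2 * th u ^+ 2 + 2*(phi*sigma)*(\sum_s th s * \sum_a ga a u*C a s u)
  +sigma ^+ 2 * \sum_s \sum_t (\sum_a ga a s*C a t u)*(\sum_a ga a t*C a s u).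
  pose h s t := \sum_a ga a s*C a t u.
  have hE s t : \sum_a A (iH s) (iV a)*C a t u = - h s t.
   by rewrite -sumrN;eqsum a;rewrite AHV mulNr.
  transitivity (\sum_s \sum_t (phi ^+ 2 * th s * th t*(s == u)%:R*(t == u)%:R +
   phi*sigma * th s*h t s*(t == u)%:R+phi*sigma * th t*h s t*(s == u)%:R +
   sigma ^+ 2*(h s t*h t s))).
   eqsum s;eqsum t;rewrite !BH !AHT !hE;ring.
  under eq_bigr do rewrite !big_split /= !sum_eq.
  rewrite !big_split /=;congr (_ + _);last first.
   by distrsum s;rewrite mulr_sumr.
  rewrite -addrA;congr (_ + _);first by rewrite sum_eq;ring.
  rewrite [X in _+X]exchange_big /=.
  under [X in _+X]eq_bigr => s _ do rewrite sum_eq.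
  by rewrite -big_split mulr_sumr;eqsum s => /=;rewrite /h;ring.
 rewrite e1 e2.
 have -> : \sum_a \sum_b B u (iV a) (iV b)*B u (iV b) (iV a) = sigma ^+ 2 *
   (\sum_a \sum_b (\sum_s ga a s*C b s u)*(\sum_s ga b s*C a s u)).
  distrsum a;distrsum b.
  rewrite !BV;ring.
 rewrite e4 e5;ring.
under eq_bigr do rewrite E.
rewrite sumrN !big_split /= -!mulr_sumr !big_split /= -!mulr_sumr sumrN -!mulr_sumr.
have f1 : \sum_u \sum_a (\sum_s th s*C a s u) * ga a u = TG.
 by eqsum u;eqsum a;rewrite mulr_suml.
have f2 : \sum_u \sum_s (\sum_a al a*C a s u)*et s u = \sum_a al a*CA a.
 rewrite exchange_big /=;under [RHS]eq_bigr => a _ do rewrite mulr_sumr.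
 rewrite [RHS]exchange_big /=;eqsum s.
 under eq_bigr do rewrite mulr_suml.
 swapsum' a;distrsum u;ring.
have f2' : \sum_u \sum_a al a*(\sum_t et u t*C a t u) = - \sum_a al a*CA a.
 rewrite exchange_big -sumrN /=;eqsum a;rewrite -mulr_sumr -mulrN;congr (_ * _).
 rewrite -sumrN;eqsum u;rewrite -sumrN;eqsum t.
 by rewrite (Cskew a u t);ring.
have f3 : \sum_u \sum_a \sum_b (\sum_s ga a s*C b s u)*(\sum_s ga b s*C a s u) = GG.
 swapsum a;swapsum b => /=.
 under eq_bigr do rewrite mulr_suml.
 swapsum s => /=.
 under eq_bigr do rewrite mulr_sumr.
 swapsum t => /=.
 distrsum u;ring.
have f4 : \sum_u \sum_a \sum_s (\sum_b be a b*C b s u)*(\sum_t et s t*C a t u) = BG.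
 swapsum a => /=.
 under [RHS]eq_bigr => b _ do rewrite mulr_sumr.
 rewrite exchange_big [RHS]exchange_big;eqsum s => /=.
 under eq_bigr do rewrite mulr_suml.
 swapsum b => /=.
 under eq_bigr do rewrite mulr_sumr.
 rewrite exchange_big mulr_sumr;eqsum t => /=.
 rewrite /GC mulr_sumr mulr_sumr;eqsum u;ring.
have f5 : \sum_u \sum_s th s*(\sum_a ga a u*C a s u) = TG.
 eqsum u;under eq_bigr do rewrite mulr_sumr.
 by swapsum a;eqsum s;rewrite -mulrA [ga _ _ * _]mulrC.
have f6 : \sum_u \sum_s \sum_t (\sum_a ga a s*C a t u)*(\sum_a ga a t*C a s u) = GG.
 rewrite /GG sum4 exchange_big;eqsum s;swapsum t => /=.
 under eq_bigr do rewrite mulr_suml.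
 swapsum a => /=.
 under eq_bigr do rewrite mulr_sumr.
 swapsum b => /=.
 distrsum u;ring.
rewrite f1 f2 f2' f3 f4 f5 f6;ring.
Qed.

Definition PHH : R := \sum_s \sum_t \sum_u \sum_v et s t*et u v * HH s u t v.

(** Combines the 4-forms that the Clifford generators offer: radial, vertical and [C a]; two
    verticals and a commutator; and the square of [C a]. The coefficient of the first is forced: it
    cancels the indefinite coupling [TG]. *)
Definition model_form (c2 c3 : R) : @tens4 R K := fun i j k l =>
 (\sum_a - (phi*sigma)*wedge (eTV a) (eC a) i j k l)
+(\sum_a \sum_b c2*wedge (eVV a b) (eG a b) i j k l)
 + \sum_a c3*wedge (eC a) (eC a) i j k l.

Hypothesis clifford : forall a b s t, GC a b s t+GC b a s t = 2*((a == b)%:R*(s == t)%:R).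

(** The radial-horizontal block of [A] drops out completely. The other blocks are coupled only
    through [CA], [gA] and [gC], so positivity becomes a matter of choosing [c2] and [c3]. *)
Lemma bform_model c2 c3 :
 bform (fun i j k l => gramq model_gram i j k l+model_form c2 c3 i j k l) A = 2 *
 (2*KT*(\sum_a al a ^+ 2)+KV*(\sum_a \sum_b be a b ^+ 2)
 + 2*(x - sigma ^+ 2)*(\sum_a \sum_s ga a s ^+ 2)
+(2*sigma ^+ 2 - 4*c2)*(\sum_a \sum_b \sum_s \sum_t ga a s * ga b t * gC a b s t)
 - 6*(phi*sigma)*(\sum_a al a*CA a)
+(2*sigma ^+ 2 + 2*c2)*(\sum_a \sum_b be a b * gA a b)
+PHH+c3*(\sum_a (CA a ^+ 2 - 2 * PC a))).
have GE a b s t : GC b a s t = (a == b)%:R*(s == t)%:R - gC a b s t.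
 have := clifford a b s t;rewrite /gC;move: ((a == b)%:R*(s == t)%:R) => d;lra.
have GGE : GG = \sum_a \sum_s ga a s ^+ 2 -
  \sum_a \sum_b \sum_s \sum_t ga a s * ga b t * gC a b s t.
 rewrite -sumrB;eqsum a.
 have -> : \sum_s ga a s ^+ 2 = \sum_b (\sum_s ga a s * ga b s)*(b == a)%:R.
  by rewrite sum_eq;eqsum s;rewrite expr2.
 rewrite -sumrB;eqsum b;rewrite mulr_suml -sumrB;eqsum s.
 have -> : ga a s * ga b s*(b == a)%:R = \sum_t ga a s * ga b t*(b == a)%:R*(t == s)%:R.
  by rewrite sum_eq.
 rewrite -sumrB;eqsum t;rewrite GE (eq_sym b) (eq_sym t);ring.
have BGE : BG = - \sum_a \sum_b be a b * gA a b.
 rewrite -sumrN;eqsum a;rewrite -sumrN;eqsum b.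
 have baa : be a b*(a == b)%:R = 0.
  have [<-|] := eqVneq a b;last by rewrite mulr0.
  by have := aA (iV a) (iV a);rewrite mulr1 => h;lra.
 rewrite /gA -mulrN -sumrN !mulr_sumr;eqsum s.
 rewrite -sumrN !mulr_sumr;eqsum t;rewrite GE.
 transitivity (be a b*(a == b)%:R*(et s t*(s == t)%:R) - be a b*(et s t * gC a b s t));first by ring.
 by rewrite baa mul0r sub0r mulrN.
rewrite bformD (bform_gramq _ aA).
have hHH : \sum_i \sum_j \sum_k \sum_l A i j*A k l*eHH i k j l = PHH.
 have z i j k l : (if (i, j, k, l) is (inr (inr _), inr (inr _), inr (inr _), inr (inr _))
  then false else true) -> eHH i k j l = 0.
  by case: i => [|[]] ?;case: j => [|[]] ?;case: k => [|[]] ?;case: l => [|[]] ?.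
 have o1 (F : K -> R) : F iT = 0 -> (forall a, F (iV a) = 0) -> \sum_i F i = \sum_s F (iH s).
  by move=> h1 h2;rewrite sumK h1 big1 ?add0r.
 rewrite o1 => [|| a];last 2 first.
 - by do 3 (rewrite big1 // => ? _);rewrite z // mulr0.
 - by do 3 (rewrite big1 // => ? _);rewrite z // mulr0.
 eqsum s;rewrite o1 => [||a];last 2 first.
 - by do 2 (rewrite big1 // => ? _);rewrite z // mulr0.
 - by do 2 (rewrite big1 // => ? _);rewrite z // mulr0.
 eqsum t;rewrite o1 => [||a];last 2 first.
 - by rewrite big1 // => ? _;rewrite z // mulr0.
 - by rewrite big1 // => ? _;rewrite z // mulr0.
 by eqsum u;rewrite o1 => [//||a];rewrite z // mulr0.
have -> : \sum_i \sum_j \sum_k \sum_l A i j*A k l * model_gram i k j l =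
  KT*(pairing A eT eV+pairing A eV eT)+phi ^+ 2*(pairing A eT eH+pairing A eH eT)
  + \sum_u pairing A (eY u) (eY u)+KV * pairing A eV eV
 +x*(pairing A eV eH+pairing A eH eV)+PHH.
 have -> : \sum_u pairing A (eY u) (eY u) =
   \sum_i \sum_j \sum_k \sum_l A i j*A k l * \sum_u eY u i k*eY u j l.
  swapsum i => /=;swapsum j => /=.
  swapsum k => /=;swapsum l => /=.
  by rewrite mulr_sumr.
 rewrite -hHH /pairing -!big_split /= !mulr_sumr -!big_split /=;eqsum i.
 rewrite -!big_split /= !mulr_sumr -!big_split /=;eqsum j.
 rewrite -!big_split /= !mulr_sumr -!big_split /=;eqsum k.
 rewrite -!big_split /= !mulr_sumr -!big_split /=;eqsum l.
 rewrite /model_gram;move: (\sum_u _) => y;ring.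
rewrite pairing_Y GGE BGE (pairing_swap eT eV aA) (pairing_swap eT eH aA) (pairing_swap eV eH aA).
rewrite pairing_TV pairing_TH pairing_VV pairing_VH.
have -> : bform (model_form c2 c3) A =
 - (phi*sigma)*(4*(\sum_a al a*CA a) - 8*TG)
+c2*(4*(\sum_a \sum_b be a b * gA a b)
   - 8 * \sum_a \sum_b \sum_s \sum_t ga a s * ga b t * gC a b s t)
+c3*(2 * \sum_a (CA a ^+ 2 - 2 * PC a)).
 rewrite /model_form bformD bformD !bform_sum;congr (_ + _ + _).
 - have -> : TG = \sum_a \sum_s \sum_t th s * ga a t*C a s t.
   rewrite /TG exchange_big;eqsum a => /=;rewrite exchange_big.
   by eqsum s;eqsum t;rewrite mulrAC.
  rewrite !mulr_sumr -sumrB mulr_sumr;eqsum a.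
  rewrite bformZ (bform_wedge _ _ aA) inner_eTV inner_eC pairing_TVC;ring.
 - rewrite !mulr_sumr -sumrB mulr_sumr;eqsum a.
  rewrite bform_sum !mulr_sumr -sumrB mulr_sumr;eqsum b.
  rewrite bformZ (bform_wedge _ _ aA) inner_eVV inner_eG pairing_VVG;ring.
 - rewrite !mulr_sumr;eqsum a.
  rewrite bformZ (bform_wedge _ _ aA) inner_eC pairing_CC;ring.
ring.
Qed.

End ModelTensor.

Section ModelFormAlternating.
Context {R : realType} {D S : finType}.
Variables (C : D -> S -> S -> R) (phi sigma c2 c3 : R).
Hypothesis Cskew : forall a s t, C a t s = - C a s t.

Lemma alternatingD (I : Type) (w w' : @tens4 R I) : altern w -> altern w' ->
 altern (fun i j k l => w i j k l+w' i j k l).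
move=> aw aw' i j k l;have [h1 h2 h3] := aw i j k l;have [h1' h2' h3'] := aw' i j k l.
by rewrite h1 h2 h3 h1' h2' h3' !opprD.
Qed.

Lemma alternating_sum (I : Type) (J : finType) (w : J -> @tens4 R I) :
 (forall m, altern (w m)) -> altern (fun i j k l => \sum_m w m i j k l).
move=> aw i j k l;split;rewrite -sumrN;eqsum m;by case: (aw m i j k l).
Qed.

Lemma alternatingZ (I : Type) (c : R) (w : @tens4 R I) : altern w ->
 altern (fun i j k l => c*w i j k l).
by move=> aw i j k l;have [-> -> ->] := aw i j k l;rewrite !mulrN. Qed.

Lemma model_form_alternating : altern (model_form C phi sigma c2 c3).
have aC a : antisym (eC C a).
 by case=> [|[]] ?;case=> [|[]] ?;rewrite /eC ?oppr0.
have aG a b : antisym (eG C a b).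
 by case=> [|[]] ?;case=> [|[]] ?;rewrite /eG ?oppr0 // gC_skew.
apply: alternatingD;first apply: alternatingD.
- apply: alternating_sum => a;apply: alternatingZ;apply: wedge_alternating => //.
 by case=> [|[]] ?;case=> [|[]] ?;rewrite /= ?oppr0 ?opprK.
- apply: alternating_sum => a;apply: alternating_sum => b.
 apply: alternatingZ;apply: wedge_alternating => //.
 case=> [|[]] ?;case=> [|[]] ?;rewrite /eVV ?oppr0 // opprB.
 by congr (_ - _);rewrite mulrC.
- by apply: alternating_sum => a;apply: alternatingZ;exact: wedge_alternating.
Qed.

End ModelFormAlternating.

(** * Positivity of the model tensor, associative and octonionic *)

Section ModelPositivity.
Context {R : realType} {D S : finType}.
Local Notation K := (unit+(D+S))%type.
Variables (C : D -> S -> S -> R) (KT KV x phi sigma : R).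
Hypothesis Cskew : forall a s t, C a t s = - C a s t.
Hypothesis clifford : forall a b s t,
 GC C a b s t+GC C b a s t = 2*((a == b)%:R*(s == t)%:R).
Hypotheses (x0 : 0 <= x) (x1 : x <= 1) (sx : sigma ^+ 2 = x*(1 - x)).
Hypotheses (KT0 : 0 <= KT) (KV0 : 0 <= KV).

(** A binary quadratic form of nonpositive discriminant, summed over an index. The case [k = 0] is
    separate because completing the square divides by [k]. *)
Lemma sum_square_completed (J : finType) (k m e : R) (u v : J -> R) : 0 <= k -> 0 <= e ->
 m ^+ 2 <= 4*k*e ->
 0 <= k*(\sum_a u a ^+ 2) - m*(\sum_a u a*v a)+e*(\sum_a v a ^+ 2).
move=> k0 e0 mke;rewrite !mulr_sumr -sumrB -big_split /=;apply: sumr_ge0 => a _.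
move: (u a) (v a) => p q.
have [k00|k1] := eqVneq k 0.
 have -> : m = 0.
  apply/eqP;rewrite -sqrf_eq0 eq_le sqr_ge0 andbT;apply: le_trans mke _.
  by rewrite k00 mulr0 mul0r.
 by rewrite k00 !mul0r subr0 add0r mulr_ge0 // sqr_ge0.
have k2 : 0 < k by rewrite lt_neqAle eq_sym k1.
have -> : k * p ^+ 2 - m*(p*q)+e*q ^+ 2 =
  k*(p - m / (2*k)*q) ^+ 2+(4*k*e - m ^+ 2) / (4*k)*q ^+ 2.
 by field;rewrite gt_eqF.
by rewrite addr_ge0 // mulr_ge0 ?sqr_ge0 ?(ltW k2) // divr_ge0 ?subr_ge0 // mulr_ge0.
Qed.

Lemma model_strong_psd (HH : @tens4 R S) c2 c3 :
 (forall A : K -> K -> R, antisym A ->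
 0 <= 2*KT*(\sum_a A iT (iV a) ^+ 2)+KV*(\sum_a \sum_b A (iV a) (iV b) ^+ 2)
 + 2*(x - sigma ^+ 2)*(\sum_a \sum_s A (iV a) (iH s) ^+ 2)
+(2*sigma ^+ 2 - 4*c2)*(\sum_a \sum_b \sum_s \sum_t
    A (iV a) (iH s)*A (iV b) (iH t) * gC C a b s t)
 - 6*(phi*sigma)*(\sum_a A iT (iV a)*CA C A a)
+(2*sigma ^+ 2 + 2*c2)*(\sum_a \sum_b A (iV a) (iV b) * gA C A a b)
+PHH HH A+c3*(\sum_a (CA C A a ^+ 2 - 2 * PC C A a))) ->
 strong_psd (gramq (model_gram C KT KV x phi sigma HH)).
move=> Hpos;exists (model_form C phi sigma c2 c3);first exact: model_form_alternating.
move=> A aA;have aA' : antisym A by [].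
by rewrite (bform_model KT KV x phi sigma HH Cskew aA' clifford) mulr_ge0 // Hpos.
Qed.

Definition etasq (A : K -> K -> R) : R := \sum_s \sum_t A (iH s) (iH t) ^+ 2.

Lemma sum_deltas (F : S -> S -> S -> S -> R) :
 \sum_s \sum_t \sum_u \sum_v F s t u v*((s == u)%:R*(t == v)%:R) = \sum_s \sum_t F s t s t.
eqsum s;eqsum t.
transitivity (\sum_u F s t u t*(s == u)%:R);last by rewrite sum_eq'.
eqsum u;rewrite -(sum_eq' (fun v => F s t u v*(s == u)%:R)).
by eqsum v;rewrite mulrA.
Qed.

Section Associative.
Variable N : R.
Hypothesis N0 : 0 < N.
Hypothesis HCA : forall A : K -> K -> R, antisym A -> \sum_a CA C A a ^+ 2 <= N*etasq A.
Hypothesis HgA : forall A : K -> K -> R, antisym A ->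
 \sum_a \sum_b gA C A a b ^+ 2 <= 2 * \sum_a CA C A a ^+ 2.
Hypotheses (HT : 9*N*(phi*sigma) ^+ 2 <= 2*KT) (HV : 3*x ^+ 2*(1 - x) <= KV).

(** The Gram tensor of the purely horizontal normal part over an associative algebra: products of
    Hermitian products are split into real parts, which give deltas, and imaginary parts, which give
    [C a]. *)
Definition assocHH : @tens4 R S := fun s u t v =>
 (2 - x)*((s == u)%:R*(t == v)%:R)+(1 - x)*((s == t)%:R*(u == v)%:R +
  (s == v)%:R*(u == t)%:R + \sum_a (C a s t*C a u v+C a s v*C a u t)).

Lemma PHH_assoc A : antisym A ->
 PHH assocHH A = etasq A+(1 - x) * \sum_a (CA C A a ^+ 2+PC C A a).
move=> aA;pose et s t := A (iH s) (iH t).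
have aet s t : et t s = - et s t by exact: aA.
have E1 : \sum_s \sum_t \sum_u \sum_v et s t*et u v*((s == u)%:R*(t == v)%:R) = etasq A.
 by rewrite (sum_deltas (fun s t u v => et s t*et u v));eqsum s;
  eqsum t;rewrite expr2.
have E2 : \sum_s \sum_t \sum_u \sum_v et s t*et u v*((s == t)%:R*(u == v)%:R) = 0.
 rewrite big1 // => s _;rewrite big1 // => t _;rewrite big1 // => u _;rewrite big1 // => v _.
 have [<-|_] := eqVneq s t;last by rewrite mul0r mulr0.
 have h : et s s = 0 by have := aet s s;move: (et s s) => e;lra.
 by rewrite h !mul0r.
have E3 : \sum_s \sum_t \sum_u \sum_v et s t*et u v*((s == v)%:R*(u == t)%:R) = - etasq A.
 rewrite -E1 -sumrN;eqsum s;rewrite -sumrN;eqsum t.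
 rewrite exchange_big -sumrN;eqsum u => /=;rewrite -sumrN;eqsum v.
 by rewrite (aet u v) (eq_sym v t);ring.
have E4 a : \sum_s \sum_t \sum_u \sum_v et s t*et u v*(C a s t*C a u v) = CA C A a ^+ 2.
 rewrite /CA expr2 mulr_suml;eqsum s;rewrite mulr_suml;eqsum t.
 distrsum u;distrsum v;rewrite /et;ring.
have E5 a : \sum_s \sum_t \sum_u \sum_v et s t*et u v*(C a s v*C a u t) = PC C A a.
 rewrite /PC;eqsum s;eqsum t.
 swapsum u => /=;eqsum v.
 by rewrite -/(et s t) -/(et u v) (aet u v) (Cskew a t v);ring.
have E6 : \sum_a (CA C A a ^+ 2+PC C A a) = \sum_s \sum_t \sum_u \sum_v
  et s t*et u v * \sum_a (C a s t*C a u v+C a s v*C a u t).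
 transitivity (\sum_a \sum_s \sum_t \sum_u \sum_v
  et s t*et u v*(C a s t*C a u v+C a s v*C a u t)).
  eqsum a;rewrite -E4 -E5 -big_split;eqsum s.
  rewrite -big_split;eqsum t;rewrite -big_split;eqsum u.
  by rewrite -big_split;eqsum v;rewrite mulrDr.
 swapsum s => /=;swapsum t => /=.
 swapsum u => /=;swapsum v => /=.
 by rewrite mulr_sumr.
pose q1 : @tens4 R S := fun s t u v => (s == u)%:R*(t == v)%:R.
pose q2 : @tens4 R S := fun s t u v => (s == t)%:R*(u == v)%:R.
pose q3 : @tens4 R S := fun s t u v => (s == v)%:R*(u == t)%:R.
pose q4 : @tens4 R S := fun s t u v => \sum_a (C a s t*C a u v+C a s v*C a u t).
have -> : PHH assocHH A = bform (fun s t u v =>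
 (fun s t u v => (2 - x)*q1 s t u v) s t u v+(fun s t u v => (1 - x) *
  (fun s t u v => (fun s t u v => q2 s t u v+q3 s t u v) s t u v+q4 s t u v) s t u v)
  s t u v) et by [].
rewrite bformD !bformZ bformD bformD.
have -> : bform q1 et = etasq A by exact: E1.
have -> : bform q2 et = 0 by exact: E2.
have -> : bform q3 et = - etasq A by exact: E3.
rewrite E6 -/(bform q4 et);move: (bform q4 et) (etasq A) => b e;ring.
Qed.

Lemma assoc_strong_psd : strong_psd (gramq (model_gram C KT KV x phi sigma assocHH)).
(* [c2] is chosen to remove the [gC] term on vertical-horizontal bivectors, [c3] to cancel the sum
   of [PC] contributed by [assocHH]. *)
apply: (@model_strong_psd _ (sigma ^+ 2 / 2) ((1 - x) / 2)) => A aA.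
rewrite (PHH_assoc aA).
pose Z := \sum_a CA C A a ^+ 2;pose P := \sum_a PC C A a.
have -> : \sum_a (CA C A a ^+ 2+PC C A a) = Z+P by rewrite big_split.
have -> : \sum_a (CA C A a ^+ 2 - 2 * PC C A a) = Z - 2 * P by rewrite sumrB -mulr_sumr.
have h1 := sum_square_completed (k := 2*KT) (m := 6*(phi*sigma)) (e := N^-1)
 (fun a => A iT (iV a)) (CA C A).
have h2 := sum_square_completed (k := KV) (m := - (3*sigma ^+ 2)) (e := 3 / 4*(1 - x))
 (fun p : D*D => A (iV p.1) (iV p.2)) (fun p => gA C A p.1 p.2).
have {}h1 := h1 _ _ _;have {}h2 := h2 _ _ _.
have k1 : 0 <= 2*KT by rewrite mulr_ge0.
have k2 : 0 <= N^-1 by rewrite invr_ge0 ltW.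
have k3 : (6*(phi*sigma)) ^+ 2 <= 4*(2*KT) / N.
 by rewrite ler_pdivlMr //;have := HT;move: (phi*sigma) => z;lra.
have k4 : 0 <= 3 / 4*(1 - x) by rewrite mulr_ge0 ?subr_ge0 //;lra.
have k5 : (- (3*sigma ^+ 2)) ^+ 2 <= 4*KV*(3 / 4*(1 - x)).
 have x1' : 0 <= 1 - x by rewrite subr_ge0.
 have := ler_wpM2r x1' HV;rewrite sx;move: (1 - x) => X;nra.
have {}h1 := h1 k1 k2 k3;have {}h2 := h2 KV0 k4 k5.
rewrite -/Z in h1.
have pe (F : D -> D -> R) : \sum_(p : D*D) F p.1 p.2 = \sum_a \sum_b F a b.
 by rewrite pair_bigA.
rewrite (pe (fun a b => A (iV a) (iV b) ^+ 2)) (pe (fun a b => A (iV a) (iV b) * gA C A a b))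
 (pe (fun a b => gA C A a b ^+ 2)) in h2.
have h3 := HCA aA;have h4 := HgA aA;rewrite -/Z in h3 h4.
have h5 : N^-1 * Z <= etasq A by rewrite mulrC ler_pdivrMr // mulrC.
have h6 : 0 <= \sum_a \sum_s A (iV a) (iH s) ^+ 2.
 by rewrite sumr_ge0 // => a _;rewrite sumr_ge0 // => s _;exact: sqr_ge0.
move: h1 h2 h4 h5 h6 k4.
move: (\sum_a A iT (iV a) ^+ 2) (\sum_a _*CA C A a) (\sum_a \sum_b A _ _ ^+ 2)
 (\sum_a \sum_b A _ _ * gA _ _ _ _) (\sum_a \sum_b gA _ _ _ _ ^+ 2)
 (\sum_a \sum_s A _ _ ^+ 2) (\sum_a \sum_b \sum_s \sum_t _) (etasq A) (N^-1 * Z).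
rewrite sx => p1 p2 p3 p4 p5 p6 p7 p8 p9 h1 h2 h4 h5 h6 k4.
have h7 : 0 <= 2*(x - x*(1 - x)) * p6.
 by rewrite mulr_ge0 // (_ : x - x*(1 - x) = x ^+ 2) ?mulr_ge0 ?sqr_ge0 //;ring.
have h8 := ler_wpM2l k4 h4.
have -> : 2*(x*(1 - x)) - 4*(x*(1 - x) / 2) = 0 by field.
rewrite mul0r addr0.
move: h1 h2 h5 h7 h8;move: (2*(x - _) * p6) => q1.
move: (phi*sigma) => z.
have -> : 2*(x*(1 - x)) + 2*(x*(1 - x) / 2) = 3*(x*(1 - x)) by field.
move: (x*(1 - x)) => y h1 h2 h5 h7 h8;lra.
Qed.

End Associative.

Section Octonionic.
Variable M : R.
Hypothesis HPC : forall A : K -> K -> R, antisym A ->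
 \sum_a PC C A a = 3*etasq A - \sum_a CA C A a ^+ 2.
Hypothesis HZ : forall A : K -> K -> R, antisym A ->
 \sum_a CA C A a ^+ 2 + 2^-1*(\sum_a \sum_b gA C A a b ^+ 2) = 8*etasq A.
Hypotheses (HT : 90*(phi*sigma) ^+ 2 <= KT) (HM : 1000 <= M)
 (HV : x ^+ 2 * M <= KV*(1+x * M)).

(** In the Cayley plane the horizontal space is a single octonionic line, on which the quadratic map
    is the inner product times a fixed vector; the two contributions [2 - x] and [2 * (1 - x)] add
    up to this factor. *)
Definition octHH : @tens4 R S := fun s u t v =>
 (1 + 3*(1 - x))*((s == u)%:R*(t == v)%:R).

Lemma PHH_oct A : PHH octHH A = (1 + 3*(1 - x))*etasq A.
transitivity ((1 + 3*(1 - x)) * \sum_s \sum_t \sum_u \sum_v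
 (A (iH s) (iH t)*A (iH u) (iH v))*((s == u)%:R*(t == v)%:R)).
 rewrite /PHH !mulr_sumr;eqsum s;rewrite !mulr_sumr;eqsum t.
 rewrite !mulr_sumr;eqsum u;rewrite !mulr_sumr;eqsum v.
 by rewrite /octHH mulrCA mulrA.
rewrite (sum_deltas (fun s t u v => A (iH s) (iH t)*A (iH u) (iH v)));congr (_ * _).
Qed.

(** For large [M] the lower bound on [KV] approaches [x], and the claim becomes [4 * x * (3 - 4 * x)
    ^ 2 <= 1 + 21 / 5 * (1 - x)] for [x] up to 3/4. This is true with margin 1/20, almost attained
    near [x = 3 / 10]; the margin pays for the correction of order [1 / M] once [M / 20] is at least
    36. *)
Lemma oct_slope (mu : R) : mu = Num.min x (3*(1 - x)) ->
 4*(x*(3*(1 - x) - mu)) ^+ 2 <= KV*(1 + 21 / 5*(1 - x)).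
have X0 : 0 <= 1 - x by rewrite subr_ge0.
have c0 : 0 <= 1 + 21 / 5*(1 - x) by lra.
have [xl|xl] := leP (3*(1 - x)) x;move=> ->.
 by rewrite subrr mulr0 expr0n mulr0 mulr_ge0.
have M0 : 0 <= M by move: HM => h;lra.
have xM0 : 0 <= x * M by exact: mulr_ge0.
have xM : 0 < 1+x * M by lra.
rewrite -(ler_pM2r xM) [leRHS]mulrAC.
apply: le_trans (ler_wpM2r c0 HV).
have -> : 4*(x*(3*(1 - x) - x)) ^+ 2*(1+x * M) =
 x ^+ 2*(4*(3 - 4*x) ^+ 2*(1+x * M)) by ring.
have -> : x ^+ 2 * M*(1 + 21 / 5*(1 - x)) = x ^+ 2*(M*(1 + 21 / 5*(1 - x))) by ring.
rewrite ler_wpM2l ?sqr_ge0 //.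
have p : 4*x*(3 - 4*x) ^+ 2 + 1 / 20 <= 1 + 21 / 5*(1 - x).
 (* The cubic is expanded around the tight point. The remainder is visibly positive for [u] at most
    45/100, which is the range [x <= 3 / 4]. *)
 pose u := x - 3 / 10;have u1 : u <= 45 / 100 by rewrite /u;lra.
 have -> : 4*x*(3 - 4*x) ^+ 2 + 1 / 20 = 1 + 21 / 5*(1 - x) -
  (1 / 500 + 3 / 25*u + 48 / 5*u ^+ 2 + 64*(45 / 100 - u)*u ^+ 2) by rewrite /u;field.
 have h1 : 0 <= 64*(45 / 100 - u)*u ^+ 2 by rewrite mulr_ge0 ?sqr_ge0 //;lra.
 have h2 : 0 <= 1 / 500 + 3 / 25*u + 48 / 5*u ^+ 2 by nra.
 lra.
have h9 : 4*(3 - 4*x) ^+ 2 <= 36 by move: x0 x1 => h1 h2;nra.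
have p1 := ler_wpM2l M0 p.
have p2 : 36 <= M*(1 / 20) by move: HM => h;lra.
apply: le_trans p1;rewrite [leRHS]mulrDr.
have -> : 4*(3 - 4*x) ^+ 2*(1+x * M) = M*(4*x*(3 - 4*x) ^+ 2) + 4*(3 - 4*x) ^+ 2 by ring.
by rewrite lerD2l (le_trans h9).
Qed.

Lemma oct_strong_psd : strong_psd (gramq (model_gram C KT KV x phi sigma octHH)).
pose mu := Num.min x (3*(1 - x)).
have X0 : 0 <= 1 - x by rewrite subr_ge0.
have mu0 : 0 <= mu by rewrite le_min x0 mulr_ge0.
have mux : mu <= x by rewrite ge_min lexx.
(* [mu] trades the [gC] term against the coupling of the vertical block with [gA]: [mu <= x] keeps
   the former nonnegative, and the value [3 * (1 - x)] removes the latter. With this [c3], the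
   identities [HPC] and [HZ] leave the weight [(1 + 21 / 5 * (1 - x)) / 16] for the squares of [gA]
   and at least 1/20 for those of [CA]. *)
apply: (@model_strong_psd _ ((sigma ^+ 2 - x * mu) / 2) (- (1 - x) / 5)) => A aA.
have clE a b s t : GC C a b s t = (a == b)%:R*(s == t)%:R+gC C a b s t.
 have := clifford a b s t;rewrite /gC;move: ((a == b)%:R*(s == t)%:R) => d;lra.
pose W := \sum_a \sum_b \sum_s \sum_t A (iV a) (iH s)*A (iV b) (iH t) * gC C a b s t.
(* By the Clifford relation, [W] completes the sum of squares of the vertical-horizontal block to
   the squared length of its image under the generators. *)
have hW : 0 <= \sum_a \sum_s A (iV a) (iH s) ^+ 2+W.
 have -> : \sum_a \sum_s A (iV a) (iH s) ^+ 2+W =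
   \sum_u (\sum_a \sum_s A (iV a) (iH s)*C a s u) ^+ 2;last first.
  by rewrite sumr_ge0 // => u _;exact: sqr_ge0.
 transitivity (\sum_a \sum_b \sum_s \sum_t A (iV a) (iH s)*A (iV b) (iH t) * GC C a b s t).
  rewrite -big_split;eqsum a => /=.
  have -> : \sum_s A (iV a) (iH s) ^+ 2 =
    \sum_b (\sum_s A (iV a) (iH s)*A (iV b) (iH s))*(b == a)%:R.
   by rewrite sum_eq;eqsum s;rewrite expr2.
  rewrite -big_split;eqsum b => /=;rewrite mulr_suml -big_split;eqsum s => /=.
  have -> : A (iV a) (iH s)*A (iV b) (iH s)*(b == a)%:R =
    \sum_t A (iV a) (iH s)*A (iV b) (iH t)*(b == a)%:R*(t == s)%:R.
   by rewrite sum_eq.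
  rewrite -big_split;eqsum t => /=;rewrite clE (eq_sym b) (eq_sym t);ring.
 rewrite sum4.
 transitivity (\sum_s \sum_t \sum_u (\sum_a A (iV a) (iH s)*C a s u) *
   (\sum_a A (iV a) (iH t)*C a t u)).
  eqsum s;eqsum t.
  under [RHS]eq_bigr => u _ do rewrite mulr_suml.
  rewrite [RHS]exchange_big;eqsum a => /=.
  under [RHS]eq_bigr => u _ do rewrite mulr_sumr.
  rewrite [RHS]exchange_big;eqsum b => /=.
  rewrite /GC mulr_sumr;eqsum u;ring.
 under eq_bigr do rewrite exchange_big.
 swapsum u => /=.
 rewrite [in RHS]exchange_big expr2 mulr_suml;eqsum s.
 by rewrite mulr_sumr.
rewrite PHH_oct;set Z := \sum_a CA C A a ^+ 2.
have -> : \sum_a (CA C A a ^+ 2 - 2 * PC C A a) = 3 * Z - 6*etasq A.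
 rewrite sumrB -mulr_sumr (HPC aA) -/Z;ring.
have h0 := HZ aA;rewrite -/Z in h0.
have h1 := sum_square_completed (k := 2*KT) (m := 6*(phi*sigma)) (e := 1 / 20)
 (fun a => A iT (iV a)) (CA C A).
have h2 := sum_square_completed (k := KV) (m := - (x*(3*(1 - x) - mu)))
 (e := (1 + 21 / 5*(1 - x)) / 16)
 (fun p : D*D => A (iV p.1) (iV p.2)) (fun p => gA C A p.1 p.2).
have k1 : 0 <= 2*KT by rewrite mulr_ge0.
have k2 : 0 <= 1 / 20 :> R by lra.
have k3 : (6*(phi*sigma)) ^+ 2 <= 4*(2*KT)*(1 / 20).
 by have := HT;move: (phi*sigma) => z;lra.
have k4 : 0 <= (1 + 21 / 5*(1 - x)) / 16 by lra.
have k5 : (- (x*(3*(1 - x) - mu))) ^+ 2 <= 4*KV*((1 + 21 / 5*(1 - x)) / 16).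
 have := oct_slope (erefl mu);rewrite sqrrN.
 move: (x*(3*(1 - x) - mu)) (1 + _) => p q;lra.
have {}h1 := h1 k1 k2 k3;have {}h2 := h2 KV0 k4 k5.
rewrite -/Z in h1.
have pe (F : D -> D -> R) : \sum_(p : D*D) F p.1 p.2 = \sum_a \sum_b F a b.
 by rewrite pair_bigA.
rewrite (pe (fun a b => A (iV a) (iV b) ^+ 2)) (pe (fun a b => A (iV a) (iV b) * gA C A a b))
 (pe (fun a b => gA C A a b ^+ 2)) in h2.
have h6 : 0 <= \sum_a \sum_s A (iV a) (iH s) ^+ 2.
 by rewrite sumr_ge0 // => a _;rewrite sumr_ge0 // => s _;exact: sqr_ge0.
have Z0 : 0 <= Z by rewrite sumr_ge0 // => a _;exact: sqr_ge0.
rewrite -/W;move: h0 h1 h2 h6 hW.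
move: (\sum_a A iT (iV a) ^+ 2) (\sum_a _*CA C A a) (\sum_a \sum_b A _ _ ^+ 2)
 (\sum_a \sum_b A _ _ * gA _ _ _ _) (\sum_a \sum_b gA _ _ _ _ ^+ 2)
 (\sum_a \sum_s A _ _ ^+ 2) W (etasq A).
rewrite sx => p1 p2 p3 p4 p5 p6 p7 p8 h0 h1 h2 h6 hW.
have g1 : 0 <= 2*(x - x*(1 - x)) * p6+(2*(x*(1 - x)) - 4*((x*(1 - x) - x * mu) / 2)) * p7.
 have -> : 2*(x - x*(1 - x)) * p6+(2*(x*(1 - x)) - 4*((x*(1 - x) - x * mu) / 2)) * p7 =
  2*(x * mu)*(p6+p7) + 2*(x*(x - mu)) * p6 by field.
 by rewrite addr_ge0 // !mulr_ge0 // subr_ge0.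
have g2 : 0 <= (1 - x) * Z by rewrite mulr_ge0.
have -> : 2*(x*(1 - x)) + 2*((x*(1 - x) - x * mu) / 2) = x*(3*(1 - x) - mu) by field.
have g3 : Z <= 8 * p8 - 2^-1 * p5 by rewrite -h0 addrK.
have -> : p8 = (Z + 2^-1 * p5) / 8 by rewrite h0;field.
have x1' : (1 - x) * Z <= Z by rewrite ler_piMl // lerBlDr lerDl.
move: h1 h2 g1 g2 x1'.
move: (x*(3*(1 - x) - mu)) (2*(x - _) * p6) (_ * p7) (phi*sigma) => m1 m2 m3 m4.
move=> h1 h2 g1 g2 x1';move: h0 h1 h2 g1 g2 x1' g3.
move: Z Z0 => z Z0;move: (1 - x) => X *.
have : X*(z + 2^-1 * p5) = X*z+X * p5 / 2 by field.
lra.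
Qed.

End Octonionic.

End ModelPositivity.

(** * Derivatives of radially weighted quadratic maps *)

Section ConeDerivatives.
Context {R : realType} {n : nat}.
Implicit Types (u v w : 'rV[R]_n).

Lemma dotDr u v w : dot w (u+v) = dot w u+dot w v.
by rewrite !(dotC w) dotDl. Qed.

Lemma dotZr (a : R) u v : dot u (a *: v) = a*dot u v.
by rewrite !(dotC u) dotZl. Qed.

Lemma dotNl u v : dot (- u) v = - dot u v.
by rewrite -scaleN1r dotZl mulN1r. Qed.

Lemma dotNr u v : dot u (- v) = - dot u v.
by rewrite !(dotC u) dotNl. Qed.

Lemma dot0r u : dot u 0 = 0.
by rewrite dotC dot0l. Qed.

Lemma dot_sumr (I : finType) u (F : I -> 'rV[R]_n) : dot u (\sum_a F a) = \sum_a dot u (F a).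
rewrite /dot exchange_big /=;eqsum i.
by rewrite summxE mulr_sumr.
Qed.

Lemma dot_delta u i : dot u (delta_mx 0 i) = u 0 i.
rewrite /dot (bigD1 i) //= mxE !eqxx mulr1 big1 ?addr0 // => j /negPf ij.
by rewrite mxE ij andbF mulr0.
Qed.

Lemma rowDE m (u v : 'rV[R]_m) j : (u+v) 0 j = u 0 j+v 0 j.
by rewrite mxE. Qed.

Lemma rowZE m (a : R) (u : 'rV[R]_m) j : (a *: u) 0 j = a*u 0 j.
by rewrite mxE. Qed.

(** The diagonal entry of the orthogonal projection onto the line spanned by [(w, 1)]: it is 1 at
    the centre of a cell and tends to 0 at infinity. *)
Definition invP w : R := (1+sqnorm w)^-1.

Definition punct : set 'rV[R]_n := [set w | 0 < sqnorm w].

Lemma open_punct : open punct.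
exact: open_sqnorm_gt. Qed.

Lemma invP_itv w : punct w -> 0 < invP w < 1.
move=> w0;have h : 0 < 1+sqnorm w by rewrite ltr_wpDr // sqnorm_ge0.
by rewrite invr_gt0 h invf_lt1 // ltrDl.
Qed.

Lemma smooth_invP U : open U -> smooth_on U invP.
move=> oU;apply: (smooth_comp1 oU smooth1_inv).
 by apply: (smoothD oU);[exact: smooth_cst|exact: smooth_sqnorm].
by move=> w _;rewrite /= gt_eqF // ltr_wpDr // sqnorm_ge0.
Qed.

Lemma dd_invP w i : dd i invP w = - 2 * invP w ^+ 2*w 0 i.
have h : 0 < 1+sqnorm w by rewrite ltr_wpDr // sqnorm_ge0.
have s1 : smooth_on setT (fun w : 'rV[R]_n => 1+sqnorm w).
 by apply: (smoothD openT);[exact: smooth_cst|exact: (smooth_sqnorm openT)].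
have di : is_derive (1+sqnorm w) (1 : R) (fun t : R => t^-1) (- (1+sqnorm w) ^- 2).
 have := derV (g := id) (lt0r_neq0 h) (is_derive_id (1+sqnorm w) 1).
 by rewrite mulr1.
rewrite (dd_comp1 (p := fun t => t^-1) i (smooth_diff openT s1 I) di).
rewrite (ddD (U := setT)) //;[|exact: smooth_cst|exact: (smooth_sqnorm openT)].
rewrite dd_cst add0r dd_sqnorm /invP -exprVn;move: (_^-1) => t;ring.
Qed.

Definition uitv : set R := [set t : R | 0 < t < 1].

Section Radial.
Variables (f f1 f2 : R -> R).
Hypotheses (sf : smooth1 uitv f) (sf1 : smooth1 uitv f1).
Hypothesis df : forall t, uitv t -> is_der t f (f1 t).
Hypothesis df1 : forall t, uitv t -> is_der t f1 (f2 t).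

(** The gradient of [f (invP w)] is [rad1] times the position vector, and the gradient of [rad1] is
    [rad2] times it. *)
Definition rad1 w : R := - 2 * invP w ^+ 2*f1 (invP w).
Definition rad2 w : R :=
 - 2 * invP w ^+ 2*(- 4 * invP w*f1 (invP w) - 2 * invP w ^+ 2*f2 (invP w)).

Let sP := smooth_invP open_punct.

Lemma smooth_radial : smooth_on punct (fun w => f (invP w)).
by apply: (smooth_comp1 open_punct sf sP) => w;exact: invP_itv. Qed.

Lemma dd_radial w i : punct w -> dd i (fun y => f (invP y)) w = rad1 w*w 0 i.
move=> w0;rewrite (dd_comp1 (p := f) (f := invP) i _ (df (invP_itv w0)));last first.
 exact: (smooth_diff open_punct sP w0).
by rewrite dd_invP /rad1;move: (f1 (invP w)) (invP w) => a b;ring.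
Qed.

Lemma smooth_rad1 : smooth_on punct rad1.
have s1 : smooth_on punct (fun w => f1 (invP w)).
 by apply: (smooth_comp1 open_punct sf1 sP) => w;exact: invP_itv.
have -> : rad1 = fun w => - 2*((invP w * invP w)*f1 (invP w)).
 by apply/funext => w;rewrite /rad1;ring.
apply: (smoothZ open_punct);apply: (smoothM open_punct) => //.
exact: (smoothM open_punct).
Qed.

Lemma dd_rad1 w i : punct w -> dd i rad1 w = rad2 w*w 0 i.
move=> w0.
have s1 : smooth_on punct (fun w => f1 (invP w)).
 by apply: (smooth_comp1 open_punct sf1 sP) => y;exact: invP_itv.
have sPP := smoothM open_punct sP sP.
have -> : rad1 = fun w => - 2*((invP w * invP w)*f1 (invP w)).
 by apply/funext => y;rewrite /rad1;ring.
rewrite (ddZ _ _ (smoothM open_punct sPP s1) w0) (ddM _ sPP s1 w0) (ddM _ sP sP w0).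
rewrite (dd_comp1 (p := f1) (f := invP) i _ (df1 (invP_itv w0)));last first.
 exact: (smooth_diff open_punct sP w0).
rewrite dd_invP /rad2;move: (f1 (invP w)) (f2 (invP w)) (invP w) (w 0 i) => a b c d;ring.
Qed.

Variable g : 'rV[R]_n -> R.
Hypothesis sg : smooth_on setT g.

Let sg' : smooth_on punct g.
by apply: smoothW sg. Qed.

Lemma smooth_radialM : smooth_on punct (fun w => f (invP w) * g w).
exact: (smoothM open_punct smooth_radial sg'). Qed.

Lemma dd_radialM w i : punct w ->
 dd i (fun y => f (invP y) * g y) w = f (invP w)*dd i g w+g w*(rad1 w*w 0 i).
by move=> w0;rewrite (ddM _ smooth_radial sg' w0) dd_radial. Qed.

Lemma dd2_radialM w i j : punct w ->
 dd i (dd j (fun y => f (invP y) * g y)) w =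
 f (invP w)*dd i (dd j g) w+rad1 w*w 0 i*dd j g w+rad1 w*w 0 j*dd i g w
+g w*(rad2 w*w 0 i*w 0 j+rad1 w*(i == j)%:R).
move=> w0;have oU := open_punct.
have sr : smooth_on punct (fun y : 'rV[R]_n => rad1 y*y 0 j).
 by apply: (smoothM oU);[exact: smooth_rad1|exact: smooth_on_coord].
rewrite (dd_eq_on (g := fun y => f (invP y)*dd j g y+g y*(rad1 y*y 0 j)) i oU _ w0);last first.
 by move=> y y0;exact: dd_radialM.
have sgj : smooth_on punct (dd j g) by exact: smooth_dd.
rewrite (ddD _ (smoothM oU smooth_radial sgj) (smoothM oU sg' sr) w0).
rewrite (ddM _ smooth_radial sgj w0) (ddM _ sg' sr w0) (dd_radial i w0).
rewrite (ddM _ smooth_rad1 (smooth_on_coord _ j) w0) (dd_rad1 i w0) dd_coord.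
move: (dd i (dd j g) w) (dd i g w) (dd j g w) => a b c;ring.
Qed.

End Radial.

Section Quadratic.
Context {N : nat}.
Variable Qm : 'I_N -> 'M[R]_n.
Hypothesis Qsym : forall l, (Qm l)^T = Qm l.

Definition quad u v : 'rV[R]_N := \row_l dot (u *m Qm l) v.

Lemma quadDl u u' v : quad (u+u') v = quad u v+quad u' v.
by apply/rowP => l;rewrite !mxE mulmxDl dotDl. Qed.

Lemma quadZl (a : R) u v : quad (a *: u) v = a *: quad u v.
by apply/rowP => l;rewrite !mxE -scalemxAl dotZl. Qed.

Lemma quadC u v : quad u v = quad v u.
apply/rowP => l;rewrite !mxE /dot.
under eq_bigr do rewrite mxE mulr_suml.
under [RHS]eq_bigr => i _ do rewrite mxE mulr_suml.
swapsum i;eqsum j => /=.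
by rewrite -{1}(Qsym l) mxE;ring.
Qed.

Lemma quadDr u v v' : quad u (v+v') = quad u v+quad u v'.
by rewrite !(quadC u) quadDl. Qed.

Lemma quadZr (a : R) u v : quad u (a *: v) = a *: quad u v.
by rewrite !(quadC u) quadZl. Qed.

Lemma dd_quad l w j : dd j (fun y => quad y y 0 l) w = 2*(quad w (delta_mx 0 j)) 0 l.
have E : (fun y => quad y y 0 l) = fun y => \sum_k (y *m Qm l) 0 k*y 0 k.
 by apply/funext => y;rewrite mxE.
have sc k : smooth_on setT (fun y : 'rV[R]_n => y 0 k) by exact: smooth_on_coord.
have sl k := smooth_linear (Qm l) k.
rewrite E (dd_sum (U := setT) _ _ openT) // => [|k];last exact: (smoothM openT).
transitivity (\sum_k ((w *m Qm l) 0 k*(j == k)%:R+Qm l j k*w 0 k)).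
 eqsum k;rewrite (ddM (U := setT)) // dd_coord dd_linear;congr (_ + _).
 by rewrite mulrC.
rewrite big_split /= (bigD1 j) //= eqxx mulr1 big1 ?addr0 => [|k /negPf kj];last first.
 by rewrite eq_sym kj mulr0.
rewrite [quad _ _ 0 l]mxE dot_delta.
have -> : \sum_k Qm l j k*w 0 k = (w *m Qm l) 0 j.
 by rewrite mxE;eqsum k;rewrite mulrC -{1}(Qsym l) mxE.
by rewrite -mulr2n mulr_natl.
Qed.

Lemma dd2_quad l w i j :
 dd i (dd j (fun y => quad y y 0 l)) w = 2*(quad (delta_mx 0 i) (delta_mx 0 j)) 0 l.
rewrite (dd_eq_on (g := fun y => 2*(y *m Qm l) 0 j) i openT _ (I : setT w));last first.
 by move=> y _;rewrite dd_quad mxE dot_delta.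
rewrite (ddZ _ _ (smooth_linear (Qm l) j)) // dd_linear.
by rewrite mxE dot_delta -rowE mxE.
Qed.

Lemma smooth_quad l : smooth_on setT (fun y => quad y y 0 l).
have -> : (fun y => quad y y 0 l) = fun y => \sum_k (y *m Qm l) 0 k*y 0 k.
 by apply/funext => y;rewrite mxE.
apply: (smooth_sum openT) => k;apply: (smoothM openT);[exact: smooth_linear|exact: smooth_on_coord].
Qed.

Section Cone.
Variables (a b c : R -> R).

Definition cone w : 'rV[R]_(n+(N + 1)) :=
 row_mx (a (invP w) *: w) (row_mx (b (invP w) *: quad w w) (const_mx (c (invP w)))).

Variables (a1 a2 b1 b2 c1 c2 : R -> R).
Hypotheses (sa : smooth1 uitv a) (sa1 : smooth1 uitv a1).
Hypothesis da : forall t, uitv t -> is_der t a (a1 t).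
Hypothesis da1 : forall t, uitv t -> is_der t a1 (a2 t).
Hypotheses (sb : smooth1 uitv b) (sb1 : smooth1 uitv b1).
Hypothesis db : forall t, uitv t -> is_der t b (b1 t).
Hypothesis db1 : forall t, uitv t -> is_der t b1 (b2 t).
Hypotheses (sc : smooth1 uitv c) (sc1 : smooth1 uitv c1).
Hypothesis dc : forall t, uitv t -> is_der t c (c1 t).
Hypothesis dc1 : forall t, uitv t -> is_der t c1 (c2 t).

Definition cone_d w u : 'rV[R]_(n+(N + 1)) :=
 row_mx (a (invP w) *: u+(rad1 a1 w*dot w u) *: w)
  (row_mx ((2*b (invP w)) *: quad w u+(rad1 b1 w*dot w u) *: quad w w)
   (const_mx (rad1 c1 w*dot w u))).

Definition cone_dd w u v : 'rV[R]_(n+(N + 1)) :=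
 row_mx ((rad1 a1 w*dot w u) *: v+(rad1 a1 w*dot w v) *: u +
   (rad2 a1 a2 w*dot w u*dot w v+rad1 a1 w*dot u v) *: w)
  (row_mx ((2*b (invP w)) *: quad u v+(2*rad1 b1 w*dot w u) *: quad w v +
    (2*rad1 b1 w*dot w v) *: quad w u +
    (rad2 b1 b2 w*dot w u*dot w v+rad1 b1 w*dot u v) *: quad w w)
   (const_mx (rad2 c1 c2 w*dot w u*dot w v+rad1 c1 w*dot u v))).

Lemma row_mx_ind (Pr : 'I_(n+(N + 1)) -> Prop) :
 (forall k, Pr (lshift _ k)) -> (forall l, Pr (rshift n (lshift 1 l))) ->
 Pr (rshift n (rshift N 0)) -> forall j, Pr j.
move=> h1 h2 h3 j;case: (split_ordP j) => [k ->|k ->] //.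
by case: (split_ordP k) => [l ->|l ->] //;rewrite ord1.
Qed.

Let coneL k : (fun w => cone w 0 (lshift _ k)) = fun w => a (invP w)*w 0 k.
by apply/funext => w;rewrite row_mxEl mxE. Qed.

Let coneM l : (fun w => cone w 0 (rshift n (lshift 1 l))) = fun w => b (invP w)*quad w w 0 l.
by apply/funext => w;rewrite row_mxEr row_mxEl !mxE. Qed.

Let coneR : (fun w => cone w 0 (rshift n (rshift N 0))) = fun w => c (invP w).
by apply/funext => w;rewrite !row_mxEr mxE. Qed.

Let scrd k : smooth_on setT (fun y : 'rV[R]_n => y 0 k).
exact: smooth_on_coord. Qed.

Lemma smooth_cone j : smooth_on punct (crd cone j).
elim/row_mx_ind: j => [k|l|];rewrite ?coneL ?coneM ?coneR.
- exact: smooth_radialM.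
- apply: smooth_radialM => //;exact: smooth_quad.
- exact: smooth_radial.
Qed.

Lemma cone_dE w j u : punct w ->
 \sum_i u 0 i*dd i (crd cone j) w = cone_d w u 0 j.
move=> w0;have dotE : dot w u = \sum_i u 0 i*w 0 i by eqsum i;rewrite mulrC.
elim/row_mx_ind: j => [k|l|];rewrite ?coneL ?coneM ?coneR.
- under eq_bigr do rewrite (dd_radialM sa da (scrd k)) // dd_coord mulrDr.
 rewrite big_split /= row_mxEl !mxE (bigD1 k) //= eqxx mulr1 big1 ?addr0 => [|i /negPf ik];last first.
  by rewrite ik !mulr0.
 rewrite mulrC dotE mulr_sumr mulr_suml;congr (_ + _);eqsum i;ring.
- under eq_bigr do rewrite (dd_radialM sb db (smooth_quad l)) // dd_quad mulrDr.
 rewrite big_split /= row_mxEr row_mxEl rowDE !rowZE;congr (_ + _).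
  rewrite !mxE dotC /dot mulr_sumr;eqsum i;rewrite mxE dot_delta;ring.
 rewrite dotE mulr_sumr mulr_suml;eqsum i;ring.
- under eq_bigr do rewrite (dd_radial dc) //.
 rewrite !row_mxEr mxE dotE mulr_sumr;eqsum i;ring.
Qed.

Lemma cone_ddE w j i k : punct w ->
 dd i (dd k (crd cone j)) w = cone_dd w (delta_mx 0 i) (delta_mx 0 k) 0 j.
move=> w0;have deltaE : dot (delta_mx 0 i) (delta_mx 0 k : 'rV[R]_n) = (i == k)%:R.
 by rewrite dot_delta mxE eqxx /= eq_sym.
elim/row_mx_ind: j => [p|l|];rewrite ?coneL ?coneM ?coneR.
- rewrite (dd2_radialM sa sa1 da da1 (scrd p)) // !dd_coord.
 have -> : dd i (dd k (fun y : 'rV[R]_n => y 0 p)) w = 0.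
  rewrite (dd_eq_on (g := fun=> (k == p)%:R) i openT _ (I : setT w)) ?dd_cst // => y _.
  by rewrite dd_coord.
 rewrite row_mxEl !rowDE !rowZE deltaE !dot_delta !mxE !eqxx /= (eq_sym p k) (eq_sym p i);ring.
- rewrite (dd2_radialM sb sb1 db db1 (smooth_quad l)) // !dd_quad dd2_quad.
 rewrite row_mxEr row_mxEl !rowDE !rowZE deltaE !dot_delta;ring.
- have sr := smooth_rad1 sc1.
 rewrite (dd_eq_on (g := fun y => rad1 c1 y*y 0 k) i open_punct _ w0);last first.
  by move=> y y0;exact: (dd_radial dc).
 rewrite (ddM _ sr (smooth_on_coord _ k) w0) (dd_rad1 sc1 dc1 i w0) dd_coord.
 rewrite !row_mxEr mxE deltaE !dot_delta;ring.
Qed.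

End Cone.
End Quadratic.
End ConeDerivatives.

(** * The model tensor evaluated on coordinate vectors *)

Section PullModel.
Context {R : realType} {n d m : nat}.
Local Notation K := (unit+('I_d + 'I_m))%type.
Variables (Cm : 'I_d -> 'M[R]_m) (KT KV x phi sigma : R) (HH : @tens4 R 'I_m).
Variables (t : 'I_n -> R) (v : 'I_n -> 'rV[R]_d) (Y : 'I_n -> 'rV[R]_m).

Local Notation C := (fun a s u => Cm a s u).

(** Coefficients of the [i]-th coordinate vector in the frame. The vertical and horizontal
    coefficients may live in spaces larger than those they describe, so the matrix need not be
    square. *)
Definition coord (i : 'I_n) (p : K) : R :=
 match p with inl _ => t i | inr (inl a) => v i 0 a | inr (inr s) => Y i 0 s end.

Definition act (a : 'rV[R]_d) (y : 'rV[R]_m) : 'rV[R]_m := \sum_c a 0 c *: (y *m Cm c).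

Definition ev i k (f : K -> K -> R) : R := \sum_p \sum_r coord i p*coord k r*f p r.

Definition HH4 i k j l : R := \sum_s \sum_u \sum_s' \sum_u'
 Y i 0 s*Y k 0 u*(Y j 0 s'*Y l 0 u') * HH s u s' u'.

Definition ymix i k : 'rV[R]_m :=
 phi *: (t i *: Y k+t k *: Y i)+sigma *: (act (v i) (Y k)+act (v k) (Y i)).

Lemma actE a y u : act a y 0 u = \sum_c \sum_s a 0 c*(y 0 s*Cm c s u).
rewrite /act summxE;eqsum c;rewrite mxE mxE mulr_sumr.
by eqsum s.
Qed.

Lemma ev_eT i k : ev i k eT = t i * t k.
exact: sum_eT. Qed.

Lemma ev_eV i k : ev i k eV = dot (v i) (v k).
exact: sum_eV. Qed.

Lemma ev_eH i k : ev i k eH = dot (Y i) (Y k).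
exact: sum_eH. Qed.

Lemma ev_eY i k u : ev i k (eY C phi sigma u) = ymix i k 0 u.
rewrite /ev sumK.
have e1 : \sum_r coord i iT*coord k r*eY C phi sigma u iT r = phi*(t i*Y k 0 u).
 rewrite sumK mulr0 add0r big1 ?add0r => [|a _];last by rewrite mulr0.
 transitivity (\sum_s (phi * t i*Y k 0 s)*(s == u)%:R);last by rewrite sum_eq mulrA.
 by eqsum s;rewrite /=;ring.
have e2 a : \sum_r coord i (iV a)*coord k r*eY C phi sigma u (iV a) r =
  sigma * \sum_s v i 0 a*(Y k 0 s*Cm a s u).
 rewrite sumK mulr0 add0r big1 ?add0r => [|b _];last by rewrite mulr0.
 by distrsum s;rewrite /=;ring.
have e3 s : \sum_r coord i (iH s)*coord k r*eY C phi sigma u (iH s) r =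
  (phi * t k*Y i 0 s)*(s == u)%:R+sigma * \sum_a v k 0 a*(Y i 0 s*Cm a s u).
 rewrite sumK [X in _+(_+X)]big1 ?addr0 => [|b _];last by rewrite mulr0.
 rewrite mulr_sumr;congr (_ + _);first by rewrite /=;ring.
 by eqsum a;rewrite /=;ring.
rewrite e1;under eq_bigr do rewrite e2.
under [X in _+(_+X)]eq_bigr => s _ do rewrite e3.
rewrite big_split /= sum_eq -!mulr_sumr [X in _+(_+(_+sigma*X))]exchange_big /=.
rewrite /ymix !rowDE !rowZE !rowDE !rowZE !actE;ring.
Qed.

Definition evHH i k j l : R := \sum_p \sum_r \sum_q \sum_s
 coord i p*coord k r*(coord j q*coord l s)*eHH HH p r q s.

Lemma evHHE i k j l : evHH i k j l = HH4 i k j l.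
have z p q r s : (if (p, q, r, s) is (inr (inr _), inr (inr _), inr (inr _), inr (inr _))
 then false else true) -> eHH HH p q r s = 0.
 by case: p => [|[]] ?;case: q => [|[]] ?;case: r => [|[]] ?;case: s => [|[]] ?.
have o1 (F : K -> R) : F iT = 0 -> (forall a, F (iV a) = 0) -> \sum_i F i = \sum_s F (iH s).
 by move=> h1 h2;rewrite sumK h1 big1 ?add0r.
rewrite /evHH o1 => [|| a];last 2 first.
- by do 3 (rewrite big1 // => ? _);rewrite z // mulr0.
- by do 3 (rewrite big1 // => ? _);rewrite z // mulr0.
eqsum s;rewrite o1 => [||a];last 2 first.
- by do 2 (rewrite big1 // => ? _);rewrite z // mulr0.
- by do 2 (rewrite big1 // => ? _);rewrite z // mulr0.
eqsum p;rewrite o1 => [||a];last 2 first.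
- by rewrite big1 // => ? _;rewrite z // mulr0.
- by rewrite big1 // => ? _;rewrite z // mulr0.
by eqsum u;rewrite o1 => [//||a];rewrite z // mulr0.
Qed.

Definition pulled i k j l : R :=
 KT*(t i * t k*dot (v j) (v l)+dot (v i) (v k)*(t j * t l))
+phi ^+ 2*(t i * t k*dot (Y j) (Y l)+dot (Y i) (Y k)*(t j * t l))
+dot (ymix i k) (ymix j l)+KV*(dot (v i) (v k)*dot (v j) (v l))
+x*(dot (v i) (v k)*dot (Y j) (Y l)+dot (Y i) (Y k)*dot (v j) (v l))
+HH4 i k j l.

Lemma pulledE i k j l : \sum_p \sum_r \sum_q \sum_s
 coord i p*coord k r*(coord j q*coord l s) * model_gram C KT KV x phi sigma HH p r q s =
 pulled i k j l.
rewrite /pulled -!ev_eT -!ev_eV -!ev_eH -evHHE.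
have -> : dot (ymix i k) (ymix j l) =
  \sum_u ev i k (eY C phi sigma u)*ev j l (eY C phi sigma u).
 by eqsum u;rewrite !ev_eY.
have P f g : ev i k f*ev j l g = \sum_p \sum_r \sum_q \sum_s
  coord i p*coord k r*(coord j q*coord l s)*(f p r * g q s).
 rewrite /ev mulr_suml;eqsum p;rewrite mulr_suml;eqsum r.
 distrsum q;distrsum s;ring.
have -> : \sum_u ev i k (eY C phi sigma u)*ev j l (eY C phi sigma u) =
 \sum_p \sum_r \sum_q \sum_s coord i p*coord k r*(coord j q*coord l s) *
  (\sum_u eY C phi sigma u p r*eY C phi sigma u q s).
 under eq_bigr do rewrite P.
 swapsum p => /=;swapsum r => /=.
 swapsum q => /=;swapsum s => /=.
 by rewrite mulr_sumr.
rewrite !P /evHH -!big_split /= !mulr_sumr -!big_split /=;eqsum p.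
rewrite -!big_split /= !mulr_sumr -!big_split /=;eqsum r.
rewrite -!big_split /= !mulr_sumr -!big_split /=;eqsum q.
rewrite -!big_split /= !mulr_sumr -!big_split /=;eqsum s.
rewrite /model_gram;move: (\sum_u _) => y;ring.
Qed.

Lemma pull_gramq i j k l :
 pull coord (gramq (model_gram C KT KV x phi sigma HH)) i j k l =
 pulled i k j l - pulled i l j k.
rewrite -!pulledE /pull.
transitivity (\sum_p \sum_r \sum_q \sum_s coord i p*coord k r*(coord j q*coord l s) *
  model_gram C KT KV x phi sigma HH p r q s -
 \sum_p \sum_q \sum_r \sum_s coord i p*coord j q*(coord k r*coord l s) *
  model_gram C KT KV x phi sigma HH p s q r).
 rewrite -sumrB;eqsum p.
 rewrite [X in _ = X - _]exchange_big -sumrB;eqsum q => /=.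
 rewrite -sumrB;eqsum r;rewrite -sumrB;eqsum s.
 rewrite /gramq;move: (model_gram _ _ _ _ _ _ _ p r q s) (model_gram _ _ _ _ _ _ _ p s q r) => a b;ring.
congr (_ - _);eqsum p;rewrite [RHS]exchange_big;eqsum q => /=.
swapsum r => /=;eqsum s;ring.
Qed.

End PullModel.

(** * The second fundamental form of a cone at one point *)

Section PointAlgebra.
Context {R : realType} {n N d m : nat}.
Variables (Qm : 'I_N -> 'M[R]_n).
Hypothesis Qsym : forall l, (Qm l)^T = Qm l.
Local Notation q := (quad Qm).
Variables (w : 'rV[R]_n) (A A1 A2 B B1 B2 C1 C2 : R).
Local Notation rho := (sqnorm w).
Hypothesis w0 : 0 < sqnorm w.

Definition pvec (u : 'rV[R]_n) (f : 'rV[R]_N) (c : R) : 'rV[R]_(n+(N + 1)) :=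
 row_mx u (row_mx f (const_mx c)).

Lemma pvecD u f c u' f' c' : pvec u f c+pvec u' f' c' = pvec (u+u') (f+f') (c+c').
rewrite /pvec !add_row_mx;congr (row_mx _ (row_mx _ _)).
by apply/rowP => j;rewrite !mxE.
Qed.

Lemma pvecZ (a : R) u f c : a *: pvec u f c = pvec (a *: u) (a *: f) (a*c).
rewrite /pvec !scale_row_mx;congr (row_mx _ (row_mx _ _)).
by apply/rowP => j;rewrite !mxE.
Qed.

Lemma dot_row_mx k l (u u' : 'rV[R]_k) (f f' : 'rV[R]_l) :
 dot (row_mx u f) (row_mx u' f') = dot u u'+dot f f'.
rewrite /dot big_split_ord /=;congr (_ + _);eqsum i.
 by rewrite !row_mxEl.
by rewrite !row_mxEr.
Qed.

Lemma dot_pvec u f c u' f' c' : dot (pvec u f c) (pvec u' f' c') = dot u u'+(dot f f'+c*c').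
by rewrite !dot_row_mx;congr (_+(_ + _));rewrite /dot big_ord1 !mxE. Qed.

(** The derivative of [cone] at [w] in the direction [u], and then [ndd], the second derivative,
    with the profile replaced by its jet at the point: from here on the computation is pure
    algebra. *)
Definition nd u := pvec (A *: u+(A1*dot w u) *: w)
 ((2*B) *: q w u+(B1*dot w u) *: q w w) (C1*dot w u).

Definition ndd u v := pvec ((A1*dot w u) *: v+(A1*dot w v) *: u +
   (A2*dot w u*dot w v+A1*dot u v) *: w)
  ((2*B) *: q u v+(2*B1*dot w u) *: q w v+(2*B1*dot w v) *: q w u +
    (B2*dot w u*dot w v+B1*dot u v) *: q w w)
  (C2*dot w u*dot w v+C1*dot u v).

(** [p_al], [p_be], [p_ga] are the coefficients of the radial tangent vector [nd w], and the
    versions ending in 2 those of [ndd w w]. [p_G] and [p_GG] are the inner products of these two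
    vectors with [nd w]. *)
Definition p_al := A1*rho+A.
Definition p_be := B1*rho + 2*B.
Definition p_ga := C1*rho.
Definition p_al2 := A2*rho ^+ 2 + 3*A1*rho.
Definition p_be2 := B2*rho ^+ 2 + 5*B1*rho + 2*B.
Definition p_ga2 := C2*rho ^+ 2+C1*rho.
Definition p_G := rho * p_al ^+ 2+rho ^+ 2 * p_be ^+ 2+p_ga ^+ 2.
Definition p_GG := rho * p_al2 * p_al+rho ^+ 2 * p_be2 * p_be+p_ga2 * p_ga.
(** The fibre ratio: a vertical vector has image of squared length [p_x / rho] times its own, while
    for a horizontal vector [E1] makes the factor [1 / rho]. *)
Definition p_x := A ^+ 2*rho.
Definition p_KT := - A*rho * p_al2+A*rho * p_al / p_G * p_GG.
Definition p_KV := p_x - p_x*(rho * p_al ^+ 2) / p_G.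
Definition p_s := Num.sqrt (2*rho).
Definition p_phi := - (p_be / A) * p_s.
Definition p_sigma := - (A*B*rho) * p_s.

Hypotheses (A0 : A != 0) (G0 : p_G != 0).
(** [E1] keeps the horizontal metric independent of the radius; [E2] and [E3] are its first and
    second derivatives along [w], divided by common factors. *)
Hypothesis E1 : A ^+ 2*rho + 2*B ^+ 2*rho ^+ 2 = 1.
Hypothesis E2 : A * p_al + 2*B*rho * p_be = 0.
Hypothesis E3 : A * p_al2 + 2*B*rho * p_be2 = - (p_al ^+ 2 + 2*rho * p_be ^+ 2).

Hypothesis qww : dot (q w w) (q w w) = rho ^+ 2.

(** [vDw] and [vHw] are [nd w] and [ndd w w]. [vtau] and [vnu] are the normal parts of the second
    derivative in radial and vertical directions; [vn] and [veta] are the normal vectors produced by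
    one and by two horizontal directions. *)
Definition vDw := pvec (p_al *: w) (p_be *: q w w) p_ga.
Definition vHw := pvec (p_al2 *: w) (p_be2 *: q w w) p_ga2.
Definition vtau := vHw - (p_GG / p_G) *: vDw.
Definition vnu := pvec (- A *: w) 0 0+(A*rho * p_al / p_G) *: vDw.
Definition veta hh u v := pvec ((- A*hh) *: w) ((- 2*B*hh) *: q w w+(2*B) *: q u v) 0.
Definition vn u := pvec ((2*B*rho) *: u) ((- 2*A) *: q w u) 0.

(* The second derivative in two tangent directions t w + v + h, written as a
 normal vector plus a tangent one. *)
Lemma ndd_decomposition t1 t2 vv hh (V1 V2 H1 H2 K12 K21 : 'rV[R]_n) :
 dot w V1 = 0 -> dot w V2 = 0 -> dot w H1 = 0 -> dot w H2 = 0 -> dot w K12 = 0 -> dot w K21 = 0 ->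
 dot V1 V2 = rho*vv -> dot H1 H2 = rho*hh -> dot V1 H2 = 0 -> dot H1 V2 = 0 ->
 q w V1 = 0 -> q w V2 = 0 -> q V1 V2 = vv *: q w w -> q V1 H2 = q w K12 -> q V2 H1 = q w K21 ->
 ndd (t1 *: w+V1+H1) (t2 *: w+V2+H2) =
 (t1 * t2) *: vtau+vv *: vnu+vn (- (p_be / A) *: (t1 *: H2+t2 *: H1)
   - (A*B*rho) *: (K12+K21))+veta hh H1 H2
+nd ((t1 * t2*(p_GG / p_G)+vv*(1 - A*rho * p_al / p_G)+hh) *: w
   +(A1*rho / A) *: (t1 *: V2+t2 *: V1)
   +(2*B ^+ 2*rho ^+ 2) *: (K12+K21) - (t1 *: H2+t2 *: H1)).
move=> wV1 wV2 wH1 wH2 wK12 wK21 VV HH' V1H2 H1V2 qV1 qV2 qVV qVH qHV.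
have dw1 : dot w (t1 *: w+V1+H1) = t1*rho.
 by rewrite !dotDr dotZr dotxx wV1 wH1 !addr0.
have dw2 : dot w (t2 *: w+V2+H2) = t2*rho.
 by rewrite !dotDr dotZr dotxx wV2 wH2 !addr0.
have d12 : dot (t1 *: w+V1+H1) (t2 *: w+V2+H2) = rho*(t1 * t2+vv+hh).
 rewrite !(dotDl, dotDr, dotZl, dotZr) dotxx VV HH' V1H2 H1V2 !(dotC _ w) wV1 wV2 wH1 wH2;ring.
have q1 : q w (t1 *: w+V1+H1) = t1 *: q w w+q w H1.
 by rewrite !(quadDr Qsym) (quadZr Qsym) qV1 addr0.
have q2 : q w (t2 *: w+V2+H2) = t2 *: q w w+q w H2.
 by rewrite !(quadDr Qsym) (quadZr Qsym) qV2 addr0.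
have q12 : q (t1 *: w+V1+H1) (t2 *: w+V2+H2) =
  (t1 * t2+vv) *: q w w+t1 *: q w H2+t2 *: q w H1+q w K12+q w K21+q H1 H2.
 rewrite !(quadDl, quadDr Qsym, quadZl, quadZr Qsym) (quadC Qsym V1 w) qV1 qV2 qVV qVH.
 rewrite (quadC Qsym H1 w) (quadC Qsym H1 V2) qHV.
 by apply/rowP => j;rewrite !(rowDE, rowZE) [(0 : 'rV_N) 0 j]mxE;ring.
rewrite /ndd dw1 dw2 d12 q1 q2 q12 /nd.
set c := _ *: w + _ + _ - _.
have dc : dot w c = rho*(t1 * t2*(p_GG / p_G)+vv*(1 - A*rho * p_al / p_G)+hh).
 rewrite /c !(dotDr, dotZr, dotNr) dotxx wV1 wV2 wH1 wH2 wK12 wK21;ring.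
have qc : q w c = (t1 * t2*(p_GG / p_G)+vv*(1 - A*rho * p_al / p_G)+hh) *: q w w
 +(2*B ^+ 2*rho ^+ 2) *: (q w K12+q w K21) - (t1 *: q w H2+t2 *: q w H1).
 rewrite /c -[- (t1 *: H2 + _)]scaleN1r !(quadDr Qsym, quadZr Qsym) qV1 qV2.
 by apply/rowP => j;rewrite !(rowDE, rowZE) !mxE;ring.
rewrite dc qc /vtau /vnu /vHw /vDw /vn /veta -scaleNr !(pvecZ, pvecD).
have EB : 2*B ^+ 2*rho ^+ 2 = 1 - A ^+ 2*rho by have := E1;lra.
have Eal : p_al = - (2*B*rho * p_be) / A.
 by apply: (mulfI A0);rewrite mulrC;apply/eqP;rewrite -subr_eq0;apply/eqP;
  rewrite -E2;field.
have qq : q w (- (p_be / A) *: (t1 *: H2+t2 *: H1) - (A*B*rho) *: (K12+K21)) =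
  - (p_be / A) *: (t1 *: q w H2+t2 *: q w H1) - (A*B*rho) *: (q w K12+q w K21).
 by rewrite -[- (_ *: (K12 + _))]scaleN1r !(quadDr Qsym, quadZr Qsym) scaleN1r.
congr (pvec _ _ _).
- apply/rowP => j;rewrite /c !(rowDE, rowZE) !mxE.
 move: (w 0 j) (V1 0 j) (V2 0 j) (H1 0 j) (H2 0 j) (K12 0 j) (K21 0 j) => wj v1 v2 h1 h2 k1 k2.
 have -> : p_al2 = A2*rho ^+ 2 + 3*A1*rho by [].
 move: (p_GG / p_G) (A*rho * p_al / p_G) => gg xi.
 have e1 : A1*rho = - (2*B*rho * p_be) / A - A.
  by rewrite -Eal /p_al addrK.
 have -> : p_al = A1*rho+A by [].
 apply/eqP;rewrite -subr_eq0;apply/eqP.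
 transitivity ((A1*rho+A+(2*B*rho * p_be) / A)*(t1*h2+t2*h1)).
  by field;rewrite ?A0.
 by rewrite e1;field;rewrite ?A0.
- rewrite qq.
 move: (q w w) (q w H1) (q w H2) (q w K12) (q w K21) (q H1 H2) => f1 f2 f3 f4 f5 f6.
 apply/rowP => j;rewrite !(rowDE, rowZE) !mxE.
 move: (f1 0 j) (f2 0 j) (f3 0 j) (f4 0 j) (f5 0 j) (f6 0 j) => g1 g2 g3 g4 g5 g6.
 move: (p_GG / p_G) (A*rho * p_al / p_G) => gg xi.
 rewrite /p_be2 /p_be.
 apply/eqP;rewrite -subr_eq0;apply/eqP.
 transitivity (2*B*(g4+g5)*(1 - (A ^+ 2*rho + 2*B ^+ 2*rho ^+ 2))).
  by field;rewrite ?A0.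
 by rewrite E1 subrr mulr0.
- rewrite /p_ga /p_ga2;move: (p_GG / p_G) (A*rho * p_al / p_G) => gg xi;ring.
Qed.

Lemma dot_vDw u f : dot vDw (pvec u f 0) = p_al*dot w u+p_be*dot (q w w) f.
by rewrite dot_pvec !dotZl mulr0 addr0. Qed.

Lemma dot_vHw u f : dot vHw (pvec u f 0) = p_al2*dot w u+p_be2*dot (q w w) f.
by rewrite dot_pvec !dotZl mulr0 addr0. Qed.

Lemma dot_DD : dot vDw vDw = p_G.
rewrite dot_pvec !(dotZl, dotZr) dotxx qww /p_G;ring. Qed.

Lemma dot_HD : dot vHw vDw = p_GG.
rewrite dot_pvec !(dotZl, dotZr) dotxx qww /p_GG;ring. Qed.

Lemma dot_tau_D : dot vtau vDw = 0.
by rewrite /vtau dotBl dotZl dot_HD dot_DD divfK ?subrr. Qed.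

Lemma dot_tau_nu : dot vtau vnu = p_KT.
rewrite /vnu dotDr dotZr dot_tau_D mulr0 addr0 /vtau dotBl dotZl dot_vDw dot_vHw !dotZr !dot0r dotxx.
rewrite /p_KT;move: p_GG p_al2 => g a2;field;by rewrite ?G0.
Qed.

Lemma dot_nu_D : dot vnu vDw = 0.
rewrite /vnu dotDl dotZl dot_DD (dotC _ vDw) dot_vDw dotZr dot0r dotxx;field;by rewrite ?G0.
Qed.

Lemma dot_nu_nu : dot vnu vnu = p_KV.
rewrite {2}/vnu dotDr dotZr dot_nu_D mulr0 addr0 /vnu dotDl dotZl dot_vDw dot_pvec.
rewrite !(dotZl, dotZr, dot0r) dotxx /p_KV /p_x;field;by rewrite ?G0.
Qed.

Lemma dot_D_eta hh u v : dot (q w w) (q u v) = 0 -> dot vDw (veta hh u v) = 0.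
move=> h;rewrite /veta dot_vDw !(dotDr, dotZr) h dotxx qww.
transitivity (- hh*rho*(A * p_al + 2*B*rho * p_be));first by ring.
by rewrite E2 mulr0.
Qed.

Lemma p_alE : p_al = - (2*B*rho * p_be) / A.
apply: (mulIf A0);rewrite divfK //;apply/eqP;rewrite -subr_eq0;apply/eqP.
by rewrite -E2;ring.
Qed.

Lemma p_s2 : p_s ^+ 2 = 2*rho.
by rewrite sqr_sqrtr // mulr_ge0 // ltW. Qed.

Lemma dot_tau_eta hh u v : dot (q w w) (q u v) = 0 -> dot vtau (veta hh u v) = p_phi ^+ 2*hh.
move=> h;rewrite /vtau dotBl dotZl dot_D_eta // mulr0 subr0 /veta dot_vHw.
rewrite !(dotDr, dotZr) h dotxx qww /p_phi exprMn p_s2.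
transitivity (- hh*rho*(A * p_al2 + 2*B*rho * p_be2));first by ring.
rewrite E3 p_alE;apply/eqP;rewrite -subr_eq0;apply/eqP.
transitivity (2*rho * p_be ^+ 2 / A ^+ 2*hh *
 (A ^+ 2*rho + 2*B ^+ 2*rho ^+ 2 - 1));first by field;rewrite ?A0.
by rewrite E1 subrr mulr0.
Qed.

Lemma dot_nu_eta hh u v : dot (q w w) (q u v) = 0 -> dot vnu (veta hh u v) = p_x*hh.
move=> h;rewrite /vnu dotDl dotZl dot_D_eta // mulr0 addr0 /veta dot_pvec.
rewrite !(dotZl, dotZr, dot0l) dotxx /p_x;ring.
Qed.

Lemma dot_tau_n u : dot w u = 0 -> dot (q w w) (q w u) = 0 -> dot vtau (vn u) = 0.
move=> h1 h2;rewrite /vtau dotBl dotZl dot_vDw dot_vHw !dotZr h1 h2.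
by rewrite !mulr0 !addr0 mulr0 subr0.
Qed.

Lemma dot_nu_n u : dot w u = 0 -> dot (q w w) (q w u) = 0 -> dot vnu (vn u) = 0.
move=> h1 h2;rewrite /vnu dotDl dotZl dot_vDw dot_pvec !(dotZl, dotZr, dot0l) h1 h2.
by rewrite !(mulr0, mul0r, addr0).
Qed.

Lemma dot_n_eta hh h u v : dot w h = 0 -> dot (q w w) (q w h) = 0 -> dot (q w h) (q u v) = 0 ->
 dot (vn h) (veta hh u v) = 0.
move=> h1 h2 h3;rewrite dot_pvec !(dotDr, dotZl, dotZr) (dotC h w) h1 (dotC _ (q w w)) h2 h3.
by rewrite !mulr0 !addr0.
Qed.

Lemma dot_n_n u v yy : dot u v = rho*yy -> dot (q w u) (q w v) = rho ^+ 2 / 2*yy ->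
 dot (vn u) (vn v) = 2*rho*yy.
move=> h1 h2;rewrite dot_pvec !(dotZl, dotZr) h1 h2.
transitivity (2*rho*yy*(A ^+ 2*rho + 2*B ^+ 2*rho ^+ 2));first by field.
by rewrite E1 mulr1.
Qed.

Lemma dot_eta_eta hh hh' u v u' v' : dot (q w w) (q u v) = 0 -> dot (q w w) (q u' v') = 0 ->
 dot (veta hh u v) (veta hh' u' v') =
 (2 - p_x)*(hh*hh') + 2*(1 - p_x) / rho ^+ 2*dot (q u v) (q u' v').
move=> h h';rewrite dot_pvec !(dotDl, dotDr, dotZl, dotZr) h' (dotC (q u v) (q w w)) h dotxx qww.
have -> : 2 - p_x = p_x + 4*B ^+ 2*rho ^+ 2 by rewrite /p_x;have := E1;lra.
have -> : 1 - p_x = 2*B ^+ 2*rho ^+ 2 by rewrite /p_x;have := E1;lra.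
by rewrite /p_x;field;rewrite gt_eqF.
Qed.

Section Frame.
Variables (V : 'M[R]_(d, n)) (H : 'M[R]_(m, n)) (Cm : 'I_d -> 'M[R]_m).
Variables (t : 'I_n -> R) (v : 'I_n -> 'rV[R]_d) (Y : 'I_n -> 'rV[R]_m).
(** On admissible coordinates [F] multiplies lengths by the norm of [w]. Since [F] may have a kernel
    elsewhere, a multiple of a projection can serve as frame, and no basis of the horizontal space
    is chosen. *)
Definition adm k (F : 'M[R]_(k, n)) (a : 'rV[R]_k) := a *m F *m F^T = rho *: a.
Hypothesis hdec : forall i, delta_mx 0 i = t i *: w+v i *m V+Y i *m H.
Hypotheses (hv : forall i, adm V (v i)) (hY : forall i, adm H (Y i)).
Hypothesis hact : forall c y, adm H y -> adm H (y *m Cm c).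
Hypotheses (wV : w *m V^T = 0) (wH : w *m H^T = 0) (VH : V *m H^T = 0).
Hypothesis qwV : forall a, q w (a *m V) = 0.
Hypothesis qVV : forall a b, adm V a -> adm V b ->
 q (a *m V) (b *m V) = dot a b *: q w w.
Hypothesis qVH : forall a y, adm V a -> adm H y ->
 q (a *m V) (y *m H) = q w (act Cm a y *m H).
Hypothesis qwwH : forall y, adm H y -> dot (q w w) (q w (y *m H)) = 0.
Hypothesis qHH1 : forall y y', adm H y -> adm H y' ->
 dot (q w (y *m H)) (q w (y' *m H)) = rho ^+ 2 / 2*dot y y'.
Hypothesis qHH2 : forall y y', adm H y -> adm H y' ->
 dot (q w w) (q (y *m H) (y' *m H)) = 0.
Hypothesis qHH3 : forall y y' y'', adm H y -> adm H y' -> adm H y'' ->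
 dot (q w (y *m H)) (q (y' *m H) (y'' *m H)) = 0.

Lemma admissibleD k (F : 'M[R]_(k, n)) a b : adm F a -> adm F b -> adm F (a+b).
by rewrite /adm => ha hb;rewrite !mulmxDl ha hb scalerDr. Qed.

Lemma admissibleZ k (F : 'M[R]_(k, n)) c a : adm F a -> adm F (c *: a).
by rewrite /adm => ha;rewrite -!scalemxAl ha !scalerA mulrC. Qed.

Lemma admissible_act a y : adm H y -> adm H (act Cm a y).
move=> ay;rewrite /act;apply: (big_ind (adm H)).
- by rewrite /adm !mul0mx scaler0.
- exact: admissibleD.
- by move=> c _;apply: admissibleZ;exact: hact.
Qed.

Lemma dot_mulmx k l (a : 'rV[R]_k) (F : 'M[R]_(k, l)) b : dot (a *m F) b = dot a (b *m F^T).
rewrite /dot;under eq_bigr do rewrite mxE mulr_suml.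
swapsum j => /=;rewrite mxE mulr_sumr.
by eqsum i;rewrite !mxE;ring.
Qed.

Lemma dot_admissible k (F : 'M[R]_(k, n)) a b : adm F b ->
 dot (a *m F) (b *m F) = rho*dot a b.
by move=> hb;rewrite dot_mulmx hb dotZr. Qed.

Definition Zf i k : 'rV[R]_m :=
 - (p_be / A) *: (t i *: Y k+t k *: Y i) - (A*B*rho) *: (act Cm (v i) (Y k)+act Cm (v k) (Y i)).

Definition Nf i k := (t i * t k) *: vtau+dot (v i) (v k) *: vnu+vn (Zf i k *m H)
+veta (dot (Y i) (Y k)) (Y i *m H) (Y k *m H).

Lemma admZ i k : adm H (Zf i k).
rewrite /Zf;have -> (u : 'rV[R]_m) : - ((A*B*rho) *: u) = (- (A*B*rho)) *: u by rewrite scaleNr.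
exact: (admissibleD (admissibleZ _ (admissibleD (admissibleZ _ (hY k)) (admissibleZ _ (hY i))))
 (admissibleZ _ (admissibleD (admissible_act _ (hY k)) (admissible_act _ (hY i))))).
Qed.

Let wVz a : dot w (a *m V) = 0.
by rewrite dotC dot_mulmx wV dot0r. Qed.
Let wHz y : dot w (y *m H) = 0.
by rewrite dotC dot_mulmx wH dot0r. Qed.
Let VHz a y : dot (a *m V) (y *m H) = 0.
by rewrite dotC dot_mulmx -mulmxA VH mulmx0 dot0r. Qed.

Lemma Nf_tangent i k : exists c, ndd (delta_mx 0 i) (delta_mx 0 k) = Nf i k+nd c.
rewrite (hdec i) (hdec k).
rewrite (@ndd_decomposition (t i) (t k) (dot (v i) (v k)) (dot (Y i) (Y k)) _ _ _ _
 (act Cm (v i) (Y k) *m H) (act Cm (v k) (Y i) *m H)) //.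
- eexists;congr (_ + _+vn _ + _+nd _).
 by rewrite /Zf mulmxBl -!scalemxAl !mulmxDl -!scalemxAl.
- by rewrite dot_admissible.
- by rewrite dot_admissible.
- by rewrite dotC VHz.
- exact: qVV.
- exact: qVH.
- exact: qVH.
Qed.

Lemma Nf_normal i k l : dot (Nf i k) (nd (delta_mx 0 l)) = 0.
rewrite (hdec l).
have -> : nd (t l *: w+v l *m V+Y l *m H) = t l *: vDw+pvec (A *: (v l *m V)) 0 0
 +pvec (A *: (Y l *m H)) ((2*B) *: q w (Y l *m H)) 0.
 rewrite /nd !(quadDr Qsym, quadZr Qsym) qwV !(dotDr, dotZr) wVz wHz dotxx !addr0.
 rewrite /vDw pvecZ !pvecD /p_al /p_be /p_ga;congr (pvec _ _ _);last by ring.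
  by apply/rowP => j;rewrite !(rowDE, rowZE);ring.
 by apply/rowP => j;rewrite !(rowDE, rowZE) [(0 : 'rV_N) 0 j]mxE;ring.
rewrite !dotDr dotZr.
have aZ := admZ i k;have aY := hY.
have -> : dot (Nf i k) vDw = 0.
 rewrite /Nf !dotDl !dotZl dot_tau_D dot_nu_D !(dotC _ vDw) dot_D_eta ?qHH2 // dot_vDw.
 by rewrite !dotZr wHz qwwH // !mulr0 !addr0.
have tauE u f : dot vtau (pvec u f 0) = (p_al2 - p_GG / p_G * p_al)*dot w u
 +(p_be2 - p_GG / p_G * p_be)*dot (q w w) f.
 rewrite /vtau dotBl dotZl dot_vDw dot_vHw;move: (p_GG / p_G) => g;ring.
have nuE u f : dot vnu (pvec u f 0) = (- A+A*rho * p_al / p_G * p_al)*dot w u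
 +(A*rho * p_al / p_G * p_be)*dot (q w w) f.
 rewrite /vnu dotDl dotZl dot_vDw dot_pvec dotZl dot0l;move: (A*rho * p_al / p_G) => g;ring.
have -> : dot (Nf i k) (pvec (A *: (v l *m V)) 0 0) = 0.
 rewrite /Nf !dotDl !dotZl tauE nuE !dot_pvec !(dotDl, dotZl, dotZr, dot0r) wVz (dotC (_ *m H)) VHz;ring.
have -> : dot (Nf i k) (pvec (A *: (Y l *m H)) ((2*B) *: q w (Y l *m H)) 0) = 0.
 rewrite /Nf !dotDl !dotZl tauE nuE !dot_pvec.
 rewrite !(dotDl, dotZl, dotZr, dot0r) wHz qwwH // qHH1 // (dotC (q (Y i *m H) _)) qHH3 //.
 by rewrite dot_admissible //;field;exact: G0.
by rewrite mulr0 !addr0.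
Qed.

Variables (HH : @tens4 R 'I_m).
Hypothesis hHH : forall i k j l, HH4 HH Y i k j l =
 (2 - p_x)*(dot (Y i) (Y k)*dot (Y j) (Y l)) +
 2*(1 - p_x) / rho ^+ 2*dot (q (Y i *m H) (Y k *m H)) (q (Y j *m H) (Y l *m H)).

(** The scale [p_s] is the factor by which [vn] stretches horizontal coordinates, so it turns [Zf]
    into [ymix]. The additional term in [vtau] is symmetric in all four indices and cancels in the
    Gauss equation. *)
Lemma Nf_gram i k j l : dot (Nf i k) (Nf j l) =
 pulled Cm p_KT p_KV p_x p_phi p_sigma HH t v Y i k j l+t i * t k*(t j * t l)*dot vtau vtau.
have aZ := admZ;have aY := hY.
have Zm : ymix Cm p_phi p_sigma t v Y = fun i k => p_s *: Zf i k.
 apply/funext => i';apply/funext => k';rewrite /ymix /Zf /p_phi /p_sigma.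
 by apply/rowP => p;rewrite !(rowDE, rowZE) !mxE;ring.
rewrite /pulled hHH Zm.
have -> : dot (p_s *: Zf i k) (p_s *: Zf j l) = 2*rho*dot (Zf i k) (Zf j l).
 by rewrite dotZl dotZr -p_s2;ring.
have e1 i' k' : dot vtau (vn (Zf i' k' *m H)) = 0 by exact: (dot_tau_n (wHz _) (qwwH (aZ _ _))).
have e2 i' k' : dot vnu (vn (Zf i' k' *m H)) = 0 by exact: (dot_nu_n (wHz _) (qwwH (aZ _ _))).
have e3 i' k' hh i'' k'' : dot (vn (Zf i' k' *m H)) (veta hh (Y i'' *m H) (Y k'' *m H)) = 0.
 exact: (dot_n_eta _ (wHz _) (qwwH (aZ _ _)) (qHH3 (aZ _ _) (aY _) (aY _))).
have e4 i' k' hh : dot vtau (veta hh (Y i' *m H) (Y k' *m H)) = p_phi ^+ 2*hh.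
 exact: (dot_tau_eta _ (qHH2 (aY _) (aY _))).
have e5 i' k' hh : dot vnu (veta hh (Y i' *m H) (Y k' *m H)) = p_x*hh.
 exact: (dot_nu_eta _ (qHH2 (aY _) (aY _))).
have e6 : dot (vn (Zf i k *m H)) (vn (Zf j l *m H)) = 2*rho*dot (Zf i k) (Zf j l).
 exact: (dot_n_n (dot_admissible _ (aZ _ _)) (qHH1 (aZ _ _) (aZ _ _))).
have expand p (a1 a2 b1 b2 : R) (x1 x2 x3 x4 y3 y4 : 'rV[R]_p) :
  dot (a1 *: x1+a2 *: x2+x3+x4) (b1 *: x1+b2 *: x2+y3+y4) =
  a1*b1*dot x1 x1+(a1*b2+a2*b1)*dot x1 x2+a2*b2*dot x2 x2
 +a1*dot x1 y3+b1*dot x1 x3+a2*dot x2 y3+b2*dot x2 x3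
 +a1*dot x1 y4+b1*dot x1 x4+a2*dot x2 y4+b2*dot x2 x4
 +dot x3 y3+dot x3 y4+dot y3 x4+dot x4 y4.
 rewrite !dotDl !dotDr !dotZl !dotZr (dotC x2 x1) (dotC x3 x1) (dotC x3 x2) (dotC x4 x1) (dotC x4 x2).
 by rewrite (dotC x4 y3);ring.
rewrite /Nf expand.
have := (e1 i k, e1 j l, e2 i k, e2 j l, e3 i k (dot (Y j) (Y l)) j l, e3 j l (dot (Y i) (Y k)) i k).
have := (e4 i k (dot (Y i) (Y k)), e4 j l (dot (Y j) (Y l)), e5 i k (dot (Y i) (Y k)), e5 j l (dot (Y j) (Y l))).
have := (e6, dot_eta_eta (dot (Y i) (Y k)) (dot (Y j) (Y l)) (qHH2 (aY i) (aY k)) (qHH2 (aY j) (aY l))).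
have := (dot_tau_nu, dot_nu_nu).
move: (dot (Zf i k) (Zf j l)) (dot (v i) (v k)) (dot (v j) (v l)) (dot (Y i) (Y k)) (dot (Y j) (Y l)) => d1 d2 d3 d4 d5.
move: (veta _ (Y i *m H) (Y k *m H)) (veta _ (Y j *m H) (Y l *m H)) (vn (Zf i k *m H)) (vn (Zf j l *m H)) vtau vnu.
move: (dot (q (Y i *m H) (Y k *m H)) (q (Y j *m H) (Y l *m H))) p_KT p_KV p_x p_phi => c1 c2 c3 c4 c5 y1 y2 y3 y4 y5 y6.
move=> [-> ->] [-> ->] [[[-> ->] ->] ->] [[[[[-> ->] ->] ->] ->] ->].
ring.
Qed.

Lemma ndD u u' : nd (u+u') = nd u+nd u'.
rewrite /nd pvecD !dotDr (quadDr Qsym);congr (pvec _ _ _);last by ring.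
 by apply/rowP => j;rewrite !(rowDE, rowZE);ring.
by apply/rowP => j;rewrite !(rowDE, rowZE);ring.
Qed.

Lemma ndZ (r : R) u : nd (r *: u) = r *: nd u.
rewrite /nd pvecZ !dotZr (quadZr Qsym);congr (pvec _ _ _);last by ring.
 by apply/rowP => j;rewrite !(rowDE, rowZE);ring.
by apply/rowP => j;rewrite !(rowDE, rowZE);ring.
Qed.

Lemma nd_delta c : nd c = \sum_l c 0 l *: nd (delta_mx 0 l).
rewrite {1}(row_sum_delta c);under [RHS]eq_bigr => l _ do rewrite -ndZ.
apply: (big_morph nd ndD);have := ndZ 0 0;by rewrite !scale0r.
Qed.

(** A particular space enters only through the relations satisfied by its quadratic map [q] in the
    frame [(w, V, H)]; everything else is the Gauss equation and the pullback of the model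
    tensor. *)
Theorem point_snn (F : 'I_(n+(N + 1)) -> 'rV[R]_n -> R) : nice F w ->
 (forall j l, dd l (F j) w = nd (delta_mx 0 l) 0 j) ->
 (forall j i k, dd i (dd k (F j)) w = ndd (delta_mx 0 i) (delta_mx 0 k) 0 j) ->
 strong_psd (gramq (model_gram (fun a s u => Cm a s u) p_KT p_KV p_x p_phi p_sigma HH)) ->
 snn F w.
move=> nF F1 F2 hm.
have [g hg] : exists g : 'I_n -> 'I_n -> 'rV[R]_n, forall i k,
  ndd (delta_mx 0 i) (delta_mx 0 k) = Nf i k+nd (g i k).
 have [g hg] := choice (fun p : 'I_n * 'I_n => Nf_tangent p.1 p.2).
 by exists (fun i k => g (i, k)) => i k;exact: hg (i, k).
have NE i k j : dd i (dd k (F j)) w - \sum_l g i k 0 l*dd l (F j) w = Nf i k 0 j.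
 rewrite F2 hg rowDE nd_delta summxE -addrA.
 rewrite [X in _+X](_ : _ = 0) ?addr0 //;apply/eqP;rewrite subr_eq0;apply/eqP.
 by eqsum l;rewrite F1 rowZE.
apply/(snn_gauss (g := fun l i k => g i k 0 l) nF) => [i k l|].
 rewrite -[RHS](Nf_normal i k l) /dot;eqsum j.
 by rewrite NE F1.
apply: eq_strong_psd (strong_psd_pull (coord t v Y) hm) => i j k l.
rewrite pull_gramq /gaussq.
have -> : \sum_a (dd i (dd k (F a)) w - \sum_m0 g i k 0 m0*dd m0 (F a) w) *
  (dd j (dd l (F a)) w - \sum_m0 g j l 0 m0*dd m0 (F a) w) = dot (Nf i k) (Nf j l).
 by eqsum a;rewrite !NE.
have -> : \sum_a (dd i (dd l (F a)) w - \sum_m0 g i l 0 m0*dd m0 (F a) w) *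
  (dd j (dd k (F a)) w - \sum_m0 g j k 0 m0*dd m0 (F a) w) = dot (Nf i l) (Nf j k).
 by eqsum a;rewrite !NE.
rewrite !Nf_gram;ring.
Qed.

End Frame.

End PointAlgebra.

(** * Closure properties of one-variable smoothness *)

Section OneVariable.
Context {R : realType}.
Implicit Types (D : set R) (p q : R -> R).

(** A real is viewed as a row of length 1, so the closure lemmas in several variables also serve in
    one variable. *)
Lemma smooth1_row D p : open D ->
 smooth_on [set y : 'rV[R]_1 | D (y 0 0)] (fun y => p (y 0 0)) -> smooth1 D p.
move=> oD sp;pose U : set 'rV[R]_1 := [set y | D (y 0 0)].
exists (fun g => smooth_on U (fun y => g (y 0 0))) => // g sg.
have cE (y : 'rV[R]_1) : const_mx (y 0 0) = y by apply/rowP => j;rewrite mxE ord1.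
exists (fun t => dd 0 (fun y : 'rV[R]_1 => g (y 0 0)) (const_mx t)).
 have := smooth_dd 0 sg;congr (smooth_on _ _).
 by apply/funext => y;rewrite cE.
move=> t Dt;pose v : 'rV[R]_1 := delta_mx 0 0.
have E (s : R) : 0+s *: v = const_mx s by apply/rowP => j;rewrite !mxE ord1 !eqxx mulr1 add0r.
have := @der_line _ _ (fun y : 'rV[R]_1 => g (y 0 0)) 0 v t
 (dd 0 (fun y : 'rV[R]_1 => g (y 0 0)) (const_mx t)).
have -> : (fun s : R => g ((0+s *: v) 0 0)) = g by apply/funext => s;rewrite E mxE.
apply;rewrite E;apply: (smooth_der 0 sg);by rewrite /U /= mxE.
Qed.

Lemma row_smooth1 D p : open D -> smooth1 D p ->
 smooth_on [set y : 'rV[R]_1 | D (y 0 0)] (fun y => p (y 0 0)).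
move=> oD sp;have oU : open [set y : 'rV[R]_1 | D (y 0 0)].
 by apply: open_comp oD => y _;exact: continuous_coord.
by apply: (smooth_comp1 oU sp) => //;exact: smooth_on_coord.
Qed.

Let open_row D : open D -> open [set y : 'rV[R]_1 | D (y 0 0)].
by move=> oD;apply: open_comp oD => y _;exact: continuous_coord. Qed.

Lemma smooth1M D p q : open D -> smooth1 D p -> smooth1 D q -> smooth1 D (fun t => p t*q t).
move=> oD sp sq;apply: (smooth1_row oD).
exact: (smoothM (open_row oD) (row_smooth1 oD sp) (row_smooth1 oD sq)).
Qed.

Lemma smooth1D D p q : open D -> smooth1 D p -> smooth1 D q -> smooth1 D (fun t => p t+q t).
move=> oD sp sq;apply: (smooth1_row oD).
exact: (smoothD (open_row oD) (row_smooth1 oD sp) (row_smooth1 oD sq)).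
Qed.

Lemma smooth1_cst D (c : R) : open D -> smooth1 D (fun=> c).
by move=> oD;apply: (smooth1_row oD);exact: smooth_cst. Qed.

Lemma smooth1_id D : open D -> smooth1 D (fun t => t).
by move=> oD;apply: (smooth1_row oD);exact: smooth_on_coord. Qed.

Lemma smooth1_comp D D' p q : open D -> smooth1 D q -> smooth1 D' p -> (forall t, D t -> D' (q t)) ->
 smooth1 D (fun t => p (q t)).
move=> oD sq sp qD;apply: (smooth1_row oD).
by apply: (smooth_comp1 (open_row oD) sp (row_smooth1 oD sq)) => y;exact: qD.
Qed.

(** A derivative given by a formula agrees on [D] with a member of the family witnessing [smooth1],
    and so inherits smoothness. *)
Lemma smooth1_derivative D p p1 : open D -> smooth1 D p ->
 (forall t, D t -> is_der t p (p1 t)) -> smooth1 D p1.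
move=> oD [S Sp HS] dp;have [p' Sp' dp'] := HS _ Sp.
exists (fun h => exists2 g, S g & forall t, D t -> h t = g t).
 exists p' => // t Dt;have [_ <-] := dp t Dt;by have [_ <-] := dp' t Dt.
move=> h [g Sg hg];have [g' Sg' dg] := HS _ Sg.
exists g';first by exists g'.
move=> t Dt;apply: (@near_eq_is_derive _ _ _ g) => //;last exact: dg.
have : \forall s \near t, D s by exact: open_nbhs_nbhs.
by apply: filterS => s Ds;rewrite hg.
Qed.

End OneVariable.

(** * The radial profile *)

Section Profile.
Context {R : realType}.
Implicit Types (t : R).

Definition isqrt t : R := t `^ (- 2^-1).

Lemma isqrt_gt0 t : 0 < t -> 0 < isqrt t.
exact: powR_gt0. Qed.

Lemma isqrt_sqr t : 0 < t -> isqrt t ^+ 2 = t^-1.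
move=> t0;rewrite expr2 /isqrt -powRD;last by rewrite (gt_eqF t0) implybT.
have -> : - 2^-1 + - 2^-1 = - 1 :> R by field.
by rewrite powR_inv1 // ltW.
Qed.

Lemma isqrt_is_derive t : 0 < t -> is_der t isqrt (- 2^-1*(isqrt t / t)).
move=> t0;apply: is_derive_eq (is_derive1_powR (- 2^-1) t0) _.
rewrite powRB ?(gt_eqF t0) ?implybT //;congr (_*(_ / _)).
by rewrite powRr1 // ltW.
Qed.

(** It vanishes for [t >= 1 / 2], which makes the end exactly round, and is positive at 0, which
    makes the profile smooth and immersive across the cut locus. *)
Definition lid t : R := flat 0 (2^-1 - t).
Definition lid1 t : R := - flat 2 (2^-1 - t).
Definition lid2 t : R := flat 4 (2^-1 - t) - 2*flat 3 (2^-1 - t).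
(** With this denominator [alpha] and [beta] solve [E1] exactly: the fibre ratio becomes
    [t / den t], and its complement to 1 is the square of [lid t] divided by [den t]. *)
Definition den t : R := t+lid t ^+ 2.
(** An open domain that also contains small negative [t]: the value 0 is taken at points at infinity
    of a cell, where smoothness has to hold on an open set. *)
Definition pdom : set R := [set t | t < 1 /\ 0 < den t].
Definition alpha t : R := isqrt (den t) * isqrt (1 - t).
Definition beta t : R := isqrt 2*(lid t*(isqrt (den t)*(1 - t)^-1)).
Definition prof_a t : R := t*alpha t.
Definition prof_b t : R := t*beta t.

Let flip_derive t : is_der t (fun s : R => 2^-1 - s) (- 1).
have h := derD (is_derive_cst (2^-1 : R) t 1) (derZ (-1) (is_derive_id t 1)).
have -> : (fun s : R => 2^-1 - s) = (fun s => cst 2^-1 s + -1 * id s).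
 by apply/funext => s;rewrite mulN1r.
by apply: is_derive_eq h _;rewrite add0r mulr1.
Qed.

Lemma lid_is_derive t : is_der t lid (lid1 t).
apply: is_derive_eq (der_comp (f := flat 0) (g := fun s => 2^-1 - s) (flat_is_derive 0 _) (flip_derive t)) _.
by rewrite /lid1 mul0r subr0 mulrN1.
Qed.

Lemma lid1_is_derive t : is_der t lid1 (lid2 t).
have h := derZ (-1) (der_comp (f := flat 2) (g := fun s => 2^-1 - s) (flat_is_derive 2 _) (flip_derive t)).
have -> : lid1 = fun s => -1*flat 2 (2^-1 - s) by apply/funext => s;rewrite mulN1r.
by apply: is_derive_eq h _;rewrite /lid2;ring.
Qed.

Lemma smooth1_flip D : open D -> smooth1 D (fun t : R => 2^-1 - t).
move=> oD;have -> : (fun s : R => 2^-1 - s) = (fun s => 2^-1 + -1*s).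
 by apply/funext => s;rewrite mulN1r.
by apply: (smooth1D oD);[exact: smooth1_cst|apply: (smooth1M oD);[exact: smooth1_cst|exact: smooth1_id]].
Qed.

Lemma smooth1_lid D : open D -> smooth1 D lid.
by move=> oD;apply: (smooth1_comp oD (smooth1_flip oD) (smooth1_flat setT 0)). Qed.

Lemma smooth1_den D : open D -> smooth1 D den.
move=> oD;have -> : den = fun t => t+lid t * lid t by apply/funext => t;rewrite /den expr2.
have sl := smooth1_lid oD.
by apply: (smooth1D oD);[exact: smooth1_id|exact: (smooth1M oD)].
Qed.

Lemma open_prof_dom : open pdom.
have -> : pdom = [set t : R | t < 1] `&` den @^-1` [set t : R | 0 < t] by [].
apply: openI;first exact: open_lt.
apply: open_comp;last exact: open_gt.
move=> t _;have [d _ hd] := smooth1_dest (smooth1_den (@openT R)).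
by have [/derivable1_diffP/differentiable_continuous] := hd t I.
Qed.

Lemma unit_prof t : uitv t -> pdom t.
by move=> /andP[t0 t1];split=> //;rewrite /den ltr_wpDr // sqr_ge0. Qed.

Lemma prof_dom0 : pdom 0.
by split=> //;rewrite /den add0r exprn_gt0 // /lid subr0 flat_gt0. Qed.

Lemma open_unit_itv : open (@uitv R).
have -> : @uitv R = [set t : R | 0 < t] `&` [set t | t < 1].
 by apply/seteqP;split=> t => [/andP[]|[h1 h2]] //;apply/andP.
by apply: openI;[exact: open_gt|exact: open_lt].
Qed.

Let one_derive t : is_der t (fun s : R => 1 - s) (- 1).
have h := derD (is_derive_cst (1 : R) t 1) (derZ (-1) (is_derive_id t 1)).
have -> : (fun s : R => 1 - s) = (fun s => cst 1 s + -1 * id s).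
 by apply/funext => s;rewrite mulN1r.
by apply: is_derive_eq h _;rewrite add0r mulr1.
Qed.

Lemma smooth1_1B D : open D -> smooth1 D (fun t : R => 1 - t).
move=> oD;have -> : (fun s : R => 1 - s) = (fun s => 1 + -1*s).
 by apply/funext => s;rewrite mulN1r.
by apply: (smooth1D oD);[exact: smooth1_cst|apply: (smooth1M oD);[exact: smooth1_cst|exact: smooth1_id]].
Qed.

Lemma smooth1_alpha : smooth1 pdom alpha.
have oD := open_prof_dom;apply: (smooth1M oD).
 by apply: (smooth1_comp oD (smooth1_den oD) (smooth1_powR _)) => t [].
by apply: (smooth1_comp oD (smooth1_1B oD) (smooth1_powR _)) => t [t1 _] /=;rewrite subr_gt0.
Qed.

Lemma smooth1_beta : smooth1 pdom beta.
have oD := open_prof_dom;apply: (smooth1M oD);first exact: smooth1_cst.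
apply: (smooth1M oD);first exact: smooth1_lid.
apply: (smooth1M oD).
 by apply: (smooth1_comp oD (smooth1_den oD) (smooth1_powR _)) => t [].
by apply: (smooth1_comp oD (smooth1_1B oD) smooth1_inv) => t [t1 _] /=;rewrite gt_eqF // subr_gt0.
Qed.

Definition den1 t : R := 1 + 2 * lid t * lid1 t.
Definition den2 t : R := 2*(lid1 t ^+ 2+lid t * lid2 t).
(** [ua] and [um] are the logarithmic derivatives of [alpha] and [mu]; [ua2] and [um2] are the
    second derivatives divided by the function. *)
Definition ua t : R := - 2^-1*(den1 t / den t) + 2^-1 / (1 - t).
Definition ua2 t : R := ua t ^+ 2 - 2^-1*(den2 t / den t - den1 t ^+ 2 / den t ^+ 2) + 2^-1 / (1 - t) ^+ 2.
Definition mu t : R := isqrt 2*(isqrt (den t)*(1 - t)^-1).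
Definition um t : R := - 2^-1*(den1 t / den t)+(1 - t)^-1.
Definition um2 t : R := um t ^+ 2 - 2^-1*(den2 t / den t - den1 t ^+ 2 / den t ^+ 2)+(1 - t) ^- 2.
Definition prof_a1 t : R := alpha t*(1+t*ua t).
Definition prof_a2 t : R := alpha t*(2*ua t+t*ua2 t).
Definition prof_b1 t : R := mu t*(lid t+t * lid1 t+t * lid t*um t).
Definition prof_b2 t : R := mu t*(2 * lid1 t+t * lid2 t+t * lid t*um2 t + 2 * lid t*um t + 2 * t * lid1 t*um t).

Lemma den_is_derive t : is_der t den (den1 t).
have h := derD (is_derive_id t (1 : R)) (derM (lid_is_derive t) (lid_is_derive t)).
have -> : den = fun s => id s+lid s * lid s by apply/funext => s;rewrite /den expr2.
by apply: is_derive_eq h _;rewrite /den1;ring.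
Qed.

Lemma den1_is_derive t : is_der t den1 (den2 t).
have h := derD (is_derive_cst (1 : R) t (1 : R)) (derZ 2 (derM (lid_is_derive t) (lid1_is_derive t))).
have -> : den1 = fun s => cst 1 s + 2*(lid s * lid1 s) by apply/funext => s;rewrite /den1 mulrA.
by apply: is_derive_eq h _;rewrite /den2 add0r;ring.
Qed.

Let isqrt_den t : pdom t ->
 is_der t (fun s => isqrt (den s)) (isqrt (den t)*(- 2^-1*(den1 t / den t))).
move=> [_ d0];apply: is_derive_eq (der_comp (isqrt_is_derive d0) (den_is_derive t)) _.
by field;rewrite gt_eqF.
Qed.

Let isqrt_1B t : pdom t ->
 is_der t (fun s => isqrt (1 - s)) (isqrt (1 - t)*(2^-1 / (1 - t))).
move=> [t1 _];have t1' : 0 < 1 - t by rewrite subr_gt0.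
apply: is_derive_eq (der_comp (g := fun s => 1 - s) (isqrt_is_derive t1') (one_derive t)) _.
by field;rewrite gt_eqF.
Qed.

Let inv_1B t : pdom t -> is_der t (fun s => (1 - s)^-1) ((1 - t)^-1*(1 - t)^-1).
move=> [t1 _];have t1' : 1 - t != 0 by rewrite gt_eqF // subr_gt0.
by apply: is_derive_eq (derV (g := fun s => 1 - s) t1' (one_derive t)) _;field.
Qed.

Lemma alpha_is_derive t : pdom t -> is_der t alpha (alpha t*ua t).
move=> dt;apply: is_derive_eq (derM (isqrt_den dt) (isqrt_1B dt)) _.
by rewrite /alpha /ua;ring.
Qed.

Lemma mu_is_derive t : pdom t -> is_der t mu (mu t*um t).
move=> dt;apply: is_derive_eq (derZ (isqrt 2) (derM (isqrt_den dt) (inv_1B dt))) _.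
by rewrite /mu /um;ring.
Qed.

Let log_derive t : pdom t ->
 is_der t (fun s => - 2^-1*(den1 s*(den s)^-1))
  (- 2^-1*(den2 t / den t - den1 t ^+ 2 / den t ^+ 2)).
move=> [_ d0];have dn : den t != 0 by rewrite gt_eqF.
apply: is_derive_eq (derZ (- 2^-1) (derM (den1_is_derive t) (derV dn (den_is_derive t)))) _.
by field.
Qed.

Lemma ua_is_derive t : pdom t -> is_der t ua (ua2 t - ua t ^+ 2).
move=> dt;have [t1 d0] := dt;have t1' : 1 - t != 0 by rewrite gt_eqF // subr_gt0.
apply: is_derive_eq (derD (log_derive dt) (derZ (2^-1) (inv_1B dt))) _.
by rewrite /ua2;field;rewrite t1' gt_eqF.
Qed.

Lemma um_is_derive t : pdom t -> is_der t um (um2 t - um t ^+ 2).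
move=> dt;have [t1 d0] := dt;have t1' : 1 - t != 0 by rewrite gt_eqF // subr_gt0.
apply: is_derive_eq (derD (log_derive dt) (inv_1B dt)) _.
by rewrite /um2;field;rewrite t1' gt_eqF.
Qed.

Lemma prof_a_is_derive t : pdom t -> is_der t prof_a (prof_a1 t).
move=> dt;apply: is_derive_eq (derM (is_derive_id t (1 : R)) (alpha_is_derive dt)) _.
by rewrite /prof_a1 /=;ring.
Qed.

Lemma prof_a1_is_derive t : pdom t -> is_der t prof_a1 (prof_a2 t).
move=> dt;have h := derM (is_derive_id t (1 : R)) (ua_is_derive dt).
apply: is_derive_eq (derM (alpha_is_derive dt)
 (derD (is_derive_cst (1 : R) t (1 : R)) h)) _.
by rewrite /prof_a2 /=;ring.
Qed.

Lemma prof_bE t : prof_b t = mu t*(t * lid t).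
by rewrite /prof_b /beta /mu;ring. Qed.

Lemma prof_b_is_derive t : pdom t -> is_der t prof_b (prof_b1 t).
move=> dt;have h := derM (is_derive_id t (1 : R)) (lid_is_derive t).
have -> : prof_b = fun t => mu t*(id t * lid t) by apply/funext => s;rewrite prof_bE.
apply: is_derive_eq (derM (mu_is_derive dt) h) _.
by rewrite /prof_b1 /=;ring.
Qed.

Lemma prof_b1_is_derive t : pdom t -> is_der t prof_b1 (prof_b2 t).
move=> dt;have i := is_derive_id t (1 : R).
have h1 := derM i (lid1_is_derive t).
have h2 := derM (derM i (lid_is_derive t)) (um_is_derive dt).
have h := derM (mu_is_derive dt) (derD (derD (lid_is_derive t) h1) h2).
by apply: is_derive_eq h _;rewrite /prof_b2 /=;ring.
Qed.

End Profile.

(** * Numerical conditions on the jet of a profile *)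

Section Numbers.
Context {R : realType} {n : nat}.
Implicit Types (w : 'rV[R]_n).

(** The interface between profiles and frames. After the constraints on the jet come the size
    conditions; large [N] means that [p_KT] dominates the coupling [p_phi * p_sigma] and that [p_KV]
    is almost as large as [p_x]. *)
Definition numbers (N : R) w (A A1 A2 B B1 B2 C1 C2 : R) : Prop :=
 [/\ A != 0, p_G w A A1 B B1 C1 != 0,
  A ^+ 2*sqnorm w + 2*B ^+ 2*sqnorm w ^+ 2 = 1,
  A * p_al w A A1 + 2*B*sqnorm w * p_be w B B1 = 0 &
  A * p_al2 w A1 A2 + 2*B*sqnorm w * p_be2 w B B1 B2 =
   - (p_al w A A1 ^+ 2 + 2*sqnorm w * p_be w B B1 ^+ 2)] /\
 [/\ 0 <= p_x w A <= 1, p_sigma w A B ^+ 2 = p_x w A*(1 - p_x w A),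
  N*(p_phi w A B B1 * p_sigma w A B) ^+ 2 <= p_KT w A A1 A2 B B1 B2 C1 C2,
  p_x w A ^+ 2*N <= p_KV w A A1 B B1 C1*(1+p_x w A*N) &
  0 <= p_KT w A A1 A2 B B1 B2 C1 C2 /\ 0 <= p_KV w A A1 B B1 C1].

(** Multiplication by [p_G] clears the denominators ([KTE], [KVE]). The growth [e0 + 2 * k] of
    [p_ga] is split in two: [e0] compensates the radial variation of the other coordinates, and
    [2 * k] is the gain that dominates the coupling. *)
Lemma numbersP (N : R) w (A A1 A2 B B1 B2 C1 C2 e0 k : R) : 0 <= N -> punct w -> A != 0 ->
 A ^+ 2*sqnorm w + 2*B ^+ 2*sqnorm w ^+ 2 = 1 ->
 A * p_al w A A1 + 2*B*sqnorm w * p_be w B B1 = 0 ->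
 A * p_al2 w A1 A2 + 2*B*sqnorm w * p_be2 w B B1 B2 =
  - (p_al w A A1 ^+ 2 + 2*sqnorm w * p_be w B B1 ^+ 2) ->
 p_ga w C1 != 0 -> p_ga2 w C1 C2 = - (e0 + 2*k) * p_ga w C1 -> 0 <= k ->
 0 <= 2*(sqnorm w * p_be w B B1) ^+ 2 + 2*B*sqnorm w ^+ 2*(p_be2 w B B1 B2+e0 * p_be w B B1) ->
 0 <= 2*B * p_be w B B1*sqnorm w ^+ 2 -> N*(2*B * p_be w B B1*sqnorm w ^+ 2) <= k ->
 (sqnorm w * p_be w B B1) ^+ 2 <= p_ga w C1 ^+ 2 ->
 N*(2*B * p_be w B B1*sqnorm w ^+ 2) ^+ 2 <= p_ga w C1 ^+ 2 ->
 numbers N w A A1 A2 B B1 B2 C1 C2.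
move=> N0 w0 A0 E1 E2 E3 ga0 ga2E k0.
have r0 : 0 < sqnorm w by exact: w0.
have s2 := p_s2 w0.
have Gdef : p_G w A A1 B B1 C1 = sqnorm w * p_al w A A1 ^+ 2+(sqnorm w * p_be w B B1) ^+ 2+p_ga w C1 ^+ 2.
 by rewrite /p_G;ring.
have ga2_gt0 : 0 < p_ga w C1 ^+ 2 by rewrite lt_neqAle eq_sym sqrf_eq0 ga0 sqr_ge0.
have F0 : 0 <= sqnorm w * p_al w A A1 ^+ 2 by rewrite mulr_ge0 ?sqr_ge0 // ltW.
have G0 : 0 < p_G w A A1 B B1 C1.
 by rewrite Gdef ltr_wpDl // addr_ge0 // sqr_ge0.
have zE : p_phi w A B B1 * p_sigma w A B = 2*B * p_be w B B1*sqnorm w ^+ 2.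
 rewrite /p_phi /p_sigma;transitivity (p_be w B B1*B*sqnorm w * p_s w ^+ 2);first by field.
 by rewrite s2;ring.
have sE : p_sigma w A B ^+ 2 = p_x w A*(1 - p_x w A).
 rewrite /p_sigma /p_x exprMn s2;have -> : 1 - A ^+ 2*sqnorm w = 2*B ^+ 2*sqnorm w ^+ 2 by lra.
 by ring.
have x0 : 0 <= p_x w A by rewrite /p_x mulr_ge0 ?sqr_ge0 // ltW.
have x1 : p_x w A <= 1.
 rewrite /p_x.
 have h2 : 0 <= 2*B ^+ 2*sqnorm w ^+ 2.
  by apply: mulr_ge0;[apply: mulr_ge0 => //|];exact: sqr_ge0.
 by move: E1 => h1;lra.
have KTE : p_KT w A A1 A2 B B1 B2 C1 C2 * p_G w A A1 B B1 C1 =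
  sqnorm w * p_al w A A1 ^+ 2*((sqnorm w * p_be w B B1) ^+ 2+p_ga w C1 ^+ 2) +
  2*(sqnorm w * p_be w B B1) ^+ 4 +
  p_ga w C1 ^+ 2*((2*(sqnorm w * p_be w B B1) ^+ 2 +
   2*B*sqnorm w ^+ 2*(p_be2 w B B1 B2+e0 * p_be w B B1)) +
   2*k*(2*B * p_be w B B1*sqnorm w ^+ 2)).
 have -> : p_KT w A A1 A2 B B1 B2 C1 C2 * p_G w A A1 B B1 C1 =
  - sqnorm w*(A * p_al2 w A1 A2) * p_G w A A1 B B1 C1 +
  sqnorm w*(A * p_al w A A1) * p_GG w A A1 A2 B B1 B2 C1 C2.
  by rewrite /p_KT;field;rewrite gt_eqF.
 have al2E : A * p_al2 w A1 A2 = - (p_al w A A1 ^+ 2 + 2*sqnorm w * p_be w B B1 ^+ 2)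
   - 2*B*sqnorm w * p_be2 w B B1 B2 by rewrite -E3 addrK.
 have alE : A * p_al w A A1 = - (2*B*sqnorm w * p_be w B B1).
  by apply/eqP;rewrite -subr_eq0 opprK E2.
 have -> : - sqnorm w*(A * p_al2 w A1 A2) * p_G w A A1 B B1 C1 +
  sqnorm w*(A * p_al w A A1) * p_GG w A A1 A2 B B1 B2 C1 C2 =
  - sqnorm w*(A * p_al2 w A1 A2)*((sqnorm w * p_be w B B1) ^+ 2+p_ga w C1 ^+ 2)
 +sqnorm w*(A * p_al w A A1)*(sqnorm w ^+ 2 * p_be2 w B B1 B2 * p_be w B B1+p_ga2 w C1 C2 * p_ga w C1).
  by rewrite Gdef /p_GG;ring.
 by rewrite al2E alE ga2E;ring.
have KVE : p_KV w A A1 B B1 C1 * p_G w A A1 B B1 C1 =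
  p_x w A*((sqnorm w * p_be w B B1) ^+ 2+p_ga w C1 ^+ 2).
 transitivity (p_x w A*(p_G w A A1 B B1 C1 - sqnorm w * p_al w A A1 ^+ 2)).
  by rewrite /p_KV;field;rewrite gt_eqF.
 by rewrite Gdef;ring.
have xF : p_x w A*(sqnorm w * p_al w A A1 ^+ 2) = (2*B * p_be w B B1*sqnorm w ^+ 2) ^+ 2.
 transitivity ((sqnorm w*(A * p_al w A A1)) ^+ 2);first by rewrite /p_x;ring.
 have -> : A * p_al w A A1 = - (2*B*sqnorm w * p_be w B B1).
  by apply/eqP;rewrite -subr_eq0 opprK E2.
 by ring.
rewrite /numbers zE sE.
move: Gdef KTE KVE xF;rewrite exprSr.
move: (p_al w _ _) F0 E2 E3 => al F0 E2 E3.
move: (2*(_ * _) ^+ 2 + _) => P.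
have := sqr_ge0 (sqnorm w * p_be w B B1).
have -> : (sqnorm w * p_be w B B1) ^+ 4 = ((sqnorm w * p_be w B B1) ^+ 2) ^+ 2 by ring.
move: (2*B * _ * _) ((_ * p_be _ _ _) ^+ 2) => z Gb Gb0.
rewrite -exprSr;move: (p_ga w C1 ^+ 2) ga2_gt0 => g2 g2_gt0.
move: (sqnorm w*al ^+ 2) F0 => F F0 Gdef KTE KVE xF P0 z0 Nz Gbg Nzz.
have KT1 : N*z ^+ 2 <= p_KT w A A1 A2 B B1 B2 C1 C2.
 rewrite -(ler_pM2r G0) KTE Gdef.
 have h1 : 0 <= F*(g2 - N*z ^+ 2) by rewrite mulr_ge0 // subr_ge0.
 have h2 : 0 <= F * Gb by rewrite mulr_ge0.
 have h3 : 0 <= g2 * P by rewrite mulr_ge0 // ltW.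
 have h4 : 0 <= (k - N*z)*z*(g2+Gb).
  by rewrite mulr_ge0 ?addr_ge0 ?mulr_ge0 ?subr_ge0 // ltW.
 have h5 : 0 <= k*z*(g2 - Gb) by rewrite !mulr_ge0 // subr_ge0.
 have h6 : 0 <= Gb ^+ 2 by exact: sqr_ge0.
 by lra.
have KV0 : 0 <= p_KV w A A1 B B1 C1.
 by rewrite -(pmulr_lge0 _ G0) KVE mulr_ge0 // addr_ge0 // ltW.
have KT0 : 0 <= p_KT w A A1 A2 B B1 B2 C1 C2.
 by apply: le_trans KT1;rewrite mulr_ge0 // sqr_ge0.
split;first by split=> //;rewrite gt_eqF.
split=> //;first by rewrite x0 x1.
rewrite -(ler_pM2r G0) mulrAC [leRHS]mulrAC KVE Gdef.
have h1 : 0 <= p_x w A*(g2 - N*z ^+ 2) by rewrite mulr_ge0 // subr_ge0.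
have h2 : 0 <= p_x w A * Gb by rewrite mulr_ge0.
have -> : p_x w A ^+ 2*(F+Gb+g2)*N = p_x w A*N*(p_x w A*F)+p_x w A ^+ 2*N*(Gb+g2) by ring.
by rewrite xF;lra.
Qed.

End Numbers.

(** * The profile satisfies the numerical conditions *)

Section ProfileTheorem.
Context {R : realType}.

Lemma expR_ge2 (s : R) : 2*s <= expR s.
have e : expR s = expR (s / 2) ^+ 2 by rewrite expr2 -expRD;congr expR;field.
have [s0|s0] := leP s 0;first by apply: le_trans (expR_ge0 _);lra.
have h := expR_ge1Dx (s / 2).
have h1 : (1+s / 2) ^+ 2 <= expR s by rewrite e ler_sqr ?nnegrE //;lra.
by apply: le_trans h1;have := sqr_ge0 (1 - s / 2);lra.
Qed.

Lemma lid_bounds (t : R) : 0 < t ->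
 [/\ 0 <= lid t <= 1, lid1 t <= 0, 2 * lid t * - lid1 t <= 1, 0 <= lid2 t & - lid1 t <= 6].
move=> t0;have f0 : 0 <= flat 0 (2^-1 - t) by exact: flat_ge0.
have f2 : 0 <= flat 2 (2^-1 - t) by exact: flat_ge0.
have [u0|u0] := leP (2^-1 - t) 0.
 by rewrite /lid /lid1 /lid2 !(flat_le0 _ u0);split;lra.
rewrite /lid /lid1 /lid2 opprK oppr_le0 f2;split => //.
- by rewrite f0 -[leRHS]expR0 /flat u0 expr0 mul1r ler_expR oppr_le0 ltW // invr_gt0.
(* The product equals half the square of [2 * v * expR (- v)], where [v] is the inverse of
   [2^-1 - t], and this factor is at most 1 by [expR_ge2]. *)
- rewrite /flat u0 expr0 mul1r;set e := expR _.
 set v := (2^-1 - t)^-1.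
 have v0 : 0 < v by rewrite invr_gt0.
 have ev : e*(2*v) <= 1.
  have h := expR_ge2 v;have e0 : 0 < e by exact: expR_gt0.
  apply: le_trans (ler_wpM2l (ltW e0) h) _.
  by rewrite /e -expRD addNr expR0.
 have e0 : 0 <= e by exact: expR_ge0.
 have ev0 : 0 <= e*(2*v) by rewrite !mulr_ge0 // ltW.
 have -> : 2*e*(v ^+ 2*e) = (e*(2*v)) ^+ 2 / 2 by field.
 have : (e*(2*v)) ^+ 2 <= 1 by rewrite expr_le1.
 by lra.
(* Convexity: [2^-1 - t] is at most 1/2, hence [v >= 2]. *)
- rewrite /flat u0;set e := expR _;set v := (2^-1 - t)^-1.
 have v0 : 0 < v by rewrite invr_gt0.
 have e0 : 0 <= e by exact: expR_ge0.
 have v2 : 2 <= v.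
  rewrite /v -[leLHS]invrK lef_pV2 ?posrE ?invr_gt0 //;lra.
 have -> : v ^+ 4*e - 2*(v ^+ 3*e) = v ^+ 3*e*(v - 2) by ring.
 by rewrite !mulr_ge0 ?exprn_ge0 ?subr_ge0 // ltW.
- apply: le_trans (flat_bound 2 _) _.
 have -> : 4`!%:R = 24 :> R by [].
 have : (2^-1 - t) ^+ 2 <= (2^-1) ^+ 2 by rewrite ler_sqr ?nnegrE;lra.
 have -> : (2^-1 : R) ^+ 2 = 4^-1 by field.
 by lra.
Qed.

(** For [t < 1 / 4] the value of [lid] is at least [expR (- 4)], whose square is the bound; for
    larger [t] the summand [t] is enough. *)
Lemma den_ge (t : R) : 0 < t -> expR (- 8) <= den t.
move=> t0;have [t4|t4] := leP (4^-1) t.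
 apply: le_trans (_ : 4^-1 <= _);last by apply: le_trans t4 _;rewrite /den lerDl sqr_ge0.
 have h := expR_ge2 (8 : R).
 by rewrite expRN lef_pV2 ?posrE ?expR_gt0 //;lra.
rewrite /den /lid /flat ifT;last by lra.
rewrite expr0 mul1r;apply: ler_wpDl;first exact: ltW.
rewrite expr2 -expRD ler_expR.
have : (2^-1 - t)^-1 <= 4.
 by rewrite -[leRHS]invrK lef_pV2 ?posrE ?invr_gt0 //;lra.
by lra.
Qed.

Definition gam (k t : R) : R := expR (k * t).
Definition gam1 (k t : R) : R := k * gam k t.
Definition gam2 (k t : R) : R := k * gam1 k t.

Local Notation AL w t := (p_al w (prof_a t) (rad1 prof_a1 w)).
Local Notation BE w t := (p_be w (prof_b t) (rad1 prof_b1 w)).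
Local Notation AL2 w := (p_al2 w (rad1 prof_a1 w) (rad2 prof_a1 prof_a2 w)).
Local Notation BE2 w t := (p_be2 w (prof_b t) (rad1 prof_b1 w) (rad2 prof_b1 prof_b2 w)).

(** The size of [p_ga] is at least [2 * k] times [t * (1 - t)], and the quantities it must dominate
    carry matching powers of [t * (1 - t)] with bounded coefficients. One [k] therefore works
    uniformly up to both ends of the interval. *)
Lemma profile_numbers (N : R) : 0 <= N -> exists2 k, 0 < k & forall n (w : 'rV[R]_n), punct w ->
 numbers N w (prof_a (invP w)) (rad1 prof_a1 w) (rad2 prof_a1 prof_a2 w)
  (prof_b (invP w)) (rad1 prof_b1 w) (rad2 prof_b1 prof_b2 w) (rad1 (gam1 k) w) (rad2 (gam1 k) (gam2 k) w).
move=> N0;pose d : R := expR (- 8);have d0 : 0 < d by exact: expR_gt0.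
have i0 : 0 < d^-1 by rewrite invr_gt0.
have k3 : 0 <= (6+d^-1) ^+ 2*d^-1 by rewrite mulr_ge0 ?sqr_ge0 // ltW.
have k1 : 0 <= N*(2*d^-1 ^+ 2).
 by apply: mulr_ge0 => //;apply: mulr_ge0 => //;exact: sqr_ge0.
have k2 : 0 <= N*(2*d^-1 ^+ 2) ^+ 2 by rewrite mulr_ge0 // sqr_ge0.
(* Each summand secures one of the requirements [K1] to [K4]; [d^-1] bounds the inverse of [den],
   and 6 bounds the slope of [lid]. *)
exists (1+N*(2*d^-1 ^+ 2)+N*(2*d^-1 ^+ 2) ^+ 2+(6+d^-1) ^+ 2*d^-1);first by lra.
set k := 1 + _ + _ + _ => n w w0.
have K1 : 1 <= k by rewrite /k;lra.
have K2 : N*(2*d^-1 ^+ 2) <= k by rewrite /k;lra.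
have K3 : N*(2*d^-1 ^+ 2) ^+ 2 <= k by rewrite /k;lra.
have K4 : (6+d^-1) ^+ 2*d^-1 <= k by rewrite /k;lra.
clearbody k;have kk : k <= k ^+ 2 by rewrite expr2 ler_peMr //;lra.
have tw := invP_itv w0;have /andP[t0 t1] := tw;pose t := invP w.
have t0' : t != 0 by rewrite gt_eqF.
have t1' : 1 - t != 0 by rewrite gt_eqF // subr_gt0.
have dt : pdom t by exact: unit_prof.
have D0 : 0 < den t by case: dt.
have rhoE : sqnorm w = (1 - t) / t.
 rewrite /t /invP;field;by rewrite gt_eqF // ltr_wpDr // sqnorm_ge0.
have [L01 L1n LL1 L2p L1b] := lid_bounds t0;have Dd : d <= den t by exact: den_ge.
have aE : alpha t ^+ 2 = ((den t)*(1 - t))^-1.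
 by rewrite /alpha exprMn !isqrt_sqr ?subr_gt0 // invfM.
have mE : mu t ^+ 2 = (2*den t)^-1*(1 - t) ^- 2.
 rewrite /mu !exprMn !isqrt_sqr //;move: (den t) D0 => c /lt0r_neq0 c0.
 by field;rewrite t1' c0.
have a0 : alpha t != 0 by rewrite mulf_neq0 // gt_eqF // isqrt_gt0 // subr_gt0.
pose X1 : R := - t*(1 - t)*(1 - t*den1 t / den t).
pose Y1 : R := - 2 * t ^+ 2*(1 - t)*(lid1 t - lid t*den1 t / (2*den t)).
have Dn : den t != 0 by rewrite gt_eqF.
have alE : AL w t = alpha t*X1.
 rewrite /p_al /rad1 -/t rhoE /prof_a /prof_a1 /ua /X1.
 by move: (alpha t) (den1 t) (den t) Dn => a b c c0;field;rewrite t0' t1' c0.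
have beE : BE w t = mu t*Y1.
 rewrite /p_be /rad1 -/t rhoE prof_bE /prof_b1 /um /Y1.
 by move: (mu t) (den1 t) (den t) Dn => a b c c0;field;rewrite t0' t1' c0.
pose b1' : R := lid t+t * lid1 t+t * lid t*um t.
pose b2' : R := 2 * lid1 t+t * lid2 t+t * lid t*um2 t + 2 * lid t*um t + 2 * t * lid1 t*um t.
pose Y2 : R := (- 2 * t ^+ 2*(- 4 * t*b1' - 2 * t ^+ 2*b2'))*((1 - t) / t) ^+ 2
 + 5*(- 2 * t ^+ 2*b1')*((1 - t) / t) + 2*(t * lid t).
pose X2 : R := (- 2 * t ^+ 2*(- 4 * t*(1+t*ua t) - 2 * t ^+ 2*(2*ua t+t*ua2 t)))*((1 - t) / t) ^+ 2
 + 3*(- 2 * t ^+ 2*(1+t*ua t))*((1 - t) / t).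
have al2E : AL2 w = alpha t*X2.
 by rewrite /p_al2 /rad1 /rad2 -/t rhoE /prof_a1 /prof_a2 /X2;ring.
have be2E : BE2 w t = mu t*Y2.
 by rewrite /p_be2 /rad1 /rad2 -/t rhoE prof_bE /prof_b1 /prof_b2 /Y2 /b1' /b2';ring.
have gaE : p_ga w (rad1 (gam1 k) w) = - 2*(t*(1 - t))*(k * gam k t).
 by rewrite /p_ga /rad1 -/t rhoE /gam1;move: (gam k t) => g;field.
have ga2E : p_ga2 w (rad1 (gam1 k) w) (rad2 (gam1 k) (gam2 k) w) =
  - ((2*(1 - 2 * t) + 1) + 2*(t*(1 - t)*k)) * p_ga w (rad1 (gam1 k) w).
 by rewrite gaE /p_ga2 /rad1 /rad2 -/t rhoE /gam2 /gam1;move: (gam k t) => g;field.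
have zE : 2 * prof_b t*BE w t*sqnorm w ^+ 2 =
  t*(1 - t)*((lid t ^+ 2 - 2 * t * lid t * lid1 t) / den t ^+ 2).
 rewrite beE rhoE prof_bE.
 transitivity (2 * mu t ^+ 2*(t * lid t*Y1*((1 - t) / t) ^+ 2));first by ring.
 rewrite mE /Y1 /den1 /den;move: Dn;rewrite /den.
 by move: (lid t) (lid1 t) => l l1 c0;field;rewrite t0' t1' c0.
have GbE : (sqnorm w*BE w t) ^+ 2 =
  (t*(1 - t)) ^+ 2*(2*((lid1 t - lid t*den1 t / (2*den t)) ^+ 2 / den t)).
 rewrite beE rhoE.
 transitivity (mu t ^+ 2*(Y1*((1 - t) / t)) ^+ 2);first by ring.
 rewrite mE /Y1;move: (den t) Dn (den1 t) (lid t) (lid1 t) => c c0 b l l1.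
 by field;rewrite t0' t1' c0.
have PE : 2*(sqnorm w*BE w t) ^+ 2 +
 2 * prof_b t*sqnorm w ^+ 2*(BE2 w t
  +(2*(1 - 2 * t) + 1)*BE w t) =
 2*(t*(1 - t)) ^+ 2*((2 * t*(lid1 t ^+ 2+lid t * lid2 t)*den t
  + 2*(lid t ^+ 2 - 2 * t * lid t * lid1 t)*(1 + 2 * lid t * lid1 t)) / den t ^+ 3).
 rewrite be2E beE prof_bE rhoE.
 transitivity (mu t ^+ 2*(2*((1 - t) / t*Y1) ^+ 2 + 2*(t * lid t)*((1 - t) / t) ^+ 2 *
  (Y2+(2*(1 - 2 * t) + 1)*Y1)));first by ring.
 rewrite mE /Y1 /Y2 /b1' /b2' /um2 /um /den1 /den2 /den;move: Dn;rewrite /den.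
 by move: (lid t) (lid1 t) (lid2 t) => l l1 l2 c0;field;rewrite t0' t1' c0.
have E1 : prof_a t ^+ 2*sqnorm w + 2 * prof_b t ^+ 2*sqnorm w ^+ 2 = 1.
 rewrite prof_bE rhoE /prof_a.
 transitivity (alpha t ^+ 2*(t ^+ 2*((1 - t) / t))+mu t ^+ 2*(2*(t * lid t) ^+ 2*((1 - t) / t) ^+ 2)).
  by ring.
 rewrite aE mE;move: Dn;rewrite /den.
 by move: (lid t) => l c0;field;rewrite t0' t1' c0.
have E2 : prof_a t*AL w t +
  2 * prof_b t*sqnorm w*BE w t = 0.
 rewrite alE beE prof_bE rhoE {1}/prof_a.
 transitivity (alpha t ^+ 2*(t*X1)+mu t ^+ 2*(2*(t * lid t)*((1 - t) / t)*Y1)).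
  by ring.
 rewrite aE mE /X1 /Y1 /den1 /den;move: Dn;rewrite /den.
 by move: (lid t) (lid1 t) => l l1 c0;field;rewrite t0' t1' c0.
have E3 : prof_a t*AL2 w +
  2 * prof_b t*sqnorm w*BE2 w t =
  - (AL w t ^+ 2 + 2*sqnorm w*BE w t ^+ 2).
 rewrite al2E be2E alE beE prof_bE rhoE {1}/prof_a.
 transitivity (alpha t ^+ 2*(t*X2)+mu t ^+ 2*(2*(t * lid t)*((1 - t) / t)*Y2));first by ring.
 transitivity (- (alpha t ^+ 2*X1 ^+ 2+mu t ^+ 2*(2*((1 - t) / t)*Y1 ^+ 2)));last by ring.
 rewrite aE mE /X1 /Y1 /X2 /Y2 /b1' /b2' /ua2 /ua /um2 /um /den1 /den2 /den;move: Dn;rewrite /den.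
 by move: (lid t) (lid1 t) (lid2 t) => l l1 l2 c0;field;rewrite t0' t1' c0.
have s0 : 0 < t*(1 - t) by rewrite mulr_gt0 // subr_gt0.
have g1 : 1 <= gam k t by rewrite /gam -[leLHS]expR0 ler_expR mulr_ge0 //;[lra|exact: ltW].
have Di : (den t)^-1 <= d^-1 by rewrite lef_pV2.
have Di0 : 0 <= (den t)^-1 by rewrite invr_ge0 ltW.
have Di2 : 0 <= (den t) ^- 2 <= d^-1 ^+ 2.
 by rewrite invr_ge0 sqr_ge0 -exprVn ler_sqr ?nnegrE // ltW.
have x10 : 0 <= lid t ^+ 2 - 2 * t * lid t * lid1 t.
 have : 0 <= t*(2 * lid t * - lid1 t).
  by have /andP[h _] := L01;rewrite !mulr_ge0 // ?oppr_ge0 // ltW.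
 by have := sqr_ge0 (lid t);lra.
have x12 : lid t ^+ 2 - 2 * t * lid t * lid1 t <= 2.
 have h1 : lid t ^+ 2 <= 1 by have /andP[h h'] := L01;rewrite expr_le1.
 have h2 : t*(2 * lid t * - lid1 t) <= 1.
  have h3 : 0 <= 2 * lid t * - lid1 t.
   by have /andP[h _] := L01;rewrite !mulr_ge0 // ?oppr_ge0.
  by rewrite mulr_ile1 // ltW.
 by lra.
set x1 := lid t ^+ 2 - 2 * t * lid t * lid1 t in zE x10 x12 PE *.
have X10 : 0 <= x1 / den t ^+ 2 by rewrite mulr_ge0 //;case/andP: Di2.
have X12 : x1 / den t ^+ 2 <= 2*d^-1 ^+ 2 by case/andP: Di2 => h h';rewrite ler_pM.
have d1b : 0 <= den1 t <= 1.
 rewrite /den1;have : 0 <= lid t * - lid1 t.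
  by have /andP[h _] := L01;rewrite mulr_ge0 // oppr_ge0.
 by have := LL1;rewrite -/t;lra.
have gaS : p_ga w (rad1 (gam1 k) w) ^+ 2 = (t*(1 - t)) ^+ 2*(4*(k * gam k t) ^+ 2) by rewrite gaE;ring.
have kg : k <= (k * gam k t) ^+ 2.
 apply: (le_trans kk);rewrite ler_sqr ?nnegrE;[|lra|by rewrite mulr_ge0 //;lra].
 by rewrite ler_peMr //;lra.
(* The split of the growth rate found in [ga2E]: only the second part contains [k]. *)
apply: (@numbersP _ _ _ _ _ _ _ _ _ _ _ _ (2*(1 - 2 * t) + 1) (t*(1 - t)*k)) => //.
- by rewrite mulf_neq0.
- have gk : k * gam k t != 0 by rewrite gt_eqF // mulr_gt0 //;lra.
 rewrite gaE;apply: mulf_neq0 gk;apply: mulf_neq0;last by rewrite gt_eqF.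
 by rewrite oppr_eq0 pnatr_eq0.
- by rewrite mulr_ge0 ?ltW //;lra.
- rewrite -/t PE;apply: mulr_ge0;first by apply: mulr_ge0 => //;exact: sqr_ge0.
 apply: divr_ge0;last by rewrite exprn_ge0 // ltW.
 apply: addr_ge0;last first.
  by apply: mulr_ge0;[exact: mulr_ge0|have /andP[] := d1b].
 have /andP[h _] := L01;apply: mulr_ge0;last exact: ltW.
 apply: mulr_ge0;first by apply: mulr_ge0 => //;exact: ltW.
 by apply: addr_ge0;[exact: sqr_ge0|exact: mulr_ge0].
- by rewrite -/t zE mulr_ge0 // ltW.
- rewrite -/t zE mulrCA;apply: ler_wpM2l;first exact: ltW.
 by apply: le_trans K2;rewrite ler_wpM2l.
- rewrite -/t GbE gaS;apply: ler_wpM2l;first exact: sqr_ge0.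
 apply: (@le_trans _ _ (2*k));last by have := sqr_ge0 (k * gam k t);move: kg;lra.
 rewrite ler_wpM2l //;apply: le_trans K4.
 apply: ler_pM => //;first exact: sqr_ge0.
 have h : 0 <= lid t*den1 t / (2*den t) <= d^-1.
  have /andP[h1 h2] := L01;have /andP[h3 h4] := d1b.
  have h5 : lid t*den1 t <= 1 by rewrite mulr_ile1.
  have h6 : 0 <= lid t*den1 t by rewrite mulr_ge0.
  have h7 : 1 <= d^-1*den t by rewrite -(mulVf (lt0r_neq0 d0)) ler_wpM2l // ltW.
  apply/andP;split;first by apply: divr_ge0 => //;apply: mulr_ge0 => //;exact: ltW.
  by rewrite ler_pdivrMr ?mulr_gt0 //;lra.
 have -> : (lid1 t - lid t*den1 t / (2*den t)) ^+ 2 = (- lid1 t+lid t*den1 t / (2*den t)) ^+ 2.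
  by move: (lid1 t) (lid t*den1 t / (2*den t)) => u v;ring.
 by rewrite ler_sqr ?nnegrE;have := L1n;have := L1b;rewrite -/t;lra.
- rewrite -/t zE gaS.
 have -> : N*(t*(1 - t)*(x1 / den t ^+ 2)) ^+ 2 = (t*(1 - t)) ^+ 2*(N*(x1 / den t ^+ 2) ^+ 2) by ring.
 apply: ler_wpM2l;first exact: sqr_ge0.
 apply: (@le_trans _ _ k);last by have := sqr_ge0 (k * gam k t);move: kg;lra.
 apply: le_trans K3;apply: ler_wpM2l => //.
 by rewrite !expr2;apply: ler_pM.
Qed.

End ProfileTheorem.

(** * From numerical conditions to curvature of cones *)

Section ConePoints.
Context {R : realType} {n N : nat}.
Variable Qm : 'I_N -> 'M[R]_n.
Hypothesis Qsym : forall l, (Qm l)^T = Qm l.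

(** A property of the quadratic map alone, quantified over all admissible jets. The sphere case thus
    serves both for the sphere itself and for the neck of every connected sum. *)
Definition curved (K : R) (w : 'rV[R]_n) : Prop :=
 forall A A1 A2 B B1 B2 C1 C2 (F : 'I_(n+(N + 1)) -> 'rV[R]_n -> R),
 numbers K w A A1 A2 B B1 B2 C1 C2 -> nice F w ->
 (forall j l, dd l (F j) w = nd Qm w A A1 B B1 C1 (delta_mx 0 l) 0 j) ->
 (forall j i k, dd i (dd k (F j)) w = ndd Qm w A1 A2 B B1 B2 C1 C2 (delta_mx 0 i) (delta_mx 0 k) 0 j) ->
 snn F w.

Variables (a b c a1 a2 b1 b2 c1 c2 : R -> R).
Hypotheses (sa : smooth1 uitv a) (sb : smooth1 uitv b) (sc : smooth1 uitv c).
Hypothesis da : forall t, uitv t -> is_der t a (a1 t).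
Hypothesis da1 : forall t, uitv t -> is_der t a1 (a2 t).
Hypothesis db : forall t, uitv t -> is_der t b (b1 t).
Hypothesis db1 : forall t, uitv t -> is_der t b1 (b2 t).
Hypothesis dc : forall t, uitv t -> is_der t c (c1 t).
Hypothesis dc1 : forall t, uitv t -> is_der t c1 (c2 t).

Lemma cone_nice w : punct w -> a (invP w) != 0 -> c1 (invP w) != 0 ->
 nice (fun j w => cone Qm a b c w 0 j) w.
move=> w0 aw cw;apply: nice_immersive.
 exists punct;split=> //;first exact: open_punct.
 by move=> j;exact: (smooth_cone Qm sa sb sc j).
move=> u Hu.
have E : cone_d Qm a b a1 b1 c1 w u = 0.
 apply/rowP => j;rewrite -(cone_dE Qsym sa da sb db dc j u w0) Hu.
 by rewrite mxE.
have wu : dot w u = 0.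
 have := congr1 (fun v : 'rV_(n+(N + 1)) => v 0 (rshift n (rshift N 0))) E.
 rewrite /cone_d !row_mxEr mxE [RHS]mxE => /eqP;rewrite mulf_eq0 => /orP[|/eqP //].
 have /andP[h _] := invP_itv w0;rewrite /rad1 mulf_eq0 (negPf cw) orbF mulf_eq0 oppr_eq0 pnatr_eq0 /=.
 by rewrite expf_eq0 /= gt_eqF.
have /rowP H := E;apply/rowP => k;have := H (lshift _ k).
rewrite /cone_d row_mxEl wu mulr0 scale0r addr0 mxE [RHS]mxE => /eqP.
by rewrite mulf_eq0 (negPf aw) => /eqP ->;rewrite mxE.
Qed.

Lemma cone_snn (K : R) w : punct w -> c1 (invP w) != 0 -> curved K w ->
 numbers K w (a (invP w)) (rad1 a1 w) (rad2 a1 a2 w) (b (invP w)) (rad1 b1 w) (rad2 b1 b2 w)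
  (rad1 c1 w) (rad2 c1 c2 w) ->
 snn (fun j w => cone Qm a b c w 0 j) w.
move=> w0 cw Hc Hn;have [[aw _ _ _ _] _] := Hn.
have oD := @open_unit_itv R.
have sa1 := smooth1_derivative oD sa da;have sb1 := smooth1_derivative oD sb db.
have sc1 := smooth1_derivative oD sc dc.
apply: (Hc _ _ _ _ _ _ _ _ _ Hn (cone_nice w0 aw cw)) => [j l|j i k].
 have := cone_dE Qsym sa da sb db dc j (delta_mx 0 l) w0.
 rewrite (bigD1 l) //= mxE !eqxx mul1r big1 ?addr0 => [-> //|i /negPf il].
 by rewrite mxE il andbF mul0r.
rewrite (cone_ddE Qsym sa sa1 da da1 sb sb1 db db1 sc1 dc dc1) //.
Qed.

End ConePoints.

Section NumbersPositivity.
Context {R : realType} {n : nat}.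

(** The threshold 12 comes from [3 * (1 - x) * (1 + x * K) <= K]: the difference of the two sides is
    [3 / 4 * K * (1 - 2 * x) ^ 2 + K / 4 - 3 * (1 - x)]. *)
Lemma numbers_assoc_psd (D S : finType) (C : D -> S -> S -> R) (N K : R) (w : 'rV[R]_n)
  (A A1 A2 B B1 B2 C1 C2 : R) : (forall a s t, C a t s = - C a s t) ->
 (forall a b s t, GC C a b s t+GC C b a s t = 2*((a == b)%:R*(s == t)%:R)) ->
 0 < N -> 9*N <= K -> 12 <= K ->
 (forall A' : (unit+(D+S)) -> (unit+(D+S)) -> R, antisym A' ->
  \sum_a CA C A' a ^+ 2 <= N*etasq A') ->
 (forall A' : (unit+(D+S)) -> (unit+(D+S)) -> R, antisym A' ->
  \sum_a \sum_b gA C A' a b ^+ 2 <= 2 * \sum_a CA C A' a ^+ 2) ->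
 numbers K w A A1 A2 B B1 B2 C1 C2 ->
 strong_psd (gramq (model_gram C (p_KT w A A1 A2 B B1 B2 C1 C2) (p_KV w A A1 B B1 C1)
  (p_x w A) (p_phi w A B B1) (p_sigma w A B) (assocHH C (p_x w A)))).
move=> Csk Ccl N0 KN K12 HCA HgA [_ [/andP[x0 x1] sE KT1 KV1 [KT0 KV0]]].
apply: (assoc_strong_psd Csk Ccl x0 x1 sE KT0 KV0 N0 HCA HgA).
 have := sqr_ge0 (p_phi w A B B1 * p_sigma w A B).
 move: ((_ * p_sigma _ _ _) ^+ 2) KT1 => z KT1 z0.
 by have := ler_wpM2r z0 KN;lra.
move: (p_x w A) (p_KV w A A1 B B1 C1) x0 x1 KV1 KV0 => x k x0 x1 KV1 KV0.
have p0 : 0 < 1+x*K by rewrite ltr_wpDr // mulr_ge0 //;lra.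
rewrite -(ler_pM2r p0);apply: le_trans KV1.
have -> : 3*x ^+ 2*(1 - x)*(1+x*K) = x ^+ 2*(3*(1 - x)*(1+x*K)) by ring.
apply: ler_wpM2l;first exact: sqr_ge0.
have h : 0 <= K*(1 - 2*x) ^+ 2 by rewrite mulr_ge0 ?sqr_ge0 //;lra.
by lra.
Qed.

End NumbersPositivity.

(** * The sphere *)

Section SphereFrame.
Context {R : realType} {n : nat}.
Implicit Types (u v w : 'rV[R]_n).

Lemma mulmx_dot u v w : u *m (v^T *m w) = dot u v *: w.
rewrite mulmxA;have -> : u *m v^T = (dot u v)%:M by rewrite [LHS]mx11_scalar mxE;
 congr (_%:M);eqsum i;rewrite mxE.
by rewrite mul_scalar_mx.
Qed.

Definition proj_perp w : 'M[R]_n := 1%:M - (sqnorm w)^-1 *: (w^T *m w).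

Lemma proj_perpE w u : u *m proj_perp w = u - ((sqnorm w)^-1*dot u w) *: w.
by rewrite mulmxBr mulmx1 -scalemxAr mulmx_dot scalerA. Qed.

Lemma proj_perp_sym w : (proj_perp w)^T = proj_perp w.
by rewrite /proj_perp linearB /= linearZ /= trmx_mul trmxK trmx1. Qed.

Lemma proj_perp_id w u : dot u w = 0 -> u *m proj_perp w = u.
by move=> h;rewrite proj_perpE h mulr0 scale0r subr0. Qed.

Lemma dot_proj_perp w u : 0 < sqnorm w -> dot (u *m proj_perp w) w = 0.
by move=> w0;rewrite proj_perpE dotBl dotZl dotxx mulrAC mulVf ?mul1r ?subrr // gt_eqF.
Qed.

Definition sphereQ : 'I_1 -> 'M[R]_n := fun=> 1%:M.

Lemma sphereQ_quad u v : quad sphereQ u v = const_mx (dot u v).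
by apply/rowP => l;rewrite !mxE mulmx1. Qed.

Lemma dot_const1 (a b : R) : dot (const_mx a : 'rV[R]_1) (const_mx b) = a*b.
by rewrite /dot big_ord1 !mxE. Qed.

(** The whole orthogonal complement of [w] is vertical and there are no horizontal directions. [V]
    is a multiple of the projection to that complement, so redundant coordinates replace a basis of
    it. *)
Lemma sphere_curved (K : R) w : 12 <= K -> punct w -> curved sphereQ K w.
move=> K12 w0 A A1 A2 B B1 B2 C1 C2 F num nF F1 F2.
have Qs l : (sphereQ l)^T = sphereQ l by rewrite trmx1.
have [[A0 G0 E1 E2 E3] _] := num.
have r0 : 0 < sqnorm w by exact: w0.
pose r := Num.sqrt (sqnorm w).
have rr : r*r = sqnorm w by rewrite -expr2 sqr_sqrtr // ltW.
have rn : r != 0 by apply/eqP => h;move: r0;rewrite -rr h mul0r ltxx.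
pose V : 'M[R]_n := r *: proj_perp w.
have VV : V *m V^T = sqnorm w *: proj_perp w.
 rewrite /V linearZ /= proj_perp_sym -scalemxAl -scalemxAr scalerA rr;congr (_ *: _).
 by apply/row_matrixP => i;rewrite row_mul proj_perp_id // rowE dot_proj_perp.
have aV (a : 'rV[R]_n) : adm w V a -> dot a w = 0.
 rewrite /adm -mulmxA VV -scalemxAr => /(scalerI (lt0r_neq0 r0)) h.
 by rewrite -h dot_proj_perp.
have Vadm (a : 'rV[R]_n) : dot a w = 0 -> adm w V a.
 by move=> h;rewrite /adm -mulmxA VV -scalemxAr proj_perp_id.
pose Cz : 'I_n -> 'M[R]_0 := fun=> 0.
have e0 (y y' : 'rV[R]_0) : y = y' by apply/rowP => -[].
have d0 (y y' : 'rV[R]_0) : dot y y' = 0 by rewrite /dot big_ord0.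
have Vz a : dot (a *m V) w = 0.
 by rewrite /V -scalemxAr dotZl dot_proj_perp ?mulr0.
have H0 (y : 'rV[R]_0) : y *m (0 : 'M[R]_(0, n)) = 0 by rewrite mulmx0.
have s0 (C : 'I_n -> 'I_0 -> 'I_0 -> R) (A' : unit+('I_n + 'I_0) -> unit+('I_n + 'I_0) -> R) a :
  CA C A' a = 0 by rewrite /CA big_ord0.
have hpsd := @numbers_assoc_psd _ _ _ _ (fun a s s1 => Cz a s s1) 1 K w A A1 A2 B B1 B2 C1 C2.
apply: (point_snn Qs r0 A0 G0 E1 E2 E3 _ (V := V) (H := 0) (Cm := Cz) (t := fun i => (sqnorm w)^-1*w 0 i)
 (v := fun i => r^-1 *: (delta_mx 0 i *m proj_perp w)) (Y := fun=> 0) _ _ _ _ _ _ _ _ _ _ _ _ _ _ _ nF F1 F2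
 (hpsd _ _ _ _ _ _ _ num)) => //.
- by rewrite sphereQ_quad dot_const1 dotxx expr2.
- move=> i;rewrite mulmx0 addr0 /V -scalemxAl -scalemxAr scalerA mulVf // scale1r.
 rewrite (proj_perp_id (dot_proj_perp _ r0)) proj_perpE addrC -[X in X = _](subrK (((sqnorm w)^-1*w 0 i) *: w)).
 by rewrite dotC dot_delta.
- by move=> i;apply: Vadm;rewrite dotZl dot_proj_perp ?mulr0.
- by rewrite /V linearZ /= proj_perp_sym -scalemxAr proj_perpE dotxx mulVf ?gt_eqF // scale1r subrr scaler0.
- by rewrite trmx0 mulmx0.
- by move=> a;rewrite sphereQ_quad dotC Vz;apply/rowP => j;rewrite !mxE.
- move=> a b _ hb;rewrite !sphereQ_quad dotxx (dot_admissible _ hb).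
 by apply/rowP => j;rewrite !mxE mulrC.
- move=> a y _ _;rewrite !mulmx0 !sphereQ_quad !dot0r //.
- by move=> y _;rewrite mulmx0 !sphereQ_quad dot0r dot_const1 mulr0.
- by move=> y y' _ _;rewrite !mulmx0 !sphereQ_quad !dot0r d0 mulr0.
- by move=> y y' _ _;rewrite !mulmx0 !sphereQ_quad !dot0r.
- by move=> y y' y'' _ _ _;rewrite !mulmx0 !sphereQ_quad !dot0r.
- move=> i k j l;rewrite /HH4 !d0 !mul0r !mulr0 big_ord0 add0r !mulmx0 !sphereQ_quad !dot0r.
 by rewrite mulr0.
- by move=> a [].
- by move=> a b [].
- by lra.
- move=> A' _;rewrite big1 => [|a _];last by rewrite s0 expr0n.
 by rewrite mul1r /etasq big_ord0.
- move=> A' _;rewrite big1 => [|a _];last by rewrite big1 // => b _;rewrite /gA big_ord0 expr0n.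
 by rewrite mulr_ge0 // sumr_ge0 // => a _;exact: sqr_ge0.
Qed.

End SphereFrame.

(** * Cayley-Dickson algebras as composition algebras *)

Section CayleyDicksonAlgebra.
Context {R : realType}.

Lemma dot_ext n (x y : 'rV[R]_n) : (forall z, dot x z = dot y z) -> x = y.
by move=> h;apply/rowP => j;rewrite -!dot_delta h. Qed.

Lemma dot_row n m (x x' : 'rV[R]_n) (y y' : 'rV[R]_m) :
 dot (row_mx x y) (row_mx x' y') = dot x x'+dot y y'.
rewrite /dot big_split_ord /=;congr (_ + _);eqsum i.
 by rewrite !row_mxEl.
by rewrite !row_mxEr.
Qed.

Local Notation A k := 'rV[R]_(cd_dim k).
Local Notation mul := cd_mul.
Local Notation conj := cd_conj.

Lemma cind k (P : A k.+1 -> Prop) : (forall a b : A k, P (row_mx a b)) -> forall x, P x.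
by move=> h x;rewrite -[x]hsubmxK;exact: h. Qed.

Lemma cconjE k (a b : A k) : conj (row_mx a b : A k.+1) = row_mx (conj a) (- b).
by rewrite /= row_mxKl row_mxKr. Qed.

Lemma cmulE k (a b c d : A k) : mul (row_mx a b : A k.+1) (row_mx c d) =
 row_mx (mul a c - mul (conj d) b) (mul d a+mul b (conj c)).
by rewrite /= !row_mxKl !row_mxKr. Qed.

Lemma caddE k (a b c d : A k) : (row_mx a b : A k.+1)+row_mx c d = row_mx (a+c) (b+d).
exact: add_row_mx. Qed.

Lemma cscaleE k (t : R) (a b : A k) : t *: (row_mx a b : A k.+1) = row_mx (t *: a) (t *: b).
exact: scale_row_mx. Qed.

Lemma cdotE k (a b c d : A k) : dot (row_mx a b : A k.+1) (row_mx c d) = dot a c+dot b d.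
exact: dot_row. Qed.

Lemma cconjD k (x y : A k) : conj (x+y) = conj x+conj y.
elim: k x y => [//|k IH];apply: cind => a b;apply: cind => c d.
by rewrite caddE !cconjE caddE IH opprD.
Qed.

Lemma cconjZ k (t : R) (x : A k) : conj (t *: x) = t *: conj x.
elim: k x => [//|k IH];apply: cind => a b.
by rewrite cscaleE !cconjE cscaleE IH scalerN.
Qed.

Lemma cconjN k (x : A k) : conj (- x) = - conj x.
by rewrite -scaleN1r cconjZ scaleN1r. Qed.

Lemma cconjK k (x : A k) : conj (conj x) = x.
elim: k x => [//|k IH];apply: cind => a b.
by rewrite !cconjE IH opprK.
Qed.

Lemma cconj1 k : conj (cd_one k) = cd_one k :> A k.
elim: k => [//|k IH];rewrite -[cd_one k.+1]/(row_mx (cd_one k) 0 : A k.+1).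
by rewrite cconjE IH oppr0.
Qed.

Lemma cconj_dot k (x y : A k) : dot (conj x) (conj y) = dot x y.
elim: k x y => [//|k IH];apply: cind => a b;apply: cind => c d.
by rewrite !cconjE !cdotE IH dotNl dotNr opprK.
Qed.

Lemma cmulD k (x y z : A k) : mul (x+y) z = mul x z+mul y z /\ mul z (x+y) = mul z x+mul z y.
elim: k x y z => [|k IH].
 by move=> x y z;split;apply/rowP => j;rewrite !mxE ?mulrDl ?mulrDr.
apply: cind => a b;apply: cind => c d;apply: cind => e f.
have Dl (x y z : A k) : mul (x+y) z = mul x z+mul y z by case: (IH x y z).
have Dr (x y z : A k) : mul z (x+y) = mul z x+mul z y by case: (IH x y z).
rewrite caddE !cmulE !caddE !Dl !Dr !cconjD !Dl !Dr !opprD.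
by split;congr row_mx;rewrite addrACA.
Qed.

Lemma cmulDl k (x y z : A k) : mul (x+y) z = mul x z+mul y z.
by case: (cmulD x y z). Qed.

Lemma cmulDr k (x y z : A k) : mul z (x+y) = mul z x+mul z y.
by case: (cmulD x y z). Qed.

Lemma cmulZ k (t : R) (x z : A k) : mul (t *: x) z = t *: mul x z /\ mul z (t *: x) = t *: mul z x.
elim: k x z => [|k IH].
 by move=> x z;split;apply/rowP => j;rewrite !mxE;ring.
apply: cind => a b;apply: cind => e f.
have Zl (x z : A k) : mul (t *: x) z = t *: mul x z by case: (IH x z).
have Zr (x z : A k) : mul z (t *: x) = t *: mul z x by case: (IH x z).
by rewrite cscaleE !cmulE !cscaleE !Zl !Zr !cconjZ !Zl !Zr !scalerDr !scalerN.
Qed.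

Lemma cmulZl k (t : R) (x z : A k) : mul (t *: x) z = t *: mul x z.
by case: (cmulZ t x z). Qed.

Lemma cmulZr k (t : R) (x z : A k) : mul z (t *: x) = t *: mul z x.
by case: (cmulZ t x z). Qed.

Lemma cmulNl k (x z : A k) : mul (- x) z = - mul x z.
by rewrite -scaleN1r cmulZl scaleN1r. Qed.

Lemma cmulNr k (x z : A k) : mul z (- x) = - mul z x.
by rewrite -scaleN1r cmulZr scaleN1r. Qed.

Lemma cmul0l k (x : A k) : mul 0 x = 0.
by rewrite -(scale0r 0) cmulZl !scale0r. Qed.

Lemma cmul0r k (x : A k) : mul x 0 = 0.
by rewrite -(scale0r 0) cmulZr !scale0r. Qed.

Lemma cconj0 k : conj 0 = 0 :> A k.
by rewrite -(scale0r 0) cconjZ !scale0r. Qed.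

Lemma cmul1 k (x : A k) : mul (cd_one k) x = x /\ mul x (cd_one k) = x.
elim: k x => [x|k IH].
 by split;apply/rowP => j;rewrite !mxE ord1 ?mul1r ?mulr1.
apply: cind => a b;rewrite -[cd_one k.+1]/(row_mx (cd_one k) 0 : A k.+1) !cmulE.
have [l1 r1] := (fun x => (IH x).1, fun x => (IH x).2).
by rewrite cconj1 cconj0 !(l1, r1, cmul0l, cmul0r) !(subr0, addr0, add0r).
Qed.

Lemma cmul1l k (x : A k) : mul (cd_one k) x = x.
by case: (cmul1 x). Qed.

Lemma cmul1r k (x : A k) : mul x (cd_one k) = x.
by case: (cmul1 x). Qed.

Lemma cconjM k (x y : A k) : conj (mul x y) = mul (conj y) (conj x).
elim: k x y => [|k IH].
 by move=> x y;apply/rowP => j;rewrite !mxE mulrC.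
apply: cind => a b;apply: cind => c d.
rewrite !(cmulE, cconjE) !(cconjD, cconjN, IH, cconjK).
rewrite !(cmulNl, cmulNr) opprK opprD;congr row_mx.
by rewrite addrC.
Qed.

(** The two adjunctions are proved together because doubling needs both of them from the previous
    level. *)
Lemma cadjoint k (x y z : A k) :
 dot (mul x y) z = dot y (mul (conj x) z) /\ dot (mul x y) z = dot x (mul z (conj y)).
elim: k x y z => [|k IH].
 by move=> x y z;rewrite /dot !big_ord1 !mxE !ord1;split;ring.
have H1 (x y z : A k) : dot (mul x y) z = dot y (mul (conj x) z) by case: (IH x y z).
have H2 (x y z : A k) : dot (mul x y) z = dot x (mul z (conj y)) by case: (IH x y z).
apply: cind => a b;apply: cind => c d;apply: cind => e f.
rewrite !(cmulE, cconjE, cdotE) !(dotDl, dotNl, dotDr, dotNr, cconjK, cconjN, cmulNl, cmulNr) !opprK.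
split.
 rewrite (H1 a c e) (H2 d a f) (H1 b (conj c) f) -(cconj_dot (conj c)) cconjM !cconjK.
 rewrite (H2 (conj d) b e) -(cconj_dot (conj d)) cconjM !cconjK;ring.
rewrite (H2 a c e) (H1 d a f) (H2 b (conj c) f) cconjK (H1 (conj d) b e) cconjK;ring.
Qed.

Lemma cdot_mull k (x y z : A k) : dot (mul x y) z = dot y (mul (conj x) z).
by case: (cadjoint x y z). Qed.

Lemma cdot_mulr k (x y z : A k) : dot (mul x y) z = dot x (mul z (conj y)).
by case: (cadjoint x y z). Qed.

Definition cassoc k := forall x y z : A k, mul (mul x y) z = mul x (mul y z).
Definition ccomm k := forall x y : A k, mul x y = mul y x.
Definition cnorm k := forall x y : A k, sqnorm (mul x y) = sqnorm x*sqnorm y.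

Lemma ccomm01 k : (k <= 1)%N -> ccomm k.
have c0 : ccomm 0 by move=> x y;apply/rowP => j;rewrite !mxE mulrC.
case: k => [|[|//]] _;first exact: c0.
apply: (@cind 0) => a b;apply: (@cind 0) => c d.
have cE (x : A 0) : conj x = x by [].
by rewrite !cmulE !cE;congr row_mx;[congr (_ - _);exact: c0|exact: addrC].
Qed.

Lemma cassoc_double k : cassoc k -> ccomm k -> cassoc k.+1.
move=> mA mC;apply: cind => a b;apply: cind => c d;apply: cind => e f.
rewrite !cmulE !(cconjD, cconjN, cconjM, cconjK) !(cmulDl, cmulDr, cmulNl, cmulNr).
have h2 : mul (mul (conj d) b) e = mul (mul e (conj d)) b by rewrite (mC _ e) -mA.
have h3 : mul (conj f) (mul d a) = mul a (mul (conj f) d) by rewrite -mA mC.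
have h4 : mul (conj f) (mul b (conj c)) = mul (mul (conj c) (conj f)) b.
 by rewrite (mC b) -mA (mC (conj f)).
have h5 : mul f (mul a c) = mul (mul f c) a by rewrite (mC a c) -mA.
have h6 : mul (mul d a) (conj e) = mul (mul d (conj e)) a by rewrite mA (mC a) -mA.
have h7 : mul (mul b (conj c)) (conj e) = mul b (mul (conj e) (conj c)) by rewrite mA (mC (conj c)).
have h8 : mul f (mul (conj d) b) = mul b (mul (conj d) f) by rewrite mC (mC (conj d)) mA.
rewrite (mA a c e) h2 h3 h4 h5 h6 h7 h8.
by congr row_mx;apply/rowP => j;rewrite !mxE;ring.
Qed.

Lemma cassoc2 k : (k <= 2)%N -> cassoc k.
elim: k => [_ x y z|k IH k2];first by apply/rowP => j;rewrite !mxE mulrA.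
by apply: cassoc_double;[apply: IH;exact: ltnW|exact: ccomm01].
Qed.

(** The cross terms of the two components have opposite signs, and associativity shows that they are
    equal. *)
Lemma cnorm_double k : cassoc k -> cnorm k -> cnorm k.+1.
move=> mA mN;apply: cind => a b;apply: cind => c d;rewrite cmulE -!dotxx !cdotE.
rewrite !(dotDl, dotDr, dotNl, dotNr) !dotxx !mN -!(dotxx (conj _)) !cconj_dot !dotxx.
rewrite (dotC (mul (conj d) b)) (dotC (mul b (conj c))).
have -> : dot (mul a c) (mul (conj d) b) = dot (mul d a) (mul b (conj c)).
 by rewrite -cdot_mulr mA [RHS]cdot_mull.
ring.
Qed.

Lemma cnorm3 k : (k <= 3)%N -> cnorm k.
elim: k => [_ x y|k IH k3];first by rewrite /sqnorm !big_ord1 mxE exprMn.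
by apply: cnorm_double;[exact: cassoc2|apply: IH;exact: ltnW].
Qed.

Section Composition.
Variable k : nat.
Hypothesis N : cnorm k.
Implicit Types (x y z : A k).

Lemma cdot_mul2l x y z : dot (mul x y) (mul x z) = sqnorm x*dot y z.
have E (u v : A k) : sqnorm (u+v) = sqnorm u+sqnorm v + 2*dot u v.
 by rewrite -!dotxx !dotDl !dotDr (dotC v u);ring.
have := E (mul x y) (mul x z);rewrite -cmulDr !N E;move: (dot _ _) (dot _ _) => p q h;lra.
Qed.

Lemma cdot_mul2r x y z : dot (mul y x) (mul z x) = sqnorm x*dot y z.
by rewrite -cconj_dot !cconjM cdot_mul2l -dotxx cconj_dot dotxx cconj_dot. Qed.

(** The norm identity polarized in both factors; for the octonions it takes the place of
    associativity. *)
Lemma cexchange x x' y y' :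
 dot (mul x y) (mul x' y')+dot (mul x' y) (mul x y') = 2*(dot x x'*dot y y').
have := cdot_mul2l (x+x') y y';rewrite !cmulDl !dotDl !dotDr !cdot_mul2l.
have -> : sqnorm (x+x') = sqnorm x+sqnorm x' + 2*dot x x'.
 by rewrite -!dotxx !dotDl !dotDr (dotC x' x);ring.
by move=> h;lra.
Qed.

Lemma cmulKl x y : mul (conj x) (mul x y) = sqnorm x *: y.
by apply: dot_ext => z;rewrite cdot_mull cconjK cdot_mul2l dotZl. Qed.

Lemma cmulKr x y : mul (mul y x) (conj x) = sqnorm x *: y.
by apply: dot_ext => z;rewrite cdot_mulr cconjK cdot_mul2r dotZl. Qed.

Lemma csqnorm_conj x : sqnorm (conj x) = sqnorm x.
by rewrite -!dotxx cconj_dot. Qed.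

Lemma cmulVr x : mul x (conj x) = sqnorm x *: cd_one k.
by rewrite -[RHS]cmulKr cmul1l. Qed.

Lemma cmulVl x : mul (conj x) x = sqnorm x *: cd_one k.
by have := cmulKl x (cd_one k);rewrite cmul1r. Qed.

Lemma cmul_polarl x y z : mul (conj x) (mul y z)+mul (conj y) (mul x z) = (2*dot x y) *: z.
apply: dot_ext => u;rewrite dotDl (cdot_mull (conj x)) (cdot_mull (conj y)) !cconjK dotZl.
by have := cexchange y x z u;rewrite (dotC y x) => ->;ring.
Qed.

Lemma cmul_polarr x y z : mul (mul z y) (conj x)+mul (mul z x) (conj y) = (2*dot x y) *: z.
rewrite -(cconjK (mul (mul z y) _ + _)) cconjD !cconjM !cconjK -!cconjM.
rewrite -[in RHS](cconjK z) -cconjZ;congr conj.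
by rewrite !cconjM -(cconj_dot x y) -cmul_polarl !cconjK.
Qed.

Lemma cmul_polar1 x y z : mul (mul x (conj y)) z+mul (mul x (conj z)) y = (2*dot y z) *: x.
have := cmul_polarr (conj z) (conj y) x;rewrite !cconjK => ->.
by rewrite cconj_dot (dotC z).
Qed.

(** A Moufang identity: the left side is [a (x y) a], and the right side shows that it depends only
    on the product [x y]. It follows by duality from [cexchange]. *)
Lemma cmoufang a x y : mul (mul a x) (mul y a) =
 (2*dot a (conj (mul x y))) *: a - sqnorm a *: conj (mul x y).
apply: dot_ext => z;rewrite cdot_mulr cconjM.
have h := cexchange a z x (mul (conj a) (conj y)).
have e1 : mul a (mul (conj a) (conj y)) = sqnorm a *: conj y.
 by have := cmulKl (conj a) (conj y);rewrite cconjK csqnorm_conj.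
have e2 : dot x (mul (conj a) (conj y)) = dot a (conj (mul x y)).
 by rewrite -cdot_mull cdot_mulr cconjM.
have e3 : dot (mul z x) (conj y) = dot z (conj (mul x y)) by rewrite cdot_mulr cconjM.
move: h;rewrite e1 e2 dotZr e3 dotBl !dotZl (dotC (conj (mul x y)) z).
by move: (dot (mul a x) _) (dot a (conj _)) (dot z (conj _)) (dot a z) => p q r s h;lra.
Qed.

End Composition.

End CayleyDicksonAlgebra.

(** * Block vectors and matrices of linear and bilinear maps *)

Section Blocks.
Context {R : realType}.

Definition blk {p d} (u : 'rV[R]_(p*d)) (i : 'I_p) : 'rV[R]_d := row i (vec_mx u).
Definition bvec {p d} (F : 'I_p -> 'rV[R]_d) : 'rV[R]_(p*d) := mxvec (\matrix_(i, j) F i 0 j).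

Lemma blkE p d (u : 'rV[R]_(p*d)) i j : blk u i 0 j = u 0 (mxvec_index i j).
by rewrite !mxE. Qed.

Lemma blkK p d (F : 'I_p -> 'rV[R]_d) i : blk (bvec F) i = F i.
by apply/rowP => j;rewrite blkE mxvecE mxE. Qed.

Lemma blkP p d (u v : 'rV[R]_(p*d)) : (forall i, blk u i = blk v i) -> u = v.
by move=> h;apply/rowP => l;case/mxvec_indexP: l => i j;rewrite -!blkE h. Qed.

Lemma blkD p d (u v : 'rV[R]_(p*d)) i : blk (u+v) i = blk u i+blk v i.
by apply/rowP => j;rewrite !(blkE, mxE). Qed.

Lemma blkZ p d (a : R) (u : 'rV[R]_(p*d)) i : blk (a *: u) i = a *: blk u i.
by apply/rowP => j;rewrite !(blkE, mxE). Qed.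

Lemma sum_mxvec p d (F : 'I_(p*d) -> R) : \sum_l F l = \sum_i \sum_j F (mxvec_index i j).
rewrite pair_bigA (reindex _ (curry_mxvec_bij p d)) /=.
by apply: eq_bigr => -[i j] _.
Qed.

Lemma dot_blk p d (u v : 'rV[R]_(p*d)) : dot u v = \sum_i dot (blk u i) (blk v i).
rewrite /dot sum_mxvec;eqsum i;eqsum j.
by rewrite !blkE.
Qed.

Definition lmat {p d} (f : 'rV[R]_p -> 'rV[R]_d) : 'M[R]_(p, d) := \matrix_(i, j) f (delta_mx 0 i) 0 j.

Lemma lmatE p d (f : 'rV[R]_p -> 'rV[R]_d) : (forall u v, f (u+v) = f u+f v) ->
 (forall (a : R) u, f (a *: u) = a *: f u) -> forall u, u *m lmat f = f u.
move=> fD fZ u;rewrite {2}(row_sum_delta u).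
have -> : f (\sum_j u 0 j *: delta_mx 0 j) = \sum_j u 0 j *: f (delta_mx 0 j).
 rewrite (big_morph f fD (id1 := 0));first by eqsum j;rewrite fZ.
 by rewrite -(scale0r 0) fZ !scale0r.
by apply/rowP => j;rewrite !mxE summxE;eqsum i;rewrite !mxE.
Qed.

Lemma lmat_sym p (f : 'rV[R]_p -> 'rV[R]_p) : (forall u v, dot (f u) v = dot u (f v)) ->
 (lmat f)^T = lmat f.
by move=> h;apply/matrixP => i j;rewrite !mxE -!dot_delta h dotC. Qed.

Lemma lmat_antisym p (f : 'rV[R]_p -> 'rV[R]_p) : (forall u v, dot (f u) v = - dot u (f v)) ->
 forall s t, lmat f t s = - lmat f s t.
by move=> h s t;rewrite !mxE -!dot_delta h dotC. Qed.

Definition bilin {p d} (f : 'rV[R]_p -> 'rV[R]_p -> 'rV[R]_d) (l : 'I_d) : 'M[R]_p :=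
 \matrix_(i, j) f (delta_mx 0 i) (delta_mx 0 j) 0 l.

Section Bilinear.
Context {p d : nat} (f : 'rV[R]_p -> 'rV[R]_p -> 'rV[R]_d).
Hypothesis fC : forall u v, f u v = f v u.
Hypothesis fD : forall u v z, f (u+v) z = f u z+f v z.
Hypothesis fZ : forall (a : R) u z, f (a *: u) z = a *: f u z.

Lemma bilin_sym l : (bilin f l)^T = bilin f l.
by apply/matrixP => i j;rewrite !mxE fC. Qed.

Lemma quad_bilin u v : quad (bilin f) u v = f u v.
apply/rowP => l;rewrite mxE.
have -> : u *m bilin f l = \row_j f u (delta_mx 0 j) 0 l.
 apply/rowP => j;rewrite !mxE {2}(row_sum_delta u).
 rewrite (big_morph (fun u => f u (delta_mx 0 j)) (fun u v => fD u v _) (id1 := 0));last first.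
  by rewrite -(scale0r 0) fZ !scale0r.
 by rewrite summxE;eqsum i;rewrite !mxE fZ mxE.
rewrite {2}(row_sum_delta v) (fC u) (big_morph (fun v => f v u) (fun v v' => fD v v' _) (id1 := 0));last first.
 by rewrite -(scale0r 0) fZ !scale0r.
rewrite summxE /dot;eqsum j;rewrite fZ !mxE (fC u);exact: mulrC.
Qed.

End Bilinear.
End Blocks.

Section FourSum.
Context {R : realType} {m : nat}.

Definition bil (f : 'I_m -> 'I_m -> R) (y z : 'rV[R]_m) : R := \sum_s \sum_t y 0 s*z 0 t*f s t.

Lemma bil_delta y z : bil (fun s t => (s == t)%:R) y z = dot y z.
eqsum s;rewrite (bigD1 s) //= eqxx mulr1 big1 ?addr0 // => t /negPf st.
by rewrite eq_sym st mulr0.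
Qed.

Lemma sum4_bil (f g : 'I_m -> 'I_m -> R) (y1 y2 y3 y4 : 'rV[R]_m) :
 \sum_s \sum_u \sum_s' \sum_u' y1 0 s*y2 0 u*(y3 0 s'*y4 0 u')*(f s s' * g u u') =
 bil f y1 y3*bil g y2 y4.
rewrite /bil mulr_suml;eqsum s;rewrite exchange_big mulr_suml.
apply: eq_bigr => s' _ /=;distrsum u;rewrite mulr_sumr.
by apply: eq_bigr => u' _;ring.
Qed.

Lemma sum4_bil_swap (f g : 'I_m -> 'I_m -> R) (y1 y2 y3 y4 : 'rV[R]_m) :
 \sum_s \sum_u \sum_s' \sum_u' y1 0 s*y2 0 u*(y3 0 s'*y4 0 u')*(f s u' * g u s') =
 bil f y1 y4*bil g y2 y3.
rewrite -sum4_bil;eqsum s;eqsum u;rewrite exchange_big.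
by apply: eq_bigr => u' _;apply: eq_bigr => s' _ /=;ring.
Qed.

(** Evaluates [assocHH] on horizontal vectors and, with [c2 = 0], also [octHH]. *)
Lemma HH4E (I : finType) (c1 c2 : R) (C : I -> 'I_m -> 'I_m -> R) n (Y : 'I_n -> 'rV[R]_m) i k j l :
 HH4 (fun s u t v => c1*((s == u)%:R*(t == v)%:R)+c2*((s == t)%:R*(u == v)%:R +
  (s == v)%:R*(u == t)%:R + \sum_a (C a s t*C a u v+C a s v*C a u t))) Y i k j l =
 c1*(dot (Y i) (Y k)*dot (Y j) (Y l))+c2*(dot (Y i) (Y j)*dot (Y k) (Y l) +
  dot (Y i) (Y l)*dot (Y k) (Y j) + \sum_a (bil (C a) (Y i) (Y j)*bil (C a) (Y k) (Y l) +
   bil (C a) (Y i) (Y l)*bil (C a) (Y k) (Y j))).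
pose T := fun (h : 'I_m -> 'I_m -> 'I_m -> 'I_m -> R) =>
 \sum_s \sum_u \sum_s' \sum_u' Y i 0 s*Y k 0 u*(Y j 0 s'*Y l 0 u')*h s u s' u'.
have TD h h' : T (fun s u t v => h s u t v+h' s u t v) = T h+T h'.
 by rewrite /T;do 4 (rewrite -big_split;apply: eq_bigr => ? _);rewrite mulrDr.
have TZ c h : T (fun s u t v => c*h s u t v) = c*T h.
 by rewrite /T;do 4 (rewrite mulr_sumr;apply: eq_bigr => ? _);rewrite mulrCA.
have TS (h : I -> _) : T (fun s u t v => \sum_a h a s u t v) = \sum_a T (h a).
 rewrite /T;do 4 (rewrite [RHS]exchange_big;apply: eq_bigr => ? _ /=).
 by rewrite mulr_sumr.
have T1 f g : T (fun s u t v => f s t * g u v) = bil f (Y i) (Y j)*bil g (Y k) (Y l).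
 exact: sum4_bil.
have T2 f g : T (fun s u t v => f s v * g u t) = bil f (Y i) (Y l)*bil g (Y k) (Y j).
 exact: sum4_bil_swap.
have T3 : T (fun s u t v => (s == u)%:R*(t == v)%:R) = dot (Y i) (Y k)*dot (Y j) (Y l).
 rewrite -!bil_delta /T /bil mulr_suml;eqsum s;rewrite mulr_suml;eqsum u.
 distrsum t;distrsum v;ring.
rewrite -[HH4 _ _ _ _ _ _]/(T _).
rewrite (TD (fun s u t v => c1*((s == u)%:R*(t == v)%:R))).
rewrite (TZ c1 (fun s u t v => (s == u)%:R*(t == v)%:R)) T3;congr (_ + _).
rewrite (TZ c2 (fun s u t v => (s == t)%:R*(u == v)%:R+(s == v)%:R*(u == t)%:R + _));congr (_ * _).
rewrite (TD (fun s u t v => (s == t)%:R*(u == v)%:R+(s == v)%:R*(u == t)%:R)).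
rewrite (TD (fun s u t v => (s == t)%:R*(u == v)%:R)).
rewrite (T1 (fun s t => (s == t)%:R) (fun s t => (s == t)%:R)).
rewrite (T2 (fun s t => (s == t)%:R) (fun s t => (s == t)%:R)) !bil_delta;congr (_ + _).
rewrite (TS (fun a s u t v => C a s t*C a u v+C a s v*C a u t));eqsum a.
by rewrite (TD (fun s u t v => C a s t*C a u v)) T1 T2.
Qed.

End FourSum.

(** * Orthonormal bases of imaginary elements *)

Section ImaginaryUnits.
Context {R : realType}.

Definition imaginary_basis k {d} (X : 'I_d -> 'rV[R]_(cd_dim k)) : Prop :=
 [/\ forall a, cd_conj (X a) = - X a, forall a b, dot (X a) (X b) = (a == b)%:R,
   forall a, dot (X a) (cd_one k) = 0 &
   forall z, z = dot z (cd_one k) *: cd_one k + \sum_a dot z (X a) *: X a].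

Lemma sqnorm_one k : sqnorm (cd_one k : 'rV[R]_(cd_dim k)) = 1.
elim: k => [|k IH];first by rewrite /sqnorm big_ord1 mxE expr1n.
by rewrite -dotxx [LHS]cdotE !dotxx IH -dotxx dot0l addr0.
Qed.

Lemma cone_delta k : exists i0, cd_one k = delta_mx 0 i0 :> 'rV[R]_(cd_dim k).
elim: k => [|k [i0 E]].
 by exists 0;apply/rowP => j;rewrite !mxE !ord1.
exists (lshift _ i0);rewrite -[cd_one k.+1]/(row_mx (cd_one k) 0) E.
apply/rowP => j;case: (split_ordP j) => l ->.
 by rewrite row_mxEl !mxE !eqxx /= (inj_eq (@lshift_inj _ _)).
by rewrite row_mxEr !mxE eq_rlshift andbF.
Qed.

Lemma cconjE1 k (x : 'rV[R]_(cd_dim k)) : cd_conj x = (2*dot x (cd_one k)) *: cd_one k - x.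
elim: k x => [|k IH].
 move=> x;apply/rowP => j;rewrite !mxE /dot big_ord1 !mxE !ord1;ring.
apply: cind => a b;rewrite -[cd_one k.+1]/(row_mx (cd_one k) 0 : 'rV_(cd_dim k.+1)).
rewrite cconjE cdotE dot0r addr0 IH cscaleE scaler0.
rewrite -[X in _ = _ - X]scale1r -scaleNr cscaleE caddE !scaleN1r add0r //.
Qed.

Lemma imaginary_basis_ex k : exists d (X : 'I_d -> 'rV[R]_(cd_dim k)),
 cd_dim k = d.+1 /\ imaginary_basis X.
have [i0 E] := cone_delta k.
have [d dE] : exists d, cd_dim k = d.+1.
 by case: (cd_dim k) i0 {E} => [[]//|d] _;exists d.
pose cst_ := cast_ord (esym dE).
pose j0 : 'I_d.+1 := cast_ord dE i0.
pose X (a : 'I_d) : 'rV[R]_(cd_dim k) := delta_mx 0 (cst_ (lift j0 a)).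
have i0E : i0 = cst_ j0 by apply: val_inj.
have cI : injective cst_ by exact: cast_ord_inj.
have X1 a : dot (X a) (cd_one k) = 0.
 by rewrite E dot_delta mxE eqxx /= i0E (inj_eq cI) (negPf (neq_lift _ _)).
exists d, X;split=> //;split=> //.
- by move=> a;rewrite cconjE1 X1 mulr0 scale0r sub0r.
- by move=> a b;rewrite dot_delta mxE eqxx /= (inj_eq cI) (inj_eq lift_inj) eq_sym.
move=> z;rewrite E dot_delta.
transitivity (\sum_(j < d.+1) z 0 (cst_ j) *: (delta_mx 0 (cst_ j) : 'rV[R]_(cd_dim k))).
 rewrite {1}(row_sum_delta z) (reindex cst_) //.
 by exists (cast_ord dE) => j _;apply: val_inj.
rewrite (bigD1 j0) //= -i0E;congr (_ + _).
rewrite (reindex_omap (lift j0) (unlift j0)) /=;last first.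
 by move=> i;rewrite eq_sym => ij;have [j -> ->] := unlift_some ij.
apply: eq_big => [a|a _];last by rewrite dot_delta.
by rewrite eq_sym neq_lift liftK eqxx.
Qed.

Section Basis.
Variables (k d : nat) (X : 'I_d -> 'rV[R]_(cd_dim k)).
Hypothesis HX : imaginary_basis X.

Lemma imaginary_parseval x y :
 dot x y = dot x (cd_one k)*dot y (cd_one k) + \sum_a dot x (X a)*dot y (X a).
have [_ _ _ H] := HX;rewrite {1}(H x) dotDl dotZl (dotC _ y);congr (_ + _).
rewrite dotC dot_sumr;eqsum a;by rewrite dotZr.
Qed.

Lemma imaginary_sqnorm x : sqnorm x = dot x (cd_one k) ^+ 2 + \sum_a dot x (X a) ^+ 2.
by rewrite -dotxx imaginary_parseval. Qed.

End Basis.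
End ImaginaryUnits.

(** * Hermitian products and the quadratic map of projective spaces *)

Section ProjectiveAlgebra.
Context {R : realType} {k m : nat}.
Local Notation A := 'rV[R]_(cd_dim k).
Local Notation W := 'rV[R]_(m*cd_dim k).
Implicit Types (u v w : W) (x y : A).
Local Notation mul := cd_mul.
Local Notation conj := cd_conj.
Local Notation one := (cd_one k).

Definition herm u v : A := \sum_i mul (conj (blk u i)) (blk v i).
Definition rmul u x : W := bvec (fun i => mul (blk u i) x).
Definition entry (u : 'rV[R]_(m * m*cd_dim k)) (i j : 'I_m) : A := blk u (mxvec_index i j).
Definition entries (F : 'I_m -> 'I_m -> A) : 'rV[R]_(m * m*cd_dim k) :=
 bvec (fun l => \row_c (mxvec (\matrix_(i, j) F i j 0 c)) 0 l).
(** The symmetrization of the column [u] times the conjugate row of [v]; on the diagonal it gives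
    the quadratic block of a rank one projection. *)
Definition outer u v : 'rV[R]_(m * m*cd_dim k) := entries (fun i j =>
 2^-1 *: (mul (blk u i) (conj (blk v j))+mul (blk v i) (conj (blk u j)))).

Lemma entriesK F i j : entry (entries F) i j = F i j.
by rewrite /entry blkK;apply/rowP => c;rewrite mxE mxvecE mxE. Qed.

Lemma entryP (u v : 'rV[R]_(m * m*cd_dim k)) : (forall i j, entry u i j = entry v i j) -> u = v.
by move=> h;apply: blkP => l;case/mxvec_indexP: l => i j;exact: h. Qed.

Lemma entryD (u v : 'rV[R]_(m * m*cd_dim k)) i j : entry (u+v) i j = entry u i j+entry v i j.
exact: blkD. Qed.

Lemma entryZ (a : R) (u : 'rV[R]_(m * m*cd_dim k)) i j : entry (a *: u) i j = a *: entry u i j.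
exact: blkZ. Qed.

Lemma dot_entry (u v : 'rV[R]_(m * m*cd_dim k)) : dot u v = \sum_i \sum_j dot (entry u i j) (entry v i j).
by rewrite dot_blk sum_mxvec. Qed.

Lemma entry_outer u v i j : entry (outer u v) i j =
 2^-1 *: (mul (blk u i) (conj (blk v j))+mul (blk v i) (conj (blk u j))).
exact: entriesK. Qed.

Lemma outerC u v : outer u v = outer v u.
by apply: entryP => i j;rewrite !entry_outer addrC. Qed.

Lemma outerD u v w : outer (u+v) w = outer u w + outer v w.
apply: entryP => i j;rewrite entryD !entry_outer !blkD cmulDl cconjD cmulDr.
by rewrite -scalerDr addrACA.
Qed.

Lemma outerZ (a : R) u w : outer (a *: u) w = a *: outer u w.
apply: entryP => i j;rewrite entryZ !entry_outer !blkZ cmulZl cconjZ cmulZr.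
by rewrite -scalerDr !scalerA mulrC.
Qed.

Lemma outerZr (a : R) u w : outer w (a *: u) = a *: outer w u.
by rewrite !(outerC w) outerZ. Qed.

Definition projQ := bilin outer.

Lemma projQ_sym l : (projQ l)^T = projQ l.
exact: (bilin_sym outerC). Qed.

Lemma projQ_quad u v : quad projQ u v = outer u v.
exact: (quad_bilin outerC outerD outerZ). Qed.

Lemma hermC u v : herm v u = conj (herm u v).
rewrite /herm (big_morph _ (@cconjD R k) (@cconj0 R k));eqsum i.
by rewrite cconjM cconjK.
Qed.

Lemma hermD u v w : herm u (v+w) = herm u v+herm u w.
by rewrite /herm -big_split;eqsum i;rewrite blkD cmulDr. Qed.

Lemma hermZ (a : R) u v : herm u (a *: v) = a *: herm u v.
by rewrite /herm scaler_sumr;eqsum i;rewrite blkZ cmulZr. Qed.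

Lemma dot_herm u v : dot u v = dot (herm u v) one.
rewrite dot_blk dotC /herm dot_sumr;eqsum i.
by rewrite (dotC one) cdot_mull cconjK cmul1r dotC.
Qed.

Lemma rmulD u v x : rmul (u+v) x = rmul u x+rmul v x.
by apply: blkP => i;rewrite blkD !blkK blkD cmulDl. Qed.

Lemma rmulZ (a : R) u x : rmul (a *: u) x = a *: rmul u x.
by apply: blkP => i;rewrite blkZ !blkK blkZ cmulZl. Qed.

Lemma rmulDr u x y : rmul u (x+y) = rmul u x+rmul u y.
by apply: blkP => i;rewrite blkD !blkK cmulDr. Qed.

Lemma rmulZr (a : R) u x : rmul u (a *: x) = a *: rmul u x.
by apply: blkP => i;rewrite blkZ !blkK cmulZr. Qed.

Lemma rmul1 u : rmul u one = u.
by apply: blkP => i;rewrite blkK cmul1r. Qed.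

Lemma dot_rmul u v x : dot (rmul u x) v = dot u (rmul v (conj x)).
by rewrite !dot_blk;eqsum i;rewrite !blkK cdot_mulr. Qed.

Lemma rmul_sum (I : finType) u (F : I -> A) : rmul u (\sum_a F a) = \sum_a rmul u (F a).
apply: (big_morph (rmul u) (rmulDr u));have := rmulZr 0 u 0;by rewrite !scale0r.
Qed.

End ProjectiveAlgebra.

(** * Projective spaces over R, C and H *)

Section AssociativeFrame.
Context {R : realType} {k m d : nat}.
Hypotheses (As : @cassoc R k) (Nm : @cnorm R k).
Variable X : 'I_d -> 'rV[R]_(cd_dim k).
Hypothesis HX : imaginary_basis X.
Hypothesis d3 : (d <= 3)%N.
Local Notation A := 'rV[R]_(cd_dim k).
Local Notation n := (m*cd_dim k)%N.
Local Notation W := 'rV[R]_n.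
Implicit Types (u v w y : W) (x z : A).
Local Notation mul := cd_mul.
Local Notation conj := cd_conj.
Local Notation one := (cd_one k).

Lemma herm_rmul u v x : herm u (rmul v x) = mul (herm u v) x.
rewrite /herm (big_morph (fun y : A => mul y x) (fun y z : A => cmulDl y z x) (cmul0l x)).
by eqsum i;rewrite blkK As.
Qed.

Lemma dot_outer u v u' v' : dot (outer u v) (outer u' v') =
 2^-1*(dot (herm u' u) (herm v' v)+dot (herm v' u) (herm u' v)).
pose T u v u' v' := \sum_i \sum_j dot (mul (blk u i) (conj (blk v j))) (mul (blk u' i) (conj (blk v' j))).
have TE (a b a' b' : W) : T a b a' b' = dot (herm a' a) (herm b' b).
 rewrite dotC dot_sumr;eqsum i;rewrite dotC dot_sumr;eqsum j.
 by rewrite -{1}(cconjK (blk a' i)) -cdot_mull -As cdot_mulr cconjK.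
have -> : dot (outer u v) (outer u' v') = 4^-1*(T u v u' v'+T u v v' u'+T v u u' v'+T v u v' u').
 rewrite dot_entry -!big_split mulr_sumr;eqsum i => /=.
 rewrite -!big_split mulr_sumr;eqsum j => /=;rewrite !entry_outer.
 by rewrite !(dotZl, dotZr, dotDl, dotDr);field.
by rewrite !TE (dotC (herm u' v)) (dotC (herm v' v));field.
Qed.

(** The rank one matrix of [u] changes only by a real factor along the line of [u] over the algebra.
    This makes the imaginary multiples of [w] vertical. *)
Lemma outer_rmul u x z : outer (rmul u x) (rmul u z) = dot x z *: outer u u.
apply: entryP => i j;rewrite entryZ !entry_outer !blkK !cconjM !As -!cmulDr.
rewrite -(As x) -(As z) -cmulDl.
have -> : mul x (conj z)+mul z (conj x) = (2*dot x z) *: one.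
 by have := cmul_polarr Nm z x one;rewrite !cmul1l dotC.
have -> : conj (blk u j)+conj (blk u j) = 2 *: conj (blk u j) by rewrite scaler_nat mulr2n.
rewrite cmulZl cmul1l !cmulZr !scalerA;congr (_ *: _).
by field.
Qed.

Lemma outer_rmull u v x : outer (rmul u x) v = outer u (rmul v (conj x)).
apply: entryP => i j;rewrite !entry_outer !blkK !cconjM !cconjK;congr (_ *: _).
by rewrite !As addrC;congr (_ + _);rewrite ?As.
Qed.

Lemma herm_self w : herm w w = sqnorm w *: one.
rewrite /herm -dotxx dot_blk scaler_suml;eqsum i.
by rewrite (cmulVl Nm) dotxx.
Qed.

Lemma rmul_polar u v x z : dot (rmul u x) (rmul v z)+dot (rmul u z) (rmul v x) = 2*(dot x z*dot u v).
rewrite !dot_blk -big_split /= !mulr_sumr;eqsum i;rewrite !blkK.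
by rewrite (dotC (mul _ z)) (cexchange Nm);ring.
Qed.

Lemma dot_rmul_herm u v x z : dot (rmul u x) (rmul v z) = dot (mul x (conj z)) (herm u v).
rewrite dot_blk /herm dot_sumr;eqsum i;rewrite !blkK.
by rewrite cdot_mull [RHS]cdot_mulr cconjK As.
Qed.

Definition Cmx (a : 'I_d) : 'M[R]_n := lmat (fun u => rmul u (X a)).

Lemma mul_Cmx u a : u *m Cmx a = rmul u (X a).
by apply: lmatE => [v v'|r v];[exact: rmulD|exact: rmulZ]. Qed.

Local Notation C := (fun a s t => Cmx a s t).

Lemma Cmx_skew a s t : Cmx a t s = - Cmx a s t.
apply: lmat_antisym => u v;have [h _ _ _] := HX.
by rewrite dot_rmul h -scaleN1r rmulZr dotZr mulN1r.
Qed.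

Lemma GC_Cmx a b s t : GC C a b s t = dot (rmul (delta_mx 0 s) (X a)) (rmul (delta_mx 0 t) (X b)).
by eqsum l;rewrite !mxE. Qed.

Lemma Cmx_clifford a b s t : GC C a b s t+GC C b a s t = 2*((a == b)%:R*(s == t)%:R).
have [_ h _ _] := HX.
by rewrite !GC_Cmx rmul_polar h dot_delta mxE eqxx /= (eq_sym t).
Qed.

Lemma bil_Cmx a u v : bil (C a) u v = dot (X a) (herm u v).
have -> : bil (C a) u v = dot (rmul u (X a)) v.
 rewrite -mul_Cmx /dot /bil exchange_big;eqsum t => /=.
 by rewrite mxE mulr_suml;eqsum s;rewrite mulrAC.
by rewrite -[v in LHS]rmul1 dot_rmul_herm cconj1 cmul1r.
Qed.

(** A crude Cauchy-Schwarz constant suffices, since [profile_numbers] reaches every [N]. *)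
Lemma Cmx_bounded : exists2 N : R, 0 < N &
 forall A' : (unit+('I_d + 'I_n)) -> (unit+('I_d + 'I_n)) -> R, antisym A' ->
 \sum_a CA C A' a ^+ 2 <= N*etasq A'.
exists (1 + \sum_a \sum_s \sum_t Cmx a s t ^+ 2).
 rewrite ltr_wpDr // sumr_ge0 // => a _;rewrite sumr_ge0 // => s _.
 by rewrite sumr_ge0 // => t _;exact: sqr_ge0.
move=> A' _;rewrite mulrDl mul1r;apply: ler_wpDl.
 by apply: sumr_ge0 => s _;apply: sumr_ge0 => t _;exact: sqr_ge0.
rewrite mulr_suml;apply: ler_sum => a _.
pose e : 'M[R]_n := \matrix_(s, t) A' (iH s) (iH t).
have sqE (M : 'M[R]_n) : sqnorm (mxvec M) = \sum_s \sum_t M s t ^+ 2.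
 by rewrite /sqnorm sum_mxvec;eqsum s;eqsum t;rewrite mxvecE.
have := cauchy_schwarz (mxvec (Cmx a)) (mxvec e);rewrite !sqE.
have -> : dot (mxvec (Cmx a)) (mxvec e) = CA C A' a.
 rewrite /dot sum_mxvec;eqsum s;eqsum t.
 by rewrite !mxvecE [e s t]mxE mulrC.
suff -> : \sum_s \sum_t e s t ^+ 2 = etasq A' by [].
by eqsum s;eqsum t;rewrite mxE.
Qed.

(** If [Z] is the imaginary element with coordinates [CA], then [gA a b] is the inner product of
    [X a] with [Z X_b], and the double sum is [d - 1] times the squared norm of [Z]. This is where
    [d <= 3] enters. *)
Lemma gA_bound (A' : (unit+('I_d + 'I_n)) -> (unit+('I_d + 'I_n)) -> R) : antisym A' ->
 \sum_a \sum_b gA C A' a b ^+ 2 <= 2 * \sum_a CA C A' a ^+ 2.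
move=> aA;have [h1 h2 h3 _] := HX.
pose e (s : 'I_n) : W := delta_mx 0 s.
pose Z : A := \sum_s \sum_t A' (iH s) (iH t) *: herm (e s) (e t).
have dZ x : dot x Z = \sum_s \sum_t A' (iH s) (iH t)*dot x (herm (e s) (e t)).
 rewrite dot_sumr;eqsum s;rewrite dot_sumr;eqsum t.
 by rewrite dotZr.
have Zc : conj Z = - Z.
 rewrite /Z (big_morph _ (@cconjD R k) (@cconj0 R k)) exchange_big -sumrN.
 eqsum s;rewrite (big_morph _ (@cconjD R k) (@cconj0 R k)) -sumrN.
 by eqsum t;rewrite cconjZ -hermC (aA (iH s)) scaleNr opprK.
have Z1 : dot Z one = 0.
 have := cconj_dot Z one;rewrite Zc cconj1 dotNl => h;lra.
have CAE a : CA C A' a = dot (X a) Z.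
 rewrite dZ;eqsum s;eqsum t;congr (_ * _).
 rewrite mxE -dot_delta -[X in dot _ X]rmul1 dot_rmul_herm cconj1 cmul1r //.
have gAE a b : gA C A' a b = dot (X a) (mul Z (X b)).
 have E1 : \sum_s \sum_t A' (iH s) (iH t) * GC C a b s t = dot (mul (X a) (conj (X b))) Z.
  by rewrite dZ;eqsum s;eqsum t;rewrite GC_Cmx dot_rmul_herm.
 have E2 : \sum_s \sum_t A' (iH s) (iH t) * GC C b a s t = - dot (mul (X a) (conj (X b))) Z.
  rewrite -dotNr -Zc -cconj_dot cconjM !cconjK dZ;eqsum s.
  by eqsum t;rewrite GC_Cmx dot_rmul_herm.
 rewrite /gA;transitivity (\sum_s (\sum_t A' (iH s) (iH t) * GC C a b s t / 2 -
   \sum_t A' (iH s) (iH t) * GC C b a s t / 2)).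
  by eqsum s;rewrite -sumrB;eqsum t;rewrite /gC;field.
 rewrite sumrB;under eq_bigr do rewrite -mulr_suml.
 under [X in _ - X]eq_bigr => s _ do rewrite -mulr_suml.
 by rewrite -!mulr_suml E1 E2 cdot_mulr cconjK;field.
have S1 : \sum_a CA C A' a ^+ 2 = sqnorm Z.
 rewrite (imaginary_sqnorm HX) Z1 expr0n add0r;eqsum a.
 by rewrite CAE dotC.
rewrite S1 exchange_big /=.
have -> : \sum_b \sum_a gA C A' a b ^+ 2 = \sum_(b < d) (sqnorm Z - CA C A' b ^+ 2).
 eqsum b.
 have := imaginary_sqnorm HX (mul Z (X b));rewrite Nm -[sqnorm (X b)]dotxx h2 eqxx mulr1.
 rewrite cdot_mulr cmul1l h1 dotNr sqrrN dotC -CAE => h.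
 by rewrite {1}h addrC addKr;eqsum a;rewrite gAE dotC.
rewrite sumrB S1 sumr_const card_ord -mulr_natl.
have z0 := sqnorm_ge0 Z;have d3' : d%:R <= 3 :> R by rewrite ler_nat.
have : 0 <= (3 - d%:R)*sqnorm Z by rewrite mulr_ge0 // subr_ge0.
by lra.
Qed.

Lemma rmul0 u : rmul u 0 = 0.
by rewrite -(scale0r 0) rmulZr !scale0r. Qed.

Lemma dot_rmul1 u v x : dot (rmul u x) v = dot x (herm u v).
by rewrite -{1}(rmul1 v) dot_rmul_herm cconj1 cmul1r. Qed.

(** The horizontal frame is a multiple of the projection [P] onto the vectors Hermitian-orthogonal
    to [w]; its admissible coordinates are exactly those vectors. *)
Lemma assoc_curved : exists K0 : R, forall K (w : W), K0 <= K -> punct w -> curved projQ K w.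
have [N N0 HN] := Cmx_bounded.
exists (12 + 9*N) => K w K0 w0 A0 A1 A2 B B1 B2 C1 C2 F num nF F1 F2.
have [h1 h2 h3 h4] := HX;have sy l := projQ_sym (R := R) (k := k) (m := m) l.
have Ncl a b s t := Cmx_clifford a b s t.
have [[a0 G0 E1 E2 E3] _] := num.
have r0 : 0 < sqnorm w by exact: w0.
pose ri := (sqnorm w)^-1;have rri : ri*sqnorm w = 1 by rewrite mulVf // gt_eqF.
pose r := Num.sqrt (sqnorm w).
have rr : r*r = sqnorm w by rewrite -expr2 sqr_sqrtr // ltW.
have rn : r != 0 by apply/eqP => h;move: r0;rewrite -rr h mul0r ltxx.
pose P u : W := u - ri *: rmul w (herm w u).
have PD u v : P (u+v) = P u+P v.
 by rewrite /P hermD rmulDr scalerDr opprD addrACA.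
have PZ (c : R) u : P (c *: u) = c *: P u.
 by rewrite /P hermZ rmulZr scalerA mulrC -scalerA -scalerBr.
have wP u : herm w (P u) = 0.
 rewrite /P -scaleNr hermD hermZ herm_rmul herm_self cmulZl cmul1l scalerA mulNr rri.
 by rewrite scaleN1r subrr.
have PP u : herm w u = 0 -> P u = u.
 by move=> h;rewrite /P h rmul0 scaler0 subr0.
have Psym u v : dot (P u) v = dot u (P v).
 rewrite /P !dotBl !(dotC u) !dotBl !dotZl (dotC v u);congr (_ - _ * _).
 by rewrite !dot_rmul1 dotC.
pose H : 'M[R]_n := r *: lmat P.
have uH u : u *m H = r *: P u by rewrite /H -scalemxAr (lmatE PD PZ).
have HT : H^T = H by rewrite /H linearZ /= (lmat_sym Psym).
have PPP u : P (P u) = P u by apply: PP;exact: wP.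
have aH y : adm w H y -> herm w y = 0.
 rewrite /adm HT !uH PZ scalerA rr PPP => /(scalerI (lt0r_neq0 r0)) <-.
 by rewrite wP.
have Hadm y : herm w y = 0 -> adm w H y.
 by move=> h;rewrite /adm HT !uH PZ scalerA rr !(PP _ h).
have yH y : adm w H y -> y *m H = r *: y by move=> /aH h;rewrite uH PP.
(* The conjugate units are used because [outer_rmull] moves a right factor to the other argument
   with a conjugation; the Clifford action on horizontal vectors then comes out as [Cmx]. *)
pose V : 'M[R]_(d, n) := \matrix_(a, j) rmul w (conj (X a)) 0 j.
pose xi (a : 'rV[R]_d) : A := \sum_c a 0 c *: conj (X c).
have aV a : a *m V = rmul w (xi a).
 rewrite /xi rmul_sum;apply/rowP => j;rewrite mxE summxE;eqsum c.
 by rewrite rmulZr !mxE.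
have dxi a x : dot (xi a) x = \sum_c a 0 c*dot (conj (X c)) x.
 by rewrite dotC dot_sumr;eqsum c;rewrite dotZr dotC.
have xiX a c : dot (xi a) (conj (X c)) = a 0 c.
 rewrite dxi -[RHS](sum_eq (fun c => a 0 c));eqsum b.
 by rewrite cconj_dot h2.
have xixi a b : dot (xi a) (xi b) = dot a b.
 by rewrite dotC dxi dotC;eqsum c;rewrite (dotC _ (xi a)) xiX mulrC.
have xi1 a : dot (xi a) one = 0.
 by rewrite dxi big1 // => c _;rewrite -{1}(cconj1 k) cconj_dot h3 mulr0.
have actE a y : act Cmx a y = rmul y (conj (xi a)).
 rewrite /xi (big_morph _ (@cconjD R k) (@cconj0 R k)) rmul_sum;eqsum c.
 by rewrite mul_Cmx cconjZ cconjK rmulZr.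
have wr x z : dot (rmul w x) (rmul w z) = sqnorm w*dot x z.
 by rewrite dot_rmul1 herm_rmul herm_self cmulZl cmul1l dotZr.
have VTE (a : 'rV[R]_n) c : (a *m V^T) 0 c = dot a (rmul w (conj (X c))).
 by rewrite mxE;eqsum j;rewrite !mxE.
have hw u : herm w u = 0 -> herm u w = 0 by rewrite (hermC w u) => ->;rewrite cconj0.
have psd := numbers_assoc_psd (fun a s t => Cmx_skew a s t) Ncl N0 _ _ HN gA_bound num.
apply: (point_snn sy r0 a0 G0 E1 E2 E3 _ (V := V) (H := H) (Cm := Cmx)
 (t := fun i => ri*dot (herm w (delta_mx 0 i)) one)
 (v := fun i => ri *: \row_c dot (herm w (delta_mx 0 i)) (conj (X c)))
 (Y := fun i => r^-1 *: P (delta_mx 0 i)) _ _ _ _ _ _ _ _ _ _ _ _ _ _ _ nF F1 F2 (psd _ _)).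
- by rewrite projQ_quad dot_outer herm_self dotZl dotZr dotxx sqnorm_one;field.
- move=> i;rewrite -scalemxAl aV -scalemxAl uH PPP !scalerA mulVf // scale1r.
 have -> : xi (\row_c dot (herm w (delta_mx 0 i)) (conj (X c))) =
   herm w (delta_mx 0 i) - dot (herm w (delta_mx 0 i)) one *: one.
  move: (herm w (delta_mx 0 i)) => z.
  have z1 : dot (conj z) one = dot z one by rewrite -{1}(cconj1 k) cconj_dot.
  have := congr1 (@cd_conj R k) (h4 (conj z));rewrite cconjK cconjD cconjZ cconj1 z1 => E.
  rewrite {2}E addrC addKr (big_morph _ (@cconjD R k) (@cconj0 R k));eqsum c.
  by rewrite mxE cconjZ -cconj_dot cconjK.
 rewrite -scaleN1r rmulDr !rmulZr rmul1 scaleN1r scalerBr !scalerA /P.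
 by rewrite [X in _ = X + _]addrC subrK addrC subrK.
- by move=> i;apply/rowP => c;rewrite [RHS]rowZE aV VTE wr xiX.
- by move=> i;apply: Hadm;rewrite hermZ wP scaler0.
- by move=> c y /aH h;apply: Hadm;rewrite mul_Cmx herm_rmul h cmul0l.
- apply/rowP => c;rewrite VTE -{1}(rmul1 w) wr -(cconj1 k) cconj_dot dotC h3 mulr0 mxE //.
- by rewrite HT uH /P herm_self rmulZr rmul1 scalerA rri scale1r subrr scaler0.
- apply/row_matrixP => c;rewrite row0 row_mul HT uH.
 have -> : row c V = rmul w (conj (X c)) by apply/rowP => j;rewrite !mxE.
 by rewrite /P herm_rmul herm_self cmulZl cmul1l rmulZr scalerA rri scale1r subrr scaler0.
- by move=> a;rewrite projQ_quad aV -{1}(rmul1 w) outer_rmul dotC xi1 scale0r.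
- by move=> a b _ _;rewrite !projQ_quad !aV outer_rmul xixi.
- move=> a y _ ay;rewrite !projQ_quad aV actE outer_rmull (yH _ ay) rmulZ.
 rewrite yH //;apply: Hadm;by rewrite herm_rmul (aH _ ay) cmul0l.
- move=> y ay;rewrite !projQ_quad (yH _ ay) outerZr dotZr dot_outer (hw _ (aH _ ay)).
 by rewrite dot0r dot0l addr0 !mulr0.
- move=> y y' ay ay';rewrite !projQ_quad (yH _ ay) (yH _ ay') !outerZr dotZl dotZr dot_outer.
 rewrite (aH _ ay) dot0r herm_self dotZl (dotC one) -dot_herm (dotC y').
 by rewrite -rr;field.
- move=> y y' ay ay';rewrite !projQ_quad (yH _ ay) (yH _ ay') outerZ outerZr !dotZr dot_outer.
 by rewrite (hw _ (aH _ ay)) (hw _ (aH _ ay')) !dot0l;ring.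
- move=> y y' y'' ay ay' ay'';rewrite !projQ_quad (yH _ ay) (yH _ ay') (yH _ ay'') outerZ !outerZr !dotZr dotZl dot_outer.
 by rewrite (hw _ (aH _ ay')) (hw _ (aH _ ay'')) !dot0l;ring.
- move=> i j l q.
 have aY s : adm w H (r^-1 *: P (delta_mx 0 s)) by apply: Hadm;rewrite hermZ wP scaler0.
 rewrite HH4E;have := aY i;have := aY j;have := aY l;have := aY q.
 move: (r^-1 *: P (delta_mx 0 i)) (r^-1 *: P (delta_mx 0 j)) (r^-1 *: P (delta_mx 0 l)) (r^-1 *: P (delta_mx 0 q)).
 move=> yi yj yl yq hq hl hj hi.
 rewrite !projQ_quad (yH _ hi) (yH _ hj) (yH _ hl) (yH _ hq) !outerZ !outerZr !dotZl !dotZr dot_outer.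
 have -> : \sum_a (bil (fun s t => Cmx a s t) yi yl*bil (fun s t => Cmx a s t) yj yq +
   bil (fun s t => Cmx a s t) yi yq*bil (fun s t => Cmx a s t) yj yl) =
  (dot (herm yi yl) (herm yj yq) - dot yi yl*dot yj yq) +
  (dot (herm yi yq) (herm yj yl) - dot yi yq*dot yj yl).
  rewrite (imaginary_parseval HX (herm yi yl)) (imaginary_parseval HX (herm yi yq)) -!dot_herm.
  rewrite ![_ * _ + _ - _]addrAC !subrr !add0r -big_split;eqsum a.
  by rewrite !bil_Cmx !(dotC (X a)).
 rewrite -(cconj_dot (herm yl yi)) -(cconj_dot (herm yq yi)) -!hermC.
 rewrite -rr;move: (dot yi yj) (dot yl yq) (dot yi yl) (dot yj yq) (dot yi yq) (dot yj yl).
 move: (dot (herm yi yl) _) (dot (herm yi yq) _) => c1 c2 c3 c4 c5 c6 c7 c8.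
 by field.
- by lra.
- by lra.
Qed.

End AssociativeFrame.

(** * A trace identity for Clifford systems in dimension eight *)

Section CliffordTrace.
Context {R : realType} {p : nat}.
Variables (L : 'I_p -> 'M[R]_p) (e : 'I_p -> 'I_p -> R).
Hypothesis e_anti : forall s t, e t s = - e s t.
Hypothesis L1 : forall s t, L s *m (L t)^T+L t *m (L s)^T = (2*(s == t)%:R)%:M.
Hypothesis L2 : forall s t, (L s)^T *m L t+(L t)^T *m L s = (2*(s == t)%:R)%:M.

Let N : 'M[R]_p := \sum_s \sum_t e s t *: (L s *m (L t)^T).
Let M : 'M[R]_p := \sum_s \sum_t e s t *: ((L s)^T *m L t).
Let K r : 'M[R]_p := \sum_t e r t *: L t.

Let sum_delta (F : 'I_p -> 'M[R]_p) r : \sum_s (r == s)%:R *: F s = F r.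
rewrite (bigD1 r) //= eqxx scale1r big1 ?addr0 // => s /negPf sr.
by rewrite eq_sym sr scale0r.
Qed.

Let KT r : (K r)^T = \sum_t e r t *: (L t)^T.
by rewrite raddf_sum;eqsum t;rewrite /= linearZ. Qed.

(** Moving a generator through [N] exchanges it with the companion [M] and leaves a contraction; the
    two anticommutators of the move contribute [2] each. *)
Let move_left r : (L r)^T *m N = M *m (L r)^T + 4 *: (K r)^T.
have T s t : (L r)^T *m (L s *m (L t)^T) = (2*(r == s)%:R) *: (L t)^T
  - (2*(r == t)%:R) *: (L s)^T+(L s)^T *m L t *m (L r)^T.
 rewrite mulmxA;have -> : (L r)^T *m L s = (2*(r == s)%:R)%:M - (L s)^T *m L r.
  by rewrite -L2 addrK.
 rewrite mulmxBl mul_scalar_mx -(mulmxA (L s)^T (L r)).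
 have -> : L r *m (L t)^T = (2*(r == t)%:R)%:M - L t *m (L r)^T by rewrite -L1 addrK.
 by rewrite mulmxBr mul_mx_scalar opprB mulmxA addrA addrAC.
rewrite /N mulmx_sumr;under eq_bigr do rewrite mulmx_sumr.
have -> : \sum_s \sum_t (L r)^T *m (e s t *: (L s *m (L t)^T)) =
 \sum_s \sum_t ((2*e s t*(r == s)%:R) *: (L t)^T) -
 \sum_s \sum_t ((2*e s t*(r == t)%:R) *: (L s)^T) +
 \sum_s \sum_t e s t *: ((L s)^T *m L t *m (L r)^T).
 rewrite -sumrB -big_split;eqsum s => /=;rewrite -sumrB -big_split.
 eqsum t => /=;rewrite -scalemxAr T scalerDr scalerBr !scalerA.
 by congr (_ *: _ - _ *: _ + _);ring.
have -> : \sum_s \sum_t e s t *: ((L s)^T *m L t *m (L r)^T) = M *m (L r)^T.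
 rewrite mulmx_suml;eqsum s;rewrite mulmx_suml;eqsum t.
 by rewrite scalemxAl.
have -> : \sum_s \sum_t ((2*e s t*(r == s)%:R) *: (L t)^T) = 2 *: (K r)^T.
 rewrite exchange_big KT scaler_sumr;eqsum t => /=.
 rewrite -[RHS](sum_delta (fun s => 2 *: (e s t *: (L t)^T)) r);eqsum s.
 by rewrite !scalerA;congr (_ *: _);ring.
have -> : \sum_s \sum_t ((2*e s t*(r == t)%:R) *: (L s)^T) = - (2 *: (K r)^T).
 rewrite KT scaler_sumr -sumrN;eqsum s.
 rewrite -[RHS](sum_delta (fun t => - (2 *: (e t s *: (L s)^T))) r);eqsum t.
 by rewrite (e_anti s t) scaleNr !scalerN opprK !scalerA;congr (_ *: _);ring.
by rewrite opprK -scalerDl [LHS]addrC;congr (_ + _ *: _);ring.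
Qed.

Let sumLL : \sum_r (L r)^T *m L r = p%:R%:M.
have E r : (L r)^T *m L r = 1%:M.
 have h := L2 r r;rewrite eqxx mulr1 in h.
 apply: (scalerI (a := 2 : R));first by rewrite pnatr_eq0.
 by rewrite scaler_nat mulr2n h scalemx1.
under eq_bigr do rewrite E.
by rewrite sumr_const card_ord -scaler_nat scalemx1.
Qed.

Let sumLL' : \sum_r L r *m (L r)^T = p%:R%:M.
have E r : L r *m (L r)^T = 1%:M.
 have h := L1 r r;rewrite eqxx mulr1 in h.
 apply: (scalerI (a := 2 : R));first by rewrite pnatr_eq0.
 by rewrite scaler_nat mulr2n h scalemx1.
under eq_bigr do rewrite E.
by rewrite sumr_const card_ord -scaler_nat scalemx1.
Qed.

Let sumKL : \sum_r (K r)^T *m L r = - M.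
rewrite /M exchange_big -sumrN;eqsum r => /=;rewrite KT mulmx_suml -sumrN.
by eqsum t;rewrite -scalemxAl (e_anti t r) scaleNr.
Qed.

Let sumLNL : \sum_r (L r)^T *m N *m L r = (p%:R - 4) *: M.
under eq_bigr do rewrite move_left mulmxDl -mulmxA -scalemxAl.
rewrite big_split -scaler_sumr -mulmx_sumr sumLL sumKL /= mul_mx_scalar scalerN.
by rewrite scalerBl.
Qed.

Let KN r : (K r)^T *m N = M *m (K r)^T + 4 *: \sum_q e r q *: (K q)^T.
rewrite {1}KT mulmx_suml.
under eq_bigr do rewrite -scalemxAl move_left scalerDr scalemxAr scalerA mulrC -scalerA.
by rewrite big_split -mulmx_sumr -KT -scaler_sumr.
Qed.

Let sumEE : \sum_r \sum_q e r q *: ((K q)^T *m L r) = (- \sum_s \sum_t e s t ^+ 2)%:M.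
pose S r t : R := \sum_q e r q*e q t.
have Ssym r t : S r t = S t r.
 by eqsum q;rewrite (e_anti q r) (e_anti t q) mulrNN mulrC.
have -> : \sum_r \sum_q e r q *: ((K q)^T *m L r) = \sum_r \sum_t S r t *: ((L t)^T *m L r).
 eqsum r;under [RHS]eq_bigr => t _ do rewrite scaler_suml.
 rewrite [RHS]exchange_big;eqsum q => /=;rewrite KT mulmx_suml scaler_sumr.
 by eqsum t;rewrite -scalemxAl scalerA.
apply: (scalerI (a := 2 : R));first by rewrite pnatr_eq0.
rewrite -[LHS]/(2 *: \sum_r \sum_t S r t *: ((L t)^T *m L r)) scaler_nat mulr2n {1}exchange_big -big_split /=.
have -> : \sum_r (\sum_t S t r *: ((L r)^T *m L t) + \sum_t S r t *: ((L t)^T *m L r)) =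
  \sum_r (2*S r r)%:M.
 eqsum r;rewrite -big_split /=.
 rewrite -[RHS](sum_delta (fun t => (2*S r t)%:M) r);eqsum t.
 by rewrite (Ssym t r) -scalerDr L2 !scale_scalar_mx;congr (_%:M);ring.
rewrite scale_scalar_mx -raddf_sum;congr (_%:M);rewrite -mulr_sumr;congr (_ * _).
rewrite -sumrN;eqsum r;rewrite -sumrN;eqsum t.
by rewrite (e_anti r t) mulrN expr2.
Qed.

(* Conjugating by the whole Clifford frame kills the degree-four part of N^2
 in dimension eight. *)
Lemma clifford_trace : p = 8 -> \tr (N *m N) = - 16 * \sum_s \sum_t e s t ^+ 2.
move=> p8;have p8R : p%:R = 8 :> R by rewrite p8.
have E : \sum_r (L r)^T *m (N *m N) *m L r = (- 16 * \sum_s \sum_t e s t ^+ 2)%:M.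
 have T r : (L r)^T *m (N *m N) *m L r = M *m ((L r)^T *m N *m L r)
   + 4 *: ((M *m (K r)^T + 4 *: \sum_q e r q *: (K q)^T) *m L r).
  transitivity (((L r)^T *m N) *m N *m L r);first by rewrite !mulmxA.
  rewrite [in LHS]move_left (mulmxDl _ _ N) -(scalemxAl 4 _ N) KN (mulmxDl _ _ (L r)) -(scalemxAl 4 _ (L r)).
  by congr (_ + _);rewrite !mulmxA.
 under eq_bigr do rewrite T.
 rewrite big_split /= -mulmx_sumr sumLNL -scaler_sumr.
 have -> : \sum_i (M *m (K i)^T + 4 *: (\sum_q e i q *: (K q)^T)) *m L i =
   - (M *m M) + 4 *: (- \sum_s \sum_t e s t ^+ 2)%:M.
  have U r : (M *m (K r)^T + 4 *: (\sum_q e r q *: (K q)^T)) *m L r =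
    M *m ((K r)^T *m L r) + 4 *: (\sum_q e r q *: ((K q)^T *m L r)).
   rewrite mulmxDl -mulmxA -scalemxAl;congr (_ + _ *: _);rewrite mulmx_suml.
   by eqsum q;rewrite -scalemxAl.
  under eq_bigr do rewrite U.
  by rewrite big_split -mulmx_sumr sumKL -scaler_sumr sumEE mulmxN.
 rewrite p8R -scalemxAr scalerDr scalerN addrA -scalerBl.
 have -> : (8 - 4 - 4 : R) = 0 by ring.
 by rewrite scale0r add0r !scale_scalar_mx;congr (_%:M);ring.
have T2 r : \tr ((L r)^T *m (N *m N) *m L r) = \tr (L r *m (L r)^T *m (N *m N)).
 by rewrite mxtrace_mulC !mulmxA.
have := congr1 mxtrace E;rewrite raddf_sum /=.
under eq_bigr do rewrite T2.
have <- : \tr (\sum_r (L r *m (L r)^T *m (N *m N))) = \sum_r \tr (L r *m (L r)^T *m (N *m N)).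
 by rewrite raddf_sum.
have -> : \sum_r (L r *m (L r)^T *m (N *m N)) = p%:R%:M *m (N *m N) by rewrite -sumLL' mulmx_suml.
rewrite mul_scalar_mx mxtraceZ mxtrace_scalar p8R.
move: (\tr _) (\sum_s _) => u v.
have -> : -16*v *+ p = -16*v * 8 by rewrite -p8R -[LHS]mulr_natr.
by move=> h;lra.
Qed.

End CliffordTrace.

(** * The Clifford system of the octonions attached to a unit vector *)

Section OctonionClifford.
Context {R : realType} {k d : nat}.
Hypothesis Nm : @cnorm R k.
Variable X : 'I_d -> 'rV[R]_(cd_dim k).
Hypothesis HX : imaginary_basis X.
Local Notation A := 'rV[R]_(cd_dim k).
Local Notation mul := cd_mul.
Local Notation conj := cd_conj.
Local Notation one := (cd_one k).
Local Notation I := 'I_(cd_dim k).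
Local Notation K := (unit+('I_d+I))%type.
Variable f0 : A.
Hypothesis f01 : sqnorm f0 = 1.
Implicit Types (x y z : A).

(** An orthonormal basis of the complement of [f0], the unit vector in the direction of the first
    block of the point. *)
Definition fb (a : 'I_d) : A := mul f0 (X a).

Lemma fb_dot x a : dot x (fb a) = dot (mul (conj f0) x) (X a).
by rewrite [RHS]cdot_mull cconjK. Qed.

Lemma f0_dot x : dot x f0 = dot (mul (conj f0) x) one.
by rewrite cdot_mull cconjK cmul1r. Qed.

Lemma fb_parseval x y : dot x y = dot x f0*dot y f0 + \sum_a dot x (fb a)*dot y (fb a).
have -> : dot x y = dot (mul (conj f0) x) (mul (conj f0) y).
 by rewrite (cdot_mul2l Nm) (csqnorm_conj) f01 mul1r.
rewrite (imaginary_parseval HX) -!f0_dot;congr (_ + _).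
by eqsum a;rewrite !fb_dot.
Qed.

Lemma fb_orth a b : dot (fb a) (fb b) = (a == b)%:R.
by have [_ h _ _] := HX;rewrite (cdot_mul2l Nm) f01 mul1r h. Qed.

Lemma fb_f0 a : dot (fb a) f0 = 0.
by have [_ _ h _] := HX;have := cdot_mul2l Nm f0 (X a) one;rewrite cmul1r h mulr0. Qed.

(** The action dictated by [outer_vx_hy]. Without associativity the two multiplications cannot be
    merged, so the generators depend on the point through [f0]. *)
Definition Omx (a : 'I_d) : 'M[R]_(cd_dim k) := lmat (fun y => mul (mul y (conj (fb a))) f0).

Lemma mul_Omx y a : y *m Omx a = mul (mul y (conj (fb a))) f0.
by apply: lmatE => [u v|r u];rewrite ?cmulDl ?cmulZl. Qed.

Local Notation C := (fun a s t => Omx a s t).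
Local Notation e s := (delta_mx 0 s : A).

Definition Gt y z : A := mul (mul f0 (conj z)) y.

Lemma OmxE a s t : Omx a s t = dot (fb a) (Gt (e s) (e t)).
rewrite mxE -dot_delta cdot_mulr cdot_mull -cconj_dot cconjK.
by rewrite cconjM cconjK cconjM cconjK.
Qed.

Lemma Gt_f0 y z : dot f0 (Gt y z) = dot y z.
rewrite dotC /Gt cdot_mull cconjM cconjK.
by have := cmulKr Nm (conj f0) z;rewrite cconjK (csqnorm_conj f0) f01 scale1r => ->.
Qed.

Lemma Gt_swap y z : Gt y z+Gt z y = (2*dot y z) *: f0.
by rewrite /Gt (cmul_polar1 Nm) (dotC z). Qed.

Lemma e_dot s t : dot (e s) (e t) = (s == t)%:R.
by rewrite dot_delta mxE eqxx /= eq_sym. Qed.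

Lemma Omx_skew a s t : Omx a t s = - Omx a s t.
apply/eqP;rewrite -subr_eq0 opprK !OmxE -dotDr Gt_swap dotZr fb_f0 mulr0 //.
Qed.

Lemma GC_Omx a b s t : GC C a b s t = dot (mul (e s) (conj (fb a))) (mul (e t) (conj (fb b))).
transitivity (dot (mul (mul (e s) (conj (fb a))) f0) (mul (mul (e t) (conj (fb b))) f0)).
 by eqsum l;rewrite !mxE.
by rewrite (cdot_mul2r Nm) f01 mul1r.
Qed.

Lemma Omx_clifford a b s t : GC C a b s t+GC C b a s t = 2*((a == b)%:R*(s == t)%:R).
rewrite !GC_Omx [X in _+X]dotC (cexchange Nm) e_dot cconj_dot fb_orth;ring.
Qed.

Variable A' : K -> K -> R.
Hypothesis aA : antisym A'.
Local Notation et s t := (A' (iH s) (iH t)).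

Let aet s t : et t s = - et s t. Proof. exact: aA. Qed.

Let S4 (F : I -> I -> I -> I -> R) := \sum_s \sum_t \sum_u \sum_v et s t*et u v*F s t u v.

Let S4D F F' : S4 (fun s t u v => F s t u v+F' s t u v) = S4 F+S4 F'.
by rewrite /S4;do 4 (rewrite -big_split;apply: eq_bigr => ? _);rewrite mulrDr. Qed.

Let S4Z c F : S4 (fun s t u v => c*F s t u v) = c*S4 F.
by rewrite /S4;do 4 (rewrite mulr_sumr;apply: eq_bigr => ? _);rewrite mulrCA. Qed.

Let S4eq F F' : (forall s t u v, F s t u v = F' s t u v) -> S4 F = S4 F'.
by move=> h;rewrite /S4;do 4 (apply: eq_bigr => ? _);rewrite h. Qed.

Let S4_1 : S4 (fun s t u v => (s == u)%:R*(t == v)%:R) = etasq A'.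
rewrite /S4 (sum_deltas (fun s t u v => et s t*et u v)).
by eqsum s;eqsum t;rewrite expr2.
Qed.

Let S4_2 : S4 (fun s t u v => (s == v)%:R*(t == u)%:R) = - etasq A'.
rewrite -S4_1 /S4 -sumrN;eqsum s;rewrite -sumrN;eqsum t.
rewrite exchange_big -sumrN;eqsum u;rewrite -sumrN;eqsum v => /=.
by rewrite (aet u v);ring.
Qed.

Let S4_3 : S4 (fun s t u v => (s == t)%:R*(u == v)%:R) = 0.
rewrite /S4 big1 // => s _;rewrite big1 // => t _;rewrite big1 // => u _;rewrite big1 // => v _.
have [<-|_] := eqVneq s t;last by rewrite mul0r mulr0.
have h : et s s = 0 by have := aet s s;move: (et s s) => q;lra.
by rewrite h !mul0r.
Qed.

Let B s u t v : R := dot (Gt (e s) (e u)) (Gt (e t) (e v)).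

Let B_parseval s u t v : \sum_a Omx a s u * Omx a t v = B s u t v - (s == u)%:R*(t == v)%:R.
rewrite /B fb_parseval !(dotC _ f0) !Gt_f0 !e_dot [_ * _ + _]addrC addrK.
by eqsum a;rewrite !OmxE !(dotC _ (fb a)).
Qed.

Let B1 s u t v : B s u t v = 2*((s == u)%:R*(t == v)%:R) - B u s t v.
have : dot (Gt (e s) (e u)+Gt (e u) (e s)) (Gt (e t) (e v)) = 2*((s == u)%:R*(t == v)%:R).
 by rewrite Gt_swap dotZl Gt_f0 !e_dot mulrA.
by rewrite dotDl /B => <-;rewrite addrK.
Qed.

Let B2 s u t v : B s u t v = 2*((u == v)%:R*(s == t)%:R) - B t u s v.
have := cexchange Nm (mul f0 (conj (e u))) (mul f0 (conj (e v))) (e s) (e t).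
rewrite (cdot_mul2l Nm) f01 mul1r cconj_dot !e_dot /B /Gt => <-.
by rewrite [X in _ = _+X - _]dotC addrK.
Qed.

(** The tensor [B] changes sign under exchanges of its arguments up to products of deltas ([B1],
    [B2]). Three exchanges carry the contraction defining [PC] to the one defining the squares of
    [CA]; the deltas give multiples of [etasq]. *)
Lemma Omx_PC : \sum_a PC C A' a = 3*etasq A' - \sum_a CA C A' a ^+ 2.
have P1 : \sum_a PC C A' a = S4 (fun s t u v => B s u t v) - etasq A'.
 rewrite -S4_1 -[X in _ - X]mul1r -mulNr -S4Z -S4D /PC.
 swapsum s;swapsum t => /=.
 swapsum u;swapsum v => /=.
 by rewrite -mulr_sumr B_parseval mulN1r.
have Q1 : \sum_a CA C A' a ^+ 2 = S4 (fun s t u v => B s t u v).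
 have -> : S4 (fun s t u v => B s t u v) = S4 (fun s t u v => \sum_a Omx a s t * Omx a u v).
  rewrite -[RHS]addr0 -{2}S4_3 -S4D;apply: S4eq => s t u v;by rewrite B_parseval subrK.
 rewrite /S4;under eq_bigr do rewrite expr2 /CA mulr_suml.
 swapsum s => /=.
 under eq_bigr do rewrite mulr_suml.
 swapsum t => /=.
 under eq_bigr do rewrite mulr_sumr.
 swapsum u => /=.
 under eq_bigr do rewrite mulr_sumr.
 swapsum v => /=.
 by distrsum a;ring.
rewrite P1 Q1.
have -> : S4 (fun s t u v => B s u t v) = S4 (fun s t u v =>
 2*((s == u)%:R*(t == v)%:R)+(-2*((s == v)%:R*(t == u)%:R) +
 (2*((s == t)%:R*(u == v)%:R) + -1*B s t u v))).
 apply: S4eq => s t u v;rewrite (B1 s u) (B2 u s) (B1 t s) (eq_sym u t) (eq_sym t s);ring.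
rewrite (S4D (fun s t u v => 2*((s == u)%:R*(t == v)%:R))) S4Z S4_1.
rewrite (S4D (fun s t u v => -2*((s == v)%:R*(t == u)%:R))) S4Z S4_2.
rewrite (S4D (fun s t u v => 2*((s == t)%:R*(u == v)%:R))) S4Z S4_3 S4Z;ring.
Qed.

(** [CA] and [gA] are the entries of one antisymmetric operator [N] in the orthonormal basis formed
    by the conjugates of [f0] and [fb a]. The left side is half its squared norm, which
    [clifford_trace] computes. *)
Lemma Omx_Z : cd_dim k = 8 ->
 \sum_a CA C A' a ^+ 2 + 2^-1*(\sum_a \sum_b gA C A' a b ^+ 2) = 8*etasq A'.
move=> p8.
pose L s : 'M[R]_(cd_dim k) := lmat (fun x => mul (e s) x).
have LE s x : x *m L s = mul (e s) x.
 by apply: lmatE => [u v|r u];rewrite ?cmulDr ?cmulZr.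
have LT s x : x *m (L s)^T = mul (conj (e s)) x.
 apply: dot_ext => z;rewrite cdot_mull cconjK -LE dot_mulmx trmxK //.
have L1 s t : L s *m (L t)^T+L t *m (L s)^T = (2*(s == t)%:R)%:M.
 apply/row_matrixP => i;rewrite !rowE mulmxDr !mulmxA !LE !LT mul_mx_scalar.
 by rewrite (cmul_polarl Nm) e_dot eq_sym.
have L2 s t : (L s)^T *m L t+(L t)^T *m L s = (2*(s == t)%:R)%:M.
 apply/row_matrixP => i;rewrite !rowE mulmxDr !mulmxA !LT !LE mul_mx_scalar.
 have := cmul_polarl Nm (conj (e s)) (conj (e t)) (delta_mx 0 i).
 by rewrite !cconjK cconj_dot e_dot addrC => <-;rewrite addrC.
have := clifford_trace (e := fun s t => et s t) aet L1 L2 p8.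
pose N : 'M[R]_(cd_dim k) := \sum_s \sum_t et s t *: (L s *m (L t)^T).
rewrite -/N => trN.
have xN x y : dot (x *m N) y = \sum_s \sum_t et s t*dot (mul (e s) x) (mul (e t) y).
 rewrite /N mulmx_sumr dotC dot_sumr;eqsum s.
 rewrite mulmx_sumr dot_sumr;eqsum t.
 by rewrite -scalemxAr dotZr dotC mulmxA LE LT cdot_mull cconjK.
have xNa x y : dot (x *m N) y = - dot (y *m N) x.
 rewrite !xN exchange_big -sumrN;eqsum s;rewrite -sumrN;eqsum t => /=.
 by rewrite (aet s t) mulNr dotC.
have sN : \sum_i sqnorm (e i *m N) = 16*etasq A'.
 have -> : \sum_i sqnorm (e i *m N) = - \tr (N *m N).
  rewrite /mxtrace -sumrN;eqsum i.
  have -> : (N *m N) i i = dot (e i *m N *m N) (e i) by rewrite dot_delta -mulmxA -rowE [RHS]mxE.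
  by rewrite xNa opprK dotxx.
 by rewrite trN mulNr opprK.
have gP x y : dot x y = dot x (conj f0)*dot y (conj f0) + \sum_a dot x (conj (fb a))*dot y (conj (fb a)).
 rewrite -cconj_dot fb_parseval -!(cconj_dot (conj x)) -!(cconj_dot (conj y)) !cconjK.
 by congr (_ + _);eqsum a;rewrite -!(cconj_dot _ (fb a)) !cconjK.
have CAE a : CA C A' a = dot (conj (fb a) *m N) (conj f0).
 rewrite xN;eqsum s;eqsum t;congr (_ * _).
 by rewrite mxE -dot_delta cdot_mulr.
have gAE a b : gA C A' a b = dot (conj (fb a) *m N) (conj (fb b)).
 have E1 a' b' : \sum_s \sum_t et s t * GC C a' b' s t = dot (conj (fb a') *m N) (conj (fb b')).
  by rewrite xN;eqsum s;eqsum t;rewrite GC_Omx.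
 have E2 : gA C A' a b = 2^-1*(dot (conj (fb a) *m N) (conj (fb b)) - dot (conj (fb b) *m N) (conj (fb a))).
  rewrite -!E1 -sumrB mulr_sumr;eqsum s;rewrite -sumrB mulr_sumr.
  by eqsum t;rewrite /gC;field.
 by rewrite E2 (xNa (conj (fb b))) opprK;field.
have colS y : \sum_i dot (e i *m N) y ^+ 2 = sqnorm (y *m N).
 by eqsum i;rewrite xNa sqrrN dot_delta.
have z0 : dot (conj f0 *m N) (conj f0) = 0 by have := xNa (conj f0) (conj f0);lra.
have T : \sum_i sqnorm (e i *m N) = 2 * \sum_a CA C A' a ^+ 2 + \sum_a \sum_b gA C A' a b ^+ 2.
 have -> : \sum_i sqnorm (e i *m N) = sqnorm (conj f0 *m N) + \sum_b sqnorm (conj (fb b) *m N).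
  under [X in _ = _+X]eq_bigr => b _ do rewrite -colS.
  rewrite -colS [X in _ = _+X]exchange_big -big_split;eqsum i => /=.
  by rewrite -dotxx gP expr2;congr (_ + _);eqsum a;rewrite expr2.
 have -> : sqnorm (conj f0 *m N) = \sum_a CA C A' a ^+ 2.
  rewrite -dotxx gP z0 mul0r add0r;eqsum a.
  by rewrite xNa -CAE mulrNN expr2.
 have -> : \sum_b sqnorm (conj (fb b) *m N) = \sum_a CA C A' a ^+ 2 + \sum_a \sum_b gA C A' a b ^+ 2.
  rewrite -big_split;eqsum a;rewrite -dotxx gP -CAE expr2;congr (_ + _).
  by eqsum b;rewrite -gAE expr2.
 by rewrite addrA mulr2n mulrDl !mul1r.
by move: sN;rewrite T => h;lra.
Qed.

End OctonionClifford.

(** * The Cayley plane *)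

Section OctonionFrame.
Context {R : realType} {k d : nat}.
Hypothesis Nm : @cnorm R k.
Variable X : 'I_d -> 'rV[R]_(cd_dim k).
Hypothesis HX : imaginary_basis X.
Hypothesis p8 : cd_dim k = 8.
Local Notation A := 'rV[R]_(cd_dim k).
Local Notation n := (2*cd_dim k)%N.
Local Notation W := 'rV[R]_n.
Local Notation mul := cd_mul.
Local Notation conj := cd_conj.
Local Notation one := (cd_one k).
Implicit Types (u v w : W) (x y z s : A).

Definition pairv x y : W := bvec (fun i : 'I_2 => if i == 0 then x else y).

Definition sym2 (p q : R) x : 'rV[R]_(2 * 2*cd_dim k) :=
 entries (fun i j : 'I_2 => if i == 0 then (if j == 0 then p *: one else x)
              else (if j == 0 then conj x else q *: one)).

Lemma ord2P (P : 'I_2 -> Prop) : P 0 -> P 1 -> forall i, P i.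
by move=> h0 h1 [[|[|//]] i2];[have <- : 0 = Ordinal i2 by apply: val_inj|have <- : 1 = Ordinal i2 by apply: val_inj].
Qed.

Lemma sum_ord2 (F : 'I_2 -> R) : \sum_i F i = F 0+F 1.
rewrite big_ord_recl big_ord1;congr (_+F _);exact: val_inj.
Qed.

Lemma pairvP w : w = pairv (blk w 0) (blk w 1).
by apply: blkP => i;rewrite blkK;elim/ord2P: i. Qed.

Lemma pairvD x y x' y' : pairv x y+pairv x' y' = pairv (x+x') (y+y').
by apply: blkP => i;rewrite blkD !blkK;elim/ord2P: i. Qed.

Lemma pairvZ (a : R) x y : a *: pairv x y = pairv (a *: x) (a *: y).
by apply: blkP => i;rewrite blkZ !blkK;elim/ord2P: i. Qed.

Lemma dot_pairv x y x' y' : dot (pairv x y) (pairv x' y') = dot x x'+dot y y'.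
by rewrite dot_blk sum_ord2 !blkK. Qed.

Lemma dot_one : dot one one = 1 :> R.
by rewrite dotxx sqnorm_one. Qed.

Lemma dot_sym2 p q x p' q' x' : dot (sym2 p q x) (sym2 p' q' x') = p * p'+q*q' + 2*dot x x'.
rewrite dot_entry !sum_ord2 !entriesK /= cconj_dot !(dotZl, dotZr) dot_one;ring.
Qed.

Lemma sym2Z (a : R) p q x : a *: sym2 p q x = sym2 (a * p) (a*q) (a *: x).
apply: entryP => i j;rewrite entryZ !entriesK.
by elim/ord2P: i;elim/ord2P: j;rewrite /= ?scalerA ?cconjZ.
Qed.

Lemma mul_conj_sum x y : mul x (conj y)+mul y (conj x) = (2*dot x y) *: one.
by have := cmul_polarr Nm x y one;rewrite !cmul1l addrC. Qed.

Lemma outer_pairv x y x' y' : outer (pairv x y) (pairv x' y') =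
 sym2 (dot x x') (dot y y') (2^-1 *: (mul x (conj y')+mul x' (conj y))).
have h t : 2^-1*(2 * t) = t :> R by field.
apply: entryP => i j;rewrite entry_outer entriesK !blkK.
elim/ord2P: i;elim/ord2P: j;rewrite /= ?mul_conj_sum ?scalerA ?h //.
by rewrite cconjZ cconjD !cconjM !cconjK addrC.
Qed.

Section Slope.
Variable s : A.
Local Notation S := (sqnorm s).

(** [vx] parametrizes the octonionic line of slope [s], and [hy] its orthogonal complement. *)
Definition vx x : W := pairv x (mul s x).
Definition hy y : W := pairv (- mul (conj s) y) y.

Lemma vxD x y : vx (x+y) = vx x+vx y.
by rewrite /vx cmulDr pairvD. Qed.

Lemma vxZ (a : R) x : vx (a *: x) = a *: vx x.
by rewrite /vx cmulZr pairvZ. Qed.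

Lemma hyD x y : hy (x+y) = hy x+hy y.
by rewrite /hy cmulDr opprD pairvD. Qed.

Lemma hyZ (a : R) x : hy (a *: x) = a *: hy x.
by rewrite /hy cmulZr pairvZ scalerN. Qed.

Lemma dot_vx x y : dot (vx x) (vx y) = (1+S)*dot x y.
by rewrite dot_pairv (cdot_mul2l Nm);ring. Qed.

Lemma dot_hy x y : dot (hy x) (hy y) = (1+S)*dot x y.
by rewrite dot_pairv dotNl dotNr opprK (cdot_mul2l Nm) (csqnorm_conj s);ring. Qed.

Lemma dot_vx_hy x y : dot (vx x) (hy y) = 0.
by rewrite dot_pairv dotNr cdot_mull addNr. Qed.

Definition q0 := sym2 1 S (conj s).
Definition q1 := sym2 S 1 (- conj s).
Definition Fz z := sym2 (- dot s z) (dot s z) (((1+S) / 2) *: conj z - dot s z *: conj s).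

Lemma outer_vx x y : outer (vx x) (vx y) = dot x y *: q0.
rewrite outer_pairv /q0 sym2Z (cdot_mul2l Nm);congr (sym2 _ _ _);[ring|ring|].
rewrite !cconjM;have := cmul_polarl Nm (conj x) (conj y) (conj s).
rewrite !cconjK cconj_dot => ->;rewrite scalerA;congr (_ *: _);by field.
Qed.

(** The Moufang identity makes the mixed product depend only on [mul y (conj x)]; this is the source
    of the Clifford action in the plane. *)
Lemma outer_vx_hy x y : outer (vx x) (hy y) = Fz (mul y (conj x)).
rewrite outer_pairv /Fz dotNr (cdot_mull s x y) -[dot x (mul (conj s) y)]cdot_mull.
have -> : dot (mul s x) y = dot s (mul y (conj x)) by rewrite cdot_mulr.
congr (sym2 _ _ _).
rewrite cmulNl (cconjM s x).
have := cmoufang Nm (conj s) y (conj x).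
move=> ->;rewrite cconj_dot (csqnorm_conj s) cconjM cconjK.
by apply/rowP => j;rewrite !mxE;field.
Qed.

Lemma outer_hy x y : outer (hy x) (hy y) = dot x y *: q1.
rewrite outer_pairv /q1 sym2Z dotNl dotNr opprK (cdot_mul2l Nm) (csqnorm_conj s).
congr (sym2 _ _ _);[ring|ring|].
rewrite !cmulNl -opprD (cmul_polarr Nm) (dotC y) scalerN scalerA scalerN;congr (- (_ *: _)).
by field.
Qed.

Lemma q00 : dot q0 q0 = (1+S) ^+ 2.
by rewrite dot_sym2 cconj_dot dotxx;ring. Qed.

Lemma q11 : dot q1 q1 = (1+S) ^+ 2.
by rewrite dot_sym2 dotNl dotNr cconj_dot dotxx;ring. Qed.

Lemma q01 : dot q0 q1 = 0.
by rewrite dot_sym2 dotNr cconj_dot dotxx;ring. Qed.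

Lemma q0F z : dot q0 (Fz z) = 0.
by rewrite dot_sym2 dotDr dotNr !dotZr !cconj_dot dotxx;field. Qed.

Lemma q1F z : dot (Fz z) q1 = 0.
by rewrite dot_sym2 dotDl dotNl !dotNr !dotZl !cconj_dot dotxx (dotC z);field. Qed.

Lemma FF z z' : dot (Fz z) (Fz z') = (1+S) ^+ 2 / 2*dot z z'.
rewrite dot_sym2 !dotDl !dotDr !dotNl !dotNr !dotZl !dotZr !cconj_dot dotxx (dotC z s);by field.
Qed.

End Slope.

(** The slope of the octonionic line through [w] is the second block divided by the first, hence the
    condition on the first block. The remaining points are reached later by density. *)
Lemma oct_curved K w : 1000 <= K -> punct w -> blk w 0 != 0 -> curved projQ K w.
move=> K1000 w0 w10 A0 A1 A2 B B1 B2 C1 C2 F num nF F1 F2.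
have sy l := projQ_sym (R := R) (k := k) (m := 2) l.
have [[a0 G0 E1 E2 E3] [/andP[x0 x1] sE KT1 KV1 [KT0 KV0]]] := num.
have r0 : 0 < sqnorm w by exact: w0.
pose w1 := blk w 0;pose w2 := blk w 1.
have r10 : 0 < sqnorm w1 by apply: sqnorm_gt0;apply/eqP.
pose r := Num.sqrt (sqnorm w1).
have rr : r*r = sqnorm w1 by rewrite -expr2 sqr_sqrtr // ltW.
have rn : r != 0 by apply/eqP => h;move: r10;rewrite -rr h mul0r ltxx.
pose f0 := r^-1 *: w1.
have f01 : sqnorm f0 = 1.
 by rewrite -dotxx /f0 dotZl dotZr dotxx -rr;field.
pose s : A := (sqnorm w1)^-1 *: mul w2 (conj w1).
have sw1 : mul s w1 = w2.
 rewrite /s cmulZl;have := cmulKr Nm (conj w1) w2;rewrite cconjK (csqnorm_conj w1) => ->.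
 by rewrite scalerA mulVf ?gt_eqF // scale1r.
have wE : w = r *: vx s f0.
 by rewrite -vxZ /f0 scalerA divff // scale1r /vx sw1;exact: pairvP.
pose S := sqnorm s;have S0 : 0 < 1+S by rewrite ltr_wpDr // sqnorm_ge0.
have S0' : 1+S != 0 by rewrite gt_eqF.
have rho : sqnorm w = r ^+ 2*(1+S).
 by rewrite -dotxx wE dotZl dotZr dot_vx dotxx f01;rewrite -/S;ring.
pose f := fb X f0.
pose xi (a : 'rV[R]_d) : A := \sum_c a 0 c *: f c.
have dxi a x : dot (xi a) x = \sum_c a 0 c*dot (f c) x.
 by rewrite dotC dot_sumr;eqsum c;rewrite dotZr dotC.
have xif a c : dot (xi a) (f c) = a 0 c.
 rewrite dxi -[RHS](sum_eq (fun c => a 0 c));eqsum b.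
 by rewrite (fb_orth Nm HX f01).
have xixi a b : dot (xi a) (xi b) = dot a b.
 by rewrite dotC dxi dotC;eqsum c;rewrite (dotC _ (xi a)) xif mulrC.
have xi0 a : dot (xi a) f0 = 0.
 by rewrite dxi big1 // => c _;rewrite (fb_f0 Nm HX) mulr0.
pose V : 'M[R]_(d, n) := \matrix_(a, j) (r *: vx s (f a)) 0 j.
have aV a : a *m V = r *: vx s (xi a).
 have -> : vx s (xi a) = \sum_c a 0 c *: vx s (f c).
  rewrite /xi (big_morph (vx s) (vxD s) (id1 := 0));last by rewrite -(scale0r 0) vxZ !scale0r.
  by eqsum c;rewrite vxZ.
 apply/rowP => j;rewrite mxE [RHS]rowZE summxE mulr_sumr;eqsum c.
 by rewrite [V c j]mxE !rowZE mulrCA.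
pose H : 'M[R]_(cd_dim k, n) := lmat (fun y => r *: hy s y).
have yH y : y *m H = r *: hy s y.
 by apply: lmatE => [u v|a u];rewrite ?hyD ?scalerDr // hyZ !scalerA mulrC.
have aH y : adm w H y.
 apply: dot_ext => z;rewrite dotZl.
 have -> : dot (y *m H *m H^T) z = dot (y *m H) (z *m H) by rewrite dot_mulmx trmxK.
 by rewrite !yH dotZl dotZr dot_hy rho -/S;ring.
have aVm a : adm w V a.
 apply: dot_ext => z;rewrite dotZl.
 have -> : dot (a *m V *m V^T) z = dot (a *m V) (z *m V) by rewrite dot_mulmx trmxK.
 by rewrite !aV dotZl dotZr dot_vx xixi rho -/S;ring.
have actE a y : act (Omx X f0) a y = mul (mul y (conj (xi a))) f0.
 rewrite /act /xi (big_morph _ (@cconjD R k) (@cconj0 R k)).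
 have gD : {morph (fun x : A => mul (mul y x) f0) : x z / x+z} by move=> x z /=;rewrite cmulDr cmulDl.
 have g0 : mul (mul y 0) f0 = 0 by rewrite cmul0r cmul0l.
 rewrite (big_morph _ gD g0).
 by eqsum c;rewrite mul_Omx cconjZ cmulZr cmulZl.
have psd := oct_strong_psd (Omx_skew Nm HX f0) (Omx_clifford Nm HX f01) x0 x1 sE KT0 KV0
 (M := K) (fun A' aA => Omx_PC Nm HX f01 aA) (fun A' aA => Omx_Z Nm HX f01 aA p8).
pose xc i : A := (1+S)^-1 *: (blk (delta_mx 0 i : W) 0+mul (conj s) (blk (delta_mx 0 i : W) 1)).
pose yc i : A := (1+S)^-1 *: (blk (delta_mx 0 i : W) 1 - mul s (blk (delta_mx 0 i : W) 0)).
have dec i : delta_mx 0 i = vx s (xc i)+hy s (yc i).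
 rewrite {1}(pairvP (delta_mx 0 i)) /vx /hy pairvD /xc /yc.
 move: (blk _ 0) (blk _ 1) => u1 u2;congr pairv.
  rewrite cmulZr cmulDr cmulNr (cmulKl Nm) -/S;move: (mul (conj s) u2) => a.
  by apply/rowP => j;rewrite !mxE;field.
 rewrite cmulZr cmulDr;have := cmulKl Nm (conj s) u2.
 rewrite cconjK (csqnorm_conj s) -/S => ->;move: (mul s u1) => a.
 by apply/rowP => j;rewrite !mxE;field.
have xcE i : xc i = dot (xc i) f0 *: f0+xi (\row_c dot (xc i) (f c)).
 move: (xc i) => u;apply: dot_ext => z;rewrite (fb_parseval Nm HX f01 u z) dotDl dotZl dxi (dotC f0 z).
 by congr (_ + _);eqsum c;rewrite mxE ?(dotC z).
clearbody xc yc.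
have qww : quad projQ w w = r ^+ 2 *: q0 s.
 rewrite projQ_quad {1 2}wE outerZ outerZr outer_vx dotxx f01 scale1r scalerA //.
have qwH y : quad projQ w (y *m H) = r ^+ 2 *: Fz s (mul y (conj f0)).
 by rewrite projQ_quad yH {1}wE outerZ outerZr outer_vx_hy scalerA.
have qHH y y' : quad projQ (y *m H) (y' *m H) = (r ^+ 2*dot y y') *: q1 s.
 by rewrite projQ_quad !yH outerZ outerZr outer_hy !scalerA;congr (_ *: _);ring.
apply: (point_snn sy r0 a0 G0 E1 E2 E3 _ (V := V) (H := H) (Cm := Omx X f0)
 (t := fun i => r^-1*dot (xc i) f0) (v := fun i => r^-1 *: \row_c dot (xc i) (f c))
 (Y := fun i => r^-1 *: yc i) _ _ _ _ _ _ _ _ _ _ _ _ _ _ _ nF F1 F2 (psd _ _ _ _)).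
- by rewrite qww dotZl dotZr q00 rho -/S;ring.
- move=> i;rewrite -!scalemxAl aV yH !scalerA mulVf // !scale1r {1}wE scalerA mulrAC mulVf // mul1r.
 by rewrite -vxZ -vxD -xcE;exact: dec.
- by move=> i;exact: aVm.
- by move=> i;exact: aH.
- by move=> c y _;exact: aH.
- apply: dot_ext => z;rewrite dot0l dot_mulmx trmxK aV {1}wE dotZl dotZr dot_vx (dotC f0) xi0 !mulr0.
 by [].
- apply: dot_ext => z;rewrite dot0l dot_mulmx trmxK yH {1}wE dotZl dotZr dot_vx_hy !mulr0.
 by [].
- apply/row_matrixP => c;rewrite row0 row_mul rowE.
 apply: dot_ext => z;rewrite dot0l dot_mulmx trmxK aV yH dotZl dotZr dot_vx_hy !mulr0.
 by [].
- move=> a;rewrite projQ_quad aV {1}wE outerZ outerZr outer_vx (dotC f0) xi0 scale0r !scaler0 //.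
- move=> a b _ _;rewrite qww projQ_quad !aV outerZ outerZr outer_vx xixi !scalerA;congr (_ *: _).
 by ring.
- move=> a y _ _;rewrite qwH projQ_quad aV yH outerZ outerZr outer_vx_hy scalerA actE.
 by rewrite (cmulKr Nm) f01 scale1r.
- by move=> y _;rewrite qww qwH dotZl dotZr q0F !mulr0.
- move=> y y' _ _;rewrite !qwH dotZl dotZr FF (cdot_mul2r Nm) (csqnorm_conj f0) f01 rho -/S.
 by field.
- by move=> y y' _ _;rewrite qww qHH dotZl dotZr q01 !mulr0.
- by move=> y y' y'' _ _ _;rewrite qwH qHH dotZl dotZr q1F !mulr0.
- move=> i j l q;pose Y i := r^-1 *: yc i.
 change (HH4 (octHH (p_x w A0)) Y i j l q = (2 - p_x w A0)*(dot (Y i) (Y j)*dot (Y l) (Y q)) +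
  2*(1 - p_x w A0) / sqnorm w ^+ 2 *
   dot (quad projQ (Y i *m H) (Y j *m H)) (quad projQ (Y l *m H) (Y q *m H))).
 clearbody Y;rewrite !qHH dotZl dotZr q11.
 have -> : HH4 (octHH (p_x w A0)) Y i j l q =
   (1 + 3*(1 - p_x w A0))*(dot (Y i) (Y j)*dot (Y l) (Y q)).
  have := @HH4E R (cd_dim k) 'I_0 (1 + 3*(1 - p_x w A0)) 0 (fun _ _ _ => 0) n Y i j l q.
  rewrite [0*(dot _ _ * _ + _ + _)]mul0r addr0 => <-;do 4 (apply: eq_bigr => ? _);rewrite /octHH mul0r addr0 //.
 rewrite rho -/S;move: (dot (Y i) _) (dot (Y l) _) => c1 c2.
 by field;rewrite S0' rn.
- apply: le_trans _ KT1;apply: ler_wpM2r;first exact: sqr_ge0.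
 by apply: le_trans _ K1000;rewrite ler_nat.
- by [].
- by [].
Qed.

End OctonionFrame.

(** * Immersions up to local diffeomorphism and ambient isometry *)

Section LocallyGood.
Context {R : realType} {n : nat}.
Implicit Types (M N : manifold R n) (L : finType).

(** Unlike [good], this formulation visibly survives composition with local diffeomorphisms and with
    isometries of the target, which is how the pieces are assembled. *)
Definition lgood M L (G : L -> M -> R) (p : M) : Prop :=
 exists (E : L -> 'rV[R]_n -> R) (k : M -> euclidean R n) (O : set M),
 [/\ open O, O p, forall a q, O q -> G a q = E a (k q), ldiffeo k p &
   nice E (k p) /\ snn E (k p)].

Lemma lgood_good M L (G : L -> M -> R) p : lgood G p -> good G p.
by move=> [E [k [W [oO Op GE dk [nE sE]]]]];exact: (good_local oO Op GE dk nE sE). Qed.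

Lemma local_diffeo_nbhd M N (f : M -> N) p : ldiffeo f p ->
 exists A : set M, [/\ open A, A p & {in A, continuous f}].
by move=> [[A [oA Ap] [cf _]] _];exists A. Qed.

Lemma lgood_comp M N L (f : M -> N) (G : L -> N -> R) p :
 ldiffeo f p -> lgood G (f p) -> lgood (fun a q => G a (f q)) p.
move=> df [E [k [W [oO Op GE dk [nE sE]]]]].
have [A [oA Ap cf]] := local_diffeo_nbhd df.
exists E, (fun q => k (f q)), (A `&` f @^-1` W);split=> //.
- exact: open_preim.
- by move=> a q [_ Oq];exact: GE.
- exact: local_diffeo_comp dk.
Qed.

Lemma lgood_near M L (G G' : L -> M -> R) p (O : set M) : open O -> O p ->
 (forall a q, O q -> G' a q = G a q) -> lgood G p -> lgood G' p.
move=> oO Op GG [E [k [W' [oO' Op' GE dk H]]]].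
exists E, k, (O `&` W');split=> //;first exact: openI.
by move=> a q [Oq Oq'];rewrite GG // GE.
Qed.

Lemma lgood_euclidean L (E : L -> 'rV[R]_n -> R) (x : 'rV[R]_n) : nice E x -> snn E x ->
 lgood (M := euclidean R n) E x.
move=> nE sE;exists E, id, setT;split=> //;first exact: openT.
exact: local_diffeo_id.
Qed.

Section Isometry.
Variables (N N' : nat) (T : 'M[R]_(N, N')) (b : 'rV[R]_N').
Hypothesis TT : T *m T^T = 1%:M.

Definition affine (F : 'rV[R]_n -> 'rV[R]_N) y : 'rV[R]_N' := b+F y *m T.

Let affineE (F : 'rV[R]_n -> 'rV[R]_N) j :
 (fun z => affine F z 0 j) = fun z => b 0 j + \sum_a T a j*F z 0 a.
by apply/funext => z;rewrite /affine !mxE;congr (_ + _);eqsum a;rewrite mulrC.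
Qed.

Lemma smooth_affine (F : 'rV[R]_n -> 'rV[R]_N) U j : open U ->
 (smooth_row U F) -> smooth_on U (fun z => affine F z 0 j).
move=> oU sF;rewrite affineE;apply: (smoothD oU);first exact: smooth_cst.
by apply: smooth_sum => // a;exact: smoothZ.
Qed.

Lemma dd_affine (F : 'rV[R]_n -> 'rV[R]_N) U y i j : open U -> U y ->
 (smooth_row U F) ->
 dd i (fun z => affine F z 0 j) y = \sum_a dd i (crd F a) y*T a j.
move=> oU Uy sF.
have s1 a : smooth_on U (fun z => T a j*F z 0 a) by exact: smoothZ.
have s2 : smooth_on U (fun z => \sum_a T a j*F z 0 a) by exact: smooth_sum.
rewrite affineE (ddD (U := U)) //;last exact: smooth_cst.
rewrite dd_cst add0r (dd_sum (U := U)) //;eqsum a.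
by rewrite (ddZ (U := U)) // mulrC.
Qed.

Lemma gramF_affine (F : 'rV[R]_n -> 'rV[R]_N) U y : open U -> U y ->
 (smooth_row U F) ->
 gramF (fun j z => affine F z 0 j) y = gramF (fun a z => F z 0 a) y.
move=> oU Uy sF;apply/matrixP => i j;rewrite !mxE.
pose d i : 'rV[R]_N := \row_a dd i (crd F a) y.
transitivity ((d i *m T *m (d j *m T)^T) 0 0).
 rewrite mxE;eqsum k;rewrite [in RHS]mxE !(dd_affine _ _ oU Uy sF) !mxE.
 by congr (_ * _);eqsum a;rewrite !mxE.
rewrite trmx_mul mulmxA -(mulmxA (d i)) TT mulmx1 mxE.
by eqsum a;rewrite !mxE.
Qed.

Lemma lgood_affine M (G : 'I_N -> M -> R) p : lgood G p ->
 lgood (fun j q => (b+(\row_a G a q) *m T) 0 j) p.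
move=> [E [k [W [oO Op GE dk [nE sE]]]]].
pose F y : 'rV[R]_N := \row_a E a y.
have FE : (fun a z => F z 0 a) = E by apply/funext => a;apply/funext => z;rewrite mxE.
have [U [oU Ux sE' imE]] := nE.
have sF a : smooth_on U (crd F a) by rewrite (_ : (fun z => _) = E a) //;rewrite -FE.
have gE y : U y -> gramF (fun j z => affine F z 0 j) y = gramF E y.
 by move=> Uy;rewrite (gramF_affine oU Uy sF) FE.
exists (fun j z => affine F z 0 j), k, W;split=> // [j q Oq|].
 by rewrite /affine;congr ((_ + _ *m _) 0 _);apply/rowP => a;rewrite !mxE GE.
split;last by apply: (snn_isometric oU Ux _ sE) => y Uy;rewrite gE.
exists U;split=> // [j|y Uy];first exact: smooth_affine.
by apply: unit_immersive;rewrite gE // gramF_unit //;exact: imE.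
Qed.

End Isometry.

End LocallyGood.

Section Nearby.
Context {R : realType} {n : nat} {L : finType}.
Variables (F G : L -> 'rV[R]_n -> R) (U : set 'rV[R]_n) (x : 'rV[R]_n).
Hypotheses (oU : open U) (Ux : U x) (FG : forall a y, U y -> F a y = G a y).

Lemma nice_near : nice F x -> nice G x.
move=> [V [oV Vx sF imF]];have oUV := openI oU oV.
exists (U `&` V);split=> // [a|y [Uy Vy] v Hv].
 by apply: (smooth_on_eq oUV _ (smoothW _ (sF a))) => [y [Uy _]|y []//];exact: FG.
apply: (imF y Vy) => a;rewrite -[RHS](Hv a);eqsum i;congr (_ * _).
by apply: (dd_eq_on i oU _ Uy) => z;exact: FG.
Qed.

Lemma snn_near : snn F x -> snn G x.
apply: (snn_isometric oU Ux) => y Uy;apply/matrixP => i j;rewrite !mxE.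
by eqsum a;congr (_ * _);apply: (dd_eq_on _ oU _ Uy) => z;exact: FG.
Qed.

End Nearby.

Section DirectionalDerivative.
Context {R : realType} {n : nat}.
Variables (U : set 'rV[R]_n) (w v : 'rV[R]_n).
Hypotheses (oU : open U) (Uw : U w).

Definition dirD (f : 'rV[R]_n -> R) : R := \sum_i v 0 i*dd i f w.

Lemma dirD_mul f g : smooth_on U f -> smooth_on U g ->
 dirD (fun y => f y * g y) = f w*dirD g+g w*dirD f.
move=> sf sg;rewrite /dirD !mulr_sumr -big_split;eqsum i => /=.
by rewrite (ddM i sf sg Uw);ring.
Qed.

Lemma dirD_comp1 (p : R -> R) f d : smooth_on U f -> is_derive (f w) (1 : R) p d ->
 dirD (fun y => p (f y)) = d*dirD f.
move=> sf dp;rewrite /dirD mulr_sumr;eqsum i.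
by rewrite (dd_comp1 i (smooth_diff oU sf Uw) dp) mulrCA.
Qed.

Lemma dirD_affine m (b : R) (c : 'I_m -> R) (f : 'I_m -> 'rV[R]_n -> R) :
 (forall a, smooth_on U (f a)) -> dirD (fun y => b + \sum_a f a y*c a) = \sum_a dirD (f a)*c a.
move=> sf;have s1 a : smooth_on U (fun z => f a z*c a).
 by apply: (smoothM oU) => //;exact: smooth_cst.
have s2 : smooth_on U (fun z => \sum_a f a z*c a) by exact: smooth_sum.
under [RHS]eq_bigr => a _ do rewrite /dirD mulr_suml.
rewrite [RHS]exchange_big;eqsum i => /=.
rewrite (ddD (U := U)) //;last exact: smooth_cst.
rewrite dd_cst add0r (dd_sum (U := U)) // mulr_sumr;eqsum a.
by rewrite (ddM (U := U)) //;[rewrite dd_cst mulr0 add0r [c a * _]mulrC mulrA|exact: smooth_cst].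
Qed.

Lemma dirD_eq f g : (forall y, U y -> f y = g y) -> dirD f = dirD g.
by move=> fg;eqsum i;rewrite (dd_eq_on i oU fg Uw). Qed.

Lemma dirD_coord k : dirD (fun y => y 0 k) = v 0 k.
rewrite /dirD (bigD1 k) //= dd_coord eqxx mulr1 big1 ?addr0 // => i /negPf ik.
by rewrite dd_coord ik mulr0.
Qed.

End DirectionalDerivative.

Section Parts.
Context {R : realType} {n NQ : nat}.
Implicit Types y : 'rV[R]_(n+(NQ + 1)).

Definition Lpart y : 'rV[R]_n := lsubmx y.
Definition Qpart y : 'rV[R]_NQ := lsubmx (rsubmx y).
Definition ppart y : R := y 0 (rshift n (rshift NQ 0)).

Lemma Lpart_pvec (u : 'rV[R]_n) (f : 'rV[R]_NQ) c : Lpart (pvec u f c) = u.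
exact: row_mxKl. Qed.
Lemma Qpart_pvec (u : 'rV[R]_n) (f : 'rV[R]_NQ) c : Qpart (pvec u f c) = f.
by rewrite /Qpart row_mxKr row_mxKl. Qed.
Lemma ppart_pvec (u : 'rV[R]_n) (f : 'rV[R]_NQ) c : ppart (pvec u f c) = c.
by rewrite /ppart !row_mxEr mxE. Qed.
End Parts.

(* A homogeneous model: the subset [X] of [R^N] is covered by cells, the cell
 [j] being parametrized by [w |-> psi j w] with affine coordinates
 [(w, q(w, w), 1) / (1 + |w|^2)]. *)
Section Model.
Context {R : realType} {n N NQ : nat} {J : Type}.
Variable Qm : 'I_NQ -> 'M[R]_n.
Hypothesis Qsym : forall l, (Qm l)^T = Qm l.
Variable X : set 'rV[R]_N.
Local Notation D := (n+(NQ + 1))%N.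
Implicit Types (w u : 'rV[R]_n) (v : 'rV[R]_N) (j l : J).
Variables (S : J -> 'M[R]_(N, D)) (t : J -> 'rV[R]_D) (Rm : J -> 'M[R]_(D, N)) (r : J -> 'rV[R]_N).

Definition aff j v : 'rV[R]_D := t j+v *m S j.
Definition cellh (w : 'rV[R]_n) : 'rV[R]_D := invP w *: pvec w (quad Qm w w) 1.
Definition psi j w : 'rV[R]_N := r j+cellh w *m Rm j.

Variable K kap : R.
Hypothesis psiX : forall j w, X (psi j w).
Hypothesis aff_psi : forall j w, aff j (psi j w) = cellh w.
Hypothesis X_aff : forall j v, X v -> v = r j+aff j v *m Rm j.
Hypothesis X_cell : forall j v, X v -> ppart (aff j v) != 0 -> exists w, v = psi j w.
Hypothesis X_cover : forall v, X v -> exists j, ppart (aff j v) != 0.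
Hypothesis X_dense : forall j l w (U : set 'rV[R]_n), open U -> U w ->
 exists w' u, [/\ U w', psi l w' = psi j u & punct u -> curved Qm K u].
Hypothesis kap0 : kap != 0.
Hypothesis nums : forall w : 'rV[R]_n, punct w ->
 numbers K w (prof_a (invP w)) (rad1 prof_a1 w) (rad2 prof_a1 prof_a2 w)
  (prof_b (invP w)) (rad1 prof_b1 w) (rad2 prof_b1 prof_b2 w)
  (rad1 (gam1 kap) w) (rad2 (gam1 kap) (gam2 kap) w).

(** Expressed in the affine coordinates, which stay smooth at infinity of the cell, and not in the
    parameter [w]; inside the cell it is a cone ([profile_cellh]). *)
Definition profile (y : 'rV[R]_D) : 'rV[R]_D :=
 pvec (alpha (ppart y) *: Lpart y) (beta (ppart y) *: Qpart y) (gam kap (ppart y)).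

Lemma ppart_cellh w : ppart (cellh w) = invP w.
by rewrite /cellh pvecZ ppart_pvec mulr1. Qed.

Lemma Lpart_cellh w : Lpart (cellh w) = invP w *: w.
by rewrite /cellh pvecZ Lpart_pvec. Qed.

Lemma profile_cellh w : profile (cellh w) = cone Qm prof_a prof_b (gam kap) w.
rewrite /profile ppart_cellh Lpart_cellh /cellh pvecZ Qpart_pvec !scalerA.
by rewrite /cone /pvec /prof_a /prof_b ![_ * invP w]mulrC.
Qed.

Lemma invP_gt0 w : 0 < invP w.
by rewrite invr_gt0 ltr_wpDr // sqnorm_ge0. Qed.

Lemma invP_lt1 (w : 'rV[R]_n) : invP w < 1 -> punct w.
rewrite /invP invf_lt1 ?ltrDl //;by rewrite ltr_wpDr // sqnorm_ge0.
Qed.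

(** Cell [l] seen in the affine coordinates of cell [j]. Its last coordinate is 0 at infinity of
    cell [j] and 1 at the centre of cell [j]. *)
Definition chg j l w : 'rV[R]_D := aff j (psi l w).

Definition cellk (y : 'rV[R]_D) : 'rV[R]_n := (ppart y)^-1 *: Lpart y.

Lemma cellkK w : cellk (cellh w) = w.
by rewrite /cellk ppart_cellh Lpart_cellh scalerA mulVf ?scale1r // gt_eqF // invP_gt0. Qed.

Lemma chgE j l w : ppart (chg j l w) != 0 -> psi l w = psi j (cellk (chg j l w)).
move=> h;have [u E] := X_cell (psiX l w) h.
by rewrite /chg E aff_psi cellkK.
Qed.

Lemma ppart_ge0 j v : X v -> 0 <= ppart (aff j v) <= 1.
move=> Xv;have [->|p0] := eqVneq (ppart (aff j v)) 0;first by rewrite lexx ler01.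
have [w ->] := X_cell Xv p0;rewrite aff_psi ppart_cellh ltW ?invP_gt0 //=.
by rewrite /invP invf_le1 ?lerDl ?sqnorm_ge0 // ltr_wpDr // sqnorm_ge0.
Qed.

Lemma smooth_cellh a : smooth_on setT (crd cellh a).
have sP : smooth_on setT (@invP R n) by exact: smooth_invP openT.
have -> : (crd cellh a) = fun w => invP w * pvec w (quad Qm w w) 1 0 a.
 by apply/funext => w;rewrite rowZE.
apply: (smoothM openT) => //;move: a;apply: row_mx_ind => [k|l|].
- rewrite (_ : (fun _ => _) = fun w : 'rV[R]_n => w 0 k);first exact: smooth_on_coord.
 by apply/funext => w;rewrite row_mxEl.
- rewrite (_ : (fun _ => _) = fun w => quad Qm w w 0 l);first exact: smooth_quad.
 by apply/funext => w;rewrite row_mxEr row_mxEl.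
- rewrite (_ : (fun _ => _) = fun=> 1);first exact: smooth_cst.
 by apply/funext => w;rewrite !row_mxEr mxE.
Qed.

Lemma smooth_psi l a : smooth_on setT (fun w => psi l w 0 a).
exact: (smooth_affine (Rm l) (r l) (F := cellh) a openT smooth_cellh). Qed.

Lemma smooth_chg j l a : smooth_on setT (fun w => chg j l w 0 a).
exact: (smooth_affine (S j) (t j) (F := psi l) a openT (smooth_psi l)). Qed.

Lemma open_chg j l (V : set R) : open V -> open [set w | V (ppart (chg j l w))].
move=> oV;apply: open_comp oV => w _.
exact: (smooth_cts (smooth_chg j l (rshift n (rshift NQ 0))) I).
Qed.

Lemma open_ppart : open [set y : 'rV[R]_D | ppart y != 0].
by apply: open_comp (@open_neq R 0) => y _;exact: continuous_coord. Qed.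

Lemma smooth_cellk_part k : smooth_on [set y : 'rV[R]_D | ppart y != 0] (crd cellk k).
have oU := open_ppart.
have E : (crd cellk k) = fun y : 'rV[R]_D => (ppart y)^-1*y 0 (lshift _ k).
 by apply/funext => w;rewrite rowZE mxE.
rewrite E;apply: (smoothM oU);last exact: smooth_on_coord.
by apply: (smooth_comp1 oU smooth1_inv);[exact: smooth_on_coord|].
Qed.

Lemma smooth_cellk j l k :
 smooth_on [set w | ppart (chg j l w) != 0] (fun w => cellk (chg j l w) 0 k).
have oU : open [set w | ppart (chg j l w) != 0] by exact: (open_chg (j := j) (l := l) (@open_neq R 0)).
apply: (smooth_comp oU open_ppart _ _ (smooth_cellk_part k)) => // a.
by apply: smoothW (smooth_chg j l a).
Qed.

Lemma gam_is_derive (s : R) : is_derive s (1 : R) (gam kap) (gam1 kap s).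
have h := der_comp (f := @expR R) (g := fun s => kap*s) (is_derive_expR _) (derZ kap (is_derive_id s 1)).
by apply: is_derive_eq h _;rewrite mulr1 mulrC.
Qed.

Lemma gam1_is_derive (s : R) : is_derive s (1 : R) (gam1 kap) (gam2 kap s).
exact: (derZ kap (gam_is_derive s)). Qed.

Lemma gam1_neq0 (s : R) : gam1 kap s != 0.
by rewrite mulf_neq0 // gt_eqF // expR_gt0. Qed.

Lemma smooth1_gam (Dm : set R) : smooth1 Dm (gam kap).
exact: smooth1_expR. Qed.

Let sa : smooth1 uitv (@prof_a R).
have sub : smooth1 uitv (@alpha R).
 have [P Pa HP] := @smooth1_alpha R;exists P => // g /HP[g' Sg' Hg'];exists g' => // s Ds.
 by apply: Hg';exact: unit_prof.
by apply: (smooth1M open_unit_itv) => //;exact: smooth1_id open_unit_itv.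
Qed.

Let sb : smooth1 uitv (@prof_b R).
have sub : smooth1 uitv (@beta R).
 have [P Pa HP] := @smooth1_beta R;exists P => // g /HP[g' Sg' Hg'];exists g' => // s Ds.
 by apply: Hg';exact: unit_prof.
by apply: (smooth1M open_unit_itv) => //;exact: smooth1_id open_unit_itv.
Qed.

Let cn w : punct w -> nice (fun a w => cone Qm prof_a prof_b (gam kap) w 0 a) w.
move=> w0;have [[aw _ _ _ _] _] := nums w0.
exact: (cone_nice Qsym sa sb (smooth1_gam _) (fun s Ds => prof_a_is_derive (unit_prof Ds))
 (fun s Ds => prof_b_is_derive (unit_prof Ds)) (fun s _ => gam_is_derive s) w0 aw (gam1_neq0 _)).
Qed.

Let cs w : punct w -> curved Qm K w ->
 snn (fun a w => cone Qm prof_a prof_b (gam kap) w 0 a) w.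
move=> w0 cw;exact: (cone_snn Qsym sa sb (smooth1_gam _)
 (fun s Ds => prof_a_is_derive (unit_prof Ds)) (fun s Ds => prof_a1_is_derive (unit_prof Ds))
 (fun s Ds => prof_b_is_derive (unit_prof Ds)) (fun s Ds => prof_b1_is_derive (unit_prof Ds))
 (fun s _ => gam_is_derive s) (fun s _ => gam1_is_derive s) w0 (gam1_neq0 _) cw (nums w0)).
Qed.

Let F j l (a : 'I_D) w := profile (chg j l w) 0 a.

Lemma punctured_chg j l w : ppart (chg j l w) != 0 -> ppart (chg j l w) < 1 ->
 punct (cellk (chg j l w)).
move=> p0 p1;apply: invP_lt1;have := chgE p0 => E.
by move: p1;rewrite {1}/chg E aff_psi ppart_cellh.
Qed.

(** At points inside cell [j] the profile is the cone reparametrized by the change of cells, which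
    is étale because the opposite change inverts it. *)
Lemma chg_reparam j l w : ppart (chg j l w) != 0 -> ppart (chg j l w) < 1 ->
 nice (F j l) w /\ (curved Qm K (cellk (chg j l w)) -> snn (F j l) w).
move=> p0 p1;pose V := [set w | ppart (chg j l w) != 0].
have oV : open V by exact: (open_chg (j := j) (l := l) (@open_neq R 0)).
pose h w := cellk (chg j l w);pose h' w := cellk (chg l j w).
have h'h y : V y -> h' (h y) = y.
 by move=> Vy;rewrite /h' /chg -(chgE Vy) aff_psi cellkK.
have oV' : open [set w | ppart (chg l j w) != 0] by exact: (open_chg (j := l) (l := j) (@open_neq R 0)).
have eh : etale h w.
 apply: (etale_left_inverse (k := h') oV oV' p0 _ (smooth_cellk j l) (smooth_cellk l j) h'h).
 by rewrite /= /chg -(chgE p0) aff_psi ppart_cellh gt_eqF // invP_gt0.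
have pu := punctured_chg p0 p1.
have FE a y : V y -> cone Qm prof_a prof_b (gam kap) (h y) 0 a = F j l a y.
 by move=> Vy;rewrite -profile_cellh -(aff_psi j) -(chgE Vy).
split=> [|cw].
 apply: (nice_near oV p0 FE).
 exact: (reparam_nice oV p0 (smooth_cellk j l) eh (cn pu)).
apply: (snn_near oV p0 FE).
exact: (reparam_snn oV p0 (smooth_cellk j l) eh (cn pu) (cs pu cw)).
Qed.

Let Udom j l := [set w | pdom (ppart (chg j l w))].

Let oU j l : open (Udom j l).
exact: (open_chg (j := j) (l := l) (@open_prof_dom R)). Qed.

Lemma prof_chg j l w : ppart (chg j l w) < 1 -> Udom j l w.
have /andP[h _] := ppart_ge0 j (psiX l w);move=> h1.
have [E|p0] := eqVneq (ppart (chg j l w)) 0;first by rewrite /Udom /= E;exact: prof_dom0.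
by apply: unit_prof;rewrite /uitv /= h1 andbT lt_neqAle eq_sym p0 h.
Qed.

Let s_comp (g : R -> R) j l : smooth1 pdom g -> smooth_on (Udom j l) (fun w => g (ppart (chg j l w))).
move=> sg;refine (@smooth_comp1 _ _ _ (@oU j l) pdom g (fun w => ppart (chg j l w)) sg _ _) => //.
by apply: smoothW (smooth_chg j l _).
Qed.

Let s_chg j l a : smooth_on (Udom j l) (fun w => chg j l w 0 a).
by apply: smoothW (smooth_chg j l _). Qed.

Let FL j l k : F j l (lshift _ k) = fun w => alpha (ppart (chg j l w))*chg j l w 0 (lshift _ k).
by apply/funext => w;rewrite /F row_mxEl rowZE mxE. Qed.
Let FM j l k : F j l (rshift n (lshift 1 k)) =
 fun w => beta (ppart (chg j l w))*chg j l w 0 (rshift n (lshift 1 k)).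
by apply/funext => w;rewrite /F row_mxEr row_mxEl rowZE !mxE. Qed.
Let FR j l : F j l (rshift n (rshift NQ 0)) = fun w => gam kap (ppart (chg j l w)).
by apply/funext => w;rewrite /F !row_mxEr mxE. Qed.

Lemma smooth_profile j l a : smooth_on (Udom j l) (F j l a).
move: a;apply: row_mx_ind => [k|k|];rewrite ?FL ?FM ?FR.
- by apply: smoothM => //;apply: s_comp;exact: smooth1_alpha.
- by apply: smoothM => //;apply: s_comp;exact: smooth1_beta.
- by apply: s_comp;exact: smooth1_gam.
Qed.

(** A vector killed by the derivative first kills the height, hence the arguments of [alpha] and
    [beta]. These are nonzero at [t = 0], so it kills all affine coordinates, then the embedded
    point, and finally the parameter itself. *)
Lemma immersive_infinity j l w : ppart (chg j l w) = 0 -> immersive (F j l) w.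
move=> p0 v Hv.
have Uw : Udom j l w by apply: prof_chg;rewrite p0.
have oD := @open_prof_dom R.
pose pp := rshift n (rshift NQ 0) : 'I_D.
have Dp : dirD w v (fun w => chg j l w 0 pp) = 0.
 have := Hv pp;rewrite -/(dirD w v _) FR (dirD_comp1 v (@oU j l) Uw (s_chg j l pp) (gam_is_derive _)).
 by move/eqP;rewrite mulf_eq0 (negPf (gam1_neq0 _)) => /eqP.
have comp (g : R -> R) : smooth1 pdom g -> dirD w v (fun w => g (ppart (chg j l w))) = 0.
 move=> [P Pg HP];have [g' _ Hg'] := HP _ Pg.
 by rewrite (dirD_comp1 v (@oU j l) Uw (s_chg j l pp) (Hg' _ Uw)) Dp mulr0.
have Dc a : dirD w v (fun w => chg j l w 0 a) = 0.
 move: a;apply: row_mx_ind => [k|k|] //.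
  have := Hv (lshift _ k);rewrite -/(dirD w v _) FL.
  rewrite (dirD_mul v Uw (s_comp j l smooth1_alpha) (s_chg j l _)) (comp _ smooth1_alpha) mulr0 addr0.
  move/eqP;rewrite mulf_eq0 p0 => /orP[|/eqP //].
  by rewrite /alpha mulf_eq0 !gt_eqF // ?isqrt_gt0 ?subr0 //;have [] := @prof_dom0 R.
 have := Hv (rshift n (lshift 1 k));rewrite -/(dirD w v _) FM.
 rewrite (dirD_mul v Uw (s_comp j l smooth1_beta) (s_chg j l _)) (comp _ smooth1_beta) mulr0 addr0.
 move/eqP;rewrite mulf_eq0 p0 => /orP[|/eqP //].
 rewrite /beta subr0 invr1 mulr1 !mulf_eq0 !gt_eqF // ?isqrt_gt0 //;first by have [] := @prof_dom0 R.
 by apply: flat_gt0;rewrite subr0 invr_gt0.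
have Dpsi a : dirD w v (fun w => psi l w 0 a) = 0.
 rewrite (dirD_eq (g := fun w => r j 0 a + \sum_b chg j l w 0 b * Rm j b a) v (@oU j l) Uw).
  by rewrite (dirD_affine v (@oU j l) Uw) // big1 // => b _;rewrite Dc mul0r.
 by move=> y _;rewrite {1}(X_aff j (psiX l y)) !mxE.
have sT a : smooth_on (Udom j l) (fun w => psi l w 0 a) by apply: smoothW (smooth_psi l _).
have Dh a : dirD w v (crd cellh a) = 0.
 rewrite (dirD_eq (g := fun w => t l 0 a + \sum_b psi l w 0 b*S l b a) v (@oU j l) Uw).
  by rewrite (dirD_affine v (@oU j l) Uw) // big1 // => b _;rewrite Dpsi mul0r.
 by move=> y _;rewrite -(aff_psi l) !mxE.
have sP : smooth_on setT (@invP R n) by exact: smooth_invP openT.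
have DP : dirD w v (@invP R n) = 0.
 rewrite -[RHS](Dh pp);congr (dirD w v _);apply/funext => y.
 by rewrite -ppart_cellh.
apply/rowP => k;rewrite [RHS]mxE.
have := Dh (lshift _ k);rewrite (_ : (fun _ => _) = fun y : 'rV[R]_n => invP y*y 0 k);last first.
 by apply/funext => y;rewrite /cellh pvecZ row_mxEl rowZE.
rewrite (dirD_mul v (I : setT w) sP (smooth_on_coord _ k)) DP mulr0 addr0 dirD_coord.
by move/eqP;rewrite mulf_eq0 gt_eqF ?invP_gt0 //= => /eqP.
Qed.

Lemma profile_nice j l w : ppart (chg j l w) < 1 -> nice (F j l) w.
move=> p1;have [p0|p0] := eqVneq (ppart (chg j l w)) 0;last by have [] := chg_reparam p0 p1.
apply: nice_immersive (immersive_infinity p0);exists (Udom j l);split=> //.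
 exact: prof_chg.
exact: smooth_profile.
Qed.

(** The frame computation is available only at generic points inside the cell; [X_dense] and
    [snn_limit] supply all the others, among them the cut locus. *)
Lemma profile_snn j l w : ppart (chg j l w) < 1 -> snn (F j l) w.
move=> p1;apply: snn_limit (profile_nice p1) _ => U oU' Uw.
have o1 : open [set w | ppart (chg j l w) < 1].
 by apply: (open_chg (V := [set s | s < 1]));exact: open_lt.
have [w' [u [[Uw' p1'] E cu]]] := X_dense j l (openI oU' o1) (conj Uw p1).
have hE : chg j l w' = cellh u by rewrite /chg E aff_psi.
have p0 : ppart (chg j l w') != 0 by rewrite hE ppart_cellh gt_eqF // invP_gt0.
have uE : cellk (chg j l w') = u by rewrite hE cellkK.
exists w' => //;have [_ H] := chg_reparam p0 p1';apply: H;rewrite uE;apply: cu.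
by rewrite -uE;exact: punctured_chg.
Qed.

Section OnManifold.
Variables (M : manifold R n) (f : M -> euclidean R N).
Hypotheses (n0 : (0 < n)%N) (sf : smooth_map setT f) (rf : range f = X).
Hypothesis hf : forall q, X q -> exists (U : set (euclidean R N)) (h : euclidean R N -> M),
 [/\ open U, U q, smooth_map U h & forall p, U (f p) -> h (f p) = p].

Let fX p : X (f p).
by rewrite -rf;exists p. Qed.

Lemma model_map_inj : injective f.
move=> p q E;have [U [h [_ Up _ hK]]] := hf (fX p).
by rewrite -(hK p) // E hK // -E.
Qed.

Lemma cell_point l w : exists p, f p = psi l w.
by have := psiX l w;rewrite -rf => -[p _ E];exists p. Qed.

Definition iota l (w : euclidean R n) : M := sval (cid (cell_point l w)).

Lemma f_iota l w : f (iota l w) = psi l w.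
exact: (svalP (cid (cell_point l w))). Qed.

Definition kf j (p : M) : euclidean R n := cellk (aff j (f p)).
Definition cell j : set M := [set p | ppart (aff j (f p)) != 0].

Lemma kf_iota j w : kf j (iota j w) = w.
by rewrite /kf f_iota aff_psi cellkK. Qed.

Lemma cell_iota j w : cell j (iota j w).
by rewrite /cell /= f_iota aff_psi ppart_cellh gt_eqF // invP_gt0. Qed.

Lemma f_kf j p : cell j p -> f p = psi j (kf j p).
by move=> h;have [w E] := X_cell (fX p) h;rewrite /kf E aff_psi cellkK. Qed.

Lemma iota_kf j p : cell j p -> iota j (kf j p) = p.
by move=> h;apply: model_map_inj;rewrite f_iota -f_kf. Qed.

Lemma image_iota j : iota j @` setT = cell j.
apply/seteqP;split=> [_ [w _ <-]|p cp];first exact: cell_iota.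
by exists (kf j p) => //;exact: iota_kf.
Qed.

Lemma smoothf_aff j a : smoothf setT (fun p => aff j (f p) 0 a).
move=> c ac;have oc : open (cd c setT) by apply: open_cd;exact: openT.
exact: (smooth_affine (S j) (t j) (F := fun x => f (cinv c x)) a oc (fun b => smooth_map_coord b sf ac)).
Qed.

Lemma open_cell j : open (cell j).
have -> : cell j = f @^-1` [set v | ppart (aff j v) != 0] by [].
apply: open_comp;first by move=> p _;apply: sf.1;rewrite inE.
apply: open_comp (@open_neq R 0) => v _.
have := smooth_affine (S j) (t j) (F := id) (rshift n (rshift NQ 0)) openT (@smooth_on_coord R N setT).
by move/smooth_cts;apply.
Qed.

Lemma smooth_kf j : smooth_map (cell j) (kf j).
have oc := open_cell j;apply: smooth_map_to_euclidean => // k c ac.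
have oc' : open (cd c (cell j)) by exact: open_cd.
refine (smooth_comp (h := fun x => aff j (f (cinv c x))) oc' open_ppart _ _ (smooth_cellk_part k)) => [a|x [_ h] //].
by apply: smoothW (smoothf_aff j a ac) => x [].
Qed.

Lemma smooth_iota l : smooth_map setT (iota l).
apply: smooth_map_local => w _;have [U [h [oU' Uw sh hK]]] := hf (psiX l w).
have sp : smooth_map setT (psi l : euclidean R n -> euclidean R N).
 by apply: smooth_map_to_euclidean => [|b];[exact: openT|apply: smoothf_euclidean;exact: smooth_psi].
pose B : set (euclidean R n) := setT `&` psi l @^-1` U.
have oB : open B by apply: (open_preim (M := euclidean R n) (N := euclidean R N)) sp.1 => //;exact: openT.
exists B => //;refine (smooth_map_eq (f := fun w : euclidean R n => h (psi l w)) oB _ _) => [y [_ Uy]|].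
 by have Uf : U (f (iota l y)) by [rewrite f_iota];rewrite -f_iota hK.
have sB : smooth_map B (psi l : euclidean R n -> euclidean R N) by apply: smooth_mapW sp.
exact: (smooth_map_comp oB oU' sB sh (fun y By => By.2)).
Qed.

Lemma iota_embedding l : open_embedding setT (iota l).
split;rewrite ?image_iota;[exact: openT|exact: open_cell|exact: smooth_iota|].
by exists (kf l);[exact: smooth_kf|move=> w _;exact: kf_iota].
Qed.

Lemma kf_local_diffeo l p : cell l p -> ldiffeo (kf l) p.
move=> cp;apply: (inverse_local_diffeo (iota_embedding l));rewrite ?image_iota //.
 exact: smooth_kf.
exact: kf_iota.
Qed.

Lemma lgood_profile j p : ppart (aff j (f p)) < 1 ->
 lgood (fun a q => profile (aff j (f q)) 0 a) p.
move=> p1;have [l cl] := X_cover (fX p).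
have h q : cell l q -> aff j (f q) = chg j l (kf l q) by move=> cq;rewrite {1}(f_kf cq).
rewrite h // in p1.
exists (F j l), (kf l), (cell l);split=> //.
- exact: open_cell.
- by move=> a q cq;rewrite /F h.
- exact: kf_local_diffeo.
- by split;[exact: profile_nice|exact: profile_snn].
Qed.

(** For [sqnorm w < 1] the value of [invP] exceeds 1/2, where [lid] vanishes: the quadratic block
    disappears and a round cylinder remains. *)
Lemma profile_near_pole w : sqnorm w < 1 -> punct w ->
 profile (cellh w) = pvec (isqrt (sqnorm w) *: w) 0 (gam kap (invP w)).
move=> w1 w0;have r0 : 0 < sqnorm w by exact: w0.
have P0 := invP_gt0 w;have h1 : 0 < 1+sqnorm w by lra.
have P2 : 2^-1 - invP w <= 0.
 by rewrite subr_le0 /invP lef_pV2 ?posrE //;lra.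
have l0 : lid (invP w) = 0 by rewrite /lid flat_le0.
rewrite profile_cellh /cone /prof_b /beta l0 mul0r !mulr0 scale0r /pvec;congr (row_mx (_ *: _) _).
have d1 : 1 - invP w = sqnorm w * invP w by rewrite /invP;field;rewrite gt_eqF.
rewrite /prof_a /alpha /den l0 expr0n addr0 d1 /isqrt powRM ?(ltW P0) ?(ltW r0) //.
have E : invP w `^ (- 2^-1) ^+ 2 = (invP w)^-1 by exact: isqrt_sqr.
rewrite mulrCA mulrC;move: (sqnorm w `^ _) => z;rewrite mulrCA -mulrA mulrC.
rewrite (_ : _ * _ = z*(invP w * invP w `^ (- 2^-1) ^+ 2));last by rewrite expr2;ring.
by rewrite E mulfV ?mulr1 // gt_eqF.
Qed.

(* A neighbourhood of the point [i1 0] is rounded off by diffeomorphisms of [M]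
 until [i1] is the restriction of a rotated and rescaled cell. *)
Lemma model_end (i1 : euclidean R n -> M) : open_embedding setT i1 ->
 exists (G : 'I_D -> M -> R) (eps : R),
 [/\ 0 < eps, forall p, p <> i1 (0 : 'rV[R]_n) -> lgood G p &
   forall x : 'rV[R]_n, 0 < sqnorm x < 4 ->
   \row_a G a (i1 x) = pvec (isqrt (sqnorm x) *: x) 0 (expR (kap / (1+eps*sqnorm x)))].
move=> emb;have [oT oi si [g sg gK]] := emb.
have [j cj] := X_cover (fX (i1 (0 : 'rV[R]_n))).
pose w0 := kf j (i1 (0 : 'rV[R]_n));have iw0 : iota j w0 = i1 (0 : 'rV[R]_n) by exact: iota_kf.
have embj := iota_embedding j.
have [_ _ sj _] := embj.
pose k (w : 'rV[R]_n) : 'rV[R]_n := g (iota j w).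
pose U : set 'rV[R]_n := setT `&` iota j @^-1` (i1 @` setT).
have oUk : open (U : set (euclidean R n)) by apply: (open_preim (M := euclidean R n)) sj.1.
have Uw0 : U w0 by split=> //;rewrite /preimage /= iw0;exists (0 : 'rV[R]_n).
have sk a : smooth_on U (crd k a).
 apply: (@euclidean_smoothf R n U);apply: smooth_map_coord.
 apply: (smooth_map_comp oUk oi _ sg (fun y Uy => Uy.2)).
 by apply: smooth_mapW sj.
have k0 : k w0 = 0 by rewrite /k iw0 gK.
have dk : ldiffeo (fun w : euclidean R n => g (iota j w)) w0.
 apply: local_diffeo_comp;first exact: embedding_local_diffeo.
 by apply: (inverse_local_diffeo emb sg) => [x|];[exact: gK|rewrite iw0;exists (0 : 'rV[R]_n)].
have ek : etale k w0 by exact: (dk.2 (euclidean_chart n) (euclidean_chart n) erefl erefl I I).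
have [s [Q [rad [ds QQ r0 sw0 sE]]]] := straighten n0 oUk Uw0 sk ek k0.
have [Phi [PhiE dPhi PhiI]] := modification embj ds.
pose h x := kf j (i1 x).
have [del del0 hdel] : exists2 del, 0 < del &
  forall x : 'rV[R]_n, sqnorm x < del -> Phi (i1 x) = iota j (x *m Q).
 pose V : set (euclidean R n) := setT `&` i1 @^-1` cell j.
 have oV : open V by apply: (open_preim (M := euclidean R n)) si.1 => //;exact: open_cell.
 pose V' : set (euclidean R n) := V `&` h @^-1` [set w : 'rV[R]_n | sqnorm (w - w0) < rad].
 have sh : smooth_map V (h : euclidean R n -> euclidean R n).
  apply: (smooth_map_comp oV (open_cell j) _ (smooth_kf j) (fun y Vy => Vy.2)).
  by apply: smooth_mapW si.
 have oB : open [set w : 'rV[R]_n | sqnorm (w - w0) < rad].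
  have -> : [set w : 'rV[R]_n | sqnorm (w - w0) < rad] =
   (fun w => w - w0) @^-1` [set w : 'rV[R]_n | sqnorm w < rad] by [].
  apply: open_comp;last exact: open_sqnorm_lt.
  move=> w _;apply: (smooth_row_cts openT _ (I : setT w)) => b.
  rewrite (_ : (fun _ => _) = fun w : 'rV[R]_n => w 0 b+(- w0) 0 b).
   by apply: (smoothD openT);[exact: smooth_on_coord|exact: smooth_cst].
  by apply/funext => y;rewrite mxE.
 have oV' : open V' by apply: (open_preim (M := euclidean R n) (N := euclidean R n)) sh.1.
 have V0 : V' (0 : 'rV[R]_n) by split;[split|rewrite /= -/w0 subrr sqnorm0].
 have [del del0 Hd] := nbhs_sqnorm (open_nbhs_nbhs (conj oV' V0)).
 exists del => // x xd;have [[_ cx] hx] : V' x by apply: Hd;rewrite subr0.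
 by rewrite -{1}(iota_kf cx) PhiE sE // /k (iota_kf cx) gK.
(* After dilation by [e1], points with [sqnorm x < 4] lie where the straightened parametrization is
   exact ([hdel]) and where the profile is round. *)
pose e1 : R := Num.min 1 del / 4.
have m0 : 0 < Num.min 1 del by rewrite lt_min ltr01.
have m1 : Num.min 1 del <= 1 by rewrite ge_min lexx.
have m2 : Num.min 1 del <= del by rewrite ge_min lexx orbT.
have e10 : 0 < e1 by rewrite /e1;lra.
have e11 : e1 <= 1 by rewrite /e1;lra.
have e1s : e1 ^+ 2 * 4 <= Num.min 1 del / 4.
 rewrite expr2 -mulrA -[leRHS]mulr1;apply: ler_pM => //;[exact: ltW|lra|rewrite /e1;lra].
have four : 0 < 4 :> R by lra.
have [s' ds' sE'] := dilation_diff0 (n := n) e10 e11 four.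
have [Phi' [PhiE' dPhi' PhiI']] := modification emb ds'.
(* The rotation left over by [straighten] is undone by an isometry of the target space. *)
pose T : 'M[R]_D := block_mx Q^T 0 0 1%:M.
have QQ' : Q^T *m Q = 1%:M by exact: mulmx1C.
have TT : T *m T^T = 1%:M.
 by rewrite /T tr_block_mx mulmx_block !trmx0 trmxK trmx1 !mulmx0 !mul0mx mulmx1 !addr0 add0r QQ' -scalar_mx_block.
pose G0 p := profile (aff j (f (Phi (Phi' p)))).
exists (fun a p => (0+(\row_b G0 p 0 b) *m T) 0 a), (e1 ^+ 2);split.
- exact: exprn_gt0.
- move=> p pne;apply: (lgood_affine 0 TT (G := fun b p => G0 p 0 b)).
 apply: (lgood_comp (f := Phi') (G := fun a q => profile (aff j (f (Phi q))) 0 a) (dPhi' p)).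
 apply: (lgood_comp (f := Phi) (G := fun a q => profile (aff j (f q)) 0 a) (dPhi _)).
 apply: lgood_profile;set q := Phi _.
 (* The profile is singular only at the centre of the cell; injectivity of both modifications shows
    that [i1 0] is the only point sent there. *)
 have /andP[_] := ppart_ge0 j (fX q);rewrite le_eqVlt => /orP[/eqP p1|//].
 have cq : cell j q by rewrite /cell /= p1 oner_eq0.
 have qE : q = iota j (0 : 'rV[R]_n).
  rewrite -(iota_kf cq);congr (iota j _);move: p1;rewrite {1}(f_kf cq) aff_psi ppart_cellh.
  move=> p1;apply: sqnorm_eq0;have h2 : 1+sqnorm (kf j q) != 0.
   by rewrite gt_eqF // ltr_wpDr // sqnorm_ge0.
  by move: p1;rewrite /invP => /(congr1 GRing.inv);rewrite invrK invr1;lra.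
 have [x px sx] := PhiI _ _ qE.
 have xw : x = w0 by have [_ _ is_ _] := ds;apply: is_;rewrite sx sw0.
 have [y py sy] := PhiI' p (0 : 'rV[R]_n) (etrans px (etrans (congr1 _ xw) iw0)).
 case: pne;rewrite py;congr (i1 _);have [_ _ is_ _] := ds';apply: is_.
 by rewrite sy sE' ?scaler0 // sqnorm0.
move=> x /andP[x0 x4].
have sx : sqnorm (e1 *: x) < Num.min 1 del.
 rewrite sqnormZ;apply: (@le_lt_trans _ _ (Num.min 1 del / 4));last by lra.
 by apply: le_trans e1s;apply: ler_wpM2l;[exact: sqr_ge0|exact: ltW].
have sQ y : sqnorm (y *m Q) = sqnorm y :> R.
 by rewrite -!dotxx dot_mulmx -mulmxA QQ mulmx1.
have G0E : G0 (i1 x) = profile (cellh ((e1 *: x) *m Q)).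
 by rewrite /G0 PhiE' sE' // hdel;[rewrite f_iota aff_psi|exact: lt_le_trans m2].
have p0 : punct ((e1 *: x) *m Q) by rewrite /punct /= sQ sqnormZ mulr_gt0 // exprn_gt0.
have -> : (\row_b G0 (i1 x) 0 b) = G0 (i1 x) by apply/rowP => b;rewrite mxE.
transitivity (G0 (i1 x) *m T);first by apply/rowP => a;rewrite mxE add0r;congr ((_ *m _) 0 a);apply/rowP => b;rewrite mxE.
rewrite G0E (profile_near_pole _ p0);last by rewrite sQ (lt_le_trans sx).
rewrite /invP sQ sqnormZ /pvec /T mul_row_block !mulmx0 mulmx1 addr0 add0r;congr row_mx.
rewrite -scalemxAl -mulmxA QQ mulmx1 scalerA;congr (_ *: _).
rewrite /isqrt powRM ?sqr_ge0 ?(ltW x0) //.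
have : isqrt (e1 ^+ 2)*e1 = 1.
 have z0 : 0 < isqrt (e1 ^+ 2) by apply: isqrt_gt0;exact: exprn_gt0.
 have z2 : (isqrt (e1 ^+ 2)*e1) ^+ 2 = 1.
  by rewrite exprMn isqrt_sqr ?exprn_gt0 // mulVf // expf_neq0 // gt_eqF.
 have z1 : 0 < isqrt (e1 ^+ 2)*e1 by exact: mulr_gt0.
 move/eqP: z2;rewrite sqrf_eq1 => /orP[/eqP //|/eqP z3];move: z1;rewrite z3;lra.
by rewrite /isqrt mulrAC => ->;rewrite mul1r.
Qed.

End OnManifold.

End Model.

(** * The neck: a round cylinder with prescribed height *)

Section Neck.
Context {R : realType}.
Variable l : R -> R.
Hypothesis sl : smooth1 [set t : R | 0 < t] l.
Hypothesis dl : forall t : R, 0 < t -> exists2 d : R, d != 0 & is_der t l d.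

(** Recovers the squared norm of [w] from [invP w], the variable that [cone] expects. *)
Let u (t : R) : R := t^-1 + -1.
Let a (t : R) : R := isqrt (u t).
Let a1 (t : R) : R := 2^-1*(a t*((u t)^-1*(t^-1 * t^-1))).
Let a2 (t : R) : R := 2^-1*(a t*((u t)^-1*(t^-1 * t^-1))*(3 / 2*((u t)^-1*(t^-1 * t^-1)) - 2 * t^-1)).
Let c (t : R) : R := l (u t).

Let u_gt0 t : uitv t -> 0 < u t.
by move=> /andP[t0 t1];rewrite /u subr_gt0 invf_gt1. Qed.

Let inv_d t : uitv t -> is_der t (fun s : R => s^-1) (- (t^-1 * t^-1)).
move=> /andP[t0 _];have t0' : t != 0 by rewrite gt_eqF.
apply: is_derive_eq (derV (g := id) t0' (is_derive_id t (1 : R))) _.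
by rewrite mulr1 expr2 invfM.
Qed.

Let u_d t : uitv t -> is_der t u (- (t^-1 * t^-1)).
move=> ut;apply: is_derive_eq (derD (inv_d ut) (is_derive_cst (-1 : R) t (1 : R))) _.
by rewrite addr0.
Qed.

Let a_d t : uitv t -> is_der t a (a1 t).
move=> ut;apply: is_derive_eq (der_comp (isqrt_is_derive (u_gt0 ut)) (u_d ut)) _.
by rewrite /a1 /a;move: (isqrt (u t)) (u t)^-1 (t^-1) => z y x;ring.
Qed.

Let a1_d t : uitv t -> is_der t a1 (a2 t).
move=> ut;have u0 : u t != 0 by rewrite gt_eqF // u_gt0.
have t0 : t != 0 by case/andP: ut => t0 _;rewrite gt_eqF.
have h := derM (derV u0 (u_d ut)) (derM (inv_d ut) (inv_d ut)).
apply: is_derive_eq (derZ (2^-1) (derM (a_d ut) h)) _.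
rewrite /a2 /a1;move: (a t) (u t) u0 => z y y0.
by field;rewrite t0 y0.
Qed.

Let smooth1_u (D : set R) : open D -> (forall t, D t -> t != 0) -> smooth1 D u.
move=> oD D0;apply: (smooth1D oD);last exact: smooth1_cst.
exact: (smooth1_comp oD (smooth1_id oD) smooth1_inv).
Qed.

Let unit0 t : uitv t -> t != 0 :> R.
by case/andP => t0 _;rewrite gt_eqF. Qed.

Let sa : smooth1 uitv a.
have oD := @open_unit_itv R.
exact: (smooth1_comp oD (smooth1_u oD unit0) (smooth1_powR _) u_gt0).
Qed.

Let sc : smooth1 uitv c.
by have oD := @open_unit_itv R;exact: (smooth1_comp oD (smooth1_u oD unit0) sl u_gt0). Qed.

(** The neck is a cone over the sphere model with [b = 0] and fibre ratio 1, so [sphere_curved]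
    applies; the nonzero derivative of the height makes it an immersion. *)
Lemma neck_good n (x : 'rV[R]_n) : 0 < sqnorm x ->
 let F (j : 'I_(n+(1 + 1))) (y : 'rV[R]_n) :=
  pvec (isqrt (sqnorm y) *: y) (0 : 'rV[R]_1) (l (sqnorm y)) 0 j in
 nice F x /\ snn F x.
move=> x0 F.
have uE y : u (invP y) = sqnorm y :> R by rewrite /u /invP invrK addrC addKr.
have FE : F = fun j y => cone (@sphereQ R n) a (fun=> 0) c y 0 j.
 apply/funext => j;apply/funext => y;rewrite /F /cone /a /c uE scale0r //.
have [c1 sc1 dc] := smooth1_dest sc;have [c2 _ dc1] := smooth1_dest sc1.
have oD := @open_unit_itv R.
have sb : smooth1 uitv (fun=> 0 : R) by exact: smooth1_cst.
have db t : uitv t -> is_der t (fun=> 0 : R) ((fun=> 0) t) by move=> _;exact: is_derive_cst.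
have Px := invP_itv x0.
have aE : a (invP x) = isqrt (sqnorm x) by rewrite /a uE.
have a0 : a (invP x) != 0 by rewrite aE gt_eqF // isqrt_gt0.
have c0 : c1 (invP x) != 0.
 have [d d0 hd] := dl (u_gt0 Px).
 have [_ E1] := der_comp hd (u_d Px);have [_ E2] := dc _ Px.
 rewrite -E2 E1 mulf_neq0 // oppr_eq0 mulf_neq0 // invr_eq0;exact: unit0.
have Qs i : (@sphereQ R n i)^T = sphereQ i by rewrite /sphereQ trmx1.
have r1 : rad1 (fun=> 0) x = 0 by rewrite /rad1 mulr0.
have r2 : rad2 (fun=> 0) (fun=> 0) x = 0 by rewrite /rad2 !mulr0 subr0 mulr0.
have P0 : invP x != 0 by exact: unit0.
have s0 : sqnorm x != 0 by rewrite gt_eqF.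
have A1 : rad1 a1 x = - (isqrt (sqnorm x) / sqnorm x).
 rewrite /rad1 /a1 uE aE;move: (invP x) (sqnorm x) P0 s0 (isqrt _) => p y p0 y0 z.
 by field;rewrite p0 y0.
have A2 : rad2 a1 a2 x = 3 * isqrt (sqnorm x) / sqnorm x ^+ 2.
 rewrite /rad2 /a2 /a1 uE aE;move: (invP x) (sqnorm x) P0 s0 (isqrt _) => p y p0 y0 z.
 by field;rewrite p0 y0.
have nm : numbers 12 x (a (invP x)) (rad1 a1 x) (rad2 a1 a2 x) 0 (rad1 (fun=> 0) x)
  (rad2 (fun=> 0) (fun=> 0) x) (rad1 c1 x) (rad2 c1 c2 x).
 rewrite r1 r2 A1 A2 aE.
 have g0 : p_ga x (rad1 c1 x) != 0.
  by rewrite /p_ga mulf_neq0 // /rad1 mulf_neq0 // mulf_neq0 ?expf_neq0 // oppr_eq0 pnatr_eq0.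
 pose e0 := - p_ga2 x (rad1 c1 x) (rad2 c1 c2 x) / p_ga x (rad1 c1 x).
 have be0 : p_be x 0 0 = 0 :> R by rewrite /p_be mul0r mulr0 addr0.
 have be20 : p_be2 x 0 0 0 = 0 :> R by rewrite /p_be2 !(mul0r, mulr0, addr0).
 have al0 : p_al x (isqrt (sqnorm x)) (- (isqrt (sqnorm x) / sqnorm x)) = 0.
  by rewrite /p_al mulNr divfK // addNr.
 have al20 : p_al2 x (- (isqrt (sqnorm x) / sqnorm x)) (3 * isqrt (sqnorm x) / sqnorm x ^+ 2) = 0.
  by rewrite /p_al2;move: (sqnorm x) s0 (isqrt _) => y y0 z;field.
 have hz (y z : R) : y = 0 -> 0 <= z -> y <= z by move=> ->.
 have hz' (y : R) : y = 0 -> 0 <= y by move=> ->.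
 apply: (numbersP (e0 := e0) (k := 0)) => //;rewrite ?be0 ?be20 ?al0 ?al20.
 - by rewrite gt_eqF // isqrt_gt0.
 - by rewrite isqrt_sqr //;field.
 - by ring.
 - by ring.
 - by rewrite /e0;move: (p_ga x _) (p_ga2 x _ _) g0 => g h g0;field.
 - by apply: hz';ring.
 - by apply: hz';ring.
 - by apply: hz => //;ring.
 - by apply: hz (sqr_ge0 _);ring.
 - by apply: hz (sqr_ge0 _);ring.
have twelve : 12 <= 12 :> R by [].
rewrite FE;split.
 exact: (cone_nice Qs sa sb sc a_d db dc x0 a0 c0).
exact: (cone_snn Qs sa sb sc a_d a1_d db db dc dc1 x0 c0 (sphere_curved twelve x0) nm).
Qed.

End Neck.

(** * Interpolation between the heights of two ends *)

Section NeckProfile.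
Context {R : realType}.
Variables (k1 e1 k2 e2 : R).
Hypotheses (k10 : 0 < k1) (e10 : 0 < e1) (k20 : 0 < k2) (e20 : 0 < e2).

(** The height of a rounded end as a function of the squared radius [t], where [e] records the
    rescaling made in [model_end]. *)
Definition endf (k e t : R) : R := expR (k / (1+e * t)).
(** Lowers the first end below the second one turned upside down, so that switching from the second
    to the first also goes downwards. *)
Definition neck_cst : R := expR k1+expR k2.
(** It is 1 up to [2 / 3] and 0 from [3 / 2] on, an interval symmetric under the inversion of
    [t]. *)
Definition switch (t : R) : R := bump (5^-1 + 6 / 5 * t).
Definition neckf (t : R) : R :=
 (1 - switch t)*(endf k1 e1 t - neck_cst) + - switch t*endf k2 e2 t^-1.

Let oP : open [set t : R | 0 < t]. Proof. exact: open_gt. Qed.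

Let den_gt0 (e t : R) : 0 < e -> 0 < t -> 0 < 1+e * t.
by move=> h1 h2;rewrite addr_gt0 // mulr_gt0. Qed.

Let endf_le (k e t : R) : 0 < k -> 0 < e -> 0 < t -> endf k e t <= expR k.
move=> h1 h2 h3;rewrite ler_expR ler_pdivrMr ?den_gt0 // ler_peMr ?(ltW h1) //.
by rewrite lerDl mulr_ge0 // ltW.
Qed.

Let endf_d (k e t : R) : 0 < k -> 0 < e -> 0 < t -> exists2 d, d < 0 & is_der t (endf k e) d.
move=> h1 h2 h3;have d0 := den_gt0 h2 h3.
have u := derD (is_derive_cst (1 : R) t (1 : R)) (derZ e (is_derive_id t (1 : R))).
have d0' : cst 1 t+e * id t != 0 by rewrite gt_eqF.
have h := der_comp (is_derive_expR _) (derZ k (derV (g := fun s : R => cst 1 s+e * id s) d0' u)).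
eexists;last exact: h.
rewrite /= add0r mulr1 pmulr_rlt0 ?expR_gt0 // pmulr_rlt0 // pmulr_llt0 // oppr_lt0 invr_gt0.
by rewrite exprn_gt0.
Qed.

Let smooth_endf k e : 0 < e -> smooth1 [set t : R | 0 < t] (endf k e).
move=> h2;have s1 : smooth1 [set t : R | 0 < t] (fun t => 1+e * t).
 by apply: (smooth1D oP);[exact: smooth1_cst|apply: (smooth1M oP);[exact: smooth1_cst|exact: smooth1_id]].
have s2 : smooth1 [set t : R | 0 < t] (fun t => (1+e * t)^-1).
 by apply: (smooth1_comp oP s1 smooth1_inv) => t t0;rewrite /= gt_eqF // den_gt0.
exact: (smooth1_comp oP s2 (smooth1_expR setT k)).
Qed.

Let smooth_switch : smooth1 [set t : R | 0 < t] switch.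
have oU : open [set y : 'rV[R]_1 | 0 < y 0 0].
 by apply: open_comp oP => y _;exact: continuous_coord.
apply: (smooth1_row oP);apply: (smooth_bump oU).
by apply: (smoothD oU);[exact: smooth_cst|apply: (smoothZ oU);exact: smooth_on_coord].
Qed.
Let switch_d (t : R) : exists2 d, d <= 0 & is_der t switch d.
have [d [d0 _] hd] := bump_is_derive (5^-1 + 6 / 5 * t).
have u := derD (is_derive_cst (5^-1 : R) t (1 : R)) (derZ (6 / 5) (is_derive_id t (1 : R))).
exists (d*(0 + 6 / 5 * 1));last exact: (der_comp (f := bump) (g := fun s : R => 5^-1 + 6 / 5*s) hd u).
by rewrite add0r mulr1;lra.
Qed.

Lemma smooth_neckf : smooth1 [set t : R | 0 < t] neckf.
have s1 : smooth1 [set t : R | 0 < t] (fun t => - switch t).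
 rewrite (_ : (fun _ => _) = fun t => -1*switch t);last by apply/funext => t;rewrite mulN1r.
 by apply: (smooth1M oP) => //;exact: smooth1_cst.
have s2 : smooth1 [set t : R | 0 < t] (fun t => t^-1).
 by apply: (smooth1_comp oP (smooth1_id oP) smooth1_inv) => t t0;rewrite /= gt_eqF.
have s3 : smooth1 [set t : R | 0 < t] (fun t => endf k2 e2 t^-1).
 by apply: (smooth1_comp oP s2 (smooth_endf k2 e20)) => t t0;rewrite /= invr_gt0.
apply: (smooth1D oP);last by apply: (smooth1M oP).
apply: (smooth1M oP);apply: (smooth1D oP) => //;first exact: smooth1_cst.
 exact: smooth_endf.
exact: smooth1_cst.
Qed.

(** Both branches decrease strictly, the switch decreases, and the branch it leaves lies above the
    branch it enters by the choice of [neck_cst]; hence the derivative is negative. *)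
Lemma neckf_d (t : R) : 0 < t -> exists2 d : R, d != 0 & is_der t neckf d.
move=> t0;have [b b0 hb] := switch_d t.
have [d1 d10 hd1] := endf_d k10 e10 t0.
have ti : 0 < t^-1 by rewrite invr_gt0.
have t0' : t != 0 by rewrite gt_eqF.
have [d2 d20 hd2] := endf_d k20 e20 ti.
have hi := derV (g := id) t0' (is_derive_id t (1 : R)).
have h2 := der_comp (f := endf k2 e2) hd2 hi.
have hN := derZ (-1) hb.
have h := derD (derM (derD (is_derive_cst (1 : R) t (1 : R)) hN)
 (derD hd1 (is_derive_cst (- neck_cst) t (1 : R)))) (derM hN h2).
have E : neckf = fun s => (cst 1 s + -1*switch s)*(endf k1 e1 s+cst (- neck_cst) s) +
  (-1*switch s)*endf k2 e2 s^-1.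
 by apply/funext => s;rewrite /neckf mulN1r.
rewrite E;eexists;last exact: h.
rewrite /= mulN1r addr0 add0r mulN1r mulr1.
have B0 : 0 <= switch t by exact: bump_ge0.
have B1 : switch t <= 1 by exact: bump_le1.
have f1 := endf_le k10 e10 t0;have f2 := endf_le k20 e20 ti.
have z0 : 0 < t ^- 2 by rewrite invr_gt0 exprn_gt0.
rewrite lt_eqF // /neck_cst.
move: (t ^- 2) (switch t) (endf k1 e1 t) (endf k2 e2 t^-1) (expR k1) (expR k2) z0 B0 B1 f1 f2 => z s y1 y2 x1 x2 z0 s0 s1 f1 f2.
have g1 : - b*(y1 - (x1+x2)+y2) <= 0 by rewrite mulr_ge0_le0 // ?oppr_ge0 //;lra.
have g2 : (1 - s)*d1 <= 0 by rewrite mulr_ge0_le0 ?subr_ge0 // ltW.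
have dz : d2*z < 0 by rewrite nmulr_rlt0.
have g3 : s*(d2*z) <= 0 by rewrite mulr_ge0_le0 // ltW.
have g4 : (1 - s)*d1+s*(d2*z) < 0.
 have [hs|hs] := ltP s 1;first by apply: ltr_wnDr => //;rewrite pmulr_rlt0 // subr_gt0.
 by have -> : s = 1 by [apply/eqP;rewrite eq_le s1];rewrite subrr mul0r mul1r add0r.
rewrite (_ : _ + _ = - b*(y1 - (x1+x2)+y2)+((1 - s)*d1+s*(d2*z)));last by ring.
lra.
Qed.

Lemma neckf_left t : 3 / 2 <= t -> neckf t = endf k1 e1 t - neck_cst.
move=> h;rewrite /neckf /switch bump0;last by lra.
by rewrite subr0 mul1r oppr0 mul0r addr0.
Qed.

Lemma neckf_right t : t <= 2 / 3 -> neckf t = - endf k2 e2 t^-1.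
move=> h;rewrite /neckf /switch bump1;last by lra.
by rewrite subrr mul0r add0r mulN1r.
Qed.

End NeckProfile.

(** * Isometric embeddings into a common target *)

Section Extension.
Context {R : realType} {n m m' : nat}.
Variables (A : 'M[R]_(m, m')) (s : R).
Hypotheses (AA : A *m A^T = 1%:M) (ss : s*s = 1).

(** Moves the quadratic block to its own place in a larger space; [s = -1] turns the height of the
    second side upside down. *)
Definition ext_mx : 'M[R]_(n+(m + 1), n+(m' + 1)) := block_mx 1%:M 0 0 (block_mx A 0 0 s%:M).

Lemma ext_mxK : ext_mx *m ext_mx^T = 1%:M.
rewrite /ext_mx !tr_block_mx !mulmx_block !trmx0 !trmx1 !mulmx0 !mul0mx mulmx1 !addr0 !add0r AA.
by rewrite tr_scalar_mx -scalar_mxM ss -!scalar_mx_block.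
Qed.

Lemma pvec_ext (u : 'rV[R]_n) f c : pvec u f c *m ext_mx = pvec u (f *m A) (c*s).
rewrite /pvec /ext_mx !mul_row_block !mulmx0 mulmx1 !addr0 !add0r.
congr (row_mx _ (row_mx _ _));apply/rowP => j.
by rewrite mul_mx_scalar !mxE mulrC.
Qed.

End Extension.

(** * Gluing two rounded pieces *)

Section Glue.
Context {R : realType} {n : nat}.

(** All that the gluing must know about a piece. The range up to squared radius 4 leaves room for
    the neck on both sides of the unit sphere. *)
Definition rounded (M : manifold R n) (i : euclidean R n -> M) : Prop :=
 exists NQ (G : 'I_(n+(NQ + 1)) -> M -> R) (k e : R),
 [/\ 0 < k, 0 < e, forall p, p <> i (0 : 'rV[R]_n) -> lgood G p &
   forall x : 'rV[R]_n, 0 < sqnorm x < 4 ->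
   \row_a G a (i x) = pvec (isqrt (sqnorm x) *: x) 0 (endf k e (sqnorm x))].

Lemma open_away (M : manifold R n) (i : euclidean R n -> M) r : open_embedding setT i ->
 open (~` (i @` [set x : 'rV[R]_n | sqnorm x <= r])).
move=> [_ _ [ci _] _];apply: closed_openC.
apply: (compact_closed (@manifold_hausdorff _ _ M));apply: continuous_compact;last exact: compact_sqnorm_le.
by apply: continuous_subspaceT => x;apply: ci;rewrite inE.
Qed.

Lemma embedding_inverse_diffeo (M N : manifold R n) (A : set M) (j : M -> N) (g : N -> M) p :
 open A -> open (j @` A) -> smooth_map A j -> smooth_map (j @` A) g ->
 (forall q, A q -> g (j q) = q) -> A p -> ldiffeo g (j p).
move=> oA oj sj sg gK Ap.
apply: (local_diffeo_left_inverse oj oA _ _ sg sj);first by exists p.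
 by rewrite gK.
by move=> _ [q Aq <-];rewrite gK.
Qed.

Variables (M1 M2 M : manifold R n) (i1 : euclidean R n -> M1) (i2 : euclidean R n -> M2).
Variables (j1 : M1 -> M) (j2 : M2 -> M).
Let A1 := [set p | p <> i1 (0 : 'rV[R]_n)].
Let A2 := [set p | p <> i2 (0 : 'rV[R]_n)].
Hypotheses (e1 : open_embedding setT i1) (e2 : open_embedding setT i2).
Hypotheses (f1 : open_embedding A1 j1) (f2 : open_embedding A2 j2).
Hypothesis cov : j1 @` A1 `|` j2 @` A2 = setT.
Hypothesis glue : forall p q, A1 p -> A2 q -> (j1 p = j2 q <-> exists2 x : 'rV[R]_n, x <> 0 &
      p = i1 x /\ q = i2 ((sqnorm x)^-1 *: x)).

(** The direction [x / |x|] does not change under the gluing inversion, so on the overlap the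
    immersions of the two sides and of the neck can differ only in their height, and there [neckf]
    agrees with each of them. *)
Lemma glue_good : rounded i1 -> rounded i2 ->
 exists (L : finType) (G : L -> M -> R), forall p, good G p.
move=> [N1 [G1 [k1 [c1 [k10 c10 good1 end1]]]]] [N2 [G2 [k2 [c2 [k20 c20 good2 end2]]]]].
(* The middle blocks of the two sides and of the neck are placed in orthogonal summands; on the
   overlaps all of them are zero. *)
pose B1 : 'M[R]_(N1, N1+N2 + 1) := row_mx (row_mx 1%:M 0) 0.
pose B2 : 'M[R]_(N2, N1+N2 + 1) := row_mx (row_mx 0 1%:M) 0.
pose B3 : 'M[R]_(1, N1+N2 + 1) := row_mx 0 1%:M.
have BB1 : B1 *m B1^T = 1%:M by rewrite /B1 !tr_row_mx !mul_row_col !trmx0 trmx1 mulmx1 !mulmx0 !addr0.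
have BB2 : B2 *m B2^T = 1%:M.
 by rewrite /B2 !tr_row_mx !mul_row_col !trmx0 trmx1 mulmx1 !mulmx0 addr0 add0r.
have BB3 : B3 *m B3^T = 1%:M by rewrite /B3 !tr_row_mx !mul_row_col !trmx0 trmx1 mulmx1 !mulmx0 add0r.
have one1 : 1 * 1 = 1 :> R by rewrite mulr1.
have one2 : -1 * -1 = 1 :> R by rewrite mulrNN mulr1.
pose l := neckf k1 c1 k2 c2;pose C := neck_cst k1 k2.
pose F3 (a : 'I_(n+(1 + 1))) (y : 'rV[R]_n) := pvec (isqrt (sqnorm y) *: y) (0 : 'rV[R]_1) (l (sqnorm y)) 0 a.
pose H1 a p := (pvec 0 0 (- C)+(\row_b G1 b p) *m ext_mx B1 1) 0 a.
pose H2 a p := (0+(\row_b G2 b p) *m ext_mx B2 (-1)) 0 a.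
pose H3 a (x : 'rV[R]_n) := (0+(\row_b F3 b x) *m ext_mx B3 1) 0 a.
have l1 p : A1 p -> lgood H1 p.
 by move=> Ap;apply: (lgood_affine _ (ext_mxK BB1 one1));exact: good1.
have l2 p : A2 p -> lgood H2 p.
 by move=> Ap;apply: (lgood_affine _ (ext_mxK BB2 one2));exact: good2.
have l3 (x : 'rV[R]_n) : 0 < sqnorm x -> lgood (M := euclidean R n) H3 x.
 move=> x0;apply: (lgood_affine (M := euclidean R n) (G := F3) _ (ext_mxK BB3 one1)).
 have [h1 h2] := neck_good (smooth_neckf k1 k2 c10 c20) (neckf_d k10 c10 k20 c20) x0.
 exact: lgood_euclidean.
have row3 (x : 'rV[R]_n) : \row_b F3 b x = pvec (isqrt (sqnorm x) *: x) 0 (l (sqnorm x)).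
 by apply/rowP => b;rewrite mxE.
have H13 a (x : 'rV[R]_n) : 3 / 2 <= sqnorm x -> sqnorm x < 4 -> H1 a (i1 x) = H3 a x.
 move=> h1 h2;rewrite /H1 /H3 end1;last by rewrite h2 andbT;lra.
 by rewrite row3 !pvec_ext !mul0mx pvecD !mulr1 !add0r /l neckf_left // addrC.
have H23 a (x : 'rV[R]_n) : 4^-1 < sqnorm x -> sqnorm x <= 2 / 3 ->
  H2 a (i2 ((sqnorm x)^-1 *: x)) = H3 a x.
 move=> h1 h2;have x0 : 0 < sqnorm x by lra.
 have sE : sqnorm ((sqnorm x)^-1 *: x) = (sqnorm x)^-1.
  by rewrite sqnormZ expr2 -mulrA mulVf ?mulr1 // gt_eqF.
 rewrite /H2 /H3 end2 ?sE;last first.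
  by rewrite invr_gt0 x0 -[ltRHS]invrK ltf_pV2 ?posrE // invr_gt0.
 rewrite row3 !pvec_ext !mul0mx !add0r mulr1 mulrN1 /l neckf_right // scalerA.
 congr (pvec (_ *: _) _ _ 0 a).
 have z1 : 0 < isqrt (sqnorm x)^-1 by apply: isqrt_gt0;rewrite invr_gt0.
 have z2 : 0 < isqrt (sqnorm x) by exact: isqrt_gt0.
 have z : (isqrt (sqnorm x)^-1 / sqnorm x) ^+ 2 = isqrt (sqnorm x) ^+ 2.
  by rewrite exprMn !isqrt_sqr ?invr_gt0 // invrK;field;rewrite gt_eqF.
 apply/eqP;move/eqP: z;rewrite eqf_sqr => /orP[//|/eqP z].
 by have := divr_gt0 z1 x0;rewrite z oppr_gt0 ltNge ltW.
have [oA1 oj1 sj1 [g1 sg1 gK1]] := f1;have [oA2 oj2 sj2 [g2 sg2 gK2]] := f2.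
have [oT oi1 si1 [h1 sh1 hK1]] := e1.
have inj1 := embedding_inj e1;have inj2 := embedding_inj e2.
pose K1 := i1 @` [set x : 'rV[R]_n | sqnorm x <= 3 / 2].
pose K2 := i2 @` [set x : 'rV[R]_n | sqnorm x <= 3 / 2].
(* [W1] and [W2] are the parts beyond squared radius [3 / 2] on either side; they are disjoint, and
   what they leave out lies in the neck region between [1 / 2] and 2. *)
pose W1 : set M := j1 @` A1 `&` g1 @^-1` (~` K1).
pose W2 : set M := j2 @` A2 `&` g2 @^-1` (~` K2).
have oW1 : open W1 by apply: open_preim sg1.1 => //;exact: open_away.
have oW2 : open W2 by apply: open_preim sg2.1 => //;exact: open_away.
pose G a m := if `[< W1 m >] then H1 a (g1 m) else if `[< W2 m >] then H2 a (g2 m) else H3 a (h1 (g1 m)).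
have G_1 a m : W1 m -> G a m = H1 a (g1 m) by move=> Wm;rewrite /G asboolT.
have disj m : W1 m -> W2 m -> False.
 move=> [[p Ap <-] hp] [[q Aq jq] hq];have [x x0 [px qx]] := (glue Ap Aq).1 (esym jq).
 have r0 := sqnorm_gt0 x0.
 have a1 : 3 / 2 < sqnorm x.
  by rewrite ltNge;apply/negP => xr;apply: hp;rewrite gK1 // px;exists x.
 apply: hq;rewrite -jq gK2 // qx;exists ((sqnorm x)^-1 *: x) => //=.
 rewrite sqnormZ expr2 -mulrA mulVf ?mulr1 ?gt_eqF // -[leRHS]invrK lef_pV2 ?posrE ?invr_gt0 //;lra.
have G_2 a m : W2 m -> G a m = H2 a (g2 m).
 by move=> Wm;rewrite /G asboolF ?asboolT // => W1m;exact: disj W1m Wm.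
have ne1 (x : 'rV[R]_n) : x <> 0 -> A1 (i1 x) by move=> x0 /inj1.
have gne2 (x : 'rV[R]_n) : x <> 0 -> A2 (i2 ((sqnorm x)^-1 *: x)).
 move=> x0 /inj2 /eqP;rewrite scaler_eq0 invr_eq0 gt_eqF ?sqnorm_gt0 //= => /eqP;exact: x0.
have G_3 a (x : 'rV[R]_n) : x <> 0 -> 2^-1 < sqnorm x < 2 -> G a (j1 (i1 x)) = H3 a x.
 move=> x0 /andP[xl xr];have Ax := ne1 _ x0.
 have [Wx|nW1] := pselect (W1 (j1 (i1 x))).
  rewrite G_1 // gK1 // H13 //;last by lra.
  move: Wx => [_];rewrite /preimage /= gK1 // => hK;rewrite ltW // ltNge;apply/negP => h.
  by apply: hK;exists x.
 have [Wx|nW2] := pselect (W2 (j1 (i1 x))).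
  have Aq := gne2 _ x0;have E : j1 (i1 x) = j2 (i2 ((sqnorm x)^-1 *: x)) by apply/glue => //;exists x.
  rewrite G_2 // {1}E gK2 // H23 //;first by lra.
  move: Wx => [_];rewrite /preimage /= E gK2 // => hK;rewrite leNgt;apply/negP => h.
  apply: hK;exists ((sqnorm x)^-1 *: x) => //=.
  by rewrite sqnormZ expr2 -mulrA mulVf ?mulr1 ?gt_eqF ?sqnorm_gt0 // -[leRHS]invrK lef_pV2 ?posrE ?invr_gt0 ?sqnorm_gt0 //;lra.
 by rewrite /G !asboolF // gK1 // hK1.
exists _, G => m;apply: lgood_good.
have [W1m|nW1] := pselect (W1 m).
 apply: (lgood_near oW1 W1m G_1);have [[p Ap <-] _] := W1m.
 by apply: (lgood_comp (embedding_inverse_diffeo oA1 oj1 sj1 sg1 gK1 Ap));rewrite gK1 //;exact: l1.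
have [W2m|nW2] := pselect (W2 m).
 apply: (lgood_near oW2 W2m G_2);have [[p Ap <-] _] := W2m.
 by apply: (lgood_comp (embedding_inverse_diffeo oA2 oj2 sj2 sg2 gK2 Ap));rewrite gK2 //;exact: l2.
have [x [x0 xr mE]] : exists x : 'rV[R]_n, [/\ x <> 0, 2^-1 < sqnorm x < 2 & m = j1 (i1 x)].
 have bound2 (x : 'rV[R]_n) : x <> 0 -> m = j2 (i2 ((sqnorm x)^-1 *: x)) -> 2^-1 < sqnorm x.
  move=> x0 mE;rewrite ltNge;apply/negP => h;apply: nW2;split;first by exists (i2 ((sqnorm x)^-1 *: x)) => //;exact: gne2.
  rewrite /preimage /= mE gK2;last exact: gne2.
  move=> [y /= yr /inj2 yE];move: yr;rewrite yE sqnormZ expr2 -mulrA mulVf ?mulr1 ?gt_eqF ?sqnorm_gt0 //.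
  have : 2^-1^-1 <= (sqnorm x)^-1 by rewrite lef_pV2 ?posrE ?invr_gt0 ?sqnorm_gt0.
  rewrite invrK;lra.
 have bound1 (x : 'rV[R]_n) : x <> 0 -> m = j1 (i1 x) -> sqnorm x <= 3 / 2.
  move=> x0 mE;rewrite leNgt;apply/negP => h;apply: nW1;split;first by exists (i1 x) => //;exact: ne1.
  rewrite /preimage /= mE gK1;last exact: ne1.
  by move=> [y /= yr /inj1 yE];move: yr;rewrite yE;lra.
 have fin (x : 'rV[R]_n) : x <> 0 -> m = j1 (i1 x) -> exists x : 'rV[R]_n, [/\ x <> 0, 2^-1 < sqnorm x < 2 & m = j1 (i1 x)].
  move=> x0 mE;exists x;split=> //;have b1 := bound1 _ x0 mE.
  apply/andP;split;last by lra.
  by apply: (bound2 _ x0);rewrite mE;apply/glue;[exact: ne1|exact: gne2|exists x].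
 have : (j1 @` A1 `|` j2 @` A2) m by rewrite cov.
 case=> [[p Ap pm]|[q Aq qm]].
  have [[x _ px]|ip] := pselect ((i1 @` setT) p).
   by apply: (fin x);[move=> x0;apply: Ap;rewrite -px x0|rewrite px].
  case: nW1;split;first by exists p.
  by rewrite /preimage /= -pm gK1 // => -[x _ px];apply: ip;exists x.
 have [[y _ qy]|iq] := pselect ((i2 @` setT) q);last first.
  case: nW2;split;first by exists q.
  by rewrite /preimage /= -qm gK2 // => -[x _ px];apply: iq;exists x.
 have y0 : y <> 0 by move=> y0;apply: Aq;rewrite -qy y0.
 have r0 := sqnorm_gt0 y0.
 have x0 : (sqnorm y)^-1 *: y <> 0.
  by move/eqP;rewrite scaler_eq0 invr_eq0 gt_eqF //= => /eqP;exact: y0.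
 apply: (fin _ x0);rewrite -qm;apply/esym/glue => //;first exact: ne1.
 exists ((sqnorm y)^-1 *: y) => //;split=> //;rewrite -qy;congr (i2 _).
 by rewrite sqnormZ scalerA expr2 -mulrA mulVf ?gt_eqF // mulr1 invrK divff ?gt_eqF // scale1r.
pose NK0 : set M := j1 @` A1 `&` g1 @^-1` (i1 @` setT).
have oNK0 : open NK0 by apply: open_preim sg1.1.
have sNK : smooth_map NK0 (fun q => h1 (g1 q)).
 apply: (smooth_map_comp oNK0 oi1 _ sh1 (fun y Vy => Vy.2)).
 by apply: smooth_mapW sg1 => q [].
pose NK : set M := NK0 `&` (fun q => h1 (g1 q)) @^-1` [set x : 'rV[R]_n | 2^-1 < sqnorm x < 2].
have oNK : open NK.
 apply: (open_preim (N := euclidean R n) oNK0 _ sNK.1).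
 have -> : [set x : 'rV[R]_n | 2^-1 < sqnorm x < 2] =
   [set x : 'rV[R]_n | 2^-1 < sqnorm x] `&` [set x : 'rV[R]_n | sqnorm x < 2].
  by apply/seteqP;split=> z /= => [/andP|/andP].
 apply: openI;[exact: open_sqnorm_gt|exact: open_sqnorm_lt].
have Ax := ne1 _ x0.
have NKm : NK m.
 by rewrite mE;split;[split;[exists (i1 x)|rewrite /preimage /= gK1 //;exists x]|rewrite /preimage /= gK1 // hK1].
have G_n a q : NK q -> G a q = H3 a (h1 (g1 q)).
 move=> [[[p Ap <-]]];rewrite /preimage /= gK1 // => -[y _ py];rewrite -py hK1 // => yr.
 by apply: G_3 yr => y0;apply: Ap;rewrite -py y0.
apply: (lgood_near oNK NKm G_n);rewrite mE.
have hx : h1 (g1 (j1 (i1 x))) = x by rewrite gK1 // hK1.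
apply: (lgood_comp (f := fun q => h1 (g1 q)) (G := H3));last by rewrite hx;apply: l3;exact: sqnorm_gt0.
apply: (local_diffeo_comp (f := g1) (g := h1)).
 exact: embedding_inverse_diffeo oA1 oj1 sj1 sg1 gK1 Ax.
rewrite gK1 //;exact: embedding_inverse_diffeo oT oi1 si1 sh1 hK1 I.
Qed.

End Glue.

Lemma model_rounded {R : realType} {n N NQ : nat} {J : Type} (Qm : 'I_NQ -> 'M[R]_n)
  (X : set 'rV[R]_N) S t Rm (r : J -> 'rV[R]_N) (K : R) (M : manifold R n) (i1 : euclidean R n -> M) :
 (forall l, (Qm l)^T = Qm l) -> 0 <= K ->
 (forall j w, X (psi Qm Rm r j w)) ->
 (forall j w, aff S t j (psi Qm Rm r j w) = cellh Qm w) ->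
 (forall j v, X v -> v = r j+aff S t j v *m Rm j) ->
 (forall j v, X v -> ppart (aff S t j v) != 0 -> exists w, v = psi Qm Rm r j w) ->
 (forall v, X v -> exists j, ppart (aff S t j v) != 0) ->
 (forall j l (w : 'rV[R]_n) (U : set 'rV[R]_n), open U -> U w ->
  exists w' u, [/\ U w', psi Qm Rm r l w' = psi Qm Rm r j u & punct u -> curved Qm K u]) ->
 (0 < n)%N -> @diffeomorphic_to_subset R n N M X -> open_embedding setT i1 -> rounded i1.
move=> Qs K0 h1 h2 h3 h4 h5 h6 n0 [f [sf rf hf]] emb.
have [kap kap0 nums] := profile_numbers K0.
have kap0' : kap != 0 by rewrite gt_eqF.
have [G [eps [e0 lG rG]]] := model_end Qs h1 h2 h3 h4 h5 h6 kap0' (nums n) n0 sf rf hf emb.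
by exists NQ, G, kap, eps.
Qed.

(** * Generic points of cells *)

Section Generic.
Context {R : realType}.

Lemma avoid_finite (s : seq R) (e : R) : 0 < e -> exists2 d, 0 < d & forall c, 0 < c < d -> c < e /\ c \notin s.
move=> e0;elim: s => [|x s [d d0 H]];first by exists e => // c /andP[_ ?].
exists (if 0 < x then Num.min d x else d);first by case: ifP => // x0;rewrite lt_min d0.
move=> c /andP[c0];case: ifP => x0.
 rewrite lt_min => /andP[cd cx];have [|h1 h2] := H c;first by rewrite c0.
 by rewrite in_cons (lt_eqF cx).
move=> cd;have [|h1 h2] := H c;first by rewrite c0.
by split=> //;rewrite in_cons negb_or h2 andbT;apply: contraFneq x0 => <-.
Qed.

Lemma generic_translate n (w d : 'rV[R]_n) (U : set 'rV[R]_n) (s : seq R) : open U -> U w ->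
 exists2 c, c \notin s & U (w+c *: d).
move=> oU Uw;have [e e0 He] := nbhs_sqnorm (open_nbhs_nbhs (conj oU Uw)).
have q0 : 0 < 1+sqnorm d by rewrite ltr_wpDr // sqnorm_ge0.
pose e' := Num.min 1 (e / (1+sqnorm d)).
have e'0 : 0 < e' by rewrite lt_min ltr01 divr_gt0.
have [b b0 Hb] := avoid_finite s e'0.
have [|ce cs] := Hb (b / 2);first by lra.
exists (b / 2) => //;apply: He;rewrite addrAC subrr add0r sqnormZ.
move: ce;rewrite lt_min ltr_pdivlMr // => /andP[c1 c2].
have c0 : 0 < b / 2 by lra.
apply: le_lt_trans c2;rewrite expr2 -mulrA;apply: ler_pM => //;first exact: ltW.
- by rewrite mulr_ge0 ?sqnorm_ge0 // ltW.
- by apply: le_trans (_ : sqnorm d <= _);[rewrite ler_piMl ?sqnorm_ge0 // ltW|lra].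
Qed.

End Generic.

(** * The sphere as a model with two stereographic cells *)

Section Sphere.
Context {R : realType} {n : nat}.
Implicit Types (v : 'rV[R]_n.+1) (w : 'rV[R]_n) (j : bool).

Definition tail v : 'rV[R]_n := \row_k v 0 (lift 0 k).
Definition rcons0 (a : R) w : 'rV[R]_n.+1 := \row_i (if unlift 0 i is Some k then w 0 k else a).

Lemma rcons0_head a w : rcons0 a w 0 0 = a. Proof. by rewrite mxE unlift_none. Qed.
Lemma rcons0_tail a w : tail (rcons0 a w) = w. Proof. by apply/rowP => k;rewrite !mxE liftK. Qed.
Lemma rcons0P v : v = rcons0 (v 0 0) (tail v).
by apply/rowP => i;rewrite mxE;case: unliftP => [k ->|->];rewrite ?mxE. Qed.
Lemma rcons0D a b w w' : rcons0 a w+rcons0 b w' = rcons0 (a+b) (w+w').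
by apply/rowP => i;rewrite !mxE;case: unliftP => [k _|_];rewrite ?mxE. Qed.
Lemma rcons0Z (c : R) a w : c *: rcons0 a w = rcons0 (c*a) (c *: w).
by apply/rowP => i;rewrite !mxE;case: unliftP => [k _|_];rewrite ?mxE. Qed.
Lemma sqnorm_tail v : sqnorm v = v 0 0 ^+ 2+sqnorm (tail v).
by rewrite /sqnorm big_ord_recl;congr (_ + _);eqsum k;rewrite mxE. Qed.
Lemma tailD v v' : tail (v+v') = tail v+tail v'.
by apply/rowP => k;rewrite !mxE. Qed.
Lemma tailZ (c : R) v : tail (c *: v) = c *: tail v.
by apply/rowP => k;rewrite !mxE. Qed.

Let sg j : R := (-1) ^+ j.
Let sgsg j : sg j*sg j = 1. Proof. by rewrite -expr2 sqrr_sign. Qed.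

Let sg_mul j l : sg j*sg l = 1 \/ sg j*sg l = -1.
by rewrite /sg;case: j;case: l;rewrite ?expr1 ?expr0 ?mulr1 ?mul1r ?mulrNN ?mulr1;[left|right|right|left]. Qed.

Let Tl j v : 'rV[R]_(n+(1 + 1)) :=
 pvec (2^-1 *: tail v) (const_mx (- (sg j / 2*v 0 0))) (sg j / 2*v 0 0).
Let St j : 'M[R]_(n.+1, n+(1 + 1)) := lmat (Tl j).
Let tt j : 'rV[R]_(n+(1 + 1)) := pvec 0 (const_mx 2^-1) 2^-1.
Let Rl j (y : 'rV[R]_(n+(1 + 1))) := rcons0 (2*sg j * ppart y) (2 *: Lpart y).
Let Rt j : 'M[R]_(n+(1 + 1), n.+1) := lmat (Rl j).
Let rt j := rcons0 (- sg j) 0.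

Let affE j v : aff St tt j v =
 pvec (2^-1 *: tail v) (const_mx (2^-1 - sg j / 2*v 0 0)) (2^-1+sg j / 2*v 0 0).
rewrite /aff lmatE => [|x y|a x];rewrite /Tl.
- by rewrite /tt pvecD add0r;congr pvec;apply/rowP => i;rewrite !mxE.
- rewrite pvecD tailD scalerDr mxE mulrDr;congr pvec;apply/rowP => i;rewrite !mxE;ring.
- rewrite pvecZ tailZ !scalerA mxE [a * 2^-1]mulrC;congr pvec;first by apply/rowP => i;rewrite !mxE;ring.
 ring.
Qed.

Let RE j y : y *m Rt j = Rl j y.
rewrite lmatE // => [x z|a x];rewrite /Rl /ppart /Lpart.
- by rewrite rcons0D linearD scalerDr mxE mulrDr.
- by rewrite rcons0Z linearZ /= !scalerA mxE [a * 2]mulrC;congr rcons0;ring.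
Qed.

Let psiE j w : psi (@sphereQ R n) Rt rt j w = rcons0 (sg j*(2 * invP w - 1)) ((2 * invP w) *: w).
rewrite /psi RE /Rl ppart_cellh Lpart_cellh rcons0D add0r scalerA;congr rcons0;ring.
Qed.

Let cellhE w : cellh (@sphereQ R n) w = pvec (invP w *: w) (const_mx (invP w*sqnorm w)) (invP w).
by rewrite /cellh sphereQ_quad dotxx pvecZ mulr1;congr pvec;apply/rowP => i;rewrite !mxE.
Qed.

Let invPE w : invP w*(1+sqnorm w) = 1.
by rewrite /invP mulVf // gt_eqF // ltr_wpDr // sqnorm_ge0. Qed.

Lemma sphere_rounded (M : manifold R n) (i1 : euclidean R n -> M) : (0 < n)%N ->
 diffeomorphic_to_subset M (@unit_sphere R n) -> open_embedding setT i1 -> rounded i1.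
move=> n0 dM emb.
have cellE j (v : 'rV[R]_n.+1) : sqnorm v = 1 -> ppart (aff St tt j v) != 0 ->
  exists w, v = psi (@sphereQ R n) Rt rt j w.
 move=> v1;rewrite affE ppart_pvec;set p := 2^-1 + _ => p0.
 have t1 : sqnorm (tail v) = 4 * p*(1 - p).
  have := sgsg j;rewrite sqnorm_tail in v1;rewrite /p;move: (sg j) (v 0 0) v1 => s a v1 ss.
  have -> : sqnorm (tail v) = 1 - a ^+ 2 by lra.
  have -> : a ^+ 2 = (s*s)*a ^+ 2 by rewrite ss mul1r.
  by field.
 exists ((2 * p)^-1 *: tail v);rewrite psiE.
 have -> : invP ((2 * p)^-1 *: tail v) = p.
  rewrite /invP sqnormZ t1;apply: (mulIf (x := 1+(2 * p)^-1 ^+ 2*(4 * p*(1 - p)))).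
   by rewrite gt_eqF // -t1 ltr_wpDr // mulr_ge0 ?sqr_ge0 ?sqnorm_ge0.
  rewrite mulVf;first by field.
  by rewrite gt_eqF // -t1 ltr_wpDr // mulr_ge0 ?sqr_ge0 ?sqnorm_ge0.
 rewrite scalerA divff ?scale1r ?mulf_neq0 ?pnatr_eq0 // {1}(rcons0P v);congr rcons0.
 have := sgsg j;rewrite /p;move: (sg j) (v 0 0) => s a ss.
 have {1}-> : a = (s*s)*a by rewrite ss mul1r.
 by field.
have twelve : 12 <= 12 :> R by [].
have K0 : 0 <= 12 :> R by [].
apply: (model_rounded (Qm := @sphereQ R n) (X := @unit_sphere R n) (S := St) (t := tt) (Rm := Rt) (r := rt) (K := 12)) => //.
- by move=> l;rewrite /sphereQ trmx1.
- move=> j w;rewrite /unit_sphere /= psiE sqnorm_tail rcons0_head rcons0_tail sqnormZ.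
 have := sgsg j;have := invPE w;move: (invP w) (sqnorm w) (sg j) => p y s py ss.
 have -> : (s*(2 * p - 1)) ^+ 2 = (s*s)*(2 * p - 1) ^+ 2 by ring.
 rewrite ss;have -> : y = (1 - p) * p^-1.
  have p0 : p != 0 by apply/eqP => h;move: py;rewrite h mul0r => /eqP;rewrite eq_sym oner_eq0.
  apply: (mulfI p0);rewrite mulrCA mulfV // mulr1;lra.
 by field;apply/eqP => h;move: py;rewrite h mul0r => /eqP;rewrite eq_sym oner_eq0.
- move=> j w;rewrite affE psiE rcons0_tail rcons0_head cellhE scalerA.
 have := sgsg j;have := invPE w;move: (invP w) (sqnorm w) (sg j) => p y s py ss.
 have E : s / 2*(s*(2 * p - 1)) = (2 * p - 1) / 2.
  by transitivity ((s*s)*((2 * p - 1) / 2));[field|rewrite ss mul1r].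
 rewrite E;congr pvec;[congr (_ *: _);by field| |by field].
 by apply/rowP => i;rewrite !mxE;have -> : p*y = 1 - p by [lra];field.
- move=> j v _;rewrite affE RE /Rl ppart_pvec Lpart_pvec /rt rcons0D add0r scalerA divff ?pnatr_eq0 // scale1r.
 rewrite {1}(rcons0P v);congr rcons0;have := sgsg j;move: (sg j) (v 0 0) => s a ss.
 have {1}-> : a = (s*s)*a by rewrite ss mul1r.
 by field.
- move=> v _;have [h|h] := eqVneq (ppart (aff St tt true v)) 0;last by exists true.
 exists false;move: h;rewrite !affE !ppart_pvec /sg expr1 expr0 => h.
 by apply/eqP => h';lra.
move=> j l w U oU Uw.
pose i0 : 'I_n := Ordinal n0.
(* An arbitrarily small translate is nonzero; the corresponding point is then neither pole and lies
   in both cells. *)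
have [c cs Uc] := generic_translate (delta_mx 0 i0) [:: - w 0 i0] oU Uw.
set w' := w+c *: delta_mx 0 i0 in Uc.
have w'0 : 0 < sqnorm w'.
 apply: sqnorm_gt0 => /rowP/(_ i0);rewrite !mxE !eqxx mulr1 => h.
 by move: cs;rewrite inE;case/negP;apply/eqP;lra.
have P1 := invP_itv w'0.
have v1 : sqnorm (psi (@sphereQ R n) Rt rt l w') = 1.
 rewrite psiE sqnorm_tail rcons0_head rcons0_tail sqnormZ.
 have := sgsg l;have := invPE w';move: (invP w') (sqnorm w') (sg l) => p y s py ss.
 have p0 : p != 0 by apply/eqP => h;move: py;rewrite h mul0r => /eqP;rewrite eq_sym oner_eq0.
 have -> : (s*(2 * p - 1)) ^+ 2 = (s*s)*(2 * p - 1) ^+ 2 by ring.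
 rewrite ss;have -> : y = (1 - p) * p^-1 by apply: (mulfI p0);rewrite mulrCA mulfV // mulr1;lra.
 by field.
have [|u E] := cellE j _ v1.
 rewrite affE ppart_pvec psiE rcons0_head;move: P1 => /andP[].
 have h := sg_mul j l.
 move: (invP w') (sg j) (sg l) h => p s s' h q1 q2;apply/eqP.
 have -> : s / 2*(s'*(2 * p - 1)) = (s*s')*((2 * p - 1) / 2) by field.
 case: h => ->;lra.
by exists w', u;split=> // u0;exact: sphere_curved.
Qed.

End Sphere.

(** * Projective spaces and the Cayley plane as models *)

Section Projective.
Context {R : realType} {k m : nat}.
Local Notation A := 'rV[R]_(cd_dim k).
Local Notation n := (m*cd_dim k)%N.
Local Notation N := (m.+1 * m.+1*cd_dim k)%N.
Local Notation D := (n+(m * m*cd_dim k + 1))%N.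
Local Notation mul := cd_mul.
Local Notation conj := cd_conj.
Local Notation one := (cd_one k : A).
Implicit Types (v : 'rV[R]_N) (w u : 'rV[R]_n) (j i l : 'I_m.+1) (a b : 'I_m).
Hypothesis Nm : @cnorm R k.

Section Idempotent.
Variable v : 'rV[R]_N.
Hypothesis Xv : @projective_space R k m v.
Local Notation P := (entry v).
Let pr i : R := dot (P i i) one.

Lemma idem_herm i l : P l i = conj (P i l).
by have [h _ _] := Xv;exact: h. Qed.

Lemma idem_mul i l : \sum_q mul (P i q) (P q l) = P i l.
by have [_ h _] := Xv;exact: h. Qed.

Lemma idem_trace : \sum_i pr i = 1.
have [_ _ h] := Xv;have := congr1 (fun z : A => dot z one) h.
by rewrite /= (dotxx one) sqnorm_one dotC dot_sumr => <-;eqsum i;rewrite dotC.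
Qed.

Lemma idem_diag i : P i i = pr i *: one.
have h := cconjE1 (P i i);rewrite -idem_herm in h.
apply/rowP => q;have := congr1 (fun z : A => z 0 q) h;rewrite /= !mxE -/(pr i).
move: (P i i 0 q) (pr i) (one 0 q) => x y z;lra.
Qed.

Lemma idem_sqnorm i : \sum_l sqnorm (P i l) = pr i.
rewrite /pr -(idem_mul i i) dotC dot_sumr;eqsum l.
by rewrite (idem_herm i l) (cmulVr Nm) dotZr dotxx sqnorm_one mulr1.
Qed.

Lemma idem_ge0 i : 0 <= pr i.
by rewrite -idem_sqnorm sumr_ge0 // => l _;exact: sqnorm_ge0. Qed.

Let sqnormB (x y : A) : sqnorm (x - y) = sqnorm x - 2*dot x y+sqnorm y.
by rewrite -!dotxx dotDl !dotDr !dotNl !dotNr (dotC y x);ring. Qed.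

Lemma idem_defect i j : \sum_l sqnorm (pr j *: P i l - mul (P i j) (P j l)) =
 pr j*(pr i * pr j - sqnorm (P i j)).
transitivity (pr j ^+ 2*(\sum_l sqnorm (P i l)) - 2 * pr j*dot (P i j) (\sum_l mul (P i l) (P l j))
 +sqnorm (P i j) * \sum_l sqnorm (P j l)).
 move: (pr j) => c;rewrite dot_sumr !mulr_sumr -sumrB -big_split;eqsum l => /=.
 rewrite sqnormB sqnormZ Nm dotZl (dotC (P i l)) (cdot_mulr (P i j)) -idem_herm.
 ring.
by rewrite idem_mul !idem_sqnorm dotxx;ring.
Qed.

(** By [idem_defect] each difference of the two sides has one sign, and the differences sum to
    [1 - 1]. This reaches the rank one property without associativity, so it covers the
    octonions. *)
Lemma idem_minor i j : sqnorm (P i j) = pr i * pr j.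
have le i' j' : 0 <= pr i' * pr j' - sqnorm (P i' j').
 have [p0|p0] := eqVneq (pr j') 0.
  have h : sqnorm (P j' i') <= pr j'.
   by rewrite -idem_sqnorm (bigD1 i') //= lerDl sumr_ge0 // => l _;exact: sqnorm_ge0.
  by rewrite p0 mulr0 sub0r oppr_ge0 idem_herm (csqnorm_conj) -p0.
 have pp : 0 < pr j' by rewrite lt_neqAle eq_sym p0 idem_ge0.
 by rewrite -(pmulr_rge0 _ pp) -idem_defect sumr_ge0 // => l _;exact: sqnorm_ge0.
have S0 : \sum_i \sum_j (pr i * pr j - sqnorm (P i j)) = 0.
 under eq_bigr => i' _ do rewrite sumrB -mulr_sumr idem_trace idem_sqnorm mulr1 subrr.
 by rewrite big1.
have /eqP := S0;rewrite psumr_eq0 => [/allP/(_ i)|i' _];last by rewrite sumr_ge0.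
rewrite mem_index_enum => /(_ isT);rewrite psumr_eq0 // => /allP/(_ j).
by rewrite mem_index_enum => /(_ isT);rewrite subr_eq0 => /eqP.
Qed.

(** Once the minors vanish, so does the sum of squares in [idem_defect]; each entry is thereby
    recovered from a single row and column. *)
Lemma idem_rank1 i j l : pr j *: P i l = mul (P i j) (P j l).
have /eqP := idem_defect i j;rewrite idem_minor subrr mulr0 psumr_eq0 => [|? _];last exact: sqnorm_ge0.
move=> /allP/(_ l);rewrite mem_index_enum => /(_ isT)/eqP/sqnorm_eq0/eqP.
by rewrite subr_eq0 => /eqP.
Qed.

End Idempotent.

Definition homog j w i : A := if unlift j i is Some a then blk w a else one.

Lemma homog_lift j w a : homog j w (lift j a) = blk w a. Proof. by rewrite /homog liftK. Qed.
Lemma homog_self j w : homog j w j = one. Proof. by rewrite /homog unlift_none. Qed.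

Lemma sum_homog j w : \sum_i sqnorm (homog j w i) = 1+sqnorm w.
rewrite (bigD1_ord j) //= homog_self sqnorm_one;congr (_ + _).
by rewrite -dotxx dot_blk;eqsum a;rewrite homog_lift dotxx.
Qed.

Let Tl j v : 'rV[R]_D := pvec (bvec (fun a => entry v (lift j a) j))
 (entries (fun a b => entry v (lift j a) (lift j b))) (dot (entry v j j) one).
Let St j : 'M[R]_(N, D) := lmat (Tl j).
Let tt j : 'rV[R]_D := 0.
Let Rl j (y : 'rV[R]_D) : 'rV[R]_N := entries (fun i l =>
 match unlift j i, unlift j l with
 | Some a, Some b => entry (Qpart y) a b
 | Some a, None => blk (Lpart y) a
 | None, Some b => conj (blk (Lpart y) b)
 | None, None => ppart y *: one
 end).
Let Rt j : 'M[R]_(D, N) := lmat (Rl j).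
Let rt j : 'rV[R]_N := 0.

Let affE j v : aff St tt j v = Tl j v.
rewrite /aff /tt add0r lmatE // => [x y|c x];rewrite /Tl.
- rewrite pvecD;congr pvec;last by rewrite entryD dotDl.
  by apply: blkP => a;rewrite blkD !blkK entryD.
 by apply: entryP => a b;rewrite entryD !entriesK entryD.
- rewrite pvecZ;congr pvec;last by rewrite entryZ dotZl.
  by apply: blkP => a;rewrite blkZ !blkK entryZ.
 by apply: entryP => a b;rewrite entryZ !entriesK entryZ.
Qed.

Let RE j y : y *m Rt j = Rl j y.
rewrite lmatE // => [x z|c x];apply: entryP => i l;rewrite /Rl /ppart /Lpart /Qpart.
- rewrite entryD !entriesK !linearD;case: unlift => [a|];case: unlift => [b|].
+by rewrite entryD.
+by rewrite blkD.
+by rewrite blkD cconjD.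
+by rewrite mxE scalerDl.
- rewrite entryZ !entriesK !linearZ /=;case: unlift => [a|];case: unlift => [b|].
+by rewrite entryZ.
+by rewrite blkZ.
+by rewrite blkZ cconjZ.
+by rewrite mxE scalerA.
Qed.

Let psiE j w i l : entry (psi (@projQ R k m) Rt rt j w) i l =
 invP w *: mul (homog j w i) (conj (homog j w l)).
rewrite /psi /rt add0r RE /Rl entriesK ppart_cellh Lpart_cellh /cellh pvecZ Qpart_pvec projQ_quad /homog.
case: unlift => [a|];case: unlift => [b|].
- rewrite entryZ entry_outer;by congr (_ *: _);apply/rowP => q;rewrite !mxE;field.
- by rewrite blkZ cconj1 cmul1r.
- by rewrite blkZ cconjZ cmul1l.
- by rewrite cconj1 cmul1l.
Qed.

(** The only triple product that idempotency of a normalized rank one matrix requires; isolating it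
    lets the associative and octonionic cases share the rest. *)
Hypothesis tri : forall (W : 'I_m.+1 -> A) j, W j = one -> forall i l q,
 mul (mul (W i) (conj (W l))) (mul (W l) (conj (W q))) = sqnorm (W l) *: mul (W i) (conj (W q)).

Let rho0 w : 0 < 1+sqnorm w. Proof. by rewrite ltr_wpDr // sqnorm_ge0. Qed.
Let psiX j w : @projective_space R k m (psi (@projQ R k m) Rt rt j w).
have eE i l : cd_entry (psi (@projQ R k m) Rt rt j w) i l = invP w *: mul (homog j w i) (conj (homog j w l)).
 exact: psiE.
split=> [i l|i q|].
- by rewrite !eE cconjZ cconjM cconjK.
- under eq_bigr do rewrite !eE cmulZl cmulZr (tri (homog_self j w)) !scalerA.
 rewrite -scaler_suml eE;congr (_ *: _);rewrite -mulr_sumr sum_homog /invP -mulrA mulVf ?mulr1 //.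
 by rewrite gt_eqF.
- under eq_bigr do rewrite eE (cmulVr Nm) scalerA.
 by rewrite -scaler_suml -mulr_sumr sum_homog /invP mulVf ?scale1r // gt_eqF.
Qed.

Let aff_psi j w : aff St tt j (psi (@projQ R k m) Rt rt j w) = cellh (@projQ R k m) w.
rewrite affE /Tl /cellh pvecZ projQ_quad;congr pvec.
- by apply: blkP => a;rewrite blkK psiE homog_lift homog_self cconj1 cmul1r blkZ.
- apply: entryP => a b;rewrite entriesK psiE !homog_lift entryZ entry_outer;congr (_ *: _).
 by apply/rowP => q;rewrite !mxE;field.
- by rewrite psiE homog_self cconj1 cmul1r dotZl dotxx sqnorm_one.
Qed.

Let X_aff j v : @projective_space R k m v -> v = rt j+aff St tt j v *m Rt j.
move=> Xv;rewrite affE RE /rt add0r;apply: entryP => i l;rewrite entriesK /Tl.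
rewrite Qpart_pvec Lpart_pvec ppart_pvec.
case: (unliftP j i) => [a ->|->];case: (unliftP j l) => [b ->|->].
- by rewrite entriesK.
- by rewrite blkK.
- by rewrite blkK -(idem_herm Xv).
- exact: idem_diag.
Qed.

Let X_cell j v : @projective_space R k m v -> ppart (aff St tt j v) != 0 ->
 exists w, v = psi (@projQ R k m) Rt rt j w.
move=> Xv;rewrite affE ppart_pvec => p0;pose p := dot (entry v j j) one;rewrite -/p in p0.
pose w : 'rV[R]_n := bvec (fun a => p^-1 *: entry v (lift j a) j);exists w.
have WE i : homog j w i = p^-1 *: entry v i j.
 case: (unliftP j i) => [a ->|->];first by rewrite homog_lift blkK.
 by rewrite homog_self (idem_diag Xv) scalerA mulVf // scale1r.
have iP : invP w = p.
 rewrite /invP -(sum_homog j) (eq_bigr (fun i => p^-1 ^+ 2*sqnorm (entry v j i))) => [|i _].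
  by rewrite -mulr_sumr (idem_sqnorm Xv) -/p expr2 -mulrA mulVf // mulr1 invrK.
 by rewrite WE sqnormZ (idem_herm Xv j i) (csqnorm_conj).
apply: entryP => i l;rewrite psiE !WE cconjZ cmulZl cmulZr -(idem_herm Xv) -(idem_rank1 Xv).
by rewrite !scalerA iP -/p divff // mul1r mulVf // scale1r.
Qed.

Let X_cover v : @projective_space R k m v -> exists j, ppart (aff St tt j v) != 0.
move=> Xv;apply: contrapT => h;have := idem_trace Xv;rewrite big1 => [/esym/eqP|j _];first by rewrite oner_eq0.
apply/eqP/negPn/negP => pj;apply: h;exists j;by rewrite affE ppart_pvec.
Qed.

Variable K : R.
Hypothesis K0 : 0 <= K.
Hypothesis Kc : forall u, punct u -> (forall a, blk u a <> 0) -> curved (@projQ R k m) K u.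

Let X_dense j l w (U : set 'rV[R]_n) : open U -> U w -> exists w' u,
 [/\ U w', psi (@projQ R k m) Rt rt l w' = psi (@projQ R k m) Rt rt j u &
   punct u -> curved (@projQ R k m) K u].
move=> oU Uw.
(* A generic translate has all homogeneous coordinates nonzero, so the point lies in every cell and
   has the nonzero blocks that [Kc] asks for. *)
have [c cs Uc] := generic_translate (bvec (fun=> one) : 'rV[R]_n)
 [seq - dot (blk w a) one | a <- enum 'I_m] oU Uw.
set w' := w + _ in Uc.
have W0 i : 0 < sqnorm (homog l w' i).
 case: (unliftP l i) => [a ->|->];last by rewrite homog_self sqnorm_one.
 apply: sqnorm_gt0;rewrite homog_lift /w' blkD blkZ blkK => h.
 have := congr1 (fun z : A => dot z one) h;rewrite /= dotDl dotZl (dotxx one) sqnorm_one mulr1 dot0l => h'.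
 move: cs;case/negP;apply/mapP;exists a;first by rewrite mem_enum.
 lra.
have P0 := invP_gt0 w'.
have e0 i q : 0 < sqnorm (entry (psi (@projQ R k m) Rt rt l w') i q).
 by rewrite psiE sqnormZ Nm (csqnorm_conj) !mulr_gt0 // exprn_gt0.
have [|u E] := X_cell (j := j) (psiX l w').
 rewrite affE ppart_pvec psiE (cmulVr Nm) !dotZl (dotxx one) sqnorm_one mulr1.
 by rewrite mulf_neq0 // gt_eqF.
exists w', u;split=> // u0;apply: Kc => // a ua.
have := e0 (lift j a) j;rewrite E psiE homog_lift ua cmul0l scaler0 sqnorm0 ltxx //.
Qed.

Lemma projective_rounded (M : manifold R n) (i1 : euclidean R n -> M) : (0 < n)%N ->
 diffeomorphic_to_subset M (@projective_space R k m) -> open_embedding setT i1 -> rounded i1.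
move=> n0 dM emb.
exact: (model_rounded (@projQ_sym R k m) K0 psiX aff_psi X_aff X_cell X_cover X_dense n0 dM emb).
Qed.

End Projective.

(** * Every compact rank one symmetric space is rounded *)

Section Roundings.
Context {R : realType}.

Lemma assoc_triple k m (W : 'I_m.+1 -> 'rV[R]_(cd_dim k)) : @cassoc R k -> @cnorm R k ->
 forall i l q, cd_mul (cd_mul (W i) (cd_conj (W l))) (cd_mul (W l) (cd_conj (W q))) =
  sqnorm (W l) *: cd_mul (W i) (cd_conj (W q)).
move=> As Nm i l q;rewrite As -(As (cd_conj (W l))) (cmulVl Nm) cmulZl cmul1l.
by rewrite cmulZr.
Qed.

Lemma ord3_cover (i l q j : 'I_3) : i != l -> l != q -> i != q -> [|| j == i, j == l | j == q].
by case: i => [[|[|[|//]]] ?];case: l => [[|[|[|//]]] ?];case: q => [[|[|[|//]]] ?];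
 case: j => [[|[|[|//]]] ?].
Qed.

(* By alternativity, associativity is only needed for three distinct entries,
 and then one of them is [1]. *)
Lemma plane_triple k (W : 'I_3 -> 'rV[R]_(cd_dim k)) j : @cnorm R k -> W j = cd_one k ->
 forall i l q, cd_mul (cd_mul (W i) (cd_conj (W l))) (cd_mul (W l) (cd_conj (W q))) =
  sqnorm (W l) *: cd_mul (W i) (cd_conj (W q)).
move=> Nm Wj i l q.
have [->|il] := eqVneq i l;first by rewrite (cmulVr Nm) cmulZl cmul1l.
have [->|lq] := eqVneq l q;first by rewrite (cmulVr Nm) cmulZr cmul1r.
have [->|iq] := eqVneq i q.
 have -> : cd_mul (W l) (cd_conj (W q)) = cd_conj (cd_mul (W q) (cd_conj (W l))).
  by rewrite cconjM cconjK.
 by rewrite !(cmulVr Nm) Nm (csqnorm_conj (W l)) scalerA mulrC.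
have /or3P[] := ord3_cover j il lq iq => /eqP E;rewrite -E Wj.
- by rewrite !cmul1l (cmulKl Nm).
- by rewrite cconj1 cmul1r cmul1l sqnorm_one scale1r.
- by rewrite cconj1 !cmul1r -{2}(cconjK (W l)) (cmulKr Nm) (csqnorm_conj (W l)).
Qed.

Lemma CROSS_rounded n (M : manifold R n) (i : euclidean R n -> M) : (0 < n)%N -> is_CROSS M ->
 open_embedding setT i -> rounded i.
move=> n0 [dM|[k [m [k2 nE dM]]]|[nE dM]] emb.
- exact: sphere_rounded dM emb.
- subst n;have [d [X [dE HX]]] := @imaginary_basis_ex R k.
 have k3 : (k <= 3)%N by exact: leq_trans k2 _.
 have Nm := @cnorm3 R k k3;have As := @cassoc2 R k k2.
 have d3 : (d <= 3)%N by rewrite -ltnS -dE;clear - k2;case: k k2 => [|[|[|]]].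
 have [K1 HK] := assoc_curved (m := m) As Nm HX d3.
 apply: (projective_rounded Nm _ (K := Num.max 0 K1) _ _ n0 dM emb).
+by move=> W j _;exact: assoc_triple.
+by rewrite le_max lexx.
+by move=> u u0 _;apply: HK => //;rewrite le_max lexx orbT.
have nE' : n = (2*cd_dim 3)%N by rewrite nE.
clear nE;subst n;have [d [X [dE HX]]] := @imaginary_basis_ex R 3.
have Nm := @cnorm3 R 3 isT.
have p8 : cd_dim 3 = 8 by [].
have K0 : 0 <= 1000 :> R by rewrite ler0n.
apply: (projective_rounded Nm _ (K := 1000) K0 _ n0 dM emb).
- by move=> W j Wj;exact: plane_triple Wj.
- by move=> u u0 ub;apply: (oct_curved Nm HX p8 (lexx _) u0);apply/eqP.
Qed.

End Roundings.

Theorem theoremA (R : realType) (n : nat) (M1 M2 M : manifold R n) :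
 (0 < n)%N -> is_CROSS M1 -> is_CROSS M2 -> connected_sum M1 M2 M ->
 exists g : riemannian_metric M, strongly_nonnegative_curvature g.
Proof.
move=> n0 c1 c2 [i1 [i2 [j1 [j2 [[e1 e2] [f1 f2] cov glue]]]]].
have [L [G HG]] := glue_good e1 e2 f1 f2 cov glue (CROSS_rounded n0 c1 e1) (CROSS_rounded n0 c2 e2).
exact: metric_of_good HG.
Qed.
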